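(* Let $k,l$ be positive integers and let $\omega=(0,\mathbf{1}^k,k)$, where $\mathbf{1}^k=(1,\dots,1)$ has length $k$. For each of $$(\alpha,\beta)=\left(\tfrac12,\tfrac12\right),\ \left(\tfrac12,-\tfrac12\right),\ \left(-\tfrac12,-\tfrac12\right),\ (0,0),$$ with corresponding pair $(G_1,G_2)=(Sp_{2l},Sp_{2k})$, $(SO_{2l+1},Pin_{2k})$, $(O_{2l},SO_{2k})$, ''$(O_{2l+1},SO_{2k+1})$'' respectively, the skew Howe duality measure $\mu_{n,k}$ of the pair equals the spectral measure $\mu^\omega_{l,\alpha,\beta}$, as probability measures on partitions $\lambda$ with at most $l$ parts (where $\mu_{n,k}(\lambda)=0$ if $\lambda_1>k$).
   Context: Skew Howe measures $\mu_{n,k}$, on partitions $\lambda$ with at most $l$ parts and $\lambda_1\le k$ (here $n=2l$ or $2l+1$ is the dimension of the natural representation of $G_1$): - For $(Sp_{2l},Sp_{2k})$ and $(SO_{2l+1},Pin_{2k})$: $\mu_{n,k}(\lambda)=2^{-nk}$ times the dimension of the $G_1$-isotypic component of highest weight $\lambda=\sum\lambda_i\epsilon_i$ in $\bigwedge(\mathbb{C}^n\otimes\mathbb{C}^k)=(\bigwedge\mathbb{C}^n)^{\otimes k}$. - For $(O_{2l},SO_{2k})$: $\mu_{n,k}(\lambda)=2^{-2lk}$ times the total dimension of the $SO_{2l}$-isotypic components of highest weights $(\lambda_1,\dots,\lambda_{l-1},\pm\lambda_l)$ in $\bigwedge(\mathbb{C}^{2l}\otimes\mathbb{C}^k)$.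 - For ''$(O_{2l+1},SO_{2k+1})$'' (not an actual duality): $\mu_{n,k}(\lambda)=Z\cdot\dim V_{SO_{2l+1}}(\lambda)\cdot\dim V_{SO_{2k+1}}(\overline\lambda')$, where $\overline\lambda_i=k-\lambda_{l+1-i}$, the prime is conjugation, and $Z$ is the constant making this a probability measure. Multivariate Jacobi polynomials: $P_\lambda(x_1,\dots,x_l)=\frac{\det[J^{(\alpha,\beta)}_{\lambda_j+l-j}(x_i)]_{i,j=1}^l}{\prod_{i<j}(x_i-x_j)}$, where $J_m^{(\alpha,\beta)}$ is the degree $m$ Jacobi polynomial (orthogonal on $[-1,1]$ with weight $(1-x)^\alpha(1+x)^\beta$). Spectral measures: an extremal character is given by $\omega=(\mathbf a,\mathbf b,\delta)$, with sequences $\mathbf a=(a_1\ge a_2\ge\cdots\ge0)$, $\mathbf b=(1\ge b_1\ge b_2\ge\cdots\ge0)$ and $\delta\ge\sum(a_i+b_i)$. Put $\gamma=\delta-\sum(a_i+b_i)$ and $$\varphi_\omega(x)=e^{\gamma(x-1)}\prod_i\frac{1+\frac{b_i(2-b_i)}{2}(x-1)}{1-\frac{a_i(2+a_i)}{2}(x-1)}.$$ The spectral measure $\mu^\omega_{l,\alpha,\beta}$ (restriction to rank $l$) is defined by the expansion $$\prod_{i=1}^l\varphi_\omega(x_i)=\sum_{\ell(\lambda)\le l}\mu^\omega_{l,\alpha,\beta}(\lambda)\,\frac{P_\lambda(x_1,\dots,x_l)}{P_\lambda(1,\dots,1)}.$$ For $\omega=(0,\mathbf1^k,k)$ all $a_i=0$,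 $b_1=\cdots=b_k=1$, the remaining $b_i$ vanish, and $\gamma=0$, so $\varphi_\omega(x)=\left(\frac{1+x}{2}\right)^k$. *)

(* Defs.v *)
From mathcomp Require Import all_boot all_order all_algebra.
From mathcomp Require Import all_classical all_reals all_analysis.
From mathcomp Require Import zify complex.
From mathcomp Require mpoly.
Import -(notations) mpoly.

Set Implicit Arguments.
Unset Strict Implicit.
Unset Printing Implicit Defensive.

Import Order.TTheory GRing.Theory Num.Theory numFieldNormedType.Exports.

Local Open Scope classical_set_scope.
Local Open Scope ring_scope.

(* Partitions with at most [l] parts, padded with zeros; part number [i] of the
   mathematical notation is component [i.-1]. *)
Definition intpart (l : nat) : Type := {lam : l.-tuple nat | sorted geq lam}.

Definition parts (l : nat) (lam : intpart l) (i : 'I_l) : nat :=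
  tnth (val lam) i.

Definition in_box (l k : nat) (lam : intpart l) : bool :=
  [forall i : 'I_l, (parts lam i <= k)%N].

Definition box (l k : nat) : set (intpart l) := [set lam | in_box k lam].
Arguments box : clear implicits.

(* The conjugate of the complement of [lam] in the [l] x [k] rectangle. *)
Definition conj_compl (l k : nat) (lam : intpart l) (j : 'I_k) : nat :=
  #|[pred i : 'I_l | (j < k - parts lam (rev_ord i))%N]|.

Definition is_probability (R : realType) (T : choiceType) (mu : T -> R) : Prop :=
  (forall x, 0 <= mu x) /\ \esum_(x in [set: T]) (mu x)%:E = 1%E.

(* The classical normalization J_m(1) = binom(m + alpha, m) pins down one
   polynomial; it cancels in the ratios P_lam(x) / P_lam(1, ..., 1). *)
Definition is_jacobi (R : realType) (alpha beta : R) (m : nat) (p : {poly R})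
    : Prop :=
  [/\ size p = m.+1,
      forall q : {poly R}, (size q <= m)%N ->
        (\int[lebesgue_measure]_(x in `[(-1)%R, 1%R])
          (p.[x] * q.[x] * (1 - x) `^ alpha * (1 + x) `^ beta)%:E = 0)%E
    & p.[1] = \prod_(i < m) ((alpha + i.+1%:R) / i.+1%:R)].

Definition jacobi (R : realType) (alpha beta : R) (m : nat) : {poly R} :=
  xget 0 [set p | is_jacobi alpha beta m p].

Definition vandermonde_mpoly (R : realType) (l : nat) : mpoly l R :=
  \prod_(i < l) \prod_(j < l | (i < j)%N) (mpolyX R (mnm1 i) -
                                           mpolyX R (mnm1 j)).

Definition jacobi_det (R : realType) (l : nat) (alpha beta : R)
    (lam : intpart l) : mpoly l R :=
  \det (\matrix_(i < l, j < l)
    (map_poly (@mpolyC l R)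
       (jacobi alpha beta (parts lam j + (l - j.+1)))).[mpolyX R (mnm1 i)]).

(* The exact quotient, as a polynomial: it can be evaluated at points with equal
   coordinates, in particular at (1, ..., 1). *)
Definition jacobiP (R : realType) (l : nat) (alpha beta : R)
    (lam : intpart l) : mpoly l R :=
  xget 0 [set p | p * vandermonde_mpoly R l = jacobi_det alpha beta lam].

Definition normalized_jacobiP (R : realType) (l : nat) (alpha beta : R)
    (lam : intpart l) (x : 'I_l -> R) : R :=
  meval x (jacobiP alpha beta lam) /
  meval (fun=> 1) (jacobiP alpha beta lam).

Record extremal_point (R : realType) := ExtremalPoint {
  ep_a : nat -> R;
  ep_b : nat -> R;
  ep_delta : R;
  ep_a_noninc : forall i, ep_a i.+1 <= ep_a i;
  ep_a_ge0 : forall i, 0 <= ep_a i;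
  ep_b_noninc : forall i, ep_b i.+1 <= ep_b i;
  ep_b_ge0 : forall i, 0 <= ep_b i;
  ep_b_le1 : forall i, ep_b i <= 1;
  ep_sum_le : forall N, \sum_(0 <= i < N) (ep_a i + ep_b i) <= ep_delta }.

Definition ep_gamma (R : realType) (w : extremal_point R) : R :=
  ep_delta w - limn (fun N => \sum_(0 <= i < N) (ep_a w i + ep_b w i)).

Definition phi (R : realType) (w : extremal_point R) (x : R) : R :=
  expR (ep_gamma w * (x - 1)) *
  limn (fun N => \prod_(0 <= i < N)
    ((1 + ep_b w i * (2 - ep_b w i) / 2 * (x - 1)) /
     (1 - ep_a w i * (2 + ep_a w i) / 2 * (x - 1)))).

Lemma omega_noninc (R : realType) (k i : nat) :
  (i.+1 < k)%N%:R <= (i < k)%N%:R :> R.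
Proof. by rewrite ler_nat; case: ltnP => // /ltnW ->. Qed.

Lemma omega_le1 (R : realType) (k i : nat) : (i < k)%N%:R <= 1 :> R.
Proof. by rewrite lern1 leq_b1. Qed.

Lemma omega_sum (R : realType) (k N : nat) :
  \sum_(0 <= i < N) ((0 : R) + (i < k)%N%:R) <= k%:R.
Proof.
under eq_bigr do rewrite add0r.
rewrite -natr_sum ler_nat big_mkord.
have -> : (\sum_(i < N) (i < k) = minn N k)%N.
  elim: N => [|N IH]; first by rewrite big_ord0 min0n.
  by rewrite big_ord_recr /= IH; case: ltnP; lia.
by rewrite geq_minr.
Qed.

(* (0, 1^k, k) *)
Definition omega (R : realType) (k : nat) : extremal_point R :=
  @ExtremalPoint R (fun=> 0) (fun i => (i < k)%N%:R) k%:R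
    (fun=> lexx 0) (fun=> lexx 0)
    (omega_noninc R k) (fun i => ler0n R _)
    (omega_le1 R k) (omega_sum R k).

(* The expansion of the character restricted to rank [l]: the partial sums over
   the partitions with largest part at most [N] converge uniformly on
   [-1, 1]^l. *)
Definition is_spectral_expansion (R : realType) (l : nat) (alpha beta : R)
    (w : extremal_point R) (mu : intpart l -> R) : Prop :=
  forall e : R, 0 < e -> \forall N \near \oo,
    forall x : 'I_l -> R, (forall i, -1 <= x i <= 1) ->
      `|\prod_(i < l) phi w (x i) -
        \sum_(lam \in box l N) mu lam * normalized_jacobiP alpha beta lam x| <= e.

Definition is_spectral_measure (R : realType) (l : nat) (alpha beta : R)
    (w : extremal_point R) (mu : intpart l -> R) : Prop :=
  is_probability mu /\ is_spectral_expansion alpha beta w mu.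

(* In the forms below, defined by antidiagonal matrices, the upper triangular
   elements of the group are a Borel subgroup, the diagonal ones a maximal torus,
   and [epsilon_i] is the [i]-th diagonal entry, for [i] at most the rank. *)

Definition antidiag_mx (C : fieldType) (n : nat) : 'M[C]_n :=
  \matrix_(i, j) (j == rev_ord i)%:R.

Definition symplectic_mx (C : fieldType) (l : nat) : 'M[C]_(l + l) :=
  \matrix_(i, j) ((if (i < l)%N then 1 else -1) * (j == rev_ord i)%:R).

Definition Sp (C : fieldType) (l : nat) : set 'M[C]_(l + l) :=
  [set g | g^T *m symplectic_mx C l *m g = symplectic_mx C l].

Definition SO (C : fieldType) (n : nat) : set 'M[C]_n :=
  [set g | g^T *m antidiag_mx C n *m g = antidiag_mx C n /\ \det g = 1].

Section HighestWeight.

Variables (C : fieldType) (l m : nat) (G : set 'M[C]_(l + m)).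
Variables (V : vectType C) (act : 'M[C]_(l + m) -> V -> V).

Definition submodule (U : {vspace V}) : Prop :=
  forall g u, G g -> u \in U -> act g u \in U.

Definition irreducible (U : {vspace V}) : Prop :=
  [/\ U != 0%VS, submodule U
    & forall U' : {vspace V}, (U' <= U)%VS -> submodule U' ->
        U' = 0%VS \/ U' = U].

Definition hw_vector (lam : 'I_l -> int) (v : V) : Prop :=
  v != 0 /\ forall g, G g -> is_trig_mx g^T ->
    act g v = (\prod_(i < l) g (lshift m i) (lshift m i) ^ lam i) *: v.

Definition irreducible_hw (lam : 'I_l -> int) (U : {vspace V}) : Prop :=
  irreducible U /\ exists2 v, v \in U & hw_vector lam v.

(* The sum of all irreducible submodules of highest weight [lam]. *)
Definition isotypic (lam : 'I_l -> int) : {vspace V} :=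
  xget 0%VS [set U : {vspace V} |
    (forall W, irreducible_hw lam W -> (W <= U)%VS) /\
    (forall U', (forall W, irreducible_hw lam W -> (W <= U')%VS) ->
       (U <= U')%VS)].

End HighestWeight.

(* On a closed subgroup of SL_n, such as the ones above, the regular functions
   are the polynomials in the matrix entries. *)
Definition rational_repr (C : fieldType) (n d : nat) (G : set 'M[C]_n)
    (rho : 'M[C]_n -> 'M[C]_d) : Prop :=
  [/\ rho 1%:M = 1%:M,
      forall g h, G g -> G h -> rho (g *m h) = rho g *m rho h
    & exists q : 'I_d -> 'I_d -> mpoly (n * n) C,
        forall g, G g -> forall i j,
          rho g i j = meval (fun t => mxvec g 0 t) (q i j)].

(* The dimension of the irreducible representation of highest weight [lam]. *)
Definition irr_dim (C : fieldType) (l m : nat) (G : set 'M[C]_(l + m))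
    (lam : 'I_l -> int) : nat :=
  xget 0%N [set d | exists rho : 'M[C]_(l + m) -> 'M[C]_d,
    rational_repr G rho /\
    @irreducible_hw C l m G 'cV[C]_d (fun g v => rho g *m v) lam fullv].

Section Exterior.

Variables (C : fieldType) (I : finType).

(* The coordinate at [S] is that on the product of the elements of [S], in
   increasing order for [enum I]. *)
Definition exterior : Type := {ffun {set I} -> C^o}.

Definition inversions (S T : {set I}) : nat :=
  #|[pred p : I * I | [&& p.1 \in S, p.2 \in T &
                         (enum_rank p.2 < enum_rank p.1)%N]]|.

Definition wedge (u v : exterior) : exterior :=
  [ffun U : {set I} => \sum_(S : {set I} | S \subset U)
     (-1) ^+ inversions S (U :\: S) * (u S * v (U :\: S)) : C^o].

Definition ext_one : exterior := [ffun S : {set I} => (S == finset.set0)%:R : C^o].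

Definition ext_gen (p : I) : exterior :=
  [ffun S : {set I} => (S == [set p]%SET)%:R : C^o].

End Exterior.

(* [(i, j)] stands for e_i (x) e_j in C^n (x) C^k; an n x n matrix acts on the
   first factor, and multiplicatively on the exterior algebra. *)
Definition ext_act (C : fieldType) (n k : nat) (g : 'M[C]_n)
    (u : exterior C ('I_n * 'I_k)%type) : exterior C ('I_n * 'I_k)%type :=
  \sum_(S : {set 'I_n * 'I_k}) (u S : C) *:
    \big[@wedge C _/ext_one C _]_(p <- enum S)
      \sum_(i < n) g i p.1 *: ext_gen C (i, p.2).

Definition ext_isotypic (C : fieldType) (l m k : nat) (G : set 'M[C]_(l + m))
    (lam : 'I_l -> int) : {vspace exterior C ('I_(l + m) * 'I_k)%type} :=
  isotypic G (@ext_act C (l + m) k) lam.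

Definition weight (l : nat) (lam : intpart l) (i : 'I_l) : int :=
  (parts lam i)%:Z.

(* (lam_1, ..., lam_(l-1), - lam_l) *)
Definition weight_flip (l : nat) (lam : intpart l) (i : 'I_l) : int :=
  if i.+1 == l then - (parts lam i)%:Z else (parts lam i)%:Z.

Definition howe_Sp_Sp (R : realType) (l k : nat) (lam : intpart l) : R :=
  if in_box k lam then
    2 ^- ((l + l) * k) * (\dim (ext_isotypic k (@Sp R[i] l) (weight lam)))%:R
  else 0.

Definition howe_SOodd_Pin (R : realType) (l k : nat) (lam : intpart l) : R :=
  if in_box k lam then
    2 ^- ((l + l.+1) * k) *
    (\dim (ext_isotypic k (@SO R[i] (l + l.+1)) (weight lam)))%:R
  else 0.

(* The sum of subspaces counts the component once when [lam_l = 0], and is direct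
   otherwise. *)
Definition howe_Oeven_SO (R : realType) (l k : nat) (lam : intpart l) : R :=
  if in_box k lam then
    2 ^- ((l + l) * k) *
    (\dim (ext_isotypic k (@SO R[i] (l + l)) (weight lam) +
           ext_isotypic k (@SO R[i] (l + l)) (weight_flip lam))%VS)%:R
  else 0.

Definition odd_odd_weight (R : realType) (l k : nat) (lam : intpart l) : R :=
  (irr_dim (@SO R[i] (l + l.+1)) (weight lam))%:R *
  (irr_dim (@SO R[i] (k + k.+1)) (fun j => (@conj_compl l k lam j)%:Z))%:R.

Definition howe_Oodd_SOodd (R : realType) (l k : nat) (lam : intpart l) : R :=
  if in_box k lam then
    odd_odd_weight R k lam / \sum_(nu \in box l k) odd_odd_weight R k nu
  else 0.

(* Main.v *)
(* Each isotypic component of the exterior algebra is generated, under the Lie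
   algebra of G_1, by its highest weight vectors.  The trace F of the maximal torus
   on it is, in the variables x_i = (z_i + 1/z_i) / 2, a symmetric polynomial bounded
   by lam for the dominance order.  Since the Casimir operator acts by a scalar,
   V F, where V is the Vandermonde product, is an eigenvector of the sum of the l
   Jacobi differential operators; being alternating, it is orthogonal to all
   products of Jacobi polynomials of decreasing degrees but one, so that
   F = (dimension of the component) P_lam(x) / P_lam(1, ..., 1).  Summing over lam,
   the trace of the torus on the whole exterior algebra, 2^(n k) prod ((1 + x_i) / 2)^k,
   gives the spectral expansion, and orthogonality gives uniqueness.

   In the remaining case the expansion is computed directly.  With N_m = m (m + 1),
   the integrals of (1 + x)^m against a Legendre polynomial J_n satisfy
   (N_m - N_n) b_m = 2 m^2 b_(m-1), whence the coefficient of P_lam is, up to a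
   constant, vdm(N_(n_i))^2 / prod_i prod_(a <> n_i) |N_a - N_(n_i)| with
   n_i = lam_i + l - i and 0 <= a < k + l.  The n_i and the analogous integers of the
   conjugate of the complement of lam partition {0, ..., k + l - 1}, so that this is
   proportional to the product of the two dimensions, which are read off the leading
   coefficient of F for the component generated by one monomial. *)
From HB Require Import structures.
Require Import Defs.
From mathcomp Require Import all_boot all_order all_algebra perm.
From mathcomp Require Import all_classical all_reals all_analysis measurable_realfun.
From mathcomp Require Import zify ring lra complex finmap.
From mathcomp Require mpoly.
Import -(notations) mpoly.

Set Implicit Arguments.
Unset Strict Implicit.
Unset Printing Implicit Defensive.

Import Order.TTheory GRing.Theory Num.Theory numFieldNormedType.Exports.

Local Open Scope ring_scope.

(** * The exterior algebra as a Fock space *)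

(** The statements concern matrix groups, the computations concern operators. They are tied by
    generation: each group is generated by root and torus elements, and root vectors have cube zero,
    so that their exponentials are polynomial in the parameter and stability under the group becomes
    stability under [dr]. Semisimplicity comes from the Hermitian form [dot], for which lowering
    operators are adjoint to raising ones. The Casimir operator becomes differential because
    cyclicity of the trace solves for each root term at a torus element with distinct entries. For
    [SO_2l] the Weyl group lacks single sign changes; the components of [lam] and of its flip are
    added, and the sum is invariant under the missing reflection. In the odd-odd case the dimensions
    come from the parameters [(1/2, -1/2)] and the expansion from [(0, 0)]; both have
    [al + be + 1 = 1], hence the same eigenvalues [m (m + 1)], which makes their Vandermonde
    products comparable. As [irr_dim] refers to an arbitrary model, it must also be shown that the
    highest weight determines the dimension. *)

Section Fock.

Variables (C : fieldType) (I : finType).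
Local Notation W := (exterior C I).
Local Notation rk := enum_rank.

Definition ebas (S : {set I}) : W := [ffun T => (T == S)%:R : C^o].

Definition fsgn (p : I) (S : {set I}) : C :=
  (-1) ^+ #|[pred q in S | (rk q < rk p)%N]|.

(** Creation operator: left multiplication by the generator [p] (see [wedge_gen]). The operator
    [an p] is the contraction, its adjoint for the form [dot]. The anticommutation relations of the
    two replace computations with general products. *)
Definition cr (p : I) (u : W) : W :=
  [ffun S : {set I} => if p \in S then fsgn p (S :\ p)%SET * u (S :\ p)%SET else 0 : C^o].

Definition an (p : I) (u : W) : W :=
  [ffun S : {set I} => if p \in S then 0 else fsgn p S * u (p |: S)%SET : C^o].

Lemma cr_is_linear p : linear (cr p).
Proof.
by move=> a u v; apply/ffunP=> S; rewrite !ffunE; case: ifP => _;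
  rewrite ?scaler0 ?addr0 // mulrDr; congr (_ + _); exact: mulrCA.
Qed.
HB.instance Definition _ p := GRing.isLinear.Build C W W *:%R (cr p) (cr_is_linear p).

Lemma an_is_linear p : linear (an p).
Proof.
by move=> a u v; apply/ffunP=> S; rewrite !ffunE; case: ifP => _;
  rewrite ?scaler0 ?addr0 // mulrDr; congr (_ + _); exact: mulrCA.
Qed.
HB.instance Definition _ p := GRing.isLinear.Build C W W *:%R (an p) (an_is_linear p).

Lemma fsgnU p q (S : {set I}) : q \notin S ->
  fsgn p (q |: S)%SET = (if (rk q < rk p)%N then -1 else 1) * fsgn p S.
Proof.
move=> qS; rewrite /fsgn.
have -> : #|[pred x in (q |: S)%SET | (rk x < rk p)%N]| =
    ((rk q < rk p) + #|[pred x in S | (rk x < rk p)%N]|)%N.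
  rewrite [LHS](cardD1 q) !inE eqxx /=; congr (_ + _)%N.
  apply: eq_card => x; rewrite !inE.
  by case: eqP => [->|_] //=; rewrite (negbTE qS).
by rewrite exprD; case: ifP => _; rewrite ?expr0 ?expr1.
Qed.

Lemma fsgnK p S : fsgn p S * fsgn p S = 1.
Proof. by rewrite /fsgn -expr2 -exprM mulnC exprM sqrrN expr1n expr1n. Qed.

Definition rsgn (p q : I) : C := if (rk q < rk p)%N then -1 else 1.

Lemma rsgnN p q : p != q -> rsgn p q = - rsgn q p.
Proof.
rewrite /rsgn; case: (ltngtP (rk p) (rk q)); rewrite ?opprK // => /val_inj/enum_rank_inj ->.
by rewrite eqxx.
Qed.

Lemma rsgnK p q : rsgn p q * rsgn p q = 1.
Proof. by rewrite /rsgn; case: ifP => _; rewrite ?mulr1 // mulrNN mulr1. Qed.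

Lemma fsgnE p q (S : {set I}) : q \notin S ->
  fsgn p (q |: S)%SET = rsgn p q * fsgn p S.
Proof. exact: fsgnU. Qed.

Lemma cr_cr p q u : cr p (cr q u) = - cr q (cr p u).
Proof.
apply/ffunP=> S; rewrite !ffunE !inE.
have [<-|pq] := eqVneq p q.
  by case: ifP => _; rewrite /= ?mulr0 oppr0.
rewrite /=.
case pS: (p \in S); case qS: (q \in S); rewrite /= ?mulr0 ?oppr0 //.
pose T := (S :\ p :\ q)%SET.
have Tp : p \notin T by rewrite !inE eqxx andbF.
have Tq : q \notin T by rewrite !inE eqxx.
have TE : (S :\ q :\ p)%SET = T by rewrite /T !finset.setDDl finset.setUC.
have Sp : (S :\ p)%SET = (q |: T)%SET by rewrite /T finset.setD1K // !inE eq_sym pq.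
have Sq : (S :\ q)%SET = (p |: T)%SET by rewrite -TE finset.setD1K // !inE pq.
rewrite TE -/T Sp Sq !fsgnE // (rsgnN pq) !mulrA -mulNr; congr (_ * _).
by ring.
Qed.

Lemma an_cr_eq p u : an p (cr p u) = u - cr p (an p u).
Proof.
apply/ffunP=> S; rewrite !ffunE !inE eqxx /=; case: ifP => pS.
  rewrite finset.setD1K // mulrA fsgnK mul1r.
  by rewrite [X in _ = X]subrr.
rewrite finset.setU1K ?pS // mulrA fsgnK mul1r.
by rewrite [X in _ = X]subr0.
Qed.

Lemma an_cr_neq p q u : p != q -> an q (cr p u) = - cr p (an q u).
Proof.
move=> pq; apply/ffunP=> S; rewrite !ffunE !inE ![q == p]eq_sym (negbTE pq) /=.
case pS: (p \in S); case qS: (q \in S); rewrite /= ?mulr0 ?oppr0 //.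
pose T := (S :\ p)%SET.
have Tp : p \notin T by rewrite !inE eqxx.
have Tq : q \notin T by rewrite !inE qS andbF.
have -> : ((q |: S) :\ p)%SET = (q |: T)%SET.
  by apply/finset.setP=> x; rewrite !inE; case: (eqVneq x q) => [->|//]; rewrite eq_sym pq.
rewrite -/T -[in LHS](finset.setD1K pS) -/T !fsgnE // (rsgnN pq) !mulrA -mulNr; congr (_ * _).
rewrite -[fsgn p T * fsgn q T]mul1r -(rsgnK q p).
by ring.
Qed.

Definition vac : W := ebas finset.set0.

Lemma an_vac p : an p vac = 0.
Proof.
apply/ffunP=> S; rewrite !ffunE; case: ifP => // _.
by case: eqP => [E|_]; [have := finset.setU11 p S; rewrite E inE|exact: mulr0].
Qed.

Lemma ebas_sum (u : W) : u = \sum_S (u S : C) *: ebas S.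
Proof.
apply/ffunP=> T; rewrite sum_ffunE (bigD1 T) //= big1 => [|S ST].
  by rewrite !ffunE eqxx addr0; apply/esym/mulr1.
by rewrite !ffunE eq_sym (negbTE ST); exact: mulr0.
Qed.

Lemma ebas_lin_eq (V : lmodType C) (f g : {linear W -> V}) :
  (forall S, f (ebas S) = g (ebas S)) -> f =1 g.
Proof.
move=> fg u; rewrite (ebas_sum u) !linear_sum; apply: eq_bigr => S _.
by rewrite !linearZ /= fg.
Qed.

Lemma cr_ebas p S : cr p (ebas S) =
  if p \in S then 0 else fsgn p S *: ebas (p |: S)%SET.
Proof.
apply/ffunP=> T; rewrite !ffunE; case: ifP => [pT|/negbT pT]; last first.
  case: ifP => pS; rewrite !ffunE //; case: eqP pT => [->|_ _]; first by rewrite !inE eqxx.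
  by apply/esym/mulr0.
case: ifP => [pS|/negbT pS].
  rewrite !ffunE; case: eqP => [E|_]; rewrite ?mulr0 //.
  by move: pS; rewrite -E !inE eqxx.
rewrite !ffunE.
have -> : ((T :\ p)%SET == S) = (T == (p |: S)%SET).
  by apply/eqP/eqP => [<-|->]; rewrite ?finset.setD1K ?finset.setU1K.
by case: eqP => [->|_]; rewrite ?finset.setU1K // ?mulr0; apply/esym; rewrite ?[LHS]mulr0.
Qed.

Lemma wedge_gen p u : wedge (@ext_gen C I p) u = cr p u.
Proof.
apply/ffunP=> U; rewrite !ffunE.
case: ifP => pU; last first.
  rewrite big1 // => S SU; rewrite !ffunE; case: eqP SU => [->|_ _]; rewrite ?mul0r ?mulr0 //.
  by rewrite finset.sub1set pU.
rewrite (bigD1 [set p]%SET) /=; last by rewrite finset.sub1set.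
rewrite big1 ?addr0 => [|S /andP[_ /negbTE Sp]]; last by rewrite !ffunE Sp mul0r mulr0.
rewrite !ffunE eqxx mul1r; congr (_ * _); rewrite /fsgn /inversions; congr (_ ^+ _).
rewrite -[RHS](@fintype.card_image _ _ (fun q : I => (p, q))).
  apply: eq_card => -[x y]; rewrite !inE /=; apply/idP/fintype.imageP.
    by case/and3P=> /eqP -> h1 h2; exists y; rewrite // !inE h1 h2.
  by case=> q; rewrite !inE => /andP[h1 h2] [-> ->]; rewrite eqxx h1 h2.
by move=> x y [].
Qed.

Lemma index_enum_rank (q : I) : index q (enum I) = rk q.
Proof. by rewrite -{1}(nth_enum_rank q q) index_uniq ?enum_uniq // -cardE ltn_ord. Qed.

(** In [enum I] the new element comes just after the elements of [S] of smaller rank. This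
    identifies the sign [fsgn] of [cr] with the sign gained by moving an operator to its place in an
    ordered product. *)
Lemma enum_setU1_split p (S : {set I}) : p \notin S -> exists s1 s2,
  [/\ enum S = s1 ++ s2, enum (p |: S)%SET = s1 ++ p :: s2
    & size s1 = #|[pred q in S | (rk q < rk p)%N]|].
Proof.
move=> pS; pose r : nat := rk p.
have E : enum I = take r (enum I) ++ p :: drop r.+1 (enum I).
  by rewrite -{1}(cat_take_drop r (enum I)) (drop_nth p) -?cardE ?ltn_ord // nth_enum_rank.
have mt q : (q \in take r (enum I)) = (rk q < rk p)%N.
  by rewrite in_take ?mem_enum // index_enum_rank.
have uq : uniq (enum I) by exact: enum_uniq.
move: uq; rewrite E cat_uniq => /and3P[_ /hasPn nd /= /andP[pd _]].
have enE (A : {pred I}) : enum A = seq.filter (mem A) (enum I).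
  by rewrite [in RHS]enumT.
have fE (s : seq I) : p \notin s -> seq.filter (mem (p |: S)%SET) s = seq.filter (mem S) s.
  move=> ps; apply: seq.eq_in_filter => x xs; rewrite !inE.
  by case: eqP xs ps => [-> ->|].
have pt : p \notin take r (enum I) by rewrite mt ltnn.
exists (seq.filter (mem S) (take r (enum I))), (seq.filter (mem S) (drop r.+1 (enum I))); split.
- by rewrite enE [in LHS]E filter_cat /= (negbTE pS).
- by rewrite enE [in LHS]E filter_cat /= !inE eqxx /= !fE.
rewrite [RHS]cardE enE [in RHS]E filter_cat size_cat.
rewrite [X in (_ + size X)%N](_ : _ = [::]); last first.
  rewrite -(filter_pred0 (p :: drop r.+1 (enum I))); apply: seq.eq_in_filter => x /nd.
  by rewrite mt !inE => /negbTE ->; rewrite andbF.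
rewrite addn0; congr size; apply: seq.eq_in_filter => x; rewrite mt !inE /= => ->.
by rewrite andbT.
Qed.

Section Functor.

Variable A : I -> {linear W -> W}.
Hypothesis A_anti : forall p q u, A p (A q u) = - A q (A p u).
Hypothesis A_sq : forall p u, A p (A p u) = 0.

(** Functoriality of the exterior algebra: anticommuting operators of square zero extend to a map
    that fixes [vac] and turns [cr p] into [A p]. The action of a matrix is the case where [A p]
    multiplies by the image of the generator [p]. *)
Definition fock_map (u : W) : W :=
  \sum_S (u S : C) *: foldr (fun p => A p) vac (enum S).

Lemma fock_map_is_linear : linear fock_map.
Proof.
move=> a u v; rewrite /fock_map scaler_sumr -big_split /=; apply: eq_bigr => S _.
by rewrite !ffunE scalerDl scalerA.
Qed.
HB.instance Definition _ := GRing.isLinear.Build C W W *:%R fock_map fock_map_is_linear.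

Lemma fock_map_ebas S : fock_map (ebas S) = foldr (fun p => A p) vac (enum S).
Proof.
rewrite /fock_map (bigD1 S) //= big1 => [|T /negbTE ST]; rewrite !ffunE ?ST ?scale0r //.
by rewrite eqxx scale1r addr0.
Qed.

Lemma foldrA_mem p s : p \in s -> A p (foldr (fun q => A q) vac s) = 0.
Proof.
elim: s => //= q s IH; rewrite in_cons => /orP[/eqP ->|/IH h]; first exact: A_sq.
by rewrite A_anti h linear0 oppr0.
Qed.

Lemma foldrA_cat p s1 s2 : A p (foldr (fun q => A q) vac (s1 ++ s2)) =
  (-1) ^+ size s1 *: foldr (fun q => A q) vac (s1 ++ p :: s2).
Proof.
elim: s1 => [|q s1 IH] /=; first by rewrite expr0 scale1r.
by rewrite A_anti IH linearZ /= exprS mulN1r scaleNr.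
Qed.

Lemma fock_map_cr p u : fock_map (cr p u) = A p (fock_map u).
Proof.
apply: (@ebas_lin_eq _ (fock_map \o cr p) (A p \o fock_map)) => {u} S /=.
rewrite cr_ebas fock_map_ebas; case: ifP => [pS|/negbT pS].
  by rewrite linear0 foldrA_mem // mem_enum.
rewrite linearZ /= fock_map_ebas.
have [s1 [s2 [-> -> sz]]] := enum_setU1_split pS.
by rewrite foldrA_cat sz.
Qed.

Lemma fock_map_vac : fock_map vac = vac.
Proof. by rewrite fock_map_ebas enum_set0. Qed.

End Functor.

Lemma foldr_cr_uniq (s : seq I) : uniq s -> exists e : C, e * e = 1 /\
  foldr (fun p => cr p) vac s = e *: ebas [set x in s]%SET.
Proof.
elim: s => [_|p s IH /= /andP[ps /IH[e [ee ->]]]].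
  by exists 1; rewrite mulr1 scale1r; split => //; congr ebas; apply/finset.setP=> x; rewrite !inE.
rewrite linearZ /= cr_ebas inE (negbTE ps) scalerA.
exists (e * fsgn p [set x in s]%SET); split.
  by rewrite mulrACA ee fsgnK mulr1.
by congr (_ *: ebas _); apply/finset.setP=> x; rewrite !inE.
Qed.

Lemma fock_ind (P : W -> Prop) :
  (forall a u v, P u -> P v -> P (a *: u + v)) -> P vac ->
  (forall p u, P u -> P (cr p u)) -> forall u, P u.
Proof.
move=> Pl Pv Pc u.
have P0 : P 0 by have := Pl (-1) _ _ Pv Pv; rewrite scaleN1r addNr.
have PZ a v : P v -> P (a *: v) by move=> h; have := Pl a _ _ h P0; rewrite addr0.
rewrite (ebas_sum u).
apply: (big_ind P) => [//|x y Px Py|S _]; first by rewrite -(scale1r x); exact: Pl.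
apply: (PZ); have [e [ee E]] := foldr_cr_uniq (enum_uniq S).
have -> : ebas S = e *: foldr (fun p => cr p) vac (enum S).
  by rewrite E scalerA ee scale1r set_enum.
apply: PZ; elim: (enum _) => //= p s IH; exact: Pc.
Qed.

(** The vacuum is cyclic for the operators [cr p]. Hence multiplicativity, brackets and intertwining
    relations need to be checked only on [vac] and against one creation operator. *)
Lemma fock_lin_eq (f g : {linear W -> W}) : f vac = g vac ->
  (forall p u, f u = g u -> f (cr p u) = g (cr p u)) -> f =1 g.
Proof.
move=> fgv fgc; apply: fock_ind => // a u v hu hv.
by rewrite !linearP hu hv.
Qed.

End Fock.

(** * The action of matrices on the exterior algebra, its derivative, and the invariant Hermitian
    form *)

Section ExtAct.

Variables (C : numClosedFieldType) (n k : nat).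
Local Notation I := ('I_n * 'I_k)%type.
Local Notation W := (exterior C I).
Local Notation M := 'M[C]_n.

Definition gcr (g : M) (p : I) (u : W) : W := \sum_(i < n) g i p.1 *: cr (i, p.2) u.

Lemma gcr_is_linear g p : linear (gcr g p).
Proof.
move=> a u v; rewrite /gcr scaler_sumr -big_split /=; apply: eq_bigr => i _.
by rewrite linearP scalerDr !scalerA mulrC.
Qed.
HB.instance Definition _ g p := GRing.isLinear.Build C W W *:%R (gcr g p) (gcr_is_linear g p).

Lemma gcrD g h p u : gcr (g + h) p u = gcr g p u + gcr h p u.
Proof. by rewrite /gcr -big_split; apply: eq_bigr => i _; rewrite mxE scalerDl. Qed.

Lemma gcrZ a g p u : gcr (a *: g) p u = a *: gcr g p u.
Proof. by rewrite /gcr scaler_sumr; apply: eq_bigr => i _; rewrite mxE scalerA. Qed.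

Lemma gcrN g p u : gcr (- g) p u = - gcr g p u.
Proof. by rewrite -scaleN1r gcrZ scaleN1r. Qed.

Lemma gcr1 p u : gcr 1%:M p u = cr p u.
Proof.
rewrite /gcr (bigD1 p.1) //= big1 => [|i ip]; first by rewrite mxE eqxx scale1r addr0; case: p.
by rewrite mxE (negbTE ip) scale0r.
Qed.

Lemma gcr_anti g p q u : gcr g p (gcr g q u) = - gcr g q (gcr g p u).
Proof.
rewrite /gcr; under eq_bigr do rewrite linear_sum scaler_sumr.
rewrite exchange_big /= -sumrN; apply: eq_bigr => i _.
rewrite linear_sum scaler_sumr -sumrN; apply: eq_bigr => j _.
by rewrite !linearZ /= cr_cr !scalerN !scalerA mulrC.
Qed.

Lemma gcr_sq g p u : gcr g p (gcr g p u) = 0.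
Proof.
have := gcr_anti g p p u => /eqP; rewrite -addr_eq0 -mulr2n -scaler_nat.
by rewrite scaler_eq0 pnatr_eq0 /= => /eqP.
Qed.

Lemma wedge_suml (J : finType) (a : J -> C) (x : J -> W) u :
  wedge (\sum_j a j *: x j) u = \sum_j a j *: wedge (x j) u.
Proof.
apply/ffunP=> U; rewrite sum_ffunE ffunE.
under [RHS]eq_bigr do rewrite !ffunE [_ *: _]mulr_sumr.
rewrite exchange_big; apply: eq_bigr => S _ /=.
rewrite sum_ffunE mulr_suml mulr_sumr; apply: eq_bigr => j _.
by rewrite ffunE -mulrA; exact: mulrCA.
Qed.

Lemma ext_actE g : @ext_act C n k g =1 fock_map (fun p => gcr g p).
Proof.
move=> u; apply: eq_bigr => S _; congr (_ *: _).
elim: (enum _) => [|p s IH]; first by rewrite big_nil.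
rewrite big_cons IH /= wedge_suml; apply: eq_bigr => i _.
by rewrite wedge_gen.
Qed.

Lemma ext_act_is_linear g : linear (@ext_act C n k g).
Proof. by move=> a u v; rewrite !ext_actE linearP. Qed.
HB.instance Definition _ g := GRing.isLinear.Build C W W *:%R (@ext_act C n k g) (ext_act_is_linear g).

Lemma ext_act_vac g : ext_act g (vac C I) = vac C I.
Proof. by rewrite ext_actE fock_map_vac. Qed.

Lemma ext_act_cr g p u : ext_act g (cr p u) = gcr g p (ext_act g u).
Proof. by rewrite !ext_actE; apply: fock_map_cr => [{}p q v|{}p v] /=; [exact: gcr_anti|exact: gcr_sq]. Qed.

Lemma ext_act_gcr g h p u : ext_act g (gcr h p u) = gcr (g *m h) p (ext_act g u).
Proof.
rewrite {1}/gcr linear_sum /=; under eq_bigr do rewrite linearZ /= ext_act_cr /gcr scaler_sumr.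
rewrite exchange_big /=; apply: eq_bigr => i _; rewrite mxE scaler_suml.
by apply: eq_bigr => j _; rewrite scalerA mulrC.
Qed.

Lemma ext_actM g h u : ext_act (g *m h) u = ext_act g (@ext_act C n k h u).
Proof.
apply: (fock_lin_eq (f := @ext_act C n k (g *m h)) (g := @ext_act C n k g \o @ext_act C n k h)) => /=.
  by rewrite !ext_act_vac.
by move=> {}p {}u IH; rewrite !ext_act_cr ext_act_gcr IH.
Qed.

Lemma ext_act1 u : ext_act 1%:M u = u :> W.
Proof.
apply: (fock_lin_eq (f := @ext_act C n k 1%:M) (g := idfun)) => /=.
  by rewrite !ext_act_vac.
by move=> {}p {}u IH; rewrite !ext_act_cr IH gcr1.
Qed.

(* The derivation of the exterior algebra that extends A; locked, so that rewriting
   does not unfold it to a sum. *)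
Fact dr_key : unit. Proof. exact: tt. Qed.
Definition dr : M -> W -> W := locked_with dr_key (fun A u =>
  \sum_i \sum_j A i j *: \sum_(a < k) cr (i, a) (an (j, a) u)).

Lemma drE A u : dr A u = \sum_i \sum_j A i j *: \sum_(a < k) cr (i, a) (an (j, a) u).
Proof. by rewrite /dr unlock. Qed.

Lemma dr_is_linear A : linear (dr A).
Proof.
move=> a u v; rewrite !drE scaler_sumr -big_split /=; apply: eq_bigr => i _.
rewrite scaler_sumr -big_split /=; apply: eq_bigr => j _.
rewrite scalerA mulrC -scalerA -scalerDr; congr (_ *: _).
rewrite scaler_sumr -big_split /=; apply: eq_bigr => b _.
by rewrite !linearP.
Qed.
HB.instance Definition _ A := GRing.isLinear.Build C W W *:%R (dr A) (dr_is_linear A).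

Lemma drD A B u : dr (A + B) u = dr A u + dr B u.
Proof.
rewrite !drE -big_split; apply: eq_bigr => i _; rewrite -big_split; apply: eq_bigr => j _ /=.
by rewrite mxE scalerDl.
Qed.

Lemma drZ a A u : dr (a *: A) u = a *: dr A u.
Proof.
rewrite !drE scaler_sumr; apply: eq_bigr => i _; rewrite scaler_sumr; apply: eq_bigr => j _.
by rewrite mxE scalerA.
Qed.

Lemma drN A u : dr (- A) u = - dr A u.
Proof. by rewrite -scaleN1r drZ scaleN1r. Qed.

Lemma dr0 u : dr 0 u = 0.
Proof. by rewrite -(scale0r 0) drZ scale0r. Qed.

Lemma dr_sum (J : Type) (r : seq J) (P : pred J) (A : J -> M) u :
  dr (\sum_(j <- r | P j) A j) u = \sum_(j <- r | P j) dr (A j) u.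
Proof.
by apply: (big_morph (fun A => dr A u)) => [x y|]; rewrite ?drD ?dr0.
Qed.

Lemma dr_vac A : dr A (vac C I) = 0.
Proof.
rewrite !drE big1 // => i _; rewrite big1 // => j _; rewrite big1 ?scaler0 // => a _.
by rewrite an_vac linear0.
Qed.

(** Only the annihilation operator at [p] itself fails to anticommute with [cr p]; it produces the
    second term. Together with [dr_vac] this rule characterises [dr A]. *)
Lemma dr_cr A p u : dr A (cr p u) = cr p (dr A u) + gcr A p u.
Proof.
rewrite !drE /gcr linear_sum -big_split /=; apply: eq_bigr => i _.
have E j : A i j *: \sum_(a < k) cr (i, a) (an (j, a) (cr p u)) =
    cr p (A i j *: \sum_(a < k) cr (i, a) (an (j, a) u)) +
    (if j == p.1 then A i j *: cr (i, p.2) u else 0).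
  rewrite [cr p (_ *: _)]linearZ /= [cr p (\sum_(_ < _) _)]linear_sum /=.
  have -> : (if j == p.1 then A i j *: cr (i, p.2) u else 0) =
     A i j *: (if j == p.1 then cr (i, p.2) u else 0) by case: ifP; rewrite ?scaler0.
  rewrite -scalerDr; congr (_ *: _).
  have -> : (if j == p.1 then cr (i, p.2) u else 0) =
      \sum_(a < k) (if (j, a) == p then cr (i, a) u else 0).
    case: (eqVneq j p.1) => [->|jp].
      rewrite (bigD1 p.2) //= -surjective_pairing eqxx big1 ?addr0 // => a ap.
      by case: p ap => p1 p2 /= ap; rewrite xpair_eqE eqxx (negbTE ap).
    rewrite big1 // => a _.
    by case: p jp => p1 p2 /= jp; rewrite xpair_eqE (negbTE jp).
  rewrite -big_split /=; apply: eq_bigr => a _.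
  have [<-|jp] := eqVneq (j, a) p.
    by rewrite an_cr_eq linearB /= [in RHS]cr_cr addrC.
  by rewrite an_cr_neq 1?eq_sym // linearN /= cr_cr opprK addr0.
rewrite (eq_bigr _ (fun j _ => E j)) big_split /= linear_sum; congr (_ + _).
by rewrite -big_mkcond big_pred1_eq.
Qed.

Lemma dr_gcr A B p u : dr A (gcr B p u) = gcr B p (dr A u) + gcr (A *m B) p u.
Proof.
rewrite {1}/gcr linear_sum /=; under eq_bigr do rewrite linearZ /= dr_cr scalerDr.
rewrite big_split /=; congr (_ + _).
under eq_bigr do rewrite /gcr scaler_sumr.
rewrite exchange_big /=; apply: eq_bigr => i _; rewrite mxE scaler_suml.
by apply: eq_bigr => j _; rewrite scalerA mulrC.
Qed.

Lemma dr_comm A B u : dr A (dr B u) - dr B (dr A u) = dr (A *m B - B *m A) u.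
Proof.
apply: (fock_lin_eq (f := (dr A \o dr B) \- (dr B \o dr A)) (g := dr (A *m B - B *m A))) => /=.
  by rewrite !dr_vac !linear0; rewrite addr0.
move=> {}p {}u IH; rewrite !dr_cr !linearD /= !dr_cr !dr_gcr -IH gcrD gcrN !linearB /=.
set a := cr p _; set b := gcr A _ _; set c := gcr B _ _; set d := gcr _ _ _; set a' := cr p _; set e := gcr _ _ _.
move: a b c d a' e => a b c d a' e; apply/ffunP=> S; rewrite !ffunE.
have R (x y z t x' w : C) : x + y + (z + t) + (- (x' + z) - (y + w)) = x - x' + (t - w) by ring.
exact: R.
Qed.

(** The adjoint action, written [g *m A = B *m g] rather than as a conjugate so that no inverse
    appears. *)
Lemma ext_act_dr g A B u : g *m A = B *m g -> ext_act g (dr A u) = dr B (ext_act g u).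
Proof.
move=> gAB.
apply: (fock_lin_eq (f := @ext_act C n k g \o dr A) (g := dr B \o @ext_act C n k g)) => /=.
  by rewrite dr_vac ext_act_vac linear0 dr_vac.
move=> {}p {}u IH; rewrite dr_cr linearD /= !ext_act_cr ext_act_gcr dr_gcr.
by rewrite IH gAB.
Qed.

Lemma cr_an (p : I) (u : W) : cr p (an p u) = [ffun T : {set I} => if p \in T then u T else 0 : C^o].
Proof.
apply/ffunP=> T; rewrite !ffunE; case: ifP => // pT.
by rewrite !inE eqxx /= mulrA fsgnK mul1r finset.setD1K.
Qed.

Lemma dr_diag (d : 'rV[C]_n) (u : W) :
  dr (diag_mx d) u = [ffun T : {set I} => (\sum_(p in T) d 0 p.1) * u T : C^o].
Proof.
apply/ffunP=> T; rewrite drE sum_ffunE [RHS]ffunE mulr_suml.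
transitivity (\sum_(i < n) \sum_(a < k) (if (i, a) \in T then d 0 i * u T else 0)).
  apply: eq_bigr => i _; rewrite sum_ffunE (bigD1 i) //= [X in _ + X]big1 ?addr0 => [|j ji].
    rewrite mxE eqxx mulr1n ffunE sum_ffunE [LHS]mulr_sumr; apply: eq_bigr => a _.
    by rewrite cr_an ffunE; case: ifP => _ //; rewrite mulr0.
  by rewrite mxE eq_sym (negbTE ji) mulr0n scale0r ffunE.
rewrite pair_big [RHS]big_mkcond /=; apply: eq_bigr => -[i a] _ //=.
Qed.

Lemma gcr_diag (d : 'rV[C]_n) p u : gcr (diag_mx d) p u = d 0 p.1 *: cr p u.
Proof.
rewrite /gcr (bigD1 p.1) //= big1 => [|i ip]; first by rewrite mxE eqxx addr0; case: p.
by rewrite mxE (negbTE ip) scale0r.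
Qed.

Lemma ext_act_diag (d : 'rV[C]_n) (u : W) :
  ext_act (diag_mx d) u = [ffun T : {set I} => (\prod_(p in T) d 0 p.1) * u T : C^o].
Proof.
pose D (u : W) : W := [ffun T : {set I} => (\prod_(p in T) d 0 p.1) * u T : C^o].
have Dl : linear D.
  by move=> a x y; apply/ffunP=> T; rewrite !ffunE mulrDr; congr (_ + _); exact: mulrCA.
pose DL := GRing.isLinear.Build C W W *:%R D Dl.
pose D' : {linear W -> W} := HB.pack D DL.
apply: (fock_lin_eq (f := @ext_act C n k (diag_mx d)) (g := D')) => /= [|p v IH].
  rewrite ext_act_vac; apply/ffunP=> T; rewrite !ffunE; case: eqP => [->|_].
    by rewrite big_set0 mul1r.
  by rewrite mulr0.
rewrite ext_act_cr gcr_diag IH; apply/ffunP=> T; rewrite !ffunE; case: ifP => pT.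
  rewrite [in RHS](finset.big_setD1 p) //=.
  have R (a b c e : C) : a * (b * (c * e)) = a * c * (b * e) by ring.
  exact: R.
by rewrite [LHS]mulr0 mulr0.
Qed.

Definition dot (u v : W) : C := \sum_S (u S : C) * (v S : C)^*.

Lemma dotDl u v w : dot (u + v) w = dot u w + dot v w.
Proof. by rewrite /dot -big_split; apply: eq_bigr => S _; rewrite ffunE mulrDl. Qed.

Lemma dotZl a u w : dot (a *: u) w = a * dot u w.
Proof. by rewrite /dot mulr_sumr; apply: eq_bigr => S _; rewrite ffunE mulrA. Qed.

Lemma dotC u w : dot u w = (dot w u)^*.
Proof.
have cM (a b : C) : a * b^* = (b * a^*)^* by rewrite rmorphM /= conjCK mulrC.
by rewrite /dot rmorph_sum; apply: eq_bigr => S _; exact: cM.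
Qed.

Lemma dotDr u v w : dot w (u + v) = dot w u + dot w v.
Proof. by rewrite dotC dotDl rmorphD /= -!dotC. Qed.

Lemma dotZr a u w : dot w (a *: u) = a^* * dot w u.
Proof. by rewrite dotC dotZl rmorphM /= -dotC. Qed.

Lemma dot0l u : dot 0 u = 0.
Proof. by rewrite -(scale0r 0) dotZl mul0r. Qed.

Lemma dot0r u : dot u 0 = 0.
Proof. by rewrite dotC dot0l rmorph0. Qed.

Lemma dotNl u v : dot (- u) v = - dot u v.
Proof. by rewrite -scaleN1r dotZl mulN1r. Qed.

Lemma dot_suml (J : Type) (r : seq J) (P : pred J) (x : J -> W) u :
  dot (\sum_(j <- r | P j) x j) u = \sum_(j <- r | P j) dot (x j) u.
Proof. by apply: (big_morph (fun A => dot A u)) => [x' y|]; rewrite ?dotDl ?dot0l. Qed.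

Lemma dot_sumr (J : Type) (r : seq J) (P : pred J) (x : J -> W) u :
  dot u (\sum_(j <- r | P j) x j) = \sum_(j <- r | P j) dot u (x j).
Proof. by apply: (big_morph (fun A => dot u A)) => [x' y|]; rewrite ?dotDr ?dot0r. Qed.

Lemma dotuu_ge0 u : 0 <= dot u u.
Proof. by apply: sumr_ge0 => S _; rewrite mul_conjC_ge0. Qed.

Lemma dotuu_eq0 u : (dot u u == 0) = (u == 0).
Proof.
apply/idP/eqP => [|->]; last by rewrite dot0l.
rewrite /dot psumr_eq0 => [/allP h|S _]; last exact: mul_conjC_ge0.
by apply/ffunP=> S; rewrite ffunE; apply/eqP; rewrite -mul_conjC_eq0; apply: h; rewrite mem_index_enum.
Qed.

Lemma dot_ebas u S : dot u (ebas C S) = u S.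
Proof.
rewrite /dot (bigD1 S) //= big1 ?addr0 => [|T TS]; rewrite ffunE.
  by rewrite eqxx rmorph1 mulr1.
by rewrite (negbTE TS) rmorph0 mulr0.
Qed.

Lemma conj_fsgn p (S : {set I}) : (fsgn C p S)^* = fsgn C p S.
Proof. by rewrite /fsgn rmorphXn rmorphN1. Qed.

Lemma dot_cr p u v : dot (cr p u) v = dot u (an p v).
Proof.
rewrite /dot (bigID (fun S : {set I} => p \in S)) /= [X in _ + X]big1 ?addr0; last first.
  by move=> S /negbTE pS; rewrite ffunE pS mul0r.
rewrite [RHS](bigID (fun S : {set I} => p \in S)) /= [X in _ = X + _]big1 ?add0r; last first.
  by move=> S pS; rewrite ffunE pS rmorph0 mulr0.
rewrite (reindex_onto (fun S => p |: S)%SET (fun S => S :\ p)%SET) /=; last first.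
  by move=> S pS; rewrite finset.setD1K.
apply: eq_big => [S|S /andP[_ /eqP E]].
  rewrite !inE eqxx /=; apply/eqP/idP => [<-|pS]; first by rewrite !inE eqxx.
  by rewrite finset.setU1K.
have pS : p \notin S by rewrite -E !inE eqxx.
rewrite !ffunE !inE eqxx (negbTE pS) /= E.
have R (a b c : C) : a^* = a -> a * b * c^* = b * (a * c)^*.
  by move=> ac; rewrite rmorphM /= ac; ring.
exact/R/conj_fsgn.
Qed.

Lemma dot_an p u v : dot (an p u) v = dot u (cr p v).
Proof. by rewrite dotC -dot_cr -dotC. Qed.

Definition adj (A : M) : M := \matrix_(i, j) (A j i)^*.

(** An algebraic form of the unitary trick: as [adj] permutes the generators [Fm] of the Lie algebra
    ([adj_Fm]), the orthogonal complement of a stable subspace is stable. *)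
Lemma dot_dr A u v : dot (dr A u) v = dot u (dr (adj A) v).
Proof.
rewrite !drE dot_suml dot_sumr; under eq_bigr do rewrite dot_suml.
under [RHS]eq_bigr do rewrite dot_sumr.
rewrite [RHS]exchange_big /=; apply: eq_bigr => i _; apply: eq_bigr => j _.
rewrite dotZl dotZr mxE conjCK; congr (_ * _).
rewrite dot_suml dot_sumr; apply: eq_bigr => a _.
by rewrite dot_cr dot_an.
Qed.

Lemma crDr p (u v : W) : cr p (u + v) = cr p u + cr p v.
Proof. exact: linearD. Qed.

Lemma crZr p a (u : W) : cr p (a *: u) = a *: cr p u.
Proof. exact: linearZ. Qed.

Lemma cr_sumr p (J : Type) (r : seq J) (P : pred J) (x : J -> W) :
  cr p (\sum_(j <- r | P j) x j) = \sum_(j <- r | P j) cr p (x j).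
Proof. exact: linear_sum. Qed.

Lemma gcrDr A p (u v : W) : gcr A p (u + v) = gcr A p u + gcr A p v.
Proof. exact: linearD. Qed.

Lemma gcrZr A p a (u : W) : gcr A p (a *: u) = a *: gcr A p u.
Proof. exact: linearZ. Qed.

Lemma gcr_sumr A p (J : Type) (r : seq J) (P : pred J) (x : J -> W) :
  gcr A p (\sum_(j <- r | P j) x j) = \sum_(j <- r | P j) gcr A p (x j).
Proof. exact: linear_sum. Qed.

Lemma drDr A (u v : W) : dr A (u + v) = dr A u + dr A v.
Proof. exact: linearD. Qed.

Lemma drZr A a (u : W) : dr A (a *: u) = a *: dr A u.
Proof. exact: linearZ. Qed.

Lemma dr_sumr A (J : Type) (r : seq J) (P : pred J) (x : J -> W) :
  dr A (\sum_(j <- r | P j) x j) = \sum_(j <- r | P j) dr A (x j).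
Proof. exact: linear_sum. Qed.

Lemma dr0r A : dr A (0 : W) = 0.
Proof. exact: linear0. Qed.

Lemma actDr A (u v : W) : ext_act A (u + v) = ext_act A u + ext_act A v.
Proof. exact: linearD. Qed.

Lemma actZr A a (u : W) : ext_act A (a *: u) = a *: ext_act A u.
Proof. exact: linearZ. Qed.

Lemma act_sumr A (J : Type) (r : seq J) (P : pred J) (x : J -> W) :
  ext_act A (\sum_(j <- r | P j) x j) = \sum_(j <- r | P j) ext_act A (x j).
Proof. exact: linear_sum. Qed.

Lemma act0r A : ext_act A (0 : W) = 0.
Proof. exact: linear0. Qed.

End ExtAct.

(** * Generation of the classical groups by root and torus elements *)

Section Involution.

Variables (C : numClosedFieldType) (n : nat) (eps : 'I_n -> C) (eta : C).
Hypothesis eps_sq : forall i, eps i * eps i = 1.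
Hypothesis eps_rev : forall i, eps (rev_ord i) = eta * eps i.
Local Notation M := 'M[C]_n.

(* [eps] gives the entries of an antidiagonal form; its Lie algebra consists of the
   matrices [A] with [sigma A = - A]. *)
Definition sigma (A : M) : M := \matrix_(i, j) (eps i * eps j * A (rev_ord j) (rev_ord i)).

(* Wrapped in a locked matrix so that rewriting does not unfold it to a difference. *)
Definition Fm (i j : 'I_n) : M := \matrix_(a, b) (delta_mx i j - sigma (delta_mx i j)) a b.

Lemma Fm_def i j : Fm i j = delta_mx i j - sigma (delta_mx i j).
Proof. by apply/matrixP=> a b; rewrite mxE. Qed.

Lemma eta_sq (i : 'I_n) : eta * eta = 1.
Proof.
have := eps_sq (rev_ord i); rewrite eps_rev mulrACA eps_sq mulr1; exact.
Qed.

Lemma eps_neq0 i : eps i != 0.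
Proof. by apply/eqP => h; have := eps_sq i; rewrite h mul0r => /esym/eqP; rewrite oner_eq0. Qed.

Lemma conj_eps i : (eps i)^* = eps i.
Proof.
have /eqP := eps_sq i; rewrite -subr_eq0 -expr2 subr_sqr_1 mulf_eq0 subr_eq0 addr_eq0.
by case/orP => /eqP ->; rewrite ?rmorph1 // rmorphN1.
Qed.

Lemma sigmaD A B : sigma (A + B) = sigma A + sigma B.
Proof. by apply/matrixP=> i j; rewrite !mxE mulrDr. Qed.

Lemma sigmaZ a A : sigma (a *: A) = a *: sigma A.
Proof. by apply/matrixP=> i j; rewrite !mxE mulrCA. Qed.

Lemma sigmaN A : sigma (- A) = - sigma A.
Proof. by rewrite -scaleN1r sigmaZ scaleN1r. Qed.

Lemma sigma_sum (J : Type) (r : seq J) (P : pred J) (A : J -> M) :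
  sigma (\sum_(j <- r | P j) A j) = \sum_(j <- r | P j) sigma (A j).
Proof.
apply: (big_morph sigma) => [x y|]; first exact: sigmaD.
by apply/matrixP=> i j; rewrite !mxE mulr0.
Qed.

Lemma sigmaM A B : sigma (A *m B) = sigma B *m sigma A.
Proof.
apply/matrixP=> i j; rewrite !mxE mulr_sumr (reindex_inj rev_ord_inj); apply: eq_bigr => c _ /=.
rewrite ![sigma _ _ _]mxE.
transitivity ((eps c * eps c) * (eps i * eps j * (A (rev_ord j) (rev_ord c) * B (rev_ord c) (rev_ord i)))).
  by rewrite eps_sq mul1r.
by ring.
Qed.

Lemma sigma1 : sigma 1%:M = 1%:M.
Proof.
apply/matrixP=> i j; rewrite !mxE (inj_eq rev_ord_inj) eq_sym.
by case: eqP => [->|_]; rewrite ?mulr0 // eps_sq mulr1.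
Qed.

Lemma sigmaK A : sigma (sigma A) = A.
Proof.
apply/matrixP=> i j; rewrite !mxE !rev_ordK !eps_rev.
rewrite [_ * (_ * _ * A i j)](_ : _ = (eta * eta) * (eps i * eps i) * (eps j * eps j) * A i j); last by ring.
by rewrite (eta_sq i) !eps_sq !mul1r.
Qed.

Lemma sigma_delta i j : sigma (delta_mx i j) = (eps i * eps j) *: delta_mx (rev_ord j) (rev_ord i).
Proof.
apply/matrixP=> a b; rewrite !mxE.
have -> : (rev_ord b == i) && (rev_ord a == j) = (a == rev_ord j) && (b == rev_ord i).
  by rewrite andbC -(inj_eq rev_ord_inj) rev_ordK -(inj_eq rev_ord_inj b) rev_ordK.
case: andP => [[/eqP -> /eqP ->]|_]; last by rewrite !mulr0.
rewrite !mulr1 !eps_rev.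
by rewrite mulrACA (eta_sq i) mul1r mulrC.
Qed.

Lemma FmE i j : Fm i j = delta_mx i j - (eps i * eps j) *: delta_mx (rev_ord j) (rev_ord i).
Proof. by rewrite Fm_def sigma_delta. Qed.

Lemma sigma_Fm i j : sigma (Fm i j) = - Fm i j.
Proof. by rewrite Fm_def sigmaD sigmaN sigmaK opprB addrC. Qed.

Lemma adj_Fm i j : adj (Fm i j) = Fm j i.
Proof.
apply/matrixP=> a b; rewrite !FmE !mxE rmorphB rmorphM /= rmorphM /= !conj_eps.
by rewrite !rmorph_nat [eps j * _]mulrC ![_ && (b == _)]andbC.
Qed.

Lemma lie_comm X Y : sigma X = - X -> sigma Y = - Y ->
  sigma (X *m Y - Y *m X) = - (X *m Y - Y *m X).
Proof.
move=> hX hY; rewrite sigmaD sigmaN !sigmaM hX hY !mulNmx !mulmxN !opprK opprB.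
by rewrite addrC.
Qed.

(** Antisymmetrising the expansion of [X] in matrix units gives [X - sigma X], which is [2 X]; hence
    the factor. *)
Lemma lie_span X : sigma X = - X -> X = 2^-1 *: \sum_i \sum_j X i j *: Fm i j.
Proof.
move=> hX; under eq_bigr do under eq_bigr do rewrite Fm_def.
have XE : X = \sum_i \sum_j X i j *: delta_mx i j by exact: matrix_sum_delta.
have -> : \sum_i \sum_j X i j *: (delta_mx i j - sigma (delta_mx i j)) = X - sigma X.
  rewrite [X in _ = X - _]XE [X in sigma X]XE sigma_sum -sumrB; apply: eq_bigr => i _.
  by rewrite sigma_sum -sumrB; apply: eq_bigr => j _; rewrite sigmaZ scalerBr.
have -> : X - sigma X = 2 *: X by rewrite hX opprK scaler_nat mulr2n.
by rewrite scalerA mulVf ?scale1r // pnatr_eq0.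
Qed.

Lemma mul_delta_l (X : M) (i j : 'I_n) : X *m delta_mx i j = \sum_k X k i *: (delta_mx k j : M).
Proof.
apply/matrixP=> a b; rewrite !mxE summxE (bigD1 i) //= big1 => [|c ci].
  rewrite (bigD1 a) //= big1 => [|c ca]; rewrite !mxE ?eqxx /= ?addr0 //.
  by rewrite [a == c]eq_sym (negbTE ca) mulr0.
by rewrite !mxE (negbTE ci) mulr0.
Qed.

Lemma mul_delta_r (X : M) (i j : 'I_n) : delta_mx i j *m X = \sum_k X j k *: (delta_mx i k : M).
Proof.
apply/matrixP=> a b; rewrite !mxE summxE (bigD1 j) //= big1 => [|c cj].
  rewrite (bigD1 b) //= big1 => [|c cb]; rewrite !mxE ?eqxx ?andbT /= ?addr0 //; first by rewrite mulrC.
  by rewrite [b == c]eq_sym (negbTE cb) andbF mulr0.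
by rewrite !mxE (negbTE cj) andbF mul0r.
Qed.

(** Bracketing with [X] commutes with the projection [A - sigma A], so the formula is the one for
    matrix units, projected. *)
Lemma comm_Fm X i j : sigma X = - X ->
  X *m Fm i j - Fm i j *m X = \sum_k X k i *: Fm k j - \sum_k X j k *: Fm i k.
Proof.
move=> hX; rewrite Fm_def; under [X in _ = X - _]eq_bigr do rewrite Fm_def.
under [X in _ = _ - X]eq_bigr do rewrite Fm_def.
transitivity ((X *m delta_mx i j - delta_mx i j *m X) - sigma (X *m delta_mx i j - delta_mx i j *m X)).
  rewrite sigmaD sigmaN !sigmaM hX mulNmx mulmxN opprK mulmxBr mulmxBl.
  rewrite !opprB !opprD !opprK -!addrA; congr (_ + _).
  by rewrite addrCA [RHS]addrCA; congr (_ + _); rewrite addrC.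
rewrite mul_delta_l mul_delta_r.
rewrite sigmaD sigmaN !sigma_sum opprD opprK addrACA -sumrB; congr (_ + _).
  by apply: eq_bigr => k _; rewrite sigmaZ scalerBr.
rewrite addrC -sumrB -sumrN; apply: eq_bigr => k _.
by rewrite sigmaZ scalerBr opprB.
Qed.

Lemma Fm_sq i j : i != j -> Fm i j *m Fm i j =
  - (eps i * eps j) *: (delta_mx i (rev_ord i) *+ (j == rev_ord j) + delta_mx (rev_ord j) j *+ (i == rev_ord i)).
Proof.
move=> ij; rewrite FmE mulmxBl !mulmxBr -!scalemxAl -!scalemxAr !mul_delta_mx_cond.
rewrite [j == i]eq_sym (negbTE ij) (inj_eq rev_ord_inj) (negbTE ij) !mulr0n !scaler0 subr0 sub0r.
by rewrite [rev_ord i == i]eq_sym scaleNr scalerDr opprD.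
Qed.

(** By [Fm_sq] the square is nonzero only if [i] or [j] is the middle index, and distinct indices
    cannot both be in the middle. *)
Lemma Fm_cube i j : i != j -> Fm i j *m (Fm i j *m Fm i j) = 0.
Proof.
move=> ij; rewrite Fm_sq // -scalemxAr FmE.
have e0 : ~~ ((j == rev_ord j) && (i == rev_ord i)).
  apply/negP=> /andP[/eqP /(congr1 val) /= hj /eqP /(congr1 val) /= hi].
  by move/eqP: ij; apply; apply: val_inj => /=; have := ltn_ord i; have := ltn_ord j; lia.
have ji : (j == i) = false by rewrite eq_sym; apply/negbTE.
case: (eqVneq j (rev_ord j)) e0 => ej; case: (eqVneq i (rev_ord i)) => ei //= _;
  rewrite ?mulr0n ?mulr1n ?addr0 ?add0r ?mulmx0 ?scaler0 // mulmxBl -!scalemxAl !mul_delta_mx_cond.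
- by rewrite ji [rev_ord i == i]eq_sym (negbTE ei) !mulr0n scaler0 subr0 scaler0.
- by rewrite (negbTE ej) (inj_eq rev_ord_inj) eq_sym ji !mulr0n scaler0 subr0 scaler0.
Qed.

(** The one-parameter root subgroup: by [Fm_cube] this is the full exponential of [s *: Fm i j]. Its
    quadratic term survives only for the short roots of the odd orthogonal groups. *)
Definition xr (i j : 'I_n) (s : C) : M :=
  1%:M + s *: Fm i j + (s ^+ 2 / 2) *: (Fm i j *m Fm i j).

Lemma xrD i j s t : i != j -> xr i j s *m xr i j t = xr i j (s + t).
Proof.
move=> ij; have F3 := Fm_cube ij; rewrite /xr.
set F := Fm i j in F3 *; set F2 := F *m F in F3 *.
have F3' : F2 *m F = 0 by rewrite /F2 -mulmxA.
have F4 : F2 *m F2 = 0 by rewrite {1}/F2 -mulmxA F3 mulmx0.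
rewrite !mulmxDl !mulmxDr !mul1mx !mulmx1 -!scalemxAl -!scalemxAr F3 F3' F4 !scaler0 !addr0 -/F2.
apply/matrixP=> a b; rewrite !mxE.
by field.
Qed.

Lemma xr0 i j : xr i j 0 = 1%:M.
Proof. by rewrite /xr expr0n mul0r !scale0r !addr0. Qed.

Lemma sigma_xr i j s : sigma (xr i j s) = xr i j (- s).
Proof.
rewrite /xr !sigmaD sigma1 !sigmaZ sigmaM !sigma_Fm mulNmx mulmxN opprK sqrrN.
by rewrite scalerN scaleNr.
Qed.

Lemma Fm_tr i j : (Fm i j)^T = Fm j i.
Proof.
by apply/matrixP=> a b; rewrite !FmE !mxE [eps j * _]mulrC ![_ && (b == _)]andbC.
Qed.

Lemma xr_tr i j s : (xr i j s)^T = xr j i s.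
Proof. by rewrite /xr [(_ + _)^T]linearD /= [(_ + _)^T]linearD /= ![(_ *: _)^T]linearZ /= trmx1 trmx_mul Fm_tr. Qed.

Lemma Fm_upper (i j a b : 'I_n) : (i < j)%N -> (b <= a)%N -> Fm i j a b = 0.
Proof.
move=> ij ba; rewrite FmE !mxE.
case: andP => [[/eqP ai /eqP bj]|_]; first by move: ba ij; rewrite ai bj; lia.
case: andP => [[/eqP ai /eqP bj]|_]; last by rewrite mulr0 subr0.
move: ba ij; rewrite ai bj /=; have := ltn_ord i; have := ltn_ord j; lia.
Qed.

Lemma Fm2_upper (i j a b : 'I_n) : (i < j)%N -> (b <= a)%N -> (Fm i j *m Fm i j) a b = 0.
Proof.
move=> ij ba; rewrite mxE big1 // => c _.
case: (leqP c a) => ca; first by rewrite Fm_upper ?mul0r.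
by rewrite [X in _ * X]Fm_upper ?mulr0 //; apply: leq_trans (ltnW ca).
Qed.

Lemma xrE i j s a b :
  xr i j s a b = (a == b)%:R + s * Fm i j a b + s ^+ 2 / 2 * (Fm i j *m Fm i j) a b.
Proof. by rewrite /xr; move: (Fm i j) => F; rewrite !mxE. Qed.

Lemma xr_upper (i j : 'I_n) s : (i < j)%N -> is_trig_mx (xr i j s)^T /\ forall a, xr i j s a a = 1.
Proof.
move=> ij; split.
  apply/is_trig_mxP => a b ab; rewrite mxE xrE.
  rewrite (Fm2_upper ij (ltnW ab)) (Fm_upper ij (ltnW ab)) !mulr0 !addr0.
  by case: eqP ab => // ->; rewrite ltnn.
move=> a; rewrite xrE.
by rewrite Fm2_upper // Fm_upper // !mulr0 !addr0 eqxx.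
Qed.

Lemma det_xr i j s : i != j -> \det (xr i j s) = 1.
Proof.
wlog ij : i j / (i < j)%N => [h|] ij'.
  have [|ji] := boolP (i < j)%N; first by move/h; apply.
  rewrite -det_tr xr_tr; apply: h; rewrite 1?eq_sym // ltn_neqAle leqNgt ji andbT.
  by apply: contra ij' => /eqP /val_inj ->.
have [h1 h2] := xr_upper s ij.
rewrite -det_tr det_trig // big1 // => a _; by rewrite mxE h2.
Qed.

End Involution.

Lemma poly_eq0_all (F : numFieldType) (p : {poly F}) : (forall s, p.[s] = 0) -> p = 0.
Proof.
move=> h; apply/eqP/negPn/negP => p0.
pose rs := [seq (i%:R : F) | i <- iota 0 (size p)].
have : (size rs < size p)%N.
  apply: max_poly_roots => //; first by apply/allP=> x _; rewrite /root h.
  by rewrite map_inj_uniq ?iota_uniq // => x y /eqP; rewrite eqr_nat => /eqP.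
by rewrite size_map size_iota ltnn.
Qed.

Lemma vspace_sep (F : fieldType) (V : vectType F) (U : {vspace V}) :
  exists f : {linear V -> V}, forall v, (v \in U) = (f v == 0).
Proof.
exists (idfun \- projv U : {linear V -> V}) => v /=.
rewrite subr_eq0.
apply/idP/eqP => [vU|->]; first by rewrite projv_id.
exact: memv_proj.
Qed.

(** After a linear map with kernel [U], each coordinate of the curve is a polynomial that vanishes
    at all points of an infinite field. This extracts Lie algebra information from a one-parameter
    group. *)
Lemma vspace_poly_coef (F : numFieldType) (V : vectType F) (U : {vspace V}) (N : nat) (x : nat -> V) :
  (forall s : F, \sum_(m < N) s ^+ m *: x m \in U) -> forall m, (m < N)%N -> x m \in U.
Proof.
have [f fU] := vspace_sep U => h m mN; rewrite fU; apply/eqP.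
rewrite (coord_vbasis (memvf (f (x m)))) big1 // => j _.
pose p := \poly_(i < N) coord (vbasis fullv) j (f (x i)).
suff : p = 0 by move/(congr1 (fun q : {poly F} => q`_m)); rewrite coef_poly mN coef0 => ->; rewrite scale0r.
apply: poly_eq0_all => s; rewrite horner_poly.
have := h s; rewrite fU => /eqP /(congr1 (coord (vbasis fullv) j)).
rewrite linear0 !linear_sum /= => e0; rewrite -[RHS]e0.
by apply: eq_bigr => i _; rewrite !linearZ /= mulrC.
Qed.

(** * Root subgroups act by exponentials of the derived action *)

Section RootExp.

Variables (C : numClosedFieldType) (n k : nat) (F : 'M[C]_n).
Hypothesis F3 : F *m (F *m F) = 0.
Local Notation I := ('I_n * 'I_k)%type.
Local Notation W := (exterior C I).

Definition dpow (m : nat) (u : W) : W := m`!%:R^-1 *: iter m (dr F) u.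

Lemma dpow0 u : dpow 0 u = u.
Proof. by rewrite /dpow fact0 invr1 scale1r. Qed.

Lemma dpowS m u : dpow m.+1 u = m.+1%:R^-1 *: dr F (dpow m u).
Proof. by rewrite /dpow iterS linearZ /= scalerA factS natrM invfM. Qed.

Lemma dpow1 u : dpow 1 u = dr F u.
Proof. by rewrite dpowS dpow0 invr1 scale1r. Qed.

Lemma iter_dr_linear m : linear (iter m (dr F) : W -> W).
Proof. by move=> a u v; elim: m => //= m ->; rewrite linearP. Qed.

Lemma dpowP m a u v : dpow m (a *: u + v) = a *: dpow m u + dpow m v.
Proof. by rewrite /dpow iter_dr_linear scalerDr !scalerA mulrC. Qed.

Lemma gcr0 p (u : W) : gcr 0 p u = 0.
Proof. by rewrite /gcr big1 // => i _; rewrite mxE scale0r. Qed.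

(** Leibniz rule for divided powers. In general the term [gcr (F ^ j / j!) p (dpow (m + 2 - j) u)]
    occurs for every [j]; as [F] has cube zero, only three remain. *)
Lemma dpow_cr m p u : dpow m.+2 (cr p u) =
  cr p (dpow m.+2 u) + gcr F p (dpow m.+1 u) + 2^-1 *: gcr (F *m F) p (dpow m u).
Proof.
elim: m => [|m IH].
  rewrite !dpowS !dpow0 invr1 !scale1r !dr_cr linearD /= dr_cr dr_gcr.
  rewrite crZr !scalerDr !addrA; congr (_ + _).
  rewrite -addrA; congr (_ + _).
  by rewrite -scalerDl (_ : 2^-1 + 2^-1 = 1) ?scale1r //; field.
rewrite dpowS IH !drDr drZr dr_cr !dr_gcr F3 gcr0 addr0.
have dE j v : dr F (dpow j v) = j.+1%:R *: dpow j.+1 v.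
  by rewrite dpowS scalerA mulfV ?scale1r // pnatr_eq0.
have G (V : lmodType C) (x y z : V) : m.+3%:R^-1 *:
    (m.+3%:R *: x + y + (m.+2%:R *: y + z) + 2^-1 *: (m.+1%:R *: z)) = x + y + 2^-1 *: z.
  rewrite !scalerDr !scalerA mulVf ?pnatr_eq0 // scale1r -!addrA; congr (_ + _).
  rewrite addrA -scalerDl -scalerDl; congr (_ + _).
    by rewrite -[RHS]scale1r; congr (_ *: _); field; rewrite ?pnatr_eq0.
  by congr (_ *: _); field; rewrite ?pnatr_eq0.
rewrite !dE !crZr !gcrZr; exact: G.
Qed.

(** The exponential series of [dr F] and the action of the exponential of [F] agree on the vacuum
    and obey the same rule with respect to [cr]. The bound [N] depends on [u]: nilpotency is proved
    along the same induction. *)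
Lemma ext_act_exp (u : W) : exists N, (forall m, (N <= m)%N -> dpow m u = 0) /\
  forall s, ext_act (1%:M + s *: F + (s ^+ 2 / 2) *: (F *m F)) u = \sum_(m < N) s ^+ m *: dpow m u.
Proof.
have widen N N' v s : (N <= N')%N -> (forall m, (N <= m)%N -> dpow m v = 0) ->
    \sum_(m < N) s ^+ m *: dpow m v = \sum_(m < N') s ^+ m *: dpow m v.
  move=> NN' h; rewrite -!(big_mkord predT (fun m => s ^+ m *: dpow m v)).
  rewrite [RHS](big_cat_nat (leq0n _) NN') /= [X in _ = _ + X]big_nat_cond [X in _ = _ + X]big1 ?addr0 //.
  by move=> m /andP[/andP[/h -> _] _]; rewrite scaler0.
move: u; apply: fock_ind => [a u v [N1 [z1 e1]] [N2 [z2 e2]]||p u [N [z e]]].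
- exists (maxn N1 N2); split => [m|s].
    by rewrite geq_max => /andP[/z1 h1 /z2 h2]; rewrite dpowP h1 h2 scaler0 addr0.
  rewrite [ext_act _ _]linearP /= e1 e2 (widen N1 (maxn N1 N2)) ?leq_maxl // (widen N2 (maxn N1 N2)) ?leq_maxr //.
  rewrite scaler_sumr -big_split; apply: eq_bigr => m _.
  by rewrite /= dpowP scalerDr !scalerA [a * _]mulrC.
- exists 1%N; split => [[//|m] _|s]; last by rewrite big_ord1 expr0 scale1r dpow0 ext_act_vac.
  by rewrite /dpow iterSr dr_vac (_ : iter m (dr F) 0 = 0) ?scaler0 //; elim: m => //= m ->; rewrite linear0.
(* A new factor adds at most two to the degree in [s], the degree of [1 + s F + s^2 F^2 / 2]. *)
- exists N.+2; split => [[//|[//|m]] Nm|s].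
    by rewrite dpow_cr !z ?linear0 ?scaler0 ?addr0 //; lia.
  rewrite ext_act_cr e !gcrD !gcrZ gcr1.
  rewrite [in RHS]big_ord_recl [in RHS]big_ord_recl /= expr0 scale1r dpow0 expr1 dpow1 dr_cr.
  set T := \sum_(_ < _) _ *: dpow _ _.
  have E1 : T = u + s *: dr F u + \sum_(m < N) s ^+ m.+2 *: dpow m.+2 u.
    rewrite /T (widen N N.+2) // 1?leqW // big_ord_recl big_ord_recl /= expr0 scale1r dpow0 expr1 dpow1 addrA.
    by congr (_ + _).
  have E2 : T = u + \sum_(m < N) s ^+ m.+1 *: dpow m.+1 u.
    by rewrite /T (widen N N.+1) // big_ord_recl /= expr0 scale1r dpow0; congr (_ + _).
  have -> : \sum_(i < N) s ^+ bump 0 (bump 0 i) *: dpow (bump 0 (bump 0 i)) (cr p u) =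
     cr p (\sum_(m < N) s ^+ m.+2 *: dpow m.+2 u) +
     s *: gcr F p (\sum_(m < N) s ^+ m.+1 *: dpow m.+1 u) + (s ^+ 2 / 2) *: gcr (F *m F) p T.
    rewrite /T cr_sumr !gcr_sumr !scaler_sumr -!big_split; apply: eq_bigr => m _ /=.
    have G (V : lmodType C) (x y t : V) : s ^+ m.+2 *: (x + y + 2^-1 *: t) =
        s ^+ m.+2 *: x + s *: (s ^+ m.+1 *: y) + (s ^+ 2 / 2) *: (s ^+ m *: t).
      rewrite !scalerDr !scalerA -exprS; congr (_ + _ + _ *: _).
      by rewrite !exprS expr0; ring.
    transitivity (s ^+ m.+2 *: dpow m.+2 (cr p u)); first by [].
    rewrite dpow_cr (crZr p (s ^+ m.+2)) (gcrZr F p (s ^+ m.+1)) (gcrZr _ p (s ^+ m)).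
    exact (G _ (cr p (dpow m.+2 u)) (gcr F p (dpow m.+1 u)) (gcr (F *m F) p (dpow m u))).
  have G (V : lmodType C) (x y t1 t v w : V) :
     x + s *: y + t1 + s *: (t + v) + w = x + (s *: (y + t) + (t1 + s *: v + w)).
    rewrite !scalerDr -!addrA; congr (_ + _); congr (_ + _).
    by rewrite addrCA.
  rewrite {1}E1 [X in gcr F p X]E2 !crDr gcrDr crZr; exact: G.
Qed.

(** The coefficient of [s] in the polynomial curve of [ext_act_exp] is [dr F u]; the curve stays in
    [U] exactly when its coefficients do. *)
Lemma dr_xr_stable (U : {vspace W}) :
  (forall u, u \in U -> dr F u \in U) <->
  (forall s u, u \in U -> ext_act (1%:M + s *: F + (s ^+ 2 / 2) *: (F *m F)) u \in U).
Proof.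
split=> h.
  move=> s u uU; have [N [_ ->]] := ext_act_exp u.
  apply: memv_suml => m _; rewrite memvZ // /dpow memvZ //.
  by elim: (nat_of_ord m) => //= j; exact: h.
move=> u uU; have [N [z e]] := ext_act_exp u.
rewrite -dpow1; case: (leqP N 1) => [/z ->|N1]; first exact: mem0v.
apply: (@vspace_poly_coef _ _ U N (fun m => dpow m u)) => // s.
by rewrite -e; exact: h.
Qed.

End RootExp.

Section Generation.

Variables (C : numClosedFieldType) (n : nat) (eps : 'I_n -> C) (eta : C).
Hypothesis eps_sq : forall i, eps i * eps i = 1.
Hypothesis eps_rev : forall i, eps (rev_ord i) = eta * eps i.
Local Notation M := 'M[C]_n.
Local Notation sg := (sigma eps).
Local Notation xr := (xr eps).

(** The second clause concerns the middle index of an odd dimension: the form allows the entries 1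
    and -1 there, and determinant one selects 1. *)
Definition is_tor (d : 'rV[C]_n) := forall j, d 0 j * d 0 (rev_ord j) = 1 /\ (rev_ord j = j -> d 0 j = 1).

(** Generators are multiplied on the left only, which is the form in which row operations undo them
    ([ggenV_xr], [ggenV_tor]). *)
Inductive ggen : M -> Prop :=
| ggen1 : ggen 1%:M
| ggen_xr i j s g : i != j -> ggen g -> ggen (xr i j s *m g)
| ggen_tor d g : is_tor d -> ggen g -> ggen (diag_mx d *m g).

Lemma ggenV_xr i j s g : i != j -> ggen (xr i j s *m g) -> ggen g.
Proof.
move=> ij /(ggen_xr (- s) ij); rewrite mulmxA (xrD eps_sq eps_rev) // addNr.
by rewrite xr0 mul1mx.
Qed.

Lemma ggenV_tor d g : is_tor d -> ggen (diag_mx d *m g) -> ggen g.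
Proof.
move=> td.
have d0 j : d 0 j != 0.
  by apply/eqP => h; have [] := td j; rewrite h mul0r => /esym/eqP; rewrite oner_eq0.
have td' : is_tor (\row_j (d 0 j)^-1).
  by move=> j; rewrite !mxE -invfM; have [-> h] := td j; rewrite invr1; split => // /h ->; rewrite invr1.
move/(ggen_tor td'); rewrite mulmxA mulmx_diag.
rewrite [X in diag_mx X](_ : _ = const_mx 1) ?diag_const_mx ?mul1mx //.
by apply/rowP=> j; rewrite !mxE mulVf.
Qed.

Definition orth (g : M) := sg g *m g = 1%:M.

Lemma orth_mul g h : orth g -> orth h -> orth (g *m h).
Proof. by rewrite /orth => og oh; rewrite sigmaM // mulmxA -(mulmxA (sg h)) og mulmx1. Qed.

Lemma orth_xr i j s : i != j -> orth (xr i j s).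
Proof. by move=> ij; rewrite /orth (sigma_xr eps_sq eps_rev) (xrD eps_sq eps_rev) // addNr xr0. Qed.

Lemma sigma_diag d : sg (diag_mx d) = diag_mx (\row_j d 0 (rev_ord j)).
Proof.
apply/matrixP=> a b; rewrite !mxE (inj_eq rev_ord_inj) eq_sym.
case: eqP => [->|_]; last by rewrite !mulr0n mulr0.
by rewrite eps_sq mul1r.
Qed.

Lemma orth_tor d : is_tor d -> orth (diag_mx d).
Proof.
move=> td; rewrite /orth sigma_diag mulmx_diag.
rewrite [X in diag_mx X](_ : _ = const_mx 1) ?diag_const_mx //.
by apply/rowP=> j; rewrite !mxE mulrC; have [] := td j.
Qed.

Lemma det_tor d : is_tor d -> \det (diag_mx d) = 1.
Proof.
move=> td; rewrite det_diag.
have d0 j : d 0 j != 0.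
  by apply/eqP => h; have [] := td j; rewrite h mul0r => /esym/eqP; rewrite oner_eq0.
have side (i : 'I_n) : (rev_ord i < i)%N || (rev_ord i == i) || (i < rev_ord i)%N.
  by rewrite -(inj_eq val_inj) /=; lia.
rewrite (bigID (fun i : 'I_n => (i < rev_ord i)%N)) /=.
rewrite [X in _ * X](bigID (fun i : 'I_n => rev_ord i == i)) /=.
rewrite [X in _ * (X * _)]big1 ?mul1r => [|i /andP[_ /eqP]]; last by have [] := td i.
rewrite [X in _ * X](reindex_inj rev_ord_inj) /=.
rewrite [X in _ * X](eq_bigl (fun i : 'I_n => (i < rev_ord i)%N)); last first.
  move=> i; rewrite /= -!(inj_eq val_inj) /=; have := ltn_ord i; lia.
by rewrite -big_split big1 //= => i _; have [] := td i.
Qed.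

Definition cole (g : M) (c : 'I_n) := forall a, g a c = (a == c)%:R.

(** As [sg g] is a left inverse of [g], it fixes the same basis vector; its column [c] is, up to
    signs, the row [rev_ord c] of [g]. Clearing a column thus clears the opposite row for free. *)
Lemma orth_row g c : orth g -> cole g c -> forall a, g (rev_ord c) a = (a == rev_ord c)%:R.
Proof.
move=> og gc a; have h : sg g (rev_ord a) c = (rev_ord a == c)%:R.
  have /matrixP/(_ (rev_ord a) c) := og; rewrite [in LHS]mxE [in RHS]mxE (bigD1 c) //= gc eqxx mulr1.
  by rewrite [X in _ + X]big1 ?addr0 // => b bc; rewrite gc (negbTE bc) mulr0.
move: h; rewrite !mxE rev_ordK => h.
have -> : (a == rev_ord c) = (rev_ord a == c) by rewrite -[in RHS](inj_eq rev_ord_inj) rev_ordK.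
apply: (mulfI (mulf_neq0 (eps_neq0 eps_sq (rev_ord a)) (eps_neq0 eps_sq c))).
rewrite h; case: eqP => [->|_]; last by rewrite mulr0.
by rewrite eps_sq mulr1.
Qed.

Lemma xr_mulE (i j : 'I_n) s (g : M) (a c : 'I_n) : i != j -> (xr i j s *m g) a c = g a c
  + s * ((a == i)%:R * g j c - eps i * eps j * ((a == rev_ord j)%:R * g (rev_ord i) c))
  - s ^+ 2 / 2 * (eps i * eps j) * ((a == i)%:R * (j == rev_ord j)%:R * g (rev_ord i) c
         + (a == rev_ord j)%:R * (i == rev_ord i)%:R * g j c).
Proof.
move=> ij.
have FE (h : M) b : (Fm eps i j *m h) b c =
    (b == i)%:R * h j c - eps i * eps j * ((b == rev_ord j)%:R * h (rev_ord i) c).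
  rewrite (FmE eps_sq eps_rev) mulmxBl -scalemxAl.
  have dE (x y : 'I_n) : (delta_mx x y *m h) b c = (b == x)%:R * h y c.
    rewrite mxE (bigD1 y) //= big1 ?addr0 => [|z zy]; rewrite !mxE ?eqxx ?andbT //.
    by rewrite (negbTE zy) andbF mul0r.
  by rewrite 3!mxE -!dE; congr (_ - _); rewrite mxE.
move: FE; rewrite /xr; move: (Fm eps i j) => F FE.
rewrite !mulmxDl mul1mx -!scalemxAl -mulmxA.
rewrite [LHS]mxE [in LHS]mxE [X in _ + X + _]mxE [X in _ + _ + X]mxE !FE.
rewrite [j == i]eq_sym (negbTE ij) (inj_eq rev_ord_inj) (negbTE ij) !mul0r !mulr0 subr0 sub0r.
by rewrite [rev_ord i == i]eq_sym; ring.
Qed.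

Lemma cole_xr (i j : 'I_n) s (g : M) (c : 'I_n) : i != j -> cole g c -> c != j -> c != rev_ord i -> cole (xr i j s *m g) c.
Proof.
move=> ij gc cj ci a; rewrite xr_mulE // !gc [j == c]eq_sym (negbTE cj) [rev_ord i == c]eq_sym (negbTE ci).
by rewrite !mulr0 addr0 !mulr0 !subr0 mulr0 addr0.
Qed.

(** Written in continuation form: the last premise is what remains to be generated once the column
    [Q] is that of the identity, all columns cleared earlier being kept. The induction is on the
    number of nonzero entries of the column outside [Q] and its opposite. *)
Lemma clear_col (g : M) (Q : 'I_n) : orth g -> Q != rev_ord Q -> g Q Q != 0 ->
  (forall g', orth g' -> \det g' = \det g -> (forall c, c != Q -> cole g c -> cole g' c) ->
     cole g' Q -> ggen g') -> ggen g.
Proof.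
move=> og QQ gQ.
have [N] := ubnP #|[pred a | [&& a != Q, a != rev_ord Q & g a Q != 0]]|.
elim: N g og gQ => // N IH g og gQ; rewrite ltnS => leN H.
have [/existsP[a /and3P[aQ aQ' ga]]|] :=
    boolP [exists a, [&& a != Q, a != rev_ord Q & g a Q != 0]].
  (* The row operation with this parameter kills the entry in row [a]; besides row [a] it can change
     only the row [rev_ord Q], which is treated last. *)
  pose s := - g a Q / g Q Q.
  apply: (@ggenV_xr a Q s) => //.
  have E b : b != rev_ord Q -> (xr a Q s *m g) b Q = if b == a then 0 else g b Q.
    move=> bQ; rewrite xr_mulE // (negbTE bQ) (negbTE QQ) /s.
    case: eqP => [->|_]; last by rewrite !mul0r !mulr0 subr0 addr0 mulr0 !mulr0 subr0 addr0.
    by rewrite -[true%:R]/(1 : C) -[false%:R]/(0 : C); field.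
  apply: IH.
  - exact/orth_mul/og/orth_xr.
  - by rewrite E // [Q == a]eq_sym (negbTE aQ).
  - apply: leq_trans leN; apply: proper_card; apply/properP; split.
      apply/fintype.subsetP => b; rewrite !inE => /and3P[bQ bQ']; rewrite E // bQ bQ' /=.
      by case: ifP; rewrite ?eqxx.
    by exists a; rewrite !inE aQ aQ' ?ga //= E // eqxx eqxx.
  - move=> g' og' dg' pg'; apply: H => //.
      by rewrite dg' det_mulmx (det_xr eps_sq eps_rev) // mul1r.
    move=> c cQ gc; apply: pg' => //; apply: cole_xr => //.
    apply: contraNneq ga => ca; have /orth_row := gc; move/(_ og Q).
    by rewrite ca rev_ordK => ->; rewrite [Q == a]eq_sym (negbTE aQ).
rewrite negb_exists => /forallP na {IH leN N}.
have z a : a != Q -> a != rev_ord Q -> g a Q = 0.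
  by move=> h1 h2; have := na a; rewrite h1 h2 negbK => /eqP.
have QQ' : rev_ord Q != Q by rewrite eq_sym.
(* the entry at rev_ord Q vanishes by isotropy (eta = 1) or can be cleared (eta = -1) *)
wlog z' : g og gQ H z {na} / g (rev_ord Q) Q = 0 => [W|].
  have [e1|e1] := eqVneq eta 1.
    apply: W => //.
    have /matrixP/(_ (rev_ord Q) Q) := og; rewrite !mxE (negbTE QQ').
    rewrite (bigD1 Q) //= (bigD1 (rev_ord Q)) //= big1 ?addr0; last first.
      by move=> b /andP[bQ bQ']; rewrite (z b) ?mulr0.
    rewrite !mxE !rev_ordK eps_rev e1 mul1r eps_sq mul1r.
    move=> h; apply/eqP; have : 2 * (g Q Q * g (rev_ord Q) Q) == 0.
      by apply/eqP; rewrite -[RHS]h; ring.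
    by rewrite !mulf_eq0 pnatr_eq0 (negbTE gQ).
  have e2 : eta = - 1.
    have := eta_sq eps_sq eps_rev Q => /eqP; rewrite -subr_eq0 -expr2 subr_sqr_1 mulf_eq0.
    by rewrite subr_eq0 (negbTE e1) addr_eq0 /= => /eqP.
  (* For [eta = -1] the root vector [Fm (rev_ord Q) Q] is twice a matrix unit, hence the 2 in the
     denominator. *)
  pose s := - g (rev_ord Q) Q / (2 * g Q Q).
  apply: (@ggenV_xr (rev_ord Q) Q s) => //.
  have E b : (xr (rev_ord Q) Q s *m g) b Q = if b == rev_ord Q then 0 else g b Q.
    rewrite xr_mulE // rev_ordK (negbTE QQ) (negbTE QQ') eps_rev e2 mulN1r mulNr eps_sq /s.
    case: eqP => [->|_]; last by rewrite !mul0r !mulr0 subr0 addr0 mulr0 !mulr0 subr0 addr0.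
    by rewrite -[true%:R]/(1 : C) -[false%:R]/(0 : C); field.
  apply: W.
  - exact/orth_mul/og/orth_xr.
  - by rewrite E (negbTE QQ).
  - move=> g' og' dg' pg'; apply: H => //.
      by rewrite dg' det_mulmx (det_xr eps_sq eps_rev) // mul1r.
    by move=> c cQ gc; apply: pg' => //; apply: cole_xr => //; rewrite rev_ordK.
  - by move=> a aQ aQ'; rewrite E (negbTE aQ') z.
  - by rewrite E eqxx.
pose d : 'rV[C]_n := \row_j (if j == Q then (g Q Q)^-1 else if j == rev_ord Q then g Q Q else 1).
have td : is_tor d.
  move=> j; rewrite !mxE -[rev_ord j == Q](inj_eq rev_ord_inj) rev_ordK (inj_eq rev_ord_inj).
  have [->|jQ] := eqVneq j Q; first by rewrite (negbTE QQ) mulVf //; split => // /eqP; rewrite (negbTE QQ').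
  have [->|jQ'] := eqVneq j (rev_ord Q); last by rewrite mulr1.
  by rewrite mulfV //; split => // /eqP; rewrite rev_ordK (negbTE QQ).
apply: (ggenV_tor td).
have dE a c : (diag_mx d *m g) a c = d 0 a * g a c by rewrite mul_diag_mx mxE.
apply: H.
- exact/orth_mul/og/orth_tor.
- by rewrite det_mulmx det_tor // mul1r.
- move=> c cQ gc a; rewrite dE gc; case: eqP => [->|_]; rewrite ?mulr0 // mulr1 mxE (negbTE cQ).
  case: eqP => // cQ'; have := orth_row og gc Q; rewrite cQ' rev_ordK => ->.
  by rewrite eqxx.
- move=> a; rewrite dE; have [->|aQ] := eqVneq a Q; first by rewrite mxE eqxx mulVf.
  by have [->|aQ'] := eqVneq a (rev_ord Q); rewrite ?z' ?z ?mulr0.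
Qed.

(** Here [p] marks the columns already cleared. A nonzero entry of the column is moved onto the
    diagonal by a root element; the determinant condition is what rules out the orthogonal matrix
    for which no such move exists. *)
Lemma pivot_col (g : M) (Q : 'I_n) (p : pred 'I_n) : orth g -> (eta = 1 -> \det g = 1) -> (Q < rev_ord Q)%N ->
  (forall c, p c -> cole g c) -> (forall c, p (rev_ord c) = p c) -> ~~ p Q ->
  (forall g', orth g' -> \det g' = \det g -> (forall c, p c -> cole g' c) -> g' Q Q != 0 -> ggen g') ->
  ggen g.
Proof.
move=> og dg ltQ gp prev pQ H.
have QQ : Q != rev_ord Q by apply: contraTneq ltQ => <-; rewrite ltnn.
have QQ' : rev_ord Q != Q by rewrite eq_sym.
have [gQ|gQ] := eqVneq (g Q Q) 0; last exact: H.
have pz c : p c -> g c Q = 0.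
  move=> pc; have /orth_row := gp (rev_ord c) (etrans (prev c) pc); move/(_ og Q).
  by rewrite rev_ordK => ->; case: eqP => // E; rewrite E pc in pQ.
have A1 h a : orth h -> \det h = \det g -> (forall c, p c -> cole h c) -> h Q Q = 0 ->
    a != Q -> a != rev_ord Q -> ~~ p a -> h a Q != 0 -> ggen h.
  move=> oh dh hp hQ aQ aQ' pa ha.
  have aQs : Q != a by rewrite eq_sym.
  (* The new diagonal entry is a quadratic polynomial in [s] without constant term and with nonzero
     linear coefficient, so it cannot vanish at both 1 and -1. *)
  have [s hs] : exists s, (xr Q a s *m h) Q Q != 0.
    have E s : (xr Q a s *m h) Q Q = s * h a Q
      - s ^+ 2 / 2 * (eps Q * eps a) * ((a == rev_ord a)%:R * h (rev_ord Q) Q).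
      rewrite xr_mulE // hQ eqxx -[Q == rev_ord a](inj_eq rev_ord_inj) rev_ordK [rev_ord Q == a]eq_sym (negbTE aQ').
      by rewrite !mul0r !mulr0 subr0 addr0 add0r !mul1r.
    have [e1|e1] := eqVneq ((xr Q a 1 *m h) Q Q) 0; last by exists 1.
    exists (-1); apply: contraNneq ha => e2; move: e1 e2; rewrite !E mul1r mulN1r sqrrN.
    move=> /eqP; rewrite subr_eq0 => /eqP ->; move/eqP; rewrite -opprD oppr_eq0 -mulr2n mulrn_eq0 /=.
    by [].
  apply: (@ggenV_xr Q a s) => //; apply: H => //.
  - exact/orth_mul/oh/orth_xr.
  - by rewrite det_mulmx (det_xr eps_sq eps_rev) // mul1r.
  - move=> c pc; apply: cole_xr => //; first exact: hp.
      by apply: contraNneq pa => <-.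
    by apply: contraNneq pQ => E; rewrite -prev -E.
have [/existsP[a /and3P[aQ aQ' ga]]|] :=
    boolP [exists a, [&& a != Q, a != rev_ord Q & g a Q != 0]].
  by apply: (A1 g a) => //; apply: contraNN ga => /pz ->.
rewrite negb_exists => /forallP na.
have z a : a != Q -> a != rev_ord Q -> g a Q = 0.
  by move=> h1 h2; have := na a; rewrite h1 h2 negbK => /eqP.
have gQ' : g (rev_ord Q) Q != 0.
  apply/eqP => h; have /matrixP/(_ Q Q) := og; rewrite !mxE eqxx big1 => [/esym/eqP|a _].
    by rewrite oner_eq0.
  have [->|aQ] := eqVneq a Q; first by rewrite gQ mulr0.
  by have [->|aQ'] := eqVneq a (rev_ord Q); rewrite ?h ?z ?mulr0.
have [e1|e1] := eqVneq eta 1; last first.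
  have e2 : eta = - 1.
    have := eta_sq eps_sq eps_rev Q => /eqP; rewrite -subr_eq0 -expr2 subr_sqr_1 mulf_eq0.
    by rewrite subr_eq0 (negbTE e1) addr_eq0 /= => /eqP.
  (* For [eta = -1] the opposite row can be added directly, with coefficient 2, to the row [Q]. *)
  apply: (@ggenV_xr Q (rev_ord Q) 1) => //; apply: H.
  - exact/orth_mul/og/orth_xr.
  - by rewrite det_mulmx (det_xr eps_sq eps_rev) // mul1r.
  - move=> c pc; apply: cole_xr => //; first exact: gp.
      by apply: contraNneq pQ => E; rewrite -prev -E.
    by apply: contraNneq pQ => E; rewrite -prev -E.
  - rewrite xr_mulE // gQ rev_ordK eqxx (negbTE QQ) (negbTE QQ') eps_rev e2 mulN1r mulrN eps_sq.
    rewrite !mulr0 !mul0r addr0 mulr0 subr0 add0r !mul1r mulN1r opprK -mulr2n.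
    by rewrite mulrn_eq0.
have [/existsP[a /and3P[aQ aQ' pa]]|] :=
    boolP [exists a, [&& a != Q, a != rev_ord Q & ~~ p a]].
  (* For [eta = 1] the root vector joining [Q] to its opposite is zero. The nonzero entry is first
     carried to a free row [a], from which [A1] brings it to the diagonal. *)
  apply: (@ggenV_xr a (rev_ord Q) 1) => //.
  have aQs : rev_ord a != Q by rewrite -(inj_eq rev_ord_inj) rev_ordK.
  have E b : (xr a (rev_ord Q) 1 *m g) b Q = if b == a then g (rev_ord Q) Q + g a Q else
      if b == Q then (xr a (rev_ord Q) 1 *m g) Q Q else g b Q.
    case: (eqVneq b Q) => [->|bQ]; first by rewrite eq_sym (negbTE aQ).
    rewrite xr_mulE // rev_ordK (negbTE bQ) (negbTE QQ').
    by case: eqP => [->|_]; rewrite -?[true%:R]/(1 : C) -[false%:R]/(0 : C); ring.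
  have oxg : orth (xr a (rev_ord Q) 1 *m g) by exact/orth_mul/og/orth_xr.
  have dxg : \det (xr a (rev_ord Q) 1 *m g) = \det g.
    by rewrite det_mulmx (det_xr eps_sq eps_rev) // mul1r.
  have pxg c : p c -> cole (xr a (rev_ord Q) 1 *m g) c.
    move=> pc; apply: cole_xr => //; first exact: gp.
      by apply: contraNneq pQ => E'; rewrite -prev -E'.
    by apply: contraNneq pa => E'; rewrite -prev -E'.
  have [h0|] := eqVneq ((xr a (rev_ord Q) 1 *m g) Q Q) 0; last exact: H.
  by apply: (A1 _ a) => //; rewrite E eqxx (z a) // addr0.
rewrite negb_exists => /forallP nb.
have pall a : a != Q -> a != rev_ord Q -> p a.
  by move=> h1 h2; have := nb a; rewrite h1 h2 negbK.
(* the remaining case is excluded: g exchanges the two lines, hence has determinant -1 *)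
exfalso.
pose h := xrow Q (rev_ord Q) g.
have hE a b : h a b = g (tperm Q (rev_ord Q) a) b by rewrite mxE.
have ht : is_trig_mx h^T.
  apply/is_trig_mxP => a b ab; rewrite mxE hE.
  have [pa|pa] := boolP (p a).
    rewrite gp //; case: tpermP => [E|E|_ _]; last by case: eqP ab => // ->; rewrite ltnn.
      by case: eqP => // E'; rewrite -(prev Q) E' pa in pQ.
    by case: eqP => // E'; rewrite E' pa in pQ.
  have [aQ|aQ] := eqVneq a Q.
    case: tpermP => [E|E|bQ bQ']; [by rewrite E aQ ltnn in ab|by rewrite aQ gQ|].
    by rewrite aQ z //; apply/eqP.
  have [aQ'|aQ'] := eqVneq a (rev_ord Q); last by rewrite pall in pa.
  case: tpermP => [E|E|bQ bQ'].
  - by rewrite E aQ' in ab; have := ltn_trans ltQ ab; rewrite ltnn.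
  - by rewrite E aQ' ltnn in ab.
  - have pb : p b by apply: pall; apply/eqP.
    have := orth_row og (gp (rev_ord b) (etrans (prev b) pb)) a; rewrite rev_ordK => ->.
    by case: eqP ab => // ->; rewrite ltnn.
have dh : \det h = - 1.
  have QQ'' : Q != rev_ord Q by [].
  by rewrite /h xrowE det_mulmx dg // mulr1 det_perm odd_tperm QQ'' expr1.
have : \det h = g (rev_ord Q) Q * g Q (rev_ord Q).
  rewrite -det_tr det_trig // (bigD1 Q) //= (bigD1 (rev_ord Q)) //= big1 ?mulr1.
    by rewrite !mxE tpermL tpermR.
  move=> a /andP[aQ aQ']; rewrite !mxE tpermD ?[_ == a]eq_sym // gp ?eqxx //; exact: pall.
rewrite dh => e; have /matrixP/(_ (rev_ord Q) (rev_ord Q)) := og.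
rewrite !mxE eqxx (bigD1 Q) //= big1 => [|a aQ].
  rewrite addr0 !mxE rev_ordK eps_rev e1 mul1r eps_sq mul1r -e => /esym/eqP.
  by rewrite -subr_eq0 opprK (_ : 1 + 1 = 2%:R) ?pnatr_eq0.
rewrite !mxE rev_ordK; have [->|aQ'] := eqVneq a (rev_ord Q); first by rewrite rev_ordK gQ mulr0 mul0r.
by rewrite (z (rev_ord a)) ?mulr0 ?mul0r // -(inj_eq rev_ord_inj) rev_ordK // rev_ordK.
Qed.

(** Gaussian elimination compatible with the form, from the outermost pair of opposite indices
    inwards: each round clears a column, and then the opposite one, whose pivot is 1 by [orth_row].
    An index in the middle is left for the end, where the determinant decides. *)
Theorem orth_ggen g : orth g -> (eta = 1 -> \det g = 1) -> ggen g.
Proof.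
pose p r := [pred c : 'I_n | ((c < r) || (n - c.+1 < r))%N].
suff S r : (r.*2 <= n)%N -> forall g, orth g -> (eta = 1 -> \det g = 1) ->
    (forall c, p (n./2 - r)%N c -> cole g c) -> ggen g.
  move=> og dg; apply: (S n./2) => //; first by lia.
  by move=> c; rewrite /p /= subnn.
elim: r => [_ h oh dh|r IH rn h oh dh hp]; last first.
  have Qn : ((n./2 - r.+1) < n)%N by lia.
  pose Q := Ordinal Qn.
  have QQ : (Q < rev_ord Q)%N by rewrite /=; lia.
  have QQn : Q != rev_ord Q by apply: contraTneq QQ => <-; rewrite ltnn.
  have prev c : p (n./2 - r.+1)%N (rev_ord c) = p (n./2 - r.+1)%N c.
    by rewrite /p /=; have := ltn_ord c; lia.
  apply: (pivot_col oh dh QQ hp prev); first by rewrite /p /=; lia.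
  move=> h1 oh1 dh1 hp1 hQ1; apply: (clear_col oh1 QQn hQ1) => h2 oh2 dh2 hp2 hQ2.
  have E : h2 (rev_ord Q) (rev_ord Q) = 1 by rewrite (orth_row oh2 hQ2) eqxx.
  apply: (@clear_col h2 (rev_ord Q)) => //; rewrite ?rev_ordK // ?E ?oner_eq0 //; first by rewrite eq_sym.
  move=> h3 oh3 dh3 hp3 hQ3; apply: IH => //; first by lia.
    by move=> e1; rewrite dh3 dh2 dh1 dh.
  move=> c pc; have [->|cQ'] := eqVneq c (rev_ord Q); first by [].
  apply: hp3 => //; have [->|cQ] := eqVneq c Q; first by [].
  apply: hp2 => //; apply: hp1.
  move: cQ cQ' pc; rewrite /p -!(inj_eq val_inj) /=; have := ltn_ord c; lia.
rewrite subn0 => hp.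
have pm (c : 'I_n) : ~~ p n./2 c -> rev_ord c = c.
  by move=> pc; apply: val_inj; move: pc; rewrite /p /=; have := ltn_ord c; lia.
have hr c : p n./2 c -> forall a, h c a = (a == c)%:R.
  move=> pc a; have pc' : p n./2 (rev_ord c) by move: pc; rewrite /p /=; have := ltn_ord c; lia.
  by have := orth_row oh (hp _ pc') a; rewrite rev_ordK.
suff -> : h = 1%:M by exact: ggen1.
have [/existsP[m pmm]|] := boolP [exists m, ~~ p n./2 m]; last first.
  rewrite negb_exists => /forallP pa; apply/matrixP => a b; rewrite mxE hp //.
  by have := pa b; rewrite negbK.
have pother c : c != m -> p n./2 c.
  move=> cm; apply: contraNT cm => pc; have := pm _ pc; have := pm _ pmm.
  move=> /(congr1 val) /= h1 /(congr1 val) /= h2; apply/eqP/val_inj => /=.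
  by have := ltn_ord c; have := ltn_ord m; lia.
have hd a b : h a b = if a == m then (if b == m then h m m else 0) else (a == b)%:R.
  have [->|am] := eqVneq a m; last by rewrite hr ?pother // eq_sym.
  by have [->//|bm] := eqVneq b m; rewrite hp ?pother // eq_sym (negbTE bm).
have hdiag : h = diag_mx (\row_a h a a).
  apply/matrixP=> a b; rewrite !mxE hd; have [->|am] := eqVneq a m.
    by rewrite eq_sym; case: eqP.
  by rewrite [h a a]hd (negbTE am) eqxx; case: eqP.
(* A middle index equals its own opposite, which is incompatible with an alternating form. *)
have e1 : eta = 1.
  have := eps_rev m; rewrite (pm _ pmm) -{1}[eps m]mul1r => /(mulIf (eps_neq0 eps_sq m)) <-//.
have hmm : h m m = 1.
  have := dh e1; rewrite [X in \det X]hdiag det_diag (bigD1 m) //= mxE big1 ?mulr1 => [->//|a am].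
  by rewrite mxE hd (negbTE am) eqxx.
apply/matrixP=> a b; rewrite hd hmm mxE; have [->|//] := eqVneq a m.
by rewrite eq_sym; case: eqP.
Qed.

Lemma ggen_orth g : ggen g -> orth g /\ \det g = 1.
Proof.
elim=> [|i j s h ij _ [oh dh]|d h td _ [oh dh]].
- by rewrite /orth sigma1 // mul1mx det1.
- by rewrite det_mulmx dh (det_xr eps_sq eps_rev) // mulr1; split => //; exact/orth_mul/oh/orth_xr.
- by rewrite det_mulmx dh det_tor // mulr1; split => //; exact/orth_mul/oh/orth_tor.
Qed.

End Generation.

(** Among the subspaces contained in [P], one of maximal dimension contains every vector of [P],
    since otherwise adjoining that vector would enlarge it. This is how subspaces are made from
    closure properties throughout. *)
Lemma pred_vspace (F : fieldType) (V : vectType F) (P : V -> Prop) :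
  P 0 -> (forall a u v, P u -> P v -> P (a *: u + v)) ->
  exists U : {vspace V}, forall x, x \in U <-> P x.
Proof.
move=> P0 PL.
pose Q d := `[< exists U : {vspace V}, \dim U = d /\ forall x, x \in U -> P x >].
have exQ : exists d, Q d.
  by exists 0%N; apply/asboolP; exists 0%VS; rewrite dimv0; split => // x; rewrite memv0 => /eqP ->.
have ubQ d : Q d -> (d <= \dim {:V})%N by case/asboolP => U [<- _]; rewrite dimvS // subvf.
case: (ex_maxnP exQ ubQ) => d /asboolP[U [dU PU]] maxd; exists U => x; split; first exact: PU.
move=> Px; have : (\dim (U + <[x]>)%VS <= d)%N.
  apply: maxd; apply/asboolP; exists (U + <[x]>)%VS; split => // y /memv_addP[u uU [v /vlineP[a ->] ->]].
  by rewrite addrC; apply: PL => //; exact: PU.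
rewrite -dU => le; have /eqP -> : (U == U + <[x]>)%VS by rewrite eqEdim addvSl.
by apply: (subvP (addvSr U <[x]>)); exact: memv_line.
Qed.

(** * Weights, and the equivalence of stability under the group and under its Lie algebra *)

Section Weights.

Variables (C : numClosedFieldType) (n k : nat) (eps : 'I_n -> C) (eta : C).
Hypothesis eps_sq : forall i, eps i * eps i = 1.
Hypothesis eps_rev : forall i, eps (rev_ord i) = eta * eps i.
Local Notation M := 'M[C]_n.
Local Notation sg := (sigma eps).
Local Notation xr := (xr eps).
Local Notation Fm := (Fm eps).
Local Notation I := ('I_n * 'I_k)%type.
Local Notation W := (exterior C I).
Implicit Types (S T : {set I}) (u v : W) (U : {vspace W}).

Definition occ (i : 'I_n) (S : {set I}) : nat := #|[pred p in S | p.1 == i]|.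
(** The exponent of the torus coordinate [i] on the basis vector [ebas C S]: opposite coordinates
    are inverse to each other. *)
Definition wt (i : 'I_n) (S : {set I}) : int := (occ i S)%:Z - (occ (rev_ord i) S)%:Z.

Lemma wt_rev i S : wt (rev_ord i) S = - wt i S.
Proof. by rewrite /wt rev_ordK opprB. Qed.

Definition diagop (a : {set I} -> C) (u : W) : W := [ffun T : {set I} => a T * u T : C^o].

Lemma sum_fst (f : 'I_n -> C) S : \sum_(p in S) f p.1 = \sum_i f i *+ occ i S.
Proof.
rewrite (partition_big fst xpredT) //=; apply: eq_bigr => i _.
rewrite (eq_bigr (fun=> f i)) => [|p /andP[_ /eqP ->] //].
by rewrite sumr_const.
Qed.

Lemma prod_fst (f : 'I_n -> C) S : \prod_(p in S) f p.1 = \prod_i f i ^+ occ i S.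
Proof.
rewrite (partition_big fst xpredT) //=; apply: eq_bigr => i _.
rewrite (eq_bigr (fun=> f i)) => [|p /andP[_ /eqP ->] //].
by rewrite prodr_const.
Qed.

Lemma dr_Fii i u : dr (Fm i i) u = diagop (fun T => (wt i T)%:~R) u.
Proof.
have -> : Fm i i = diag_mx (\row_j ((j == i)%:R - (j == rev_ord i)%:R)).
  apply/matrixP=> a b; rewrite (FmE eps_sq eps_rev) eps_sq !mxE mul1r.
  case: (eqVneq a b) => [->|ab]; first by rewrite !andbb mulr1n.
  have na c : (a == c) && (b == c) = false.
    by apply/negbTE/negP => /andP[/eqP ac /eqP bc]; move: ab; rewrite ac bc eqxx.
  by rewrite !na subr0 mulr0n.
rewrite dr_diag; apply/ffunP=> T; rewrite !ffunE; congr (_ * _).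
under eq_bigr do rewrite mxE.
rewrite (sum_fst (fun j => (j == i)%:R - (j == rev_ord i)%:R)).
under eq_bigr do rewrite mulrnBl.
rewrite sumrB (bigD1 i) //= big1 ?addr0 => [|j /negbTE ->]; last by rewrite mul0rn.
rewrite (bigD1 (rev_ord i)) //= big1 ?addr0 => [|j /negbTE ->]; last by rewrite mul0rn.
by rewrite !eqxx /wt rmorphB.
Qed.

Lemma torus_wt (d : 'rV[C]_n) T : is_tor d ->
  \prod_(p in T) d 0 p.1 = \prod_(j < n | (j < rev_ord j)%N) d 0 j ^ wt j T.
Proof.
move=> td; rewrite (prod_fst (fun j => d 0 j)).
have d0 j : d 0 j != 0.
  by apply/eqP => h; have [] := td j; rewrite h mul0r => /esym/eqP; rewrite oner_eq0.
rewrite (bigID (fun i : 'I_n => (i < rev_ord i)%N)) /=.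
rewrite [X in _ * X](bigID (fun i : 'I_n => rev_ord i == i)) /=.
rewrite [X in _ * (X * _)]big1 ?mul1r => [|i /andP[_ /eqP ii]]; last first.
  by have [_ ->] := td i; rewrite // expr1n.
rewrite [X in _ * X](reindex_inj rev_ord_inj) /=.
rewrite [X in _ * X](eq_bigl (fun i : 'I_n => (i < rev_ord i)%N)); last first.
  move=> i; rewrite /= -!(inj_eq val_inj) /=; have := ltn_ord i; lia.
rewrite -big_split; apply: eq_bigr => i _ /=.
have [di _] := td i; have -> : d 0 (rev_ord i) = (d 0 i)^-1.
  by apply: (mulfI (d0 i)); rewrite di mulfV.
by rewrite /wt expfzDr // -invr_expz exprVn.
Qed.

Lemma diagop_sum (J : finType) (c : J -> C) (a : J -> {set I} -> C) u :
  \sum_j c j *: diagop (a j) u = diagop (fun T => \sum_j c j * a j T) u.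
Proof.
apply/ffunP=> T; rewrite sum_ffunE ffunE mulr_suml; apply: eq_bigr => j _.
by rewrite !ffunE -mulrA.
Qed.

(** Lagrange interpolation: a function of the eigenvalues of a diagonal operator is a polynomial in
    that operator. *)
Lemma diag_interp U (a b : {set I} -> C) :
  (forall u, u \in U -> diagop a u \in U) -> (forall S T, a S = a T -> b S = b T) ->
  forall u, u \in U -> diagop b u \in U.
Proof.
move=> aU ab u uU.
have prodU (s : seq C) : diagop (fun T => \prod_(c <- s) (a T - c)) u \in U.
  elim: s => [|c s IH].
    rewrite (_ : diagop _ u = u) //; apply/ffunP=> T; rewrite ffunE big_nil; exact: mul1r.
  rewrite (_ : diagop _ u = diagop a (diagop (fun T => \prod_(c <- s) (a T - c)) u) -
     c *: diagop (fun T => \prod_(c <- s) (a T - c)) u); first by rewrite memvB ?memvZ // aU.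
  apply/ffunP=> T; rewrite !ffunE big_cons -[_ *: _]/(c * (\prod_(c <- s) (a T - c) * u T)).
  have R (x y z t : C) : (x - y) * z * t = x * (z * t) - y * (z * t) by ring.
  exact: R.
pose vals S := [seq c <- undup [seq a T | T <- enum {set I}] | c != a S].
pose K S := \prod_(c <- vals S) (a S - c).
have K0 S : K S != 0.
  rewrite /K prodf_seq_neq0; apply/allP => c; rewrite mem_filter => /andP[cS _] /=.
  by rewrite subr_eq0 eq_sym.
have indE S T : \prod_(c <- vals S) (a T - c) = (a T == a S)%:R * K S.
  have [E|/eqP TS] := eqVneq (a T) (a S); first by rewrite mul1r /K E.
  rewrite mul0r; apply/eqP; rewrite prodf_seq_eq0; apply/hasP; exists (a T); last by rewrite subrr eqxx.
  rewrite mem_filter mem_undup; apply/andP; split; first exact/eqP.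
  by apply/mapP; exists T; rewrite ?mem_enum.
(* The interpolation sum below runs over sets rather than over distinct eigenvalues, so each
   eigenvalue is repeated; [N S] is its number of repetitions. *)
pose N S : C := #|[pred T | a T == a S]|%:R.
have N0 S : N S != 0.
  by rewrite pnatr_eq0 -lt0n; apply/card_gt0P; exists S; rewrite inE /= eqxx.
rewrite (_ : diagop b u = \sum_S (b S / (N S * K S)) *: diagop (fun T => \prod_(c <- vals S) (a T - c)) u).
  by apply: memv_suml => S _; rewrite memvZ.
rewrite diagop_sum; apply/ffunP=> T; rewrite !ffunE; congr (_ * _).
under eq_bigr do rewrite indE.
rewrite (bigID (fun S => a S == a T)) /= [X in _ + X]big1 ?addr0 => [|S /negbTE ST]; last first.
  by rewrite eq_sym ST mul0r mulr0.
rewrite (eq_bigr (fun=> b T / N T)) => [|S /eqP ST].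
  by rewrite sumr_const -mulr_natr -[#|_|%:R]/(N T) mulfVK.
rewrite (ab _ _ ST) ST eqxx mul1r.
have -> : K S = K T by rewrite /K /vals ST.
have -> : N S = N T by rewrite /N ST.
by rewrite invfM mulrA mulfVK.
Qed.

Lemma diag_interp_fam U (a : 'I_n -> {set I} -> C) (b : {set I} -> C) :
  (forall i u, u \in U -> diagop (a i) u \in U) ->
  (forall S T, (forall i, a i S = a i T) -> b S = b T) ->
  forall u, u \in U -> diagop b u \in U.
Proof.
move=> aU ab u uU.
pose ind S T : C := [forall i, a i T == a i S]%:R.
have indU S : diagop (ind S) u \in U.
  have H (s : seq 'I_n) : diagop (fun T => (all (fun i => a i T == a i S) s)%:R) u \in U.
    elim: s => [|i s IH] /=.
      rewrite (_ : diagop _ u = u) //; apply/ffunP=> T; rewrite ffunE; exact: mul1r.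
    rewrite (_ : diagop _ u = diagop (fun T => (a i T == a i S)%:R)
        (diagop (fun T => (all (fun i => a i T == a i S) s)%:R) u)).
      by apply: (diag_interp (a := a i)) => // [v /(aU i)//|S' T' ->].
    apply/ffunP=> T; rewrite !ffunE -mulnb natrM.
    have R (x y z : C) : x * y * z = x * (y * z) by ring.
    exact: R.
  rewrite (_ : diagop _ u = diagop (fun T => (all (fun i => a i T == a i S) (enum 'I_n))%:R) u) //.
  apply/ffunP=> T; rewrite !ffunE /ind; congr (_%:R * _); congr nat_of_bool.
  apply/forallP/allP => [h i _|h i]; first exact: h.
  by apply: h; rewrite mem_enum.
pose N S : C := #|[pred T | [forall i, a i T == a i S]]|%:R.
have N0 S : N S != 0.
  by rewrite pnatr_eq0 -lt0n; apply/card_gt0P; exists S; rewrite inE; apply/forallP.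
rewrite (_ : diagop b u = \sum_S (b S / N S) *: diagop (ind S) u).
  by apply: memv_suml => S _; rewrite memvZ.
rewrite diagop_sum; apply/ffunP=> T; rewrite !ffunE; congr (_ * _).
rewrite (bigID (fun S => [forall i, a i S == a i T])) /= [X in _ + X]big1 ?addr0 => [|S /negP ST]; last first.
  rewrite /ind; case: forallP => [h|_]; last by rewrite mulr0.
  by case: ST; apply/forallP => i; rewrite eq_sym.
rewrite (eq_bigr (fun=> b T / N T)) => [|S /forallP ST].
  by rewrite sumr_const -mulr_natr -[#|_|%:R]/(N T) mulfVK.
have ST' i : a i S = a i T by exact/eqP.
rewrite (ab _ _ ST') /ind; case: forallP => [_|[]]; last by move=> i; rewrite ST'.
rewrite mulr1; congr (_ / _); rewrite /N; congr _%:R; apply: eq_card => S'; rewrite !inE.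
by apply: eq_forallb => i; rewrite ST'.
Qed.

Definition lie_stable U := forall i j u, u \in U -> dr (Fm i j) u \in U.

Definition grp_stable U := forall g u, ggen eps g -> u \in U -> ext_act g u \in U.

Lemma ext_act_tor d u : is_tor d ->
  ext_act (diag_mx d) u = diagop (fun T => \prod_(j < n | (j < rev_ord j)%N) d 0 j ^ wt j T) u.
Proof.
by move=> td; rewrite ext_act_diag; apply/ffunP=> T; rewrite !ffunE torus_wt.
Qed.

Lemma lie_stable_diag U (b : {set I} -> C) : lie_stable U ->
  (forall S T, (forall i, wt i S = wt i T) -> b S = b T) ->
  forall u, u \in U -> diagop b u \in U.
Proof.
move=> sU hb; apply: (diag_interp_fam (a := fun i T => (wt i T)%:~R)) => [i u uU|S T h].
  by rewrite -dr_Fii; exact: sU.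
by apply: hb => i; have := h i => /intr_inj.
Qed.

(** Off the diagonal this is [dr_xr_stable]. On the diagonal, the torus and its Lie algebra both act
    through functions of the weights, and interpolation passes from one to the other provided that
    the weights can be recovered. *)
Lemma lie_stableP U : lie_stable U <-> grp_stable U.
Proof.
split => [sU g u gg|gU i j].
  elim: gg u => [u uU|i j s h ij _ IH u uU|d h td _ IH u uU]; first by rewrite ext_act1.
    rewrite ext_actM.
    have [+ _] := dr_xr_stable (Fm_cube eps_sq eps_rev ij) U.
    by move=> /(_ (sU i j) s); apply; exact: IH.
  rewrite ext_actM (ext_act_tor _ td).
  by apply: (lie_stable_diag sU); [move=> S T h'; apply: eq_bigr => a _; rewrite h'|exact: IH].
have [<-|ij] := eqVneq i j; last first.
  have [_ +] := dr_xr_stable (Fm_cube eps_sq eps_rev ij) U; apply => s u uU.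
  by rewrite -[X in ext_act X]mulmx1; apply: gU => //; apply: ggen_xr => //; exact: ggen1.
(* The diagonal generator at a middle index is zero. *)
have [ii|ii] := eqVneq i (rev_ord i).
  move=> u _; rewrite (FmE eps_sq eps_rev) -ii eps_sq scale1r subrr dr0; exact: mem0v.
(* Its eigenvalue on [ebas C T] is [2 ^ wt i T], an injective function of the weight. *)
pose d : 'rV[C]_n := \row_j (2 ^ ((j == i)%:Z - (j == rev_ord i)%:Z)).
have two0 : (2 : C) != 0 by rewrite pnatr_eq0.
have td : is_tor d.
  move=> {}j; rewrite !mxE -expfzDr // -[rev_ord j == i](inj_eq rev_ord_inj) rev_ordK (inj_eq rev_ord_inj).
  split; first by rewrite addrC addrA subrK subrr expr0z.
  move=> jj; have -> : (j == i) = false by apply: contraNF ii => /eqP <-; rewrite jj.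
  have -> : (j == rev_ord i) = false.
    by apply: contraNF ii => /eqP ji; move: jj; rewrite ji rev_ordK => /eqP.
  by rewrite subrr expr0z.
have dT T : \prod_(p in T) d 0 p.1 = 2 ^ wt i T.
  rewrite (prod_fst (fun j => d 0 j)) (bigD1 i) //= (bigD1 (rev_ord i)) 1?eq_sym //= big1 ?mulr1.
    rewrite !mxE !eqxx (negbTE ii) [rev_ord i == i]eq_sym (negbTE ii) subr0 sub0r.
    by rewrite -exprnP expr1 /wt expfzDr // -invr_expz -exprVn.
  by move=> {}j /andP[/negbTE h1 /negbTE h2]; rewrite mxE h1 h2 subrr expr0z expr1n.
move=> u uU; rewrite dr_Fii.
apply: (diag_interp (a := fun T => 2 ^ wt i T)) => // [v vU|S T /eqP].
  have := gU _ _ (ggen_tor td (ggen1 eps)) vU; rewrite mulmx1 ext_act_diag.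
  rewrite (_ : [ffun T => _] = diagop (fun T => 2 ^ wt i T) v) //.
  by apply/ffunP=> T; rewrite !ffunE dT.
have ri x : (2 : C) ^ x = ratr ((2 : rat) ^ x) by rewrite fmorphXz rmorph_nat.
by rewrite !ri (inj_eq (fmorph_inj _)) => /eqP /ieexprIz ->.
Qed.

End Weights.

(** * Highest weight theory *)

Section HighestWeightTheory.

Variables (C : numClosedFieldType) (n k : nat) (eps : 'I_n -> C) (eta : C).
Hypothesis eps_sq : forall i, eps i * eps i = 1.
Hypothesis eps_rev : forall i, eps (rev_ord i) = eta * eps i.
Local Notation M := 'M[C]_n.
Local Notation sg := (sigma eps).
Local Notation Fm := (Fm eps).
Local Notation I := ('I_n * 'I_k)%type.
Local Notation W := (exterior C I).
Local Notation lie_stable := (lie_stable eps).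
Implicit Types (S T : {set I}) (u v : W) (U : {vspace W}) (lam mu : 'I_n -> int).

Lemma dr_lie_comm X Y u : dr X (dr Y u) = dr Y (dr X u) + dr (X *m Y - Y *m X) u.
Proof. by rewrite -dr_comm addrC subrK. Qed.

Lemma dr_lie_span X u : sg X = - X -> dr X u = 2^-1 *: \sum_i \sum_j X i j *: dr (Fm i j) u.
Proof.
move=> /(lie_span) {1}->; rewrite drZ dr_sum; congr (_ *: _); apply: eq_bigr => i _.
by rewrite dr_sum; apply: eq_bigr => j _; rewrite drZ.
Qed.

(** Infinitesimal highest weight vectors. The weight is prescribed on all [n] indices, and the zero
    vector is allowed, which makes the condition linear in [v]. *)
Definition HW lam v := (forall S, v S != 0 -> forall i, wt i S = lam i) /\
  (forall a b : 'I_n, (a < b)%N -> dr (Fm a b) v = 0).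

Lemma HW_diag lam v i : HW lam v -> dr (Fm i i) v = (lam i)%:~R *: v.
Proof.
move=> [h _]; rewrite (dr_Fii eps_sq eps_rev); apply/ffunP=> T; rewrite !ffunE.
have [->|/h ->] := eqVneq (v T) 0; last by [].
by rewrite mulr0 scaler0.
Qed.

(** Only lowering operators are used, so that weights can be bounded by induction; [lowgen_lie]
    shows that the outcome is nevertheless stable under the whole Lie algebra. *)
Inductive lowgen (P : W -> Prop) : W -> Prop :=
| lowgen_in v of P v : lowgen P v
| lowgen_0 : lowgen P 0
| lowgen_lin a u v of lowgen P u & lowgen P v : lowgen P (a *: u + v)
| lowgen_F (i j : 'I_n) u of (j < i)%N & lowgen P u : lowgen P (dr (Fm i j) u).

Lemma lowgenZ P a u : lowgen P u -> lowgen P (a *: u).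
Proof. by move=> h; rewrite -[a *: u]addr0; apply: lowgen_lin => //; exact: lowgen_0. Qed.

Lemma lowgenD P u v : lowgen P u -> lowgen P v -> lowgen P (u + v).
Proof. by move=> h h'; rewrite -[u]scale1r; exact: lowgen_lin. Qed.

Lemma lowgen_sum P (J : finType) (x : J -> W) : (forall j, lowgen P (x j)) -> lowgen P (\sum_j x j).
Proof. by move=> h; apply: big_ind => // [|u v]; [exact: lowgen_0|exact: lowgenD]. Qed.

(** The induction is for all [X] of the Lie algebra at once: moving [X] past a lowering operator
    leaves a commutator, again in the Lie algebra and so covered by the induction hypothesis. This
    takes the place of a triangular decomposition of the enveloping algebra. *)
Lemma lowgen_lie P u : (forall v, P v -> exists lam, HW lam v) -> lowgen P u ->
  forall X, sg X = - X -> lowgen P (dr X u).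
Proof.
move=> PH; elim=> {u} [v Pv X|X _|a u v _ IHu _ IHv X hX|i j u ji hu IHu X hX].
- move=> /dr_lie_span ->; apply: lowgenZ; apply: lowgen_sum => i; apply: lowgen_sum => j; apply: lowgenZ.
  have [lam h] := PH _ Pv; case: (ltngtP i j) => ij.
  + by rewrite h.2 //; exact: lowgen_0.
  + by apply: lowgen_F => //; exact: lowgen_in.
  + by rewrite (val_inj ij) (HW_diag _ h); apply: lowgenZ; exact: lowgen_in.
- by rewrite dr0r; exact: lowgen_0.
- by rewrite drDr drZr; apply: lowgen_lin; [exact: IHu|exact: IHv].
- rewrite dr_lie_comm; apply: lowgenD; first by apply: lowgen_F => //; exact: IHu.
  by apply: IHu; apply: lie_comm => //; exact: (sigma_Fm eps_sq eps_rev).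
Qed.

Lemma lowgen_vspace P : exists U : {vspace W}, forall x, x \in U <-> lowgen P x.
Proof. by apply: pred_vspace => [|a u v]; [exact: lowgen_0|exact: lowgen_lin]. Qed.

Definition gen P : {vspace W} := projT1 (cid (lowgen_vspace P)).

Lemma genP P x : x \in gen P <-> lowgen P x.
Proof. exact: (projT2 (cid (lowgen_vspace P))). Qed.

Lemma gen_stable P : (forall v, P v -> exists lam, HW lam v) -> lie_stable (gen P).
Proof. by move=> PH i j u /genP h; apply/genP; apply: lowgen_lie => //; exact: (sigma_Fm eps_sq eps_rev). Qed.

Lemma gen_min P U : lie_stable U -> (forall v, P v -> v \in U) -> (gen P <= U)%VS.
Proof.
move=> sU PU; apply/subvP => x /genP; elim=> {x} [v /PU//||a u v _ h _ h'|i j u _ _ h].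
- exact: mem0v.
- by rewrite memvD // memvZ.
- exact: sU.
Qed.

Definition yw (y : 'I_n -> int) S : int := \sum_(p in S) y p.1.

Lemma dr_delta i j u : dr (delta_mx i j) u = \sum_(a < k) cr (i, a) (an (j, a) u).
Proof.
rewrite drE (bigD1 i) //= [X in _ + X]big1 => [|i' /negbTE h]; last first.
  by rewrite big1 // => j' _; rewrite mxE h scale0r.
rewrite (bigD1 j) //= [X in _ + X + _]big1 => [|j' /negbTE h]; last by rewrite mxE h andbF scale0r.
by rewrite mxE !eqxx scale1r !addr0.
Qed.

Lemma dr_delta_supp (y : 'I_n -> int) i j u S : dr (delta_mx i j) u S != 0 ->
  exists T, u T != 0 /\ yw y S = yw y T + y i - y j.
Proof.
rewrite dr_delta sum_ffunE => h.
have [/existsP[a]|] := boolP [exists a, cr (i, a) (an (j, a) u) S != 0]; last first.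
  rewrite negb_exists => /forallP h'; move: h; rewrite big1 ?eqxx // => a _.
  by have := h' a; rewrite negbK => /eqP.
rewrite !ffunE; case: ifP => [iS|_]; last by rewrite eqxx.
case: ifP => [_|/negbT jS]; first by rewrite mulr0 eqxx.
move=> h'; exists ((j, a) |: (S :\ (i, a)))%SET; split.
  by apply: contraNneq h' => ->; rewrite !mulr0.
rewrite /yw big_setU1 //= (finset.big_setD1 (i, a)) //=.
by rewrite addrAC [y j + _]addrC addrK addrC.
Qed.

Lemma Fm_supp (y : 'I_n -> int) i j u S : (forall a, y (rev_ord a) = - y a) ->
  dr (Fm i j) u S != 0 -> exists T, u T != 0 /\ yw y S = yw y T + y i - y j.
Proof.
move=> yodd; rewrite (FmE eps_sq eps_rev) drD drN drZ !ffunE.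
have [->|/(dr_delta_supp y) //] := eqVneq (dr (delta_mx i j) u S) 0.
rewrite add0r oppr_eq0 => h.
have : dr (delta_mx (rev_ord j) (rev_ord i)) u S != 0.
  by apply: contraNneq h => ->; rewrite scaler0.
by move=> /(dr_delta_supp y)[T [uT ->]]; exists T; split => //; rewrite !yodd opprK addrAC.
Qed.

Lemma yw_wt (y : 'I_n -> int) S : (forall a, y (rev_ord a) = - y a) ->
  yw y S *+ 2 = \sum_i y i * wt i S.
Proof.
move=> yodd; have E : yw y S = \sum_i y i * (occ i S)%:Z.
  rewrite /yw (partition_big fst xpredT) //=; apply: eq_bigr => i _.
  rewrite (eq_bigr (fun=> y i)) => [|p /andP[_ /eqP ->] //].
  by rewrite sumr_const -mulr_natr natz.
rewrite mulr2n [X in X + _]E E [X in _ + X](reindex_inj rev_ord_inj) -big_split; apply: eq_bigr => i _ /=.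
by rewrite yodd /wt mulrBr mulNr.
Qed.

Lemma yw_eq (y : 'I_n -> int) S T : (forall a, y (rev_ord a) = - y a) ->
  (forall i, wt i S = wt i T) -> yw y S = yw y T.
Proof.
move=> yodd h; have : yw y S *+ 2 = yw y T *+ 2.
  by rewrite !yw_wt //; apply: eq_bigr => i _; rewrite h.
by rewrite !mulr2n; lia.
Qed.

Lemma lowgen_le (y : 'I_n -> int) (c : int) P u : (forall a, y (rev_ord a) = - y a) ->
  (forall a b : 'I_n, (a <= b)%N -> y b <= y a) ->
  (forall v, P v -> forall S, v S != 0 -> yw y S <= c) ->
  lowgen P u -> forall S, u S != 0 -> yw y S <= c.
Proof.
move=> yodd ymon PH; elim=> {u} [v /PH//|S|a u v _ IHu _ IHv S|i j u ji _ IHu S].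
- by rewrite ffunE eqxx.
- rewrite !ffunE; have [uS|/IHu//] := eqVneq (u S) 0.
  by rewrite uS scaler0 add0r => /IHv.
- move=> /(Fm_supp yodd)[T [/IHu uT ->]]; rewrite -addrA; apply: le_trans uT.
  by rewrite gerDl subr_le0 ymon // ltnW.
Qed.

(** When [y] is strictly decreasing, each lowering operator strictly lowers the degree [yw y], so
    that [v0] alone contributes in degree [c]. This is the simplicity of the highest weight. *)
Lemma lowgen_lead (y : 'I_n -> int) (c : int) v0 u : (forall a, y (rev_ord a) = - y a) ->
  (forall a b : 'I_n, (a < b)%N -> y b < y a) ->
  (forall S, v0 S != 0 -> yw y S = c) ->
  lowgen (eq v0) u -> exists a, forall S, (u - a *: v0) S != 0 -> yw y S < c.
Proof.
move=> yodd ymon h0; elim=> {u} [v <-||a u v _ [b hb] _ [d hd]|i j u ji _ [b hb]].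
- by exists 1 => S; rewrite scale1r subrr ffunE eqxx.
- by exists 0 => S; rewrite scale0r subrr ffunE eqxx.
- exists (a * b + d) => S.
  have -> : a *: u + v - (a * b + d) *: v0 = a *: (u - b *: v0) + (v - d *: v0).
    by rewrite scalerDl scalerBr scalerA opprD addrACA.
  rewrite !ffunE; have [uS|] := eqVneq ((u - b *: v0) S) 0; last by move=> /hb.
  move: uS; rewrite !ffunE => ->; rewrite scaler0 add0r => vS; apply: hd.
  by rewrite !ffunE.
- exists 0 => S; rewrite scale0r subr0 => /(Fm_supp yodd)[T [uT ->]].
  have yT : yw y T <= c.
    have [dT|/hb/ltW//] := eqVneq ((u - b *: v0) T) 0.
    rewrite (h0 T) //; apply: contraNneq uT => v0T; move: dT.
    by rewrite !ffunE v0T scaler0 subr0 => ->.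
  by apply: lt_le_trans yT; rewrite -addrA gtrDl subr_lt0 ymon.
Qed.

(** The regular cocharacter [(n - 1, n - 3, ..., 1 - n)]: every raising operator increases the
    grading that it defines. *)
Definition yreg (i : 'I_n) : int := n%:Z - 1 - (2 * i)%:Z.

Lemma yreg_odd a : yreg (rev_ord a) = - yreg a.
Proof. by rewrite /yreg /=; have := ltn_ord a; lia. Qed.

Lemma yreg_mon (a b : 'I_n) : (a < b)%N -> yreg b < yreg a.
Proof. by rewrite /yreg; lia. Qed.

Lemma HW_yw lam v S T (y : 'I_n -> int) : (forall a, y (rev_ord a) = - y a) ->
  HW lam v -> v S != 0 -> v T != 0 -> yw y S = yw y T.
Proof. by move=> yodd [h _] /h hS /h hT; apply: yw_eq => // i; rewrite hS hT. Qed.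

(** A set [S] of maximal [yreg]-degree among the supports of vectors of [U] gives it: the projection
    to the weight of [S] stays in [U], and a raising operator would exceed the maximum. *)
Lemma stable_HW U : lie_stable U -> U != 0%VS -> exists lam v, [/\ v \in U, v != 0 & HW lam v].
Proof.
move=> sU U0.
pose P S := `[< exists2 u, u \in U & u S != 0 >].
have [S0 PS0] : exists S, P S.
  have v0 := memv_pick U; have := U0; rewrite -vpick0 => h.
  have [S hS] : exists S, vpick U S != 0.
    apply/existsP; apply: contraNT h; rewrite negb_exists => /forallP h; apply/eqP/ffunP => S.
    by rewrite [RHS]ffunE; have := h S; rewrite negbK => /eqP.
  by exists S; apply/asboolP; exists (vpick U).
case: (arg_maxP (yw yreg) PS0) => S /asboolP[u uU uS] maxS.
pose b T : C := [forall i, wt i T == wt i S]%:R.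
pose v := diagop b u.
have vU : v \in U.
  apply: (lie_stable_diag eps_sq eps_rev) => // T T' h; rewrite /b; congr (_%:R); congr nat_of_bool.
  by apply: eq_forallb => i; rewrite h.
have vw T : v T != 0 -> forall i, wt i T = wt i S.
  rewrite ffunE /b; case: forallP => [h _ i|_]; last by rewrite mul0r eqxx.
  exact/eqP.
exists (fun i => wt i S), v; split => //.
  apply: contraNneq uS => v0; have := congr1 (fun f : W => f S) v0; rewrite !ffunE.
  by rewrite /b; case: forallP => [_|[]//]; rewrite mul1r => ->.
split => // a b' ab; apply/ffunP => T; rewrite [RHS]ffunE; apply/eqP/negPn/negP => nz.
have [T' [vT' E]] := Fm_supp yreg_odd nz.
have : yw yreg T <= yw yreg S.
  by apply: maxS; apply/asboolP; exists (dr (Fm a b') v) => //; exact: sU.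
rewrite E (yw_eq yreg_odd (vw _ vT')) -addrA gerDl subr_le0.
by rewrite leNgt yreg_mon.
Qed.

Definition perp U u := forall x, x \in U -> dot u x = 0.

Lemma perp_stable U i j u : lie_stable U -> perp U u -> perp U (dr (Fm i j) u).
Proof. by move=> sU h x xU; rewrite dot_dr (adj_Fm eps_sq eps_rev) h //; exact: sU. Qed.

Lemma HW_perp lam v U : lie_stable U -> HW lam v ->
  forall P, (forall x, P x -> dot v x = 0) -> forall x, lowgen P x -> dot v x = 0.
Proof.
move=> sU [_ h2] P hP x; elim=> {x} [x /hP//||a u w _ IHu _ IHw|i j u ji _ _].
- by rewrite dot0r.
- by rewrite dotDr dotZr IHu IHw mulr0 addr0.
- by rewrite -[Fm i j](adj_Fm eps_sq eps_rev) -dot_dr h2 // dot0l.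
Qed.

Lemma HW_neq lam mu v x : (exists i, lam i != mu i) -> HW lam v -> HW mu x -> dot v x = 0.
Proof.
move=> [i hi] [h _] [h' _]; rewrite /dot big1 // => S _.
have [->|/h hS] := eqVneq (v S) 0; first by rewrite mul0r.
have [->|/h' hS'] := eqVneq (x S) 0; first by rewrite rmorph0 mulr0.
by move: hi; rewrite -hS -hS' eqxx.
Qed.

(** The adjoint of a lowering operator is a raising one and kills highest weight vectors, so
    orthogonality of the generated modules follows from that of the generators. *)
Lemma gen_perp (P Q : W -> Prop) : (forall v, P v -> exists lam, HW lam v) ->
  (forall v, Q v -> exists lam, HW lam v) -> (forall v x, P v -> Q x -> dot v x = 0) ->
  forall u, u \in gen P -> perp (gen Q) u.
Proof.
move=> PH QH PQ; have sQ := gen_stable QH.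
have [U HU] : exists U : {vspace W}, forall x, x \in U <-> perp (gen Q) x.
  apply: pred_vspace => [x _|a u v hu hv x xQ]; first exact: dot0l.
  by rewrite dotDl dotZl hu // hv // mulr0 addr0.
have sU : lie_stable U by move=> i j u /HU h; apply/HU; exact: perp_stable.
move=> u uP; apply/HU; apply: (subvP (gen_min sU _)) uP => v Pv; apply/HU => x /genP.
have [lam hv] := PH _ Pv; apply: (HW_perp sQ hv) => y; exact: PQ.
Qed.

(** The sum is over all pairs of indices, so that [Fm i j] occurs again, up to sign, as
    [Fm (rev_ord j) (rev_ord i)]; hence the factor 2 in [casc] and [radial]. *)
Definition casimir u : W := \sum_i \sum_j dr (Fm i j) (dr (Fm j i) u).

Lemma casimir_lin a u v : casimir (a *: u + v) = a *: casimir u + casimir v.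
Proof.
rewrite /casimir scaler_sumr -big_split; apply: eq_bigr => i _ /=.
rewrite scaler_sumr -big_split; apply: eq_bigr => j _ /=.
by rewrite !drDr !drZr.
Qed.

(** The commutators of [X] with the two factors give four triple sums with coefficients from [X],
    which cancel in pairs after renaming indices. *)
Lemma casimir_comm X u : sg X = - X -> casimir (dr X u) = dr X (casimir u).
Proof.
move=> hX; have cE i j (w : W) : dr X (dr (Fm i j) w) = dr (Fm i j) (dr X w)
    + (\sum_l X l i *: dr (Fm l j) w - \sum_l X j l *: dr (Fm i l) w).
  rewrite dr_lie_comm comm_Fm // drD drN !dr_sum; congr (_ + (_ - _)).
    by apply: eq_bigr => l _; rewrite drZ.
  by apply: eq_bigr => l _; rewrite drZ.
rewrite /casimir dr_sumr; under [RHS]eq_bigr do rewrite dr_sumr.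
have E i j : dr X (dr (Fm i j) (dr (Fm j i) u)) = dr (Fm i j) (dr (Fm j i) (dr X u))
    + (\sum_l X l i *: dr (Fm l j) (dr (Fm j i) u) - \sum_l X i l *: dr (Fm i j) (dr (Fm j l) u))
    + (\sum_l X l j *: dr (Fm i j) (dr (Fm l i) u) - \sum_l X j l *: dr (Fm i l) (dr (Fm j i) u)).
  have drB Y a b : dr Y (a - b) = dr Y a - dr Y b :> W by exact: linearB.
  have push Y (c : 'I_n -> C) (w : 'I_n -> W) : dr Y (\sum_l c l *: w l) = \sum_l c l *: dr Y (w l).
    by rewrite dr_sumr; apply: eq_bigr => l _; rewrite drZr.
  rewrite cE cE drDr drB !push.
  have R (V : zmodType) (o x y z t : V) : o + (x - y) + (z - t) = o + (z - y) + (x - t).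
    by rewrite -!addrA; congr (_ + _); rewrite addrCA [RHS]addrCA; congr (_ + _); rewrite addrCA.
  exact: R.
under [RHS]eq_bigr do under eq_bigr do rewrite E.
under [RHS]eq_bigr do rewrite !big_split /=.
rewrite !big_split /= -[LHS]addr0 -[LHS]addr0 -!addrA; congr (_ + _).
have sN (f : 'I_n -> 'I_n -> 'I_n -> W) : \sum_i \sum_j (- \sum_l f i j l) = - \sum_i \sum_j \sum_l f i j l.
  by rewrite -sumrN; apply: eq_bigr => i _; rewrite -sumrN.
rewrite !sN addrA addr0.
have -> : \sum_i \sum_j \sum_l X i l *: dr (Fm i j) (dr (Fm j l) u) =
    \sum_i \sum_j \sum_l X l i *: dr (Fm l j) (dr (Fm j i) u).
  rewrite exchange_big [RHS]exchange_big; apply: eq_bigr => j _ /=.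
  by rewrite exchange_big.
have -> : \sum_i \sum_j \sum_l X l j *: dr (Fm i j) (dr (Fm l i) u) =
    \sum_i \sum_j \sum_l X j l *: dr (Fm i l) (dr (Fm j i) u).
  by apply: eq_bigr => i _; rewrite exchange_big.
by rewrite !subrr addr0.
Qed.

(** The normalisation of the coroot in [Fm_comm_rev]: 1 in general; between opposite indices 2 for
    the symplectic form (long roots) and 0 for a symmetric form, where the root vector is zero. *)
Definition kap (i j : 'I_n) : C := 1 - (j == rev_ord i)%:R * eta.

Lemma Fm_comm_rev i j : i != j ->
  Fm i j *m Fm j i - Fm j i *m Fm i j = kap i j *: (Fm i i - Fm j j).
Proof.
move=> ij; rewrite (comm_Fm eps_sq) ?(sigma_Fm eps_sq eps_rev) //.
have S1 : \sum_l Fm i j l j *: Fm l i = kap i j *: Fm i i.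
  rewrite (eq_bigr (fun l => ((l == i)%:R : C) *: Fm l i - (eps i * eps j * ((l == rev_ord j) && (j == rev_ord i))%:R) *: Fm l i)).
    rewrite sumrB (bigD1 i) //= big1 => [|l /negbTE ->]; last by rewrite scale0r.
    rewrite (bigD1 (rev_ord j)) //= big1 => [|l /negbTE ->]; last by rewrite mulr0 scale0r.
    rewrite eqxx scale1r !addr0 eqxx /kap scalerBl scale1r; congr (_ - _).
    case: eqP => [->|_]; last by rewrite mulr0 mul0r !scale0r.
    by rewrite rev_ordK eps_rev mulr1 mul1r mulrCA eps_sq mulr1.
  move=> l _; rewrite [in LHS](FmE eps_sq eps_rev) !mxE eqxx andbT scalerBl.
  by rewrite [j == rev_ord i]eq_sym.
have S2 : \sum_l Fm i j i l *: Fm j l = kap i j *: Fm j j.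
  rewrite (eq_bigr (fun l => ((l == j)%:R : C) *: Fm j l - (eps i * eps j * ((i == rev_ord j) && (l == rev_ord i))%:R) *: Fm j l)).
    rewrite sumrB (bigD1 j) //= big1 => [|l /negbTE ->]; last by rewrite scale0r.
    rewrite (bigD1 (rev_ord i)) //= big1 => [|l /negbTE ->]; last by rewrite andbF mulr0 scale0r.
    rewrite eqxx scale1r !addr0 eqxx andbT /kap scalerBl scale1r; congr (_ - _).
    have -> : (i == rev_ord j) = (j == rev_ord i) by rewrite -(inj_eq rev_ord_inj) rev_ordK eq_sym.
    case: eqP => [E|_]; last by rewrite mulr0 mul0r !scale0r.
    by rewrite -E E eps_rev mulr1 mul1r mulrCA eps_sq mulr1.
  by move=> l _; rewrite [in LHS](FmE eps_sq eps_rev) !mxE eqxx scalerBl.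
by rewrite S1 S2 -scalerBr.
Qed.

Definition cas_val lam : C :=
  \sum_i ((lam i)%:~R ^+ 2 + \sum_(j < n | (i < j)%N) kap i j * ((lam i)%:~R - (lam j)%:~R)).

(** In each product one factor raises. If it acts first it kills [v]; otherwise it is moved to the
    right at the cost of the commutator, which is diagonal. *)
Lemma casimir_HW lam v : HW lam v -> casimir v = cas_val lam *: v.
Proof.
move=> h; rewrite /casimir /cas_val scaler_suml; apply: eq_bigr => i _.
rewrite scalerDl (bigD1 i) //= (HW_diag i h) drZr (HW_diag i h) scalerA -expr2; congr (_ + _).
rewrite (bigID (fun j : 'I_n => (i < j)%N)) /= [X in _ + X]big1 ?addr0 => [|j /andP[ji ij]]; last first.
  by rewrite h.2 ?dr0r // ltn_neqAle leqNgt ij andbT.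
rewrite scaler_suml; apply: eq_big => [j|j /andP[ji ij]].
  by apply: andb_idl => ij; apply: contraTneq ij => ->; rewrite ltnn.
rewrite dr_lie_comm h.2 // dr0r add0r Fm_comm_rev 1?eq_sym // drZ drD drN.
by rewrite !(HW_diag _ h) -scalerBl scalerA.
Qed.

Lemma casimir_gen P lam : (forall v, P v -> exists mu, HW mu v /\ cas_val mu = cas_val lam) ->
  forall u, u \in gen P -> casimir u = cas_val lam *: u.
Proof.
move=> PH u /genP; elim=> {u} [v /PH[mu [h <-]]||a u v _ IHu _ IHv|i j u _ _ IHu].
- exact: casimir_HW.
- rewrite scaler0; apply/ffunP => S; rewrite [RHS]ffunE /casimir sum_ffunE big1 // => i _.
  by rewrite sum_ffunE big1 // => j _; rewrite !dr0r ffunE.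
- by rewrite casimir_lin IHu IHv scalerDr !scalerA mulrC.
- by rewrite casimir_comm ?(sigma_Fm eps_sq eps_rev) // IHu drZr.
Qed.

End HighestWeightTheory.

(** * Traces *)

Section Traces.

Variables (C : numClosedFieldType) (n k : nat) (eps : 'I_n -> C) (eta : C).
Hypothesis eps_sq : forall i, eps i * eps i = 1.
Hypothesis eps_rev : forall i, eps (rev_ord i) = eta * eps i.
Local Notation Fm := (Fm eps).
Local Notation I := ('I_n * 'I_k)%type.
Local Notation W := (exterior C I).
Local Notation lie_stable := (lie_stable eps).
Implicit Types (S T : {set I}) (u v : W) (U : {vspace W}).

Lemma diagop_is_linear (a : {set I} -> C) : linear (diagop a : W -> W).
Proof.
move=> b u v; apply/ffunP=> T; rewrite !ffunE mulrDr; congr (_ + _).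
exact: mulrCA.
Qed.
HB.instance Definition _ (a : {set I} -> C) :=
  GRing.isLinear.Build C W W *:%R (diagop a) (diagop_is_linear a).

Lemma dotBl u v (w : W) : dot (u - v) w = dot u w - dot v w.
Proof. by rewrite dotDl dotNl. Qed.

Lemma orthobasis_nat d U : \dim U = d -> exists b : nat -> W,
  [/\ forall i, (i < d)%N -> b i \in U,
      forall i j, (i < d)%N -> (j < d)%N -> dot (b i) (b j) = (i == j)%:R
    & forall u, u \in U -> u = \sum_(i < d) dot u (b i) *: b i].
Proof.
elim: d U => [|d IH] U dU.
  exists (fun=> 0); split => // u; move/eqP: dU; rewrite dimv_eq0 => /eqP -> /[!memv0] /eqP ->.
  by rewrite big_ord0.
have U0 : U != 0%VS by rewrite -dimv_eq0 dU.
pose x := vpick U; have x0 : x != 0 by rewrite vpick0.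
have xx : dot x x != 0 by rewrite dotuu_eq0.
have sx : sqrtC (dot x x) != 0 by rewrite sqrtC_eq0.
pose e := (sqrtC (dot x x))^-1 *: x.
have eU : e \in U by rewrite memvZ // memv_pick.
have ee : dot e e = 1.
  rewrite dotZl dotZr fmorphV /= geC0_conj ?sqrtC_ge0 ?dotuu_ge0 // mulrA -invfM -expr2 sqrtCK.
  by rewrite mulVf.
have [U' HU'] : exists U' : {vspace W}, forall u, u \in U' <-> (u \in U /\ dot u e = 0).
  apply: pred_vspace => [|a u v [uU ue] [vU ve]]; first by rewrite mem0v dot0l.
  by rewrite memvD ?memvZ // dotDl dotZl ue ve mulr0 addr0.
have UE : U = (U' + <[e]>)%VS.
  apply/eqP; rewrite eqEsubv; apply/andP; split; apply/subvP => u.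
    move=> uU; apply/memv_addP; exists (u - dot u e *: e).
      apply: (HU' _).2; split; last by rewrite dotBl dotZl ee mulr1 subrr.
      apply: memvB => //; exact: memvZ.
    by exists (dot u e *: e); rewrite ?subrK // memvZ // memv_line.
  by case/memv_addP => v /HU'[vU _] [w /vlineP[a ->] ->]; rewrite memvD // memvZ.
have dU' : \dim U' = d.
  apply/eqP; rewrite -eqSS -dU UE -[X in X == _]addn1.
  have e0 : e != 0 by apply: contraTneq (oner_neq0 C) => e0; rewrite -ee e0 dot0l eqxx.
  have -> : 1%N = \dim <[e]> by rewrite dim_vline e0.
  rewrite -dimv_disjoint_sum // ?eqxx //.
  apply/eqP; rewrite -subv0; apply/subvP => u; rewrite memv_cap => /andP[/HU'[_ ue] /vlineP[a ua]].
  by move: ue; rewrite ua dotZl ee mulr1 => ->; rewrite scale0r mem0v.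
have [b [bU bb bs]] := IH U' dU'.
exists (fun i => if i is i.+1 then b i else e); split.
- by case=> [//|i] id; have /HU'[] := bU i id.
- move=> [|i] [|j] //= id jd; last by rewrite bb.
    by rewrite dotC; have /HU'[_ ->] := bU j jd; rewrite rmorph0.
  by have /HU'[_ ->] := bU i id.
move=> u uU; rewrite big_ord_recl /=.
have vU' : u - dot u e *: e \in U'.
  apply: (HU' _).2; split; last by rewrite dotBl dotZl ee mulr1 subrr.
  apply: memvB => //; exact: memvZ.
rewrite -[LHS](subrK (dot u e *: e)) addrC; congr (_ + _).
rewrite {1}(bs _ vU'); apply: eq_bigr => i _; rewrite dotBl dotZl.
have /HU'[_ bie] := bU i (ltn_ord i).
by rewrite [dot e _]dotC bie rmorph0 mulr0 subr0.
Qed.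

Lemma orthobasis U : exists b : 'I_(\dim U) -> W,
  [/\ forall i, b i \in U, forall i j, dot (b i) (b j) = (i == j)%:R
    & forall u, u \in U -> u = \sum_i dot u (b i) *: b i].
Proof.
have [b [b1 b2 b3]] := orthobasis_nat (erefl (\dim U)).
by exists (fun i => b i); split => [i|i j|//]; [exact: b1|rewrite b2].
Qed.

Definition ob U : 'I_(\dim U) -> W := projT1 (cid (orthobasis U)).
Arguments ob : clear implicits.

Lemma obP U : [/\ forall i, ob U i \in U, forall i j, dot (ob U i) (ob U j) = (i == j)%:R
    & forall u, u \in U -> u = \sum_i dot u (ob U i) *: ob U i].
Proof. exact: (projT2 (cid (orthobasis U))). Qed.

(* The squared norm of the projection of [e_S] on [U]: the trace on [U] of an
   element of the torus is the sum of its eigenvalues on the [e_S], weighted by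
   these coefficients. *)
Definition acoef U S : C := \sum_i (ob U i S : C) * (ob U i S : C)^*.

Lemma acoef_ge0 U S : 0 <= acoef U S.
Proof. by apply: sumr_ge0 => i _; rewrite mul_conjC_ge0. Qed.

Lemma acoef_sum U : \sum_S acoef U S = (\dim U)%:R.
Proof.
rewrite exchange_big /= (eq_bigr (fun=> 1)) => [|i _].
  by rewrite sumr_const card_ord.
by have [_ h _] := obP U; have := h i i; rewrite eqxx.
Qed.

Lemma acoef_supp U (Q : {set I} -> Prop) : (forall u, u \in U -> forall S, u S != 0 -> Q S) ->
  forall S, acoef U S != 0 -> Q S.
Proof.
move=> h S; have [/existsP[i hi] _|] := boolP [exists i, ob U i S != 0].
  by apply: h hi; have [-> _ _] := obP U.
rewrite negb_exists => /forallP z; rewrite /acoef big1 ?eqxx // => i _.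
by have := z i; rewrite negbK => /eqP ->; rewrite mul0r.
Qed.

Definition oproj U u : W := \sum_i dot u (ob U i) *: ob U i.

Lemma proj_in U u : oproj U u \in U.
Proof. by apply: memv_suml => i _; rewrite memvZ //; have [-> _ _] := obP U. Qed.

Lemma proj_perp U u : perp U (u - oproj U u).
Proof.
have [_ bb bs] := obP U => x /bs ->; rewrite dot_sumr big1 // => j _.
rewrite dotZr dotBl dot_suml (bigD1 j) //= big1 ?addr0 => [|i ij].
  by rewrite dotZl bb eqxx mulr1 subrr mulr0.
by rewrite dotZl bb (negbTE ij) mulr0.
Qed.

Lemma proj_uniq U u x : x \in U -> perp U (u - x) -> x = oproj U u.
Proof.
move=> xU ux; apply/eqP; rewrite -subr_eq0 -dotuu_eq0; apply/eqP.
have d : x - oproj U u \in U by rewrite memvB // proj_in.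
have E (V : zmodType) (a b c : V) : a - b = (c - b) - (c - a).
  by rewrite opprB [RHS]addrC addrA addrNK.
by rewrite {1}(E _ x (oproj U u) u) dotBl ux // proj_perp // subrr.
Qed.

Lemma acoef_proj U S : acoef U S = dot (oproj U (ebas C S)) (ebas C S).
Proof.
rewrite dot_suml; apply: eq_bigr => i _; rewrite dotZl dot_ebas [dot (ebas _ _) _]dotC dot_ebas.
exact: mulrC.
Qed.

(** Parseval: a basis vector minus its projections is orthogonal to every [U j], hence zero. *)
Lemma acoef_total (J : finType) (U : J -> {vspace W}) :
  (forall i j, i != j -> forall u, u \in U i -> perp (U j) u) ->
  (forall u, (forall j, perp (U j) u) -> u = 0) ->
  forall S, \sum_j acoef (U j) S = 1.
Proof.
move=> UU U0 S; have /(congr1 (fun u => dot u (ebas C S))) : ebas C S - \sum_j oproj (U j) (ebas C S) = 0.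
  apply: U0 => j x xj; rewrite (bigD1 j) //= opprD addrA dotBl proj_perp // sub0r dot_suml.
  by rewrite big1 ?oppr0 // => i ij; rewrite (UU _ _ ij) // proj_in.
rewrite dot0l dotBl dot_ebas ffunE eqxx dot_suml => /eqP; rewrite subr_eq0 => /eqP E.
rewrite -[1]/(true%:R : C) E.
by apply: eq_bigr => j _; rewrite acoef_proj.
Qed.

(** Such a [g] is an isometry mapping [U] onto itself, so it commutes with the orthogonal projection
    on [U]. *)
Lemma acoef_perm U (g : {linear W -> W}) (f : {set I} -> {set I}) (th : {set I} -> C) :
  injective f -> (forall S, g (ebas C S) = th S *: ebas C (f S)) -> (forall S, th S * (th S)^* = 1) ->
  (forall u, u \in U -> g u \in U) -> forall S, acoef U (f S) = acoef U S.
Proof.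
move=> fi ge th1 gU.
have iso u v : dot (g u) (g v) = dot u v.
  rewrite {1}(ebas_sum u) {1}(ebas_sum v) !linear_sum dot_suml; apply: eq_bigr => S _.
  rewrite [g (_ *: _)]linearZ /= ge dot_sumr (bigD1 S) //= big1 => [|T TS].
    rewrite [g (_ *: _)]linearZ /= ge !dotZl !dotZr dot_ebas ffunE eqxx addr0.
    have R (a b c d : C) : b * d = 1 -> a * (b * (c * (d * 1))) = a * c.
      by move=> h; transitivity (a * c * (b * d)); [ring|rewrite h mulr1].
    exact: R.
  rewrite [g (_ *: _)]linearZ /= ge !dotZl !dotZr dot_ebas ffunE (inj_eq fi).
  by rewrite (negbTE TS) !mulr0.
(* The hypothesis gives only an inclusion of [g U] in [U]; an isometry is injective, and dimensions
   give equality. *)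
have gsurj y : y \in U -> exists2 x, x \in U & y = g x.
  pose h := linfun g.
  have hU : (h @: U)%VS = U.
    apply/eqP; rewrite eqEdim; apply/andP; split.
      by apply/subvP => z /memv_imgP[x xU ->]; rewrite lfunE; exact: gU.
    rewrite limg_dim_eq //; apply/eqP; rewrite -subv0; apply/subvP => x.
    rewrite memv_cap memv_ker lfunE => /andP[_ /eqP gx0].
    by rewrite memv0 -dotuu_eq0 -iso gx0 dot0l.
  by move=> yU; move: yU; rewrite -{1}hU => /memv_imgP[x xU ->]; exists x; rewrite ?lfunE.
have pg u : oproj U (g u) = g (oproj U u).
  apply/esym/proj_uniq; first by apply: gU; exact: proj_in.
  by move=> y /gsurj[x xU ->]; rewrite -linearB iso proj_perp.
move=> S; have thS : th S != 0.
  by apply/eqP => z; have := th1 S; rewrite z mul0r => /esym/eqP; rewrite oner_eq0.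
have E : ebas C (f S) = (th S)^-1 *: g (ebas C S) by rewrite ge scalerA mulVf // scale1r.
have pZ a u : oproj U (a *: u) = a *: oproj U u.
  by rewrite /oproj scaler_sumr; apply: eq_bigr => i _; rewrite dotZl scalerA.
rewrite !acoef_proj E pZ pg dotZl dotZr iso mulrA fmorphV -invfM th1 invr1 mul1r.
by [].
Qed.

Definition trU U (f : W -> W) : C := \sum_i dot (f (ob U i)) (ob U i).

Lemma trU_comm U (f g : {linear W -> W}) :
  (forall u, u \in U -> f u \in U) -> (forall u, u \in U -> g u \in U) ->
  trU U (fun u => f (g u)) = trU U (fun u => g (f u)).
Proof.
move=> fU gU; have [bU _ bs] := obP U.
have E (f' g' : {linear W -> W}) : (forall u, u \in U -> g' u \in U) ->
    trU U (fun u => f' (g' u)) = \sum_i \sum_j dot (g' (ob U i)) (ob U j) * dot (f' (ob U j)) (ob U i).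
  move=> gU'; apply: eq_bigr => i _; rewrite {1}(bs _ (gU' _ (bU i))) linear_sum dot_suml.
  by apply: eq_bigr => j _; rewrite linearZ dotZl.
rewrite !E // exchange_big /=; apply: eq_bigr => i _; apply: eq_bigr => j _.
exact: mulrC.
Qed.

Lemma trU_diag U c : trU U (diagop c) = \sum_S acoef U S * c S.
Proof.
under [RHS]eq_bigr do rewrite mulr_suml.
rewrite exchange_big /=; apply: eq_bigr => i _; apply: eq_bigr => S _.
rewrite ffunE.
have R (x y z : C) : x * y * z = y * z * x by ring.
exact: R.
Qed.

Lemma trU_eq U f g : (forall u, u \in U -> f u = g u) -> trU U f = trU U g.
Proof. by move=> fg; apply: eq_bigr => i _; rewrite fg //; have [-> _ _] := obP U. Qed.

Lemma trU_sum U (J : finType) (f : J -> W -> W) :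
  trU U (fun u => \sum_j f j u) = \sum_j trU U (f j).
Proof. by rewrite exchange_big; apply: eq_bigr => i _; rewrite dot_suml. Qed.

Lemma trU_lin U a f g : trU U (fun u => a *: f u + g u) = a * trU U f + trU U g.
Proof. by rewrite mulr_sumr -big_split; apply: eq_bigr => i _; rewrite dotDl dotZl. Qed.

Lemma diagopM (a b : {set I} -> C) u : diagop a (diagop b u) = diagop (fun S => a S * b S) u.
Proof. by apply/ffunP=> S; rewrite !ffunE; exact: mulrA. Qed.

Lemma tor_Fm d i j : is_tor d -> diag_mx d *m Fm i j = ((d 0 i / d 0 j) *: Fm i j) *m diag_mx d.
Proof.
move=> td.
have d0 a : d 0 a != 0.
  by apply/eqP => h; have [] := td a; rewrite h mul0r => /esym/eqP; rewrite oner_eq0.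
have dV a : d 0 (rev_ord a) = (d 0 a)^-1.
  by have [h _] := td a; apply: (mulfI (d0 a)); rewrite h mulfV.
apply/matrixP=> a b; rewrite mul_diag_mx mul_mx_diag (FmE eps_sq eps_rev) !mxE.
have E1 : d 0 a * ((a == i) && (b == j))%:R = d 0 i / d 0 j * ((a == i) && (b == j))%:R * d 0 b.
  by case: andP => [[/eqP -> /eqP ->]|_]; rewrite ?mulr1 ?divfK // ?mulr0 ?mul0r.
have E2 : d 0 a * ((a == rev_ord j) && (b == rev_ord i))%:R =
    d 0 i / d 0 j * ((a == rev_ord j) && (b == rev_ord i))%:R * d 0 b.
  case: andP => [[/eqP -> /eqP ->]|_]; rewrite ?mulr0 ?mul0r // !mulr1 !dV.
  by field; rewrite !d0.
by rewrite mulrBr E1 [d 0 a * (_ * _)]mulrCA E2; ring.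
Qed.

(** For opposite root vectors [X], [Y] and a torus element [t] with [t X = r X t], cyclicity gives
    [tr (X Y t) = r tr (Y X t)], while the difference of the two traces is [tr ([X, Y] t)]. Since
    [r = d i / d j] differs from 1, these two equations determine [tr (X Y t)] from the action of
    the diagonal matrices. *)
Theorem casimir_trace U c d : lie_stable U -> (forall u, u \in U -> casimir eps u = c *: u) ->
  is_tor d -> (forall i j, i != j -> d 0 i != d 0 j) ->
  let t S := \prod_(p in S) d 0 p.1 in
  c * (\sum_S acoef U S * t S) =
    \sum_i (\sum_S acoef U S * ((wt i S)%:~R ^+ 2 * t S)
     + \sum_(j | j != i) kap eta i j * (d 0 i / (d 0 i - d 0 j)) *
        (\sum_S acoef U S * (((wt i S)%:~R - (wt j S)%:~R) * t S))).
Proof.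
move=> sU cU td dd t.
have tE u : ext_act (diag_mx d) u = diagop t u by rewrite ext_act_diag; apply/ffunP=> S; rewrite !ffunE.
have d0 a : d 0 a != 0.
  by apply/eqP => h; have [] := td a; rewrite h mul0r => /esym/eqP; rewrite oner_eq0.
have tU u : u \in U -> diagop t u \in U.
  move=> uU; rewrite -tE; have [+ _] := lie_stableP eps_sq eps_rev U; move/(_ sU).
  by apply => //; rewrite -[diag_mx d]mulmx1; apply: ggen_tor => //; exact: ggen1.
pose h i := \sum_S acoef U S * ((wt i S)%:~R * t S).
have hE i : trU U (fun u => dr (Fm i i) (diagop t u)) = h i.
  transitivity (trU U (diagop (fun S => (wt i S)%:~R * t S))); last by rewrite trU_diag.
  apply: trU_eq => u _.
  by rewrite (dr_Fii eps_sq eps_rev) diagopM.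
have key i j : i != j -> trU U (fun u => dr (Fm i j) (dr (Fm j i) (diagop t u))) =
    kap eta i j * (d 0 i / (d 0 i - d 0 j)) * (h i - h j).
  move=> ij.
  pose x := trU U (fun u => dr (Fm i j) (dr (Fm j i) (diagop t u))).
  pose y := trU U (fun u => dr (Fm j i) (dr (Fm i j) (diagop t u))).
  have xy : x = d 0 i / d 0 j * y.
    rewrite /x (@trU_comm U (dr (Fm i j)) (dr (Fm j i) \o diagop t)); last 2 first.
    - by move=> u; exact: sU.
    - by move=> u uU /=; apply: sU; exact: tU.
    rewrite /y -[RHS]addr0 -[X in _ + X](_ : trU U (fun=> 0) = 0); last first.
      by rewrite /trU big1 // => l _; rewrite dot0l.
    rewrite -trU_lin; apply: trU_eq => u uU; rewrite addr0 /= -!tE.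
    rewrite (@ext_act_dr _ _ _ _ _ _ u (tor_Fm i j td)) drZ drZr.
    by [].
  have xmy : x = y + kap eta i j * (h i - h j).
    rewrite -!hE mulrBr /x.
    transitivity (trU U (fun u => dr (Fm j i) (dr (Fm i j) (diagop t u)) +
       (kap eta i j *: dr (Fm i i) (diagop t u) - kap eta i j *: dr (Fm j j) (diagop t u)))).
      apply: trU_eq => u _; rewrite dr_lie_comm (Fm_comm_rev eps_sq eps_rev) // drZ drD drN.
      by rewrite scalerBr.
    rewrite /y /trU !mulr_sumr -sumrB -big_split; apply: eq_bigr => l _ /=.
    by rewrite dotDl dotBl !dotZl.
  have dij : d 0 i - d 0 j != 0 by rewrite subr_eq0 dd.
  have : y * (d 0 i - d 0 j) = d 0 j * (kap eta i j * (h i - h j)).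
    have -> : kap eta i j * (h i - h j) = x - y by rewrite xmy addrAC subrr add0r.
    by rewrite xy; field.
  move=> yE; rewrite -/x xy; apply: (mulIf dij).
  transitivity (d 0 i / d 0 j * (y * (d 0 i - d 0 j))); first by rewrite mulrA.
  by rewrite yE; field; rewrite dij d0.
have -> : c * (\sum_S acoef U S * t S) = trU U (fun u => casimir eps (diagop t u)).
  rewrite -(trU_diag U t) -[LHS]addr0 -[X in _ + X](_ : trU U (fun=> 0) = 0); last first.
    by rewrite /trU big1 // => l _; rewrite dot0l.
  by rewrite -trU_lin; apply: trU_eq => u uU; rewrite cU ?addr0 //; exact: tU.
rewrite /casimir trU_sum; apply: eq_bigr => i _; rewrite trU_sum (bigD1 i) //=; congr (_ + _).
  transitivity (trU U (diagop (fun S => (wt i S)%:~R ^+ 2 * t S))); last by rewrite trU_diag.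
  apply: trU_eq => u _.
  rewrite !(dr_Fii eps_sq eps_rev) !diagopM; apply/ffunP=> S; rewrite !ffunE.
  by [].
apply: eq_bigr => j ji; rewrite key 1?eq_sym //; congr (_ * _).
rewrite /h -sumrB; apply: eq_bigr => S _.
by rewrite mulrBl mulrBr.
Qed.

End Traces.

Lemma expz2_inj (F : numFieldType) : injective (fun z : int => (2 : F) ^ z).
Proof.
move=> a b; have -> : (2 : F) = ratr 2 by rewrite rmorph_nat.
rewrite -!fmorphXz => /fmorph_inj.
exact: ieexprIz.
Qed.

(** * Highest weight vectors for the upper triangular group and for the Lie algebra *)

Section Triangular.

Variables (C : numClosedFieldType) (n k : nat) (eps : 'I_n -> C) (eta : C).
Hypothesis eps_sq : forall i, eps i * eps i = 1.
Hypothesis eps_rev : forall i, eps (rev_ord i) = eta * eps i.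
Local Notation M := 'M[C]_n.
Local Notation Fm := (Fm eps).
Local Notation I := ('I_n * 'I_k)%type.
Local Notation W := (exterior C I).
Local Notation lie_stable := (lie_stable eps).
Local Notation HW := (HW eps).
Local Notation gen := (gen eps).
Local Notation lowgen := (lowgen eps).
Implicit Types (S T : {set I}) (u v : W) (U : {vspace W}) (lam mu : 'I_n -> int).

Lemma sum_supp (J : finType) (P : pred J) (x : J -> W) T :
  (\sum_(j | P j) x j) T != 0 -> exists j, P j && (x j T != 0).
Proof.
rewrite sum_ffunE => h; apply/existsP; apply: contraNT h; rewrite negb_exists => /forallP z.
rewrite big1 // => j Pj; apply/eqP; have := z j.
by rewrite Pj /= => /negPn.
Qed.

Lemma cr_supp p u S : cr p u S != 0 -> p \in S /\ u (S :\ p)%SET != 0.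
Proof.
rewrite ffunE; case: ifP => // _; last by rewrite eqxx.
by rewrite mulf_eq0 negb_or => /andP[].
Qed.

Lemma yw_rem (y : 'I_n -> int) p S : p \in S -> yw y S = y p.1 + yw y (S :\ p)%SET.
Proof. by move=> pS; rewrite /yw (finset.big_setD1 p). Qed.

Lemma ebas_supp S T : ebas C S T != 0 -> T = S.
Proof. by rewrite ffunE; case: (T =P S) => // _; rewrite eqxx. Qed.

(** An upper triangular matrix replaces an index by itself or by smaller ones, which have larger
    [y]; the diagonal entries give the only term that keeps the degree. *)
Lemma tri_act (y : 'I_n -> int) (g : M) : (forall a b : 'I_n, (a < b)%N -> y b < y a) ->
  is_trig_mx g^T -> forall S T,
  (ext_act g (ebas C S) - (\prod_(p in S) g p.1 p.1) *: ebas C S : W) T != 0 -> yw y S < yw y T.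
Proof.
move=> ymon /is_trig_mxP gt S.
move: {2}#|S| (erefl #|S|) => m; elim: m S => [|m IH] S Sm.
  move/eqP: Sm; rewrite finset.cards_eq0 => /eqP -> T.
  by rewrite -/(vac C I) ext_act_vac big_set0 scale1r subrr ffunE eqxx.
have /finset.set0Pn[p pS] : S != finset.set0 by rewrite -finset.cards_eq0 Sm.
have Sp : #|(S :\ p)%SET| = m by move: Sm; rewrite (finset.cardsD1 p) pS => -[].
have E : ebas C S = fsgn C p (S :\ p)%SET *: cr p (ebas C (S :\ p)%SET).
  by rewrite cr_ebas finset.setD11 scalerA fsgnK scale1r finset.setD1K.
pose S' := (S :\ p)%SET; pose pi' := \prod_(q in S') g q.1 q.1.
pose r : W := ext_act g (ebas C S') - pi' *: ebas C S'.
have rE : ext_act g (ebas C S') = pi' *: ebas C S' + r by rewrite addrC subrK.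
have key : ext_act g (ebas C S) - (\prod_(q in S) g q.1 q.1) *: ebas C S =
   fsgn C p S' *: (\sum_(i < n | i != p.1) (g i p.1 * pi') *: cr (i, p.2) (ebas C S') + gcr g p r).
  rewrite {1}E actZr ext_act_cr rE gcrDr gcrZr (finset.big_setD1 p) //= -/S' -/pi' E.
  rewrite {1}/gcr (bigD1 p.1) //=.
  rewrite -[(p.1, p.2)]surjective_pairing.
  have G (V : lmodType C) (s a b : C) (x Y w : V) :
      s *: (b *: (a *: x + Y) + w) - (a * b) *: (s *: x) = s *: (b *: Y + w).
    rewrite !scalerDr !scalerA; have -> : a * b * s = s * b * a by ring.
    by rewrite -[X in X - _]addrA [X in X - _]addrC addrK.
  rewrite G scaler_sumr; congr (_ *: (_ + _)); apply: eq_bigr => i _; rewrite scalerA.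
  by rewrite [pi' * _]mulrC.
move=> T; rewrite key ffunE => /[!mulf_eq0]/norP[_]; rewrite ffunE => h.
have [] : (\sum_(i < n | i != p.1) (g i p.1 * pi') *: cr (i, p.2) (ebas C S') : W) T != 0 \/ gcr g p r T != 0.
  have [z|z] := eqVneq (gcr g p r T : C) 0; [left|by right].
  by move: h; rewrite z addr0.
- move=> /sum_supp[i /andP[ip]]; rewrite ffunE mulf_eq0 => /norP[gn].
  case/cr_supp => iT /ebas_supp TS.
  have ip' : (i < p.1)%N.
    rewrite ltnNge; apply/negP; rewrite leq_eqVlt => /orP[/eqP/val_inj pi|pi].
      by rewrite pi eqxx in ip.
    by move: gn; have := gt _ _ pi; rewrite !mxE => ->; rewrite mul0r eqxx.
  rewrite (yw_rem y iT) TS (yw_rem y pS) ltrD2r.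
  exact: ymon.
- move=> /sum_supp[i /andP[_]]; rewrite ffunE mulf_eq0 => /norP[gn].
  case/cr_supp => iT rT.
  have ip' : (i <= p.1)%N.
    rewrite leqNgt; apply/negP => pi.
    by move: gn; have := gt _ _ pi; rewrite !mxE => ->; rewrite eqxx.
  rewrite (yw_rem y iT) (yw_rem y pS) ler_ltD //; last exact: IH rT.
  by move: ip'; rewrite leq_eqVlt => /orP[/eqP/val_inj ->//|/ymon/ltW].
Qed.

Lemma odd_eps_mid lam (lamo : forall i, lam (rev_ord i) = - lam i) i : rev_ord i = i -> lam i = 0.
Proof. by move=> ii; have := lamo i; rewrite ii; lia. Qed.

(** Opposite entries cancel in the product, so what remains of it is the middle entry. *)
Lemma tor_of_diag (d : 'rV[C]_n) : (forall i, d 0 i * d 0 (rev_ord i) = 1) -> \prod_i d 0 i = 1 -> is_tor d.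
Proof.
move=> dd dp j; split=> [//|jj].
pose d' : 'rV[C]_n := \row_i (if i == j then 1 else d 0 i).
have jr i : rev_ord i = i -> i = j by move: jj => /(congr1 val) /= jj /(congr1 val) /= ii; apply: val_inj => /=; lia.
have td : is_tor d'.
  move=> i; rewrite !mxE; split => [|/jr ->]; last by rewrite eqxx.
  have [->|ij] := eqVneq i j; first by rewrite jj eqxx mulr1.
  have [rj|_] := eqVneq (rev_ord i) j; last exact: dd.
  by move: ij; rewrite -(rev_ordK i) rj jj eqxx.
have := det_tor td; rewrite det_diag (bigD1 j) //= mxE eqxx mul1r => E.
move: dp; rewrite (bigD1 j) //= (_ : \prod_(i < n | i != j) d 0 i = 1) ?mulr1 //.
apply: etrans E; apply: eq_bigr => i ij.
by rewrite mxE (negbTE ij).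
Qed.

Lemma upper_tor (g : M) : ggen eps g -> is_trig_mx g^T -> is_tor (\row_i g i i).
Proof.
move=> /(ggen_orth eps_sq eps_rev)[og dg] tg; move: (tg) => /is_trig_mxP gt.
have dgE : \det g = \prod_i g i i.
  by rewrite -det_tr (det_trig tg); apply: eq_bigr => i _; rewrite mxE.
have gl (a b : 'I_n) : (b < a)%N -> g a b = 0 by move=> ba; have := gt _ _ ba; rewrite mxE.
apply: tor_of_diag => [i|]; last by under eq_bigr do rewrite mxE; rewrite -dgE.
rewrite !mxE; have := congr1 (fun A : M => A i i) og; rewrite !mxE eqxx (bigD1 i) //= big1 => [|j ji].
  by rewrite !mxE eps_sq mul1r addr0 mulrC.
rewrite !mxE; have [ij|ij] := ltnP i j; first by rewrite (gl j i) // mulr0.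
rewrite (gl (rev_ord j) (rev_ord i)) ?mulr0 ?mul0r //=.
have := ltn_ord i; move/eqP/eqP: ji; rewrite -val_eqE /= => ji.
by lia.
Qed.

(** A squeeze that does not factor [g] into root elements. As an element of the module generated by
    [v], the image is a multiple of [v] plus terms of lower degree ([lowgen_lead]); as the image
    under an upper triangular matrix, it is the expected multiple plus terms of higher degree
    ([tri_act]). *)
Lemma HW_group lam v g : (forall i, lam (rev_ord i) = - lam i) -> v != 0 -> HW lam v -> ggen eps g -> is_trig_mx g^T ->
  ext_act g v = (\prod_(j < n | (j < rev_ord j)%N) g j j ^ lam j) *: v.
Proof.
move=> lamo v0 hv gg tg.
have td := upper_tor gg tg.
have [S0 vS0] : exists S, v S != 0.
  apply/existsP; apply: contraNT v0; rewrite negb_exists => /forallP z.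
  by apply/eqP/ffunP => S; rewrite ffunE; apply/eqP; have := z S; rewrite negbK.
pose c := yw (yreg (n := n)) S0.
have vc S : v S != 0 -> yw (yreg (n := n)) S = c.
  by move=> vS; exact: (HW_yw (@yreg_odd n) hv vS vS0).
have st : lie_stable (gen (eq v)) by apply: gen_stable => // x <-; exists lam.
have vg : v \in gen (eq v) by apply/genP; exact: lowgen_in.
have [+ _] := lie_stableP eps_sq eps_rev (gen (eq v)); move/(_ st g v gg vg) => /genP.
case/(lowgen_lead eps_sq eps_rev (@yreg_odd n) (@yreg_mon n) vc) => a ha.
have gv S : v S != 0 -> \prod_(p in S) g p.1 p.1 = \prod_(j < n | (j < rev_ord j)%N) g j j ^ lam j.
  move=> vS; have := torus_wt S td; under eq_bigr do rewrite mxE.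
  by move=> ->; apply: eq_bigr => j _; rewrite mxE (hv.1 _ vS).
set b := \prod_(j < n | _) _ in gv *.
have hb S : (ext_act g v - b *: v) S != 0 -> c < yw (yreg (n := n)) S.
  have -> : ext_act g v - b *: v = \sum_T (v T : C) *: (ext_act g (ebas C T) - (\prod_(p in T) g p.1 p.1) *: ebas C T).
    rewrite {1 2}(ebas_sum v) act_sumr scaler_sumr -sumrB; apply: eq_bigr => T _.
    rewrite actZr scalerBr !scalerA; congr (_ - _).
    have [->|vT] := eqVneq (v T : C) 0; first by rewrite mulr0 mul0r.
    by rewrite (gv _ vT) mulrC.
  move=> /sum_supp[T /andP[_]]; rewrite ffunE mulf_eq0 => /norP[vT].
  by move/(tri_act (@yreg_mon n) tg); rewrite (vc _ vT).
have E S : (ext_act g v - b *: v) S = 0.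
  apply/eqP/negPn/negP => /[dup] /hb cS; rewrite !ffunE => h1.
  have vS : v S = 0 by apply/eqP/negPn/negP => /vc h; move: cS; rewrite h ltxx.
  have /ha : (ext_act g v - a *: v) S != 0 by move: h1; rewrite !ffunE vS !scaler0.
  by rewrite ltNge (ltW cS).
by apply/eqP; rewrite -subr_eq0; apply/eqP/ffunP => S; rewrite E ffunE.
Qed.

(** The weights are read off torus elements with entries 2 and 1/2. Upper root elements fix [v], so
    the polynomial curve that they describe is constant and its linear coefficient, the raising
    operator applied to [v], is zero. *)
Lemma group_HW lam v : (forall i, lam (rev_ord i) = - lam i) ->
  (forall g, ggen eps g -> is_trig_mx g^T ->
    ext_act g v = (\prod_(j < n | (j < rev_ord j)%N) g j j ^ lam j) *: v) -> HW lam v.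
Proof.
move=> lamo hv; split.
  have main (i : 'I_n) : (i < rev_ord i)%N -> forall S, v S != 0 -> wt i S = lam i.
    move=> ii S vS.
    pose d : 'rV[C]_n := \row_j (if j == i then 2 else if j == rev_ord i then 2^-1 else 1).
    have ni : i != rev_ord i by rewrite neq_ltn ii.
    have td : is_tor d.
      move=> j; rewrite !mxE; split; last first.
        have [->|ji] := eqVneq j i; first by move=> e; move: ni; rewrite e eqxx.
        have [->|//] := eqVneq j (rev_ord i).
        by move=> e; move: ni; rewrite -e rev_ordK eqxx.
      have [->|ji] := eqVneq j i; first by rewrite eq_sym (negbTE ni) eqxx mulfV // pnatr_eq0.
      have [e|jri] := eqVneq j (rev_ord i).
        by rewrite e rev_ordK eqxx mulVf // pnatr_eq0.
      have -> : (rev_ord j == i) = false.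
        by apply: contraNF jri => /eqP <-; rewrite rev_ordK.
      by rewrite (inj_eq rev_ord_inj) (negbTE ji) mulr1.
    have gd : ggen eps (diag_mx d) by rewrite -[diag_mx d]mulmx1; apply: ggen_tor => //; exact: ggen1.
    have tr : is_trig_mx (diag_mx d)^T by rewrite tr_diag_mx; exact: diag_mx_is_trig.
    have := hv _ gd tr; rewrite ext_act_tor // => /(congr1 (fun u : W => u S : C)); rewrite !ffunE => /(mulIf vS).
    rewrite (bigD1 i) //= [X in _ * X]big1 ?mulr1; last first.
      move=> j /andP[jj ji]; rewrite mxE (negbTE ji).
      have [e|_] := eqVneq j (rev_ord i); last by rewrite exp1rz.
      move: (jj : (j < rev_ord j)%N); rewrite e rev_ordK => jj'.
      by have := ltn_trans ii jj'; rewrite ltnn.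
    rewrite (bigD1 i) //= [X in _ * X]big1 ?mulr1; last first.
      move=> j /andP[jj ji]; rewrite !mxE eqxx mulr1n (negbTE ji).
      have [e|_] := eqVneq j (rev_ord i); last by rewrite exp1rz.
      move: (jj : (j < rev_ord j)%N); rewrite e rev_ordK => jj'.
      by have := ltn_trans ii jj'; rewrite ltnn.
    rewrite !mxE !eqxx mulr1n.
    exact: expz2_inj.
  move=> S vS i; have [ii|ii] := ltnP i (rev_ord i); first exact: main.
  have [e|ne] := eqVneq i (rev_ord i).
    by rewrite (odd_eps_mid lamo (esym e)); have := wt_rev i S; rewrite -e; lia.
  have ii' : (rev_ord i < rev_ord (rev_ord i))%N by rewrite rev_ordK ltn_neqAle ii eq_sym -val_eqE /= in ne *; rewrite ne.
  by have := main _ ii' _ vS; rewrite wt_rev lamo => /oppr_inj.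
move=> a b ab.
have ab' : a != b by rewrite neq_ltn ab.
have [N [hN hs]] := ext_act_exp (Fm_cube eps_sq eps_rev ab') v.
have fixv s : ext_act (xr eps a b s) v = v.
  have [tx dx] := xr_upper eps_sq eps_rev s ab.
  rewrite (hv (xr eps a b s)) //; first by rewrite big1 ?scale1r // => j _; rewrite dx exp1rz.
  by rewrite -[xr eps a b s]mulmx1; apply: ggen_xr => //; exact: ggen1.
(* The curve minus its constant term, in the zero subspace. The length [N.+2] makes the index 1
   legitimate whatever [N] is. *)
have := @vspace_poly_coef _ _ (0%VS : {vspace W}) N.+2 (fun m => dpow (Fm a b) m v - (m == 0%N)%:R *: v).
move/(_ _ 1%N isT); rewrite /= scale0r subr0 dpow1 memv0 => h; apply/eqP/h => s.
rewrite memv0 (eq_bigr (fun m : 'I_N.+2 => s ^+ m *: dpow (Fm a b) m v - s ^+ m *: ((m == 0 :> nat)%:R *: v))); last first.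
  by move=> m _; rewrite scalerBr.
rewrite sumrB; apply/eqP; have -> : \sum_(m < N.+2) s ^+ m *: dpow (Fm a b) m v = v.
  rewrite -[RHS](fixv s) /xr hs !big_ord_recr /= !hN // ?leqnSn //.
  by rewrite !scaler0 !addr0.
rewrite big_ord_recl /= expr0 !scale1r big1 ?addr0 ?subrr // => i _.
by rewrite scale0r scaler0.
Qed.

End Triangular.

(** * Isotypic components are generated by their highest weight vectors *)

Section Isotypic.

Variables (C : numClosedFieldType) (l m k : nat).
Local Notation n := (l + m)%N.
Variables (eps : 'I_n -> C) (eta : C) (G : set 'M[C]_n).
Hypothesis eps_sq : forall i, eps i * eps i = 1.
Hypothesis eps_rev : forall i, eps (rev_ord i) = eta * eps i.
Hypothesis half : forall j : 'I_n, (j < rev_ord j)%N = (j < l)%N.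
Hypothesis G_gen : forall g, G g <-> ggen eps g.
Local Notation I := ('I_n * 'I_k)%type.
Local Notation W := (exterior C I).
Implicit Types (u v : W) (U : {vspace W}) (lam mu : 'I_l -> int).

Definition full lam (i : 'I_n) : int :=
  match fintype.split i with
  | inl j => lam j
  | inr _ => match fintype.split (rev_ord i) with inl j => - lam j | inr _ => 0 end
  end.

Lemma split_inl (i : 'I_n) (h : (i < l)%N) : fintype.split i = inl (Ordinal h).
Proof. case: fintype.splitP => [j e|j e]; first by congr inl; exact: val_inj.
by have := h; rewrite {1}e ltnNge leq_addr. Qed.

Lemma split_inr (i : 'I_n) (h : (l <= i)%N) : exists j, fintype.split i = inr j.
Proof. by case: fintype.splitP => [j e|j e]; [move: h; rewrite e leqNgt ltn_ord|exists j]. Qed.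

Lemma full_lshift lam i : full lam (lshift m i) = lam i.
Proof. by rewrite /full (split_inl (i := lshift m i) (ltn_ord i)); congr lam; exact: val_inj. Qed.

Lemma full_odd lam i : full lam (rev_ord i) = - full lam i.
Proof.
rewrite /full rev_ordK; have [hi|hi] := ltnP i l.
  have ri : (l <= rev_ord i)%N.
    by rewrite leqNgt -half rev_ordK -leqNgt ltnW // half.
  by have [j ->] := split_inr ri; rewrite (split_inl hi).
have [j ->] := split_inr hi; have [hr|hr] := ltnP (rev_ord i) l.
  by rewrite (split_inl hr) opprK.
by have [j' ->] := split_inr hr; rewrite oppr0.
Qed.

Lemma prod_half (F : 'I_n -> C) : \prod_(j < n | (j < rev_ord j)%N) F j = \prod_(i < l) F (lshift m i).
Proof.
under eq_bigl do rewrite half.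
rewrite big_split_ord /= [X in _ * X]big_pred0 ?mulr1; last by move=> i; rewrite ltnNge leq_addr.
by apply: eq_bigl => i; exact: ltn_ord.
Qed.

Lemma hw_vectorP lam v : hw_vector G (@ext_act C n k) lam v <-> v != 0 /\ HW eps (full lam) v.
Proof.
have E (g : 'M[C]_n) : \prod_(j < n | (j < rev_ord j)%N) g j j ^ full lam j =
            \prod_(i < l) g (lshift m i) (lshift m i) ^ lam i.
  by rewrite prod_half; apply: eq_bigr => i _; rewrite full_lshift.
split=> -[v0 hv]; split => //.
  apply: (group_HW eps_sq eps_rev) => [i|g gg tg]; first exact: full_odd.
  by rewrite E; apply: hv => //; apply/G_gen.
move=> g /G_gen gg tg; rewrite -E; apply: (HW_group eps_sq eps_rev) => //.
exact: full_odd.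
Qed.

Lemma submoduleP U : submodule G (@ext_act C n k) U <-> lie_stable eps U.
Proof.
split=> [h|/(lie_stableP eps_sq eps_rev) h].
  by apply/(lie_stableP eps_sq eps_rev) => g u gg uU; apply: h => //; apply/G_gen.
by move=> g u /G_gen gg uU; exact: h.
Qed.

(** A nonzero submodule contains a highest weight vector [x]. If its weight were another one, [x]
    would be orthogonal to the whole module and so to itself; having the weight of [v], it is a
    multiple of [v]. *)
Lemma irr_genP lam v : v != 0 -> HW eps (full lam) v ->
  irreducible_hw G (@ext_act C n k) lam (gen eps (eq v)).
Proof.
move=> v0 hv.
have vg : v \in gen eps (eq v) by apply/(genP eps); exact: lowgen_in.
have st : lie_stable eps (gen eps (eq v)).
  by apply: (gen_stable eps_sq eps_rev) => x <-; exists (full lam).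
split; last by exists v => //; apply/hw_vectorP.
split.
- by apply: contraNneq v0 => z; rewrite z memv0 in vg.
- exact/submoduleP.
move=> U Us /submoduleP sU; have [->|U0] := eqVneq U 0%VS; [by left|right].
apply/eqP; rewrite eqEsubv Us /=; apply: (gen_min sU) => _ <-.
have [mu [x [xU x0 hx]]] := stable_HW eps_sq eps_rev sU U0.
have xg : x \in gen eps (eq v) by exact: (subvP Us).
have E i : mu i = full lam i.
  apply/eqP/negPn/negP => ne; move: x0; rewrite -dotuu_eq0.
  rewrite (@gen_perp _ _ _ eps eta eps_sq eps_rev (eq x) (eq v) _ _ _ x _ x) ?eqxx //.
  - by move=> y <-; exists mu.
  - by move=> y <-; exists (full lam).
  - move=> y z <- <-; apply: (HW_neq _ hx hv); by exists i.
  - by apply/(genP eps); exact: lowgen_in.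
have hx' : HW eps (full lam) x by split => [S xS j|]; [rewrite -E; exact: hx.1|exact: hx.2].
have [S0 vS0] : exists S, v S != 0.
  apply/existsP; apply: contraNT v0; rewrite negb_exists => /forallP z.
  by apply/eqP/ffunP => S; rewrite ffunE; apply/eqP; have := z S; rewrite negbK.
pose c := yw (yreg (n := n)) S0.
have yc (S : {set I}) : (forall i, wt i S = full lam i) -> yw (yreg (n := n)) S = c.
  by move=> h; apply: (yw_eq (@yreg_odd n)) => i; rewrite h (hv.1 _ vS0).
move/(genP eps): xg => /(lowgen_lead eps_sq eps_rev (@yreg_odd n) (@yreg_mon n)
    (fun S vS => yc S (hv.1 S vS)))[a ha].
have xa : x = a *: v.
  apply/eqP; rewrite -subr_eq0; apply/eqP/ffunP => S; rewrite [RHS]ffunE.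
  apply/eqP/negPn/negP => /[dup] /ha; rewrite !ffunE => lt ne.
  have [vS|vS] := eqVneq (v S : C) 0; last by rewrite (yc S (hv.1 S vS)) ltxx in lt.
  have xS : x S != 0 by move: ne; rewrite vS scaler0 subr0.
  by rewrite (yc S (hx'.1 S xS)) ltxx in lt.
have a0 : a != 0 by apply: contraNneq x0 => a0; rewrite xa a0 scale0r.
by rewrite -[v](scalerK a0) -xa memvZ.
Qed.

(** Both sides are least: an irreducible submodule is generated by its highest weight vector, and
    conversely a nonzero highest weight vector generates an irreducible one by [irr_genP]. *)
Theorem isotypic_gen lam : ext_isotypic k G lam = gen eps (HW eps (full lam)).
Proof.
have HWst v : HW eps (full lam) v -> exists mu : 'I_n -> int, HW eps mu v by move=> h; exists (full lam).
have up : forall X, irreducible_hw G (@ext_act C n k) lam X -> (X <= gen eps (HW eps (full lam)))%VS.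
  move=> X [[X0 sX iX] [v vX /hw_vectorP[v0 hv]]].
  have [[g0 sg _] _] := irr_genP v0 hv.
  have gX : (gen eps (eq v) <= X)%VS by apply: gen_min => [|_ <-//]; exact/submoduleP.
  have [e|<-] := iX _ gX sg; first by rewrite e eqxx in g0.
  by apply: gen_min => [|_ <-]; [exact: (gen_stable eps_sq eps_rev)|apply/(genP eps); exact: lowgen_in].
have low U : (forall X, irreducible_hw G (@ext_act C n k) lam X -> (X <= U)%VS) ->
    (gen eps (HW eps (full lam)) <= U)%VS.
  move=> h; apply/subvP => u /(genP eps) hu.
  elim: hu U h => {u} [v hv U h|U h|a u v _ IHu _ IHv U h|i j u ij _ IH U h].
  - have [->|v0] := eqVneq v 0; first exact: mem0v.
    apply: (subvP (h _ (irr_genP v0 hv))); apply/(genP eps).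
    exact: lowgen_in.
  - exact: mem0v.
  - by rewrite memvD ?memvZ ?IHu ?IHv.
  (* The subspace [U] is only an upper bound and need not be stable. The induction hypothesis is
     therefore applied to its preimage under the lowering operator, which is an upper bound as
     well. *)
  have [U2 hU2] : exists U2 : {vspace W}, forall x, x \in U2 <-> dr (Fm eps i j) x \in U.
    apply: pred_vspace => [|a x y hx hy]; first by rewrite dr0r mem0v.
    by rewrite drDr drZr memvD ?memvZ.
  apply/hU2/IH => X hX; apply/subvP => x xX; apply/hU2.
  by apply: (subvP (h X hX)); have [[_ /submoduleP sX _] _] := hX; exact: sX.
rewrite /ext_isotypic /isotypic; apply: xget_unique => [|U [h1 h2]]; first by split.
by apply/eqP; rewrite eqEsubv low // andbT h2.
Qed.

End Isotypic.

(** * Isotypic components of the exterior algebra *)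

Section Monomial.

Variables (C : numClosedFieldType) (n k : nat) (eps : 'I_n -> C) (eta : C).
Hypothesis eps_sq : forall i, eps i * eps i = 1.
Hypothesis eps_rev : forall i, eps (rev_ord i) = eta * eps i.
Variables (s : 'S_n) (th : 'I_n -> C).
Hypothesis s_rev : forall i, s (rev_ord i) = rev_ord (s i).
Hypothesis th_sq : forall i, th i * th i = 1.
Local Notation I := ('I_n * 'I_k)%type.
Local Notation W := (exterior C I).

(** A monomial matrix, lifting the Weyl group element [s]; the signs [th] serve to meet the form and
    the determinant. *)
Definition mono : 'M[C]_n := \matrix_(i, j) (th j * (i == s j)%:R).

Definition simg (S : {set I}) : {set I} := [set (s p.1, p.2) | p in S]%SET.

Lemma mono_orth : (forall i, eps i * eps (s i) * (th i * th (rev_ord i)) = 1) -> orth eps mono.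
Proof.
move=> h; apply/matrixP=> a c; rewrite !mxE (bigD1 (s a)) //= big1 => [|b ba].
  rewrite !mxE s_rev eqxx addr0 (inj_eq perm_inj).
  have [<-|ac] := eqVneq a c; last by rewrite !mulr0.
  rewrite -[true%:R]/(1 : C) !mulr1 -[RHS](h a).
  by ring.
rewrite !mxE s_rev (inj_eq rev_ord_inj) (negbTE ba).
by rewrite !mulr0 mul0r.
Qed.

Lemma det_mono : \det mono = (-1) ^+ s * \prod_i th i.
Proof.
have -> : mono = (perm_mx s)^T *m diag_mx (\row_i th i).
  by apply/matrixP=> i j; rewrite mul_mx_diag !mxE mulrC eq_sym.
rewrite det_mulmx det_tr det_perm det_diag; congr (_ * _).
by apply: eq_bigr => i _; rewrite mxE.
Qed.

Lemma simg_inj : injective simg.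
Proof.
apply: finset.imset_inj => -[i a] [j b] [] /perm_inj -> ->.
by [].
Qed.

Lemma act_mono (S : {set I}) : exists a, a * a = 1 /\ ext_act mono (ebas C S) = a *: ebas C (simg S).
Proof.
rewrite ext_actE fock_map_ebas.
pose f (p : I) : I := (s p.1, p.2).
have gE p (u : W) : gcr mono p u = th p.1 *: cr (f p) u.
  rewrite /gcr (bigD1 (s p.1)) //= big1 => [|i ip]; first by rewrite mxE eqxx mulr1 addr0.
  by rewrite mxE (negbTE ip) mulr0 scale0r.
have fE r : foldr (fun p => gcr mono p) (vac C I) r =
    (\prod_(p <- r) th p.1) *: foldr (fun p => cr p) (vac C I) (map f r).
  elim: r => [|p r IH] /=; first by rewrite big_nil scale1r.
  by rewrite IH gE crZr scalerA big_cons.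
rewrite fE; have fi : injective f by move=> [i a] [j b] [] /perm_inj -> ->.
have [e [ee E]] := @foldr_cr_uniq C I (map f (enum S)) (etrans (map_inj_uniq fi _) (enum_uniq _)).
exists ((\prod_(p <- enum S) th p.1) * e); split; last first.
  rewrite E scalerA; congr (_ *: ebas C _).
  apply/finset.setP => p; rewrite finset.inE; apply/mapP/finset.imsetP => -[q qS ->]; exists q => //.
    by move: qS; rewrite mem_enum.
  by rewrite mem_enum.
by rewrite mulrACA ee mulr1 -big_split /= big1 // => p _.
Qed.

(** Monomial matrices permute the basis of the exterior algebra up to signs, so [acoef_perm]
    applies. This is the source of all Weyl group symmetries of the weights. *)
Lemma acoef_mono (U : {vspace W}) : (forall u, u \in U -> ext_act mono u \in U) ->
  forall S, acoef U (simg S) = acoef U S.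
Proof.
move=> hU; have [a ha] := choice act_mono.
apply: (@acoef_perm _ _ _ U (@ext_act C n k mono) simg a) => //.
- exact: simg_inj.
- by move=> S; have [] := ha S.
move=> S; have [/eqP + _] := ha S; rewrite -expr2 sqrf_eq1 => /orP[]/eqP ->.
  by rewrite rmorph1 mulr1.
by rewrite rmorphN1 mulrNN mulr1.
Qed.

Lemma occ_simg i (S : {set I}) : occ (s i) (simg S) = occ i S.
Proof.
rewrite /occ /simg.
have fi : injective (fun p : I => (s p.1, p.2)) by move=> [i' a] [j b] [] /perm_inj -> ->.
rewrite -(fintype.card_image fi [pred p in S | p.1 == i]); apply: eq_card => p; rewrite !inE.
apply/andP/fintype.imageP => [[/finset.imsetP[q qS ->] /= /eqP/perm_inj qi]|[q]].
  by exists q => //; rewrite inE qS qi eqxx.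
rewrite inE => /andP[qS /eqP <-] ->; split; last by rewrite eqxx.
by apply/finset.imsetP; exists q.
Qed.

Lemma wt_simg i (S : {set I}) : wt (s i) (simg S) = wt i S.
Proof. by rewrite /wt -s_rev !occ_simg. Qed.

Lemma mono_Fm i j : (forall a, eps (s a) = eps a) -> (forall a, th a = 1) ->
  mono *m Fm eps i j = Fm eps (s i) (s j) *m mono.
Proof.
move=> es t1; apply/matrixP=> a b; rewrite !mxE.
rewrite (bigD1 ((s^-1)%g a)) //= big1 => [|c ca]; last first.
  rewrite !mxE -[a in a == _](permKV s) (inj_eq perm_inj) eq_sym (negbTE ca).
  by rewrite mulr0 mul0r.
rewrite (bigD1 (s b)) //= [X in _ = _ + X]big1 => [|c cb]; last by rewrite [mono _ _]mxE (negbTE cb) !mulr0.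
rewrite !(FmE eps_sq eps_rev) !mxE !t1 permKV !eqxx !mulr1 !mul1r !addr0 !es -!s_rev.
have E c : ((s^-1)%g a == c) = (a == s c) by rewrite -(inj_eq (@perm_inj _ s)) permKV.
have E2 x y : (s x == s y) = (x == y) by exact: (inj_eq perm_inj).
by rewrite !E !E2.
Qed.

End Monomial.

Section Decomposition.

Variables (C : numClosedFieldType) (l m k : nat) (fl : bool).
Local Notation n := (l + m)%N.
Variables (eps : 'I_n -> C) (eta : C).
Hypothesis eps_sq : forall i, eps i * eps i = 1.
Hypothesis eps_rev : forall i, eps (rev_ord i) = eta * eps i.
Hypothesis half : forall j : 'I_n, (j < rev_ord j)%N = (j < l)%N.
Hypothesis eps_l : forall i j : 'I_n, (i < l)%N -> (j < l)%N -> eps i = eps j.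
Hypothesis fl_eta : fl -> m = l /\ forall i, eps i = 1.
Hypothesis nfl : ~~ fl -> eta = 1 -> m = l.+1.
Local Notation I := ('I_n * 'I_k)%type.
Local Notation W := (exterior C I).
Implicit Types (u v : W) (U : {vspace W}) (lam mu : 'I_l -> int) (S : {set I}).
Local Notation lie_stable := (lie_stable eps).
Local Notation HW lam := (HW eps (full (l := l) (m := m) lam)).

(** The flag [fl] marks the even orthogonal case, the only one in which two highest weights are
    merged into one component; otherwise this is the identity and [HW2] repeats one condition. *)
Definition flipw lam (i : 'I_l) : int := if fl && (i.+1 == l) then - lam i else lam i.

Definition HW2 lam v := HW lam v \/ HW (flipw lam) v.

Definition comp lam : {vspace W} := gen eps (HW2 lam).

Lemma comp_stable lam : lie_stable (comp lam).
Proof. by apply: (gen_stable eps_sq eps_rev) => v [h|h]; eexists; exact: h. Qed.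

Lemma flipwK lam : flipw (flipw lam) =1 lam.
Proof. by move=> i; rewrite /flipw; case: (fl && _) => //; rewrite opprK. Qed.

Lemma HW_ext lam mu v : lam =1 mu -> HW lam v -> HW mu v.
Proof. by move=> /funext ->. Qed.

Definition lsh (i : 'I_l) : 'I_n := lshift m i.

Lemma rev_lsh_ge (i : 'I_l) : (l <= rev_ord (lsh i))%N.
Proof. by rewrite leqNgt -half rev_ordK -leqNgt ltnW // half; exact: (ltn_ord i). Qed.

Lemma rev_lsh (i j : 'I_l) : rev_ord (lsh i) != lsh j.
Proof.
rewrite -val_eqE neq_ltn; apply/orP; right.
exact: leq_trans (ltn_ord j) (rev_lsh_ge i).
Qed.

(* The transposition [(i j)], acting also on the opposite indices. *)
Definition wtr (i j : 'I_l) : 'S_n :=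
  (tperm (lsh i) (lsh j) * tperm (rev_ord (lsh i)) (rev_ord (lsh j)))%g.

Lemma wtrE i j a : i != j ->
  [/\ wtr i j (lsh i) = lsh j, wtr i j (lsh j) = lsh i,
      wtr i j (rev_ord (lsh i)) = rev_ord (lsh j), wtr i j (rev_ord (lsh j)) = rev_ord (lsh i)
    & [&& a != lsh i, a != lsh j, a != rev_ord (lsh i) & a != rev_ord (lsh j)] -> wtr i j a = a].
Proof.
move=> ij; have r1 x y := rev_lsh x y.
have r2 x y : lsh x != rev_ord (lsh y) by rewrite eq_sym.
split=> [||||/and4P[a1 a2 a3 a4]]; rewrite permM.
- by rewrite tpermL tpermD.
- by rewrite tpermR tpermD.
- by rewrite (tpermD (z := rev_ord (lsh i))) ?tpermL // eq_sym.
- by rewrite (tpermD (z := rev_ord (lsh j))) ?tpermR // eq_sym.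
by rewrite !tpermD // eq_sym.
Qed.

Lemma wtr_rev i j a : i != j -> wtr i j (rev_ord a) = rev_ord (wtr i j a).
Proof.
move=> ij; have [e1 e2 e3 e4 e5] := wtrE (rev_ord a) ij; have [_ _ _ _ e6] := wtrE a ij.
have [->|a1] := eqVneq a (lsh i); first by rewrite e1 e3.
have [->|a2] := eqVneq a (lsh j); first by rewrite e2 e4.
have [->|a3] := eqVneq a (rev_ord (lsh i)); first by rewrite rev_ordK e3 rev_ordK e1.
have [->|a4] := eqVneq a (rev_ord (lsh j)); first by rewrite rev_ordK e4 rev_ordK e2.
rewrite e6 ?a1 ?a2 ?a3 ?a4 // e5 //.
have E x y : (rev_ord x == y :> 'I_n) = (x == rev_ord y) by rewrite -(inj_eq rev_ord_inj) rev_ordK.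
by rewrite !E !rev_ordK a1 a2 a3 a4.
Qed.

Lemma eps_rl (i j : 'I_l) : eps (rev_ord (lsh i)) = eps (rev_ord (lsh j)).
Proof. by rewrite !eps_rev (eps_l (i := lsh i) (j := lsh j)) //; [exact: (ltn_ord i)|exact: (ltn_ord j)]. Qed.

Lemma wtr_eps i j a : i != j -> eps (wtr i j a) = eps a.
Proof.
move=> ij; have [e1 e2 e3 e4 e6] := wtrE a ij.
have el x y : eps (lsh x) = eps (lsh y) by apply: eps_l; [exact: (ltn_ord x)|exact: (ltn_ord y)].
have [->|a1] := eqVneq a (lsh i); first by rewrite e1.
have [->|a2] := eqVneq a (lsh j); first by rewrite e2.
have [->|a3] := eqVneq a (rev_ord (lsh i)); first by rewrite e3; exact: eps_rl.
have [->|a4] := eqVneq a (rev_ord (lsh j)); first by rewrite e4; exact: eps_rl.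
by rewrite e6 // a1 a2 a3 a4.
Qed.

Lemma wtr_ggen i j : i != j -> ggen eps (mono (wtr i j) (fun=> 1)).
Proof.
move=> ij; have c1 : (1 : C) * 1 = 1 by rewrite mulr1.
apply: (orth_ggen eps_sq eps_rev).
  apply: mono_orth => a; first exact: wtr_rev.
  by rewrite wtr_eps // eps_sq !mulr1.
move=> _; rewrite det_mono big1 // mulr1 /wtr odd_permM !odd_tperm.
by rewrite (inj_eq rev_ord_inj) addbb.
Qed.

Lemma acoef_wtr U i j S : lie_stable U -> i != j -> acoef U (simg (wtr i j) S) = acoef U S.
Proof.
move=> sU ij; apply: (@acoef_mono _ _ _ (wtr i j) (fun=> 1)) => [a|u uU].
  by rewrite mulr1.
by apply: ((lie_stableP eps_sq eps_rev U).1 sU) => //; exact: wtr_ggen.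
Qed.

Lemma wt_wtr i j S a : i != j -> wt a (simg (wtr i j) S) = wt (wtr i j a) S.
Proof.
move=> ij; have E : wtr i j (wtr i j a) = a.
  have [e1 e2 e3 e4 e6] := wtrE a ij.
  have [->|a1] := eqVneq a (lsh i); first by rewrite e1 e2.
  have [->|a2] := eqVneq a (lsh j); first by rewrite e2 e1.
  have [->|a3] := eqVneq a (rev_ord (lsh i)); first by rewrite e3 e4.
  have [->|a4] := eqVneq a (rev_ord (lsh j)); first by rewrite e4 e3.
  by rewrite !e6 // a1 a2 a3 a4.
by rewrite -{1}E wt_simg // => b; exact: wtr_rev.
Qed.

(* The sign change of the [i]-th coordinate; its determinant is that of the
   transposition [(i i')] unless the middle vector, if any, is negated too. *)
Definition wfl (i : 'I_l) : 'S_n := tperm (lsh i) (rev_ord (lsh i)).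

Lemma wflE i a : [/\ wfl i (lsh i) = rev_ord (lsh i), wfl i (rev_ord (lsh i)) = lsh i
  & a != lsh i -> a != rev_ord (lsh i) -> wfl i a = a].
Proof. by split; rewrite ?tpermL ?tpermR // => a1 a2; rewrite tpermD // eq_sym. Qed.

Lemma wfl_rev i a : wfl i (rev_ord a) = rev_ord (wfl i a).
Proof.
have [e1 e2 e3] := wflE i a; have [_ _ e4] := wflE i (rev_ord a).
have [->|a1] := eqVneq a (lsh i); first by rewrite e1 e2 rev_ordK.
have [->|a2] := eqVneq a (rev_ord (lsh i)); first by rewrite e2 rev_ordK e1.
rewrite e3 // e4 //; last by rewrite (inj_eq rev_ord_inj).
by apply: contraNneq a2 => <-; rewrite rev_ordK.
Qed.

Lemma wt_wfl i S a : wt a (simg (wfl i) S) = wt (wfl i a) S.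
Proof. by rewrite -{1}(tpermK (lsh i) (rev_ord (lsh i)) a) wt_simg // => b; exact: wfl_rev. Qed.

(** The sign [eta] at the opposite index makes the exchange of the two lines preserve the form; the
    sign at a middle index compensates the determinant of the transposition. *)
Definition wth (i : 'I_l) (a : 'I_n) : C :=
  if a == rev_ord (lsh i) then eta else if a == rev_ord a then -1 else 1.

Lemma eta2 (i : 'I_l) : eta * eta = 1.
Proof. exact: (eta_sq eps_sq eps_rev (lsh i)). Qed.

Lemma wth_sq i a : wth i a * wth i a = 1.
Proof. rewrite /wth; case: (a == rev_ord (lsh i)); first exact: (eta2 i).
by case: (a == rev_ord a); rewrite ?mulrNN mulr1. Qed.

Lemma wfl_orth i : orth eps (mono (wfl i) (wth i)).
Proof.
apply: mono_orth => a; first exact: wfl_rev.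
have r1 x y := negbTE (rev_lsh x y).
have r2 x y : (lsh x == rev_ord (lsh y)) = false by rewrite eq_sym.
have [e1 e2 e3] := wflE i a.
have [->|a1] := eqVneq a (lsh i).
  by rewrite e1 eps_rev /wth r2 eqxx mul1r mulrCA eps_sq mulr1 (eta2 i).
have [->|a2] := eqVneq a (rev_ord (lsh i)).
  by rewrite e2 eps_rev /wth !rev_ordK r2 eqxx -[eta * _ * _]mulrA eps_sq !mulr1 (eta2 i).
rewrite e3 // eps_sq /wth (negbTE a2) rev_ordK (inj_eq rev_ord_inj) (negbTE a1) eq_sym mul1r.
by case: ifP => _; rewrite ?mulrNN mulr1.
Qed.

Lemma wfl_ggen i : ~~ fl -> ggen eps (mono (wfl i) (wth i)).
Proof.
move=> nf; apply: (orth_ggen eps_sq eps_rev); first exact: wfl_orth.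
move=> e1; have ml := nfl nf e1.
have ln : (l < n)%N by rewrite ml addnS ltnS leq_addr.
pose mid : 'I_n := Ordinal ln.
have midr : rev_ord mid = mid by apply: val_inj => /=; rewrite ml; lia.
rewrite det_mono odd_tperm eq_sym (negbTE (rev_lsh i i)) expr1 (bigD1 mid) //= big1 => [|a am].
  rewrite mulr1 /wth midr eqxx ifN ?mulrNN ?mulr1 //.
  by apply/eqP => /(congr1 val) /=; rewrite ml; have := ltn_ord i; lia.
rewrite /wth e1; case: ifP => // _; case: eqP => // /(congr1 val) /= aa.
by case/eqP: am; apply: val_inj => /=; have := ltn_ord a; rewrite [X in (_ < l + X)%N -> _]ml; move: aa; rewrite [X in _ = (l + X - _)%N -> _]ml; lia.
Qed.

Lemma acoef_wfl U i S : ~~ fl -> lie_stable U -> acoef U (simg (wfl i) S) = acoef U S.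
Proof.
move=> nf sU; apply: (@acoef_mono _ _ _ (wfl i) (wth i)) => [a|u uU].
  exact: wth_sq.
by apply: ((lie_stableP eps_sq eps_rev U).1 sU) => //; exact: wfl_ggen.
Qed.

Lemma sum_half (V : zmodType) (f : 'I_n -> V) : (forall a, rev_ord a = a -> f a = 0) ->
  \sum_a f a = \sum_(i < l) (f (lsh i) + f (rev_ord (lsh i))).
Proof.
move=> f0; have H (g : 'I_n -> V) : \sum_(a < n | (a < rev_ord a)%N) g a = \sum_(i < l) g (lsh i).
  under eq_bigl do rewrite half.
  rewrite big_split_ord /= [X in _ + X]big_pred0 ?addr0; last by move=> i; rewrite ltnNge leq_addr.
  by apply: eq_bigl => i; exact: ltn_ord.
rewrite (bigID (fun a : 'I_n => (a < rev_ord a)%N)) /= big_split /= -(H f) -(H (fun a => f (rev_ord a))).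
congr (_ + _).
rewrite [LHS](bigID (fun a : 'I_n => (rev_ord a < a)%N)) /= [X in _ + X]big1 ?addr0; last first.
  move=> a /andP[]; rewrite -!leqNgt => h1 h2; apply: f0; apply: val_inj.
  by apply/eqP; rewrite eqn_leq; apply/andP; split.
rewrite (reindex_inj rev_ord_inj) /=; apply: eq_bigl => a.
rewrite -[(n - (n - a.+1).+1)%N]/(val (rev_ord (rev_ord a))) rev_ordK -leqNgt.
by apply/andP/idP => [[]//|h]; split=> //; exact: ltnW.
Qed.

Definition psum (r : nat) S : int := \sum_(i < l | (i < r)%N) wt (lsh i) S.

(** The dominance bound. The function [y] used in the proof is 1 on the first [r] indices, -1 on the
    last [r], and decreasing, so lowering operators cannot increase the partial sum. *)
Lemma gen_psum P (b : int) r u : (r <= l)%N -> (forall v, P v -> forall S, v S != 0 -> psum r S <= b) ->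
  lowgen eps P u -> forall S, u S != 0 -> psum r S <= b.
Proof.
move=> rl hP hu; pose y (a : 'I_n) : int := ((a < r)%N : nat)%:Z - ((rev_ord a < r)%N : nat)%:Z.
have yo a : y (rev_ord a) = - y a by rewrite /y rev_ordK opprB.
have yS S : yw y S = psum r S.
  have [] : yw y S *+ 2 = psum r S *+ 2; last by lia.
  rewrite yw_wt // sum_half => [|a ra]; last by rewrite /y ra subrr mul0r.
  rewrite /psum -sumrMnl [RHS]big_mkcond /=; apply: eq_bigr => i _.
  rewrite yo wt_rev mulrNN /y.
  have -> : (rev_ord (lsh i) < r)%N = false.
    by apply/negbTE; rewrite -leqNgt; apply: leq_trans rl _; exact: rev_lsh_ge.
  by rewrite subr0 /=; case: (i < r)%N; rewrite ?mul0r ?addr0 // mul1r -mulr2n.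
have ym (a b' : 'I_n) : (a <= b')%N -> y b' <= y a.
  move=> ab; have h1 : (b' < r)%N -> (a < r)%N by exact: leq_ltn_trans.
  have h2 : (rev_ord a < r)%N -> (rev_ord b' < r)%N by apply: leq_ltn_trans; exact: leq_sub2l.
  rewrite /y; move: h1 h2.
  by case: (b' < r)%N; case: (a < r)%N; case: (rev_ord a < r)%N; case: (rev_ord b' < r)%N => h1 h2 //;
    solve [have := h1 isT; by [] | have := h2 isT; by []].
move=> S; rewrite -yS; apply: (lowgen_le eps_sq eps_rev yo ym) hu S.
by move=> v Pv S; rewrite yS; exact: hP.
Qed.

Lemma acoef_neq0 U v S : v \in U -> v S != 0 -> acoef U S != 0.
Proof.
move=> vU; apply: contraNneq => a0; have [_ _ bs] := obP U.
rewrite (bs v vU) sum_ffunE big1 // => i _; rewrite ffunE.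
suff -> : (ob (U := U) i S : C) = 0 by rewrite scaler0.
apply/eqP; rewrite -mul_conjC_eq0; apply/eqP.
by apply: (psumr_eq0P _ a0) => // j _; exact: mul_conjC_ge0.
Qed.

Lemma neq0_supp v : v != 0 -> exists S, v S != 0.
Proof.
move=> v0; apply/existsP; apply: contraNT v0; rewrite negb_exists => /forallP z.
by apply/eqP/ffunP => S; rewrite ffunE; apply/eqP; have := z S; rewrite negbK.
Qed.

Lemma HW_full lam v S i : HW lam v -> v S != 0 -> wt (lsh i) S = lam i.
Proof. by move=> hv vS; rewrite (hv.1 _ vS) full_lshift. Qed.

Lemma HW_psum lam v S r : HW lam v -> v S != 0 -> psum r S = \sum_(i < l | (i < r)%N) lam i.
Proof. by move=> hv vS; apply: eq_bigr => i _; exact: HW_full hv vS. Qed.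

Lemma HW_genE lam v : HW lam v -> lie_stable (gen eps (eq v)) /\ v \in gen eps (eq v).
Proof.
move=> hv; split; last by apply/(genP eps); exact: lowgen_in.
by apply: (gen_stable eps_sq eps_rev) => _ <-; eexists; exact: hv.
Qed.

Lemma acoef_psum P (b : int) r S : (r <= l)%N -> (forall v, P v -> forall T, v T != 0 -> psum r T <= b) ->
  acoef (gen eps P) S != 0 -> psum r S <= b.
Proof.
move=> rl hP; apply: (@acoef_supp _ _ _ (gen eps P) (fun S => psum r S <= b)).
by move=> u /(genP eps) hu T; exact: gen_psum hu T.
Qed.

(** The weight with coordinates [i] and [j] exchanged also occurs in the module; its partial sum
    over the indices below [j] contains [lam j] instead of [lam i] and still obeys the dominance
    bound. The same argument with a sign change gives [HW_ge0]. *)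
Lemma HW_antitone lam v (i j : 'I_l) : HW lam v -> v != 0 -> (i < j)%N -> lam j <= lam i.
Proof.
move=> hv v0 ij; have [S vS] := neq0_supp v0; have [sU vU] := HW_genE hv.
have ne : i != j by rewrite neq_ltn ij.
have := acoef_neq0 vU vS; rewrite -(acoef_wtr _ sU ne).
move=> /(acoef_psum (r := j) (b := psum j S) (ltnW (ltn_ord j))) h.
have {h} : psum j (simg (wtr i j) S) <= psum j S.
  by apply: h => _ <- T vT; rewrite (HW_psum _ hv vS) (HW_psum _ hv vT).
have [e1 e2 _ _ _] := wtrE (lsh i) ne.
rewrite /psum (bigD1 i) //= [X in _ <= X](bigD1 i) //= wt_wtr // e1 !(HW_full _ hv vS).
rewrite (eq_bigr (fun a => wt (lsh a) S)) ?lerD2r // => a /andP[aj ai].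
rewrite wt_wtr //; have [_ _ _ _ ->//] := wtrE (lsh a) ne.
have inj x y : (lsh x == lsh y) = (x == y) by rewrite -!val_eqE.
have r2 x y : lsh x != rev_ord (lsh y) by rewrite eq_sym rev_lsh.
by rewrite !inj ai !r2 neq_ltn aj.
Qed.

Lemma HW_ge0 lam v i : ~~ fl -> HW lam v -> v != 0 -> 0 <= lam i.
Proof.
move=> nf hv v0; have [S vS] := neq0_supp v0; have [sU vU] := HW_genE hv.
have := acoef_neq0 vU vS; rewrite -(acoef_wfl i _ nf sU).
move=> /(acoef_psum (r := i.+1) (b := psum i.+1 S) (ltn_ord i)) h.
have {h} : psum i.+1 (simg (wfl i) S) <= psum i.+1 S.
  by apply: h => _ <- T vT; rewrite (HW_psum _ hv vS) (HW_psum _ hv vT).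
have [e1 _ _] := wflE i (lsh i).
rewrite /psum (bigD1 i) //= [X in _ <= X](bigD1 i) //= wt_wfl e1 wt_rev !(HW_full _ hv vS).
rewrite (eq_bigr (fun a => wt (lsh a) S)) ?lerD2r; first by lia.
move=> a /andP[aj ai].
rewrite wt_wfl; have [_ _ ->//] := wflE i (lsh a).
by rewrite eq_sym rev_lsh.
Qed.

Lemma flip_dr (i : 'I_l) a b u : fl -> ext_act (mono (wfl i) (fun=> 1)) (dr (Fm eps a b) u) =
  dr (Fm eps (wfl i a) (wfl i b)) (ext_act (mono (wfl i) (fun=> 1)) u).
Proof.
move=> hf; have [_ e1] := fl_eta hf.
apply: ext_act_dr; apply: (mono_Fm eps_sq eps_rev) => // c; first exact: wfl_rev.
by rewrite !e1.
Qed.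

Lemma mono_supp s (th : 'I_n -> C) v T : (forall a, th a * th a = 1) ->
  ext_act (mono s th) v T != 0 -> exists S, v S != 0 /\ T = simg s S.
Proof.
move=> th1; rewrite {1}(ebas_sum v) act_sumr => /sum_supp[S /andP[_]].
have [a [_ e]] := act_mono s th1 S.
rewrite actZr e ffunE mulf_eq0 => /norP[vS]; rewrite ffunE mulf_eq0 => /norP[_ /ebas_supp ->].
by exists S.
Qed.

Lemma ordcase (a : 'I_n) : (exists i, a = lsh i) \/ (exists i, a = rev_ord (lsh i)) \/ rev_ord a = a.
Proof.
have [h|h] := ltnP a l; first by left; exists (Ordinal h); apply: val_inj.
have [h'|h'] := ltnP (rev_ord a) l.
  by right; left; exists (Ordinal h'); rewrite -[LHS]rev_ordK; congr rev_ord; apply: val_inj.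
right; right; apply: val_inj; apply/eqP; rewrite eqn_leq.
have := half a; have := half (rev_ord a); rewrite rev_ordK => h1 h2.
by rewrite leqNgt h2 -leqNgt h leqNgt h1 -leqNgt h'.
Qed.

Lemma lsh_inj x y : (lsh x == lsh y) = (x == y).
Proof. by rewrite -!val_eqE. Qed.

Lemma flip_full (i : 'I_l) lam a : fl -> i.+1 = l -> full (flipw lam) a = full lam (wfl i a) :> int.
Proof.
move=> hf il; have fo mu b : full mu (rev_ord b) = - full (m := m) mu b by exact: full_odd.
have fl0 mu j : full mu (lsh j) = mu j by exact: full_lshift.
have key j : full (flipw lam) (lsh j) = full lam (wfl i (lsh j)).
  have [e1 _ e3] := wflE i (lsh j); have [->|ji] := eqVneq j i.
    by have [-> _ _] := wflE i (lsh i); rewrite fo !fl0 /flipw hf il eqxx.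
  rewrite e3 ?lsh_inj // 1?eq_sym ?rev_lsh // !fl0 /flipw hf /=.
  by case: eqP => // jl; case/eqP: ji; apply: val_inj => /=; have := jl; rewrite -{2}il => -[].
have [[j ->]|[[j ->]|ra]] := ordcase a; [exact: key|by rewrite wfl_rev !fo key|].
have z mu b : rev_ord b = b -> full (m := m) mu b = 0 by move=> rb; apply: odd_eps_mid rb; exact: fo.
by rewrite !z // -wfl_rev ra.
Qed.

(** The reflection in the last coordinate has determinant -1 and lies outside the special orthogonal
    group, but it normalises the Lie algebra and permutes the raising operators. *)
Lemma flip_HW (i : 'I_l) lam v : fl -> i.+1 = l -> HW lam v ->
  HW (flipw lam) (ext_act (mono (wfl i) (fun=> 1)) v).
Proof.
move=> hf il hv; have [ml e1] := fl_eta hf; split.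
  have c1 (a : 'I_n) : (1 : C) * 1 = 1 by rewrite mulr1.
  move=> T /(mono_supp c1)[S [vS ->]] a.
  by rewrite wt_wfl (hv.1 _ vS) (flip_full _ _ hf il).
have ww b : wfl i (wfl i b) = b by rewrite /wfl tpermK.
move=> a b ab; rewrite -{1}(ww a) -{1}(ww b) -flip_dr //.
have [lt|ge] := ltnP (wfl i a) (wfl i b); first by rewrite hv.2 // act0r.
suff -> : Fm eps (wfl i a) (wfl i b) = 0 by rewrite dr0 act0r.
(* The reflection exchanges the two central, consecutive indices, so this is the only pair whose
   order it reverses; the root vector between opposite indices is zero here. *)
have [ea eb] : a = lsh i /\ b = rev_ord (lsh i).
  have [w1 w2 w3] := wflE i a; have [_ _ w4] := wflE i b.
  have bl := ltn_ord b; have al := ltn_ord a.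
  have inj (x y : 'I_n) : x != y -> nat_of_ord x <> nat_of_ord y by move=> h e; case/eqP: h; exact: val_inj.
  have vi : nat_of_ord (lsh i) = i by [].
  have vr : nat_of_ord (rev_ord (lsh i)) = l by rewrite /=; lia.
  have E1 : a = lsh i -> b = rev_ord (lsh i).
    move=> ea; apply/eqP/negPn/negP => nb; move: ge; rewrite ea w1 w4 //; last first.
      by apply: contraTneq ab => ->; rewrite ea ltnn.
    by move: ab (inj _ _ nb); rewrite ea; lia.
  have [ea|na] := eqVneq a (lsh i); first by split => //; exact: E1.
  exfalso; have [ea|na'] := eqVneq a (rev_ord (lsh i)).
    have n1 : b != lsh i by apply/eqP => eb; move: ab; rewrite ea eb; lia.
    have n2 : b != rev_ord (lsh i) by apply/eqP => eb; move: ab; rewrite ea eb; lia.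
    by move: ge ab; rewrite ea w2 w4 //; lia.
  move: ge; rewrite w3 //; have [eb|nb] := eqVneq b (lsh i).
    by move: ab; rewrite eb w1; lia.
  have [eb|nb'] := eqVneq b (rev_ord (lsh i)).
    by move: ab (inj _ _ na); rewrite eb w2; lia.
  by rewrite w4 //; lia.
rewrite ea eb; have [-> -> _] := wflE i (lsh i).
by rewrite (FmE eps_sq eps_rev) !e1 mulr1 rev_ordK scale1r subrr.
Qed.

Lemma comp_wfl (i : 'I_l) lam u : fl -> i.+1 = l -> u \in comp lam ->
  ext_act (mono (wfl i) (fun=> 1)) u \in comp lam.
Proof.
move=> hf il /(genP eps); elim=> {u} [v [hv|hv]||a u v _ IHu _ IHv|a b u _ _ IH].
- by apply/(genP eps)/lowgen_in; right; exact: flip_HW.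
- by apply/(genP eps)/lowgen_in; left; apply: (HW_ext (flipwK lam)); exact: flip_HW.
- by rewrite act0r mem0v.
- by rewrite actDr actZr memvD // memvZ.
by rewrite flip_dr //; apply: comp_stable.
Qed.

Lemma simgM s t S : simg (s * t)%g S = simg t (simg s S) :> {set I}.
Proof.
rewrite /simg -finset.imset_comp; apply: finset.eq_imset => p /=.
by rewrite permM.
Qed.

(** In the even orthogonal case a single sign change is not in the Weyl group. The last one
    preserves [comp lam] because it exchanges the two kinds of generators; the others are conjugate
    to it. *)
Lemma acoef_comp_wfl lam (i : 'I_l) S : acoef (comp lam) (simg (wfl i) S) = acoef (comp lam) S.
Proof.
have [hf|nf] := boolP fl; last by apply: acoef_wfl => //; exact: comp_stable.
have ll : (l.-1 < l)%N by rewrite prednK // (leq_ltn_trans _ (ltn_ord i)).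
pose la : 'I_l := Ordinal ll; have lal : la.+1 = l by rewrite /= prednK // (leq_ltn_trans _ (ltn_ord i)).
have Hla T : acoef (comp lam) (simg (wfl la) T) = acoef (comp lam) T.
  apply: (@acoef_mono _ _ _ (wfl la) (fun=> 1)) => [a|u uU]; first by rewrite mulr1.
  exact: comp_wfl.
have [->//|ne] := eqVneq i la.
have ne' : la != i by rewrite eq_sym.
have [e1 _ e3 _ _] := wtrE (lsh i) ne'.
(* Conjugation of a transposition by the permutation that exchanges the coordinates [la] and [i]. *)
have E : wfl i = ((wtr la i)^-1 * (wfl la * wtr la i))%g.
  by rewrite -/(conjg _ _) tpermJ e1 // e3.
have Hw T : acoef (comp lam) (simg (wtr la i) T) = acoef (comp lam) T.
  by apply: acoef_wtr => //; exact: comp_stable.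
rewrite E simgM.
rewrite simgM.
rewrite Hw Hla.
rewrite -Hw -simgM mulVg; congr acoef; apply/finset.setP => p.
apply/finset.imsetP/idP => [[q qS ->]|pS]; first by rewrite perm1 -surjective_pairing.
by exists p => //; rewrite perm1 -surjective_pairing.
Qed.

End Decomposition.

Section Parts.

Variable l : nat.

Lemma parts_antitone (lam : intpart l) (i j : 'I_l) : (i <= j)%N -> (parts lam j <= parts lam i)%N.
Proof.
case: lam => t st ij; rewrite /parts /= !(tnth_nth 0%N).
have gt : transitive geq by move=> a b c ba cb; apply: leq_trans cb ba.
by apply: (sorted_leq_nth gt (leqnn) 0%N st); rewrite ?inE ?size_tuple.
Qed.

Lemma intpart_of (p : 'I_l -> nat) : (forall i j : 'I_l, (i < j)%N -> (p j <= p i)%N) ->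
  exists lam : intpart l, parts lam =1 p.
Proof.
move=> hp; have st : sorted geq [tuple p i | i < l].
  apply/(sortedP 0%N) => i; rewrite size_tuple => il.
  have il' : (i < l)%N by exact: ltnW.
  rewrite -(tnth_nth 0%N _ (Ordinal il)) -(tnth_nth 0%N _ (Ordinal il')) !tnth_mktuple.
  exact: hp.
by exists (exist _ [tuple p i | i < l] st) => i; rewrite /parts /= tnth_mktuple.
Qed.

Lemma parts_inj (lam mu : intpart l) : parts lam =1 parts mu -> lam = mu.
Proof. by move=> h; apply/val_inj/eq_from_tnth. Qed.

Lemma box_finite k : finite_set (box l k).
Proof.
have [lam0 _] := @intpart_of (fun=> 0%N) (fun _ _ _ => leqnn 0).
pose f (g : {ffun 'I_l -> 'I_k.+1}) := xget lam0 [set lam : intpart l | forall i, parts lam i = g i :> nat].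
apply: (@sub_finite_set _ _ (f @` setT)) => [lam /forallP hl|]; last exact/finite_image/finite_finset.
exists [ffun i => inord (parts lam i)] => //.
apply: xget_unique => [i|mu hmu] /=; first by rewrite ffunE inordK // ltnS hl.
by apply: parts_inj => i; rewrite hmu ffunE inordK // ltnS hl.
Qed.

Lemma weight_inj_abs (lam mu : intpart l) (f g : 'I_l -> int) :
  (forall i, `|f i|%N = parts lam i) -> (forall i, `|g i|%N = parts mu i) -> lam != mu ->
  exists i, f i != g i.
Proof.
move=> fl gm ne; apply/existsP; apply: contraNT ne; rewrite negb_exists => /forallP h.
by apply/eqP/parts_inj => i; rewrite -fl -gm; have := h i; rewrite negbK => /eqP ->.
Qed.

End Parts.

(** * Orthogonal decomposition of the exterior algebra, and the Casimir eigenvalues *)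

Section Components.

Variables (C : numClosedFieldType) (l m k : nat) (fl : bool).
Local Notation n := (l + m)%N.
Variables (eps : 'I_n -> C) (eta : C).
Hypothesis eps_sq : forall i, eps i * eps i = 1.
Hypothesis eps_rev : forall i, eps (rev_ord i) = eta * eps i.
Hypothesis half : forall j : 'I_n, (j < rev_ord j)%N = (j < l)%N.
Hypothesis eps_l : forall i j : 'I_n, (i < l)%N -> (j < l)%N -> eps i = eps j.
Hypothesis fl_eta : fl -> m = l /\ forall i, eps i = 1.
Hypothesis nfl : ~~ fl -> eta = 1 -> m = l.+1.
Local Notation I := ('I_n * 'I_k)%type.
Local Notation W := (exterior C I).
Implicit Types (u v : W) (U : {vspace W}) (lam mu : intpart l) (S : {set I}).
Local Notation lie_stable := (lie_stable eps).
Local Notation hwf lam := (HW eps (full (l := l) (m := m) lam)).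
Local Notation comp lam := (comp k fl eps (weight lam)).
Local Notation HW2 lam := (HW2 fl eps (k := k) (weight lam)).
Local Notation lsh := (@lsh l m).

Lemma flip_abs (w : 'I_l -> int) i : `|flipw fl w i|%N = `|w i|%N.
Proof. by rewrite /flipw; case: ifP; rewrite ?abszN. Qed.

Lemma HW2_abs lam v : HW2 lam v -> exists f : 'I_l -> int, (forall i, `|f i|%N = parts lam i) /\ hwf f v.
Proof. by case=> h; eexists; split; [| exact: h| | exact: h] => i; rewrite ?flip_abs. Qed.

Lemma comp_perp lam mu : lam != mu -> forall u, u \in comp lam -> perp (comp mu) u.
Proof.
move=> ne; apply: (gen_perp eps_sq eps_rev) => [v|v|v x].
- by case/HW2_abs => f [_ h]; eexists; exact: h.
- by case/HW2_abs => f [_ h]; eexists; exact: h.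
move=> /HW2_abs[f [hf fv]] /HW2_abs[g [hg gx]]; apply: (HW_neq _ fv gx).
have [i fg] := weight_inj_abs hf hg ne.
by exists (lsh i); rewrite !full_lshift.
Qed.

Lemma wt_le S a : (`|wt a S| <= k)%N.
Proof.
have h b : (occ b S <= k)%N.
  rewrite /occ -[X in (_ <= X)%N]card_ord -(card_in_imset (f := fun p : I => p.2) (D := [pred p in S | p.1 == b])).
    exact: max_card.
  by move=> [x y] [x' y'] /=; rewrite !inE /= => /andP[_ /eqP ->] /andP[_ /eqP ->] ->.
have := h a; have := h (rev_ord a); rewrite /wt.
by lia.
Qed.

Lemma wt_full S a : wt a S = full (l := l) (m := m) (fun i => wt (lsh i) S) a.
Proof.
 have fo : full (m := m) (fun i => wt (lsh i) S) (rev_ord a) = _ := full_odd half _ a.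
have fl0 (f : 'I_l -> int) j : full f (lsh j) = f j by exact: full_lshift.
have [[i ->]|[[i ->]|ra]] := ordcase half a; first by rewrite fl0.
  by rewrite wt_rev (full_odd half) fl0.
by rewrite (odd_eps_mid (full_odd half _) ra); have := wt_rev a S; rewrite ra; lia.
Qed.

(** The weight is read off a set of the support, and absolute values give the partition. Each index
    occurs at most [k] times in a set, which bounds the parts. *)
Lemma HW_part (mu : 'I_n -> int) v : v != 0 -> HW eps mu v ->
  exists lam, in_box k lam /\ HW2 lam v.
Proof.
move=> v0 hv; have [S vS] := neq0_supp v0.
pose w i := wt (lsh i) S.
have hw : hwf w v.
  by split=> [T vT a|]; [rewrite -wt_full !hv.1|exact: hv.2].
have anti := HW_antitone eps_sq eps_rev half eps_l fl_eta nfl.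
have ge0 : ~~ fl -> forall i, 0 <= w i.
  by move=> nf i; exact: (HW_ge0 eps_sq eps_rev half fl_eta nfl i nf hw v0).
(* [HW_antitone] is used twice, for [v] and for its reflection, whose last coordinate has the
   opposite sign. *)
have flip (i : 'I_l) : fl -> i.+1 = l -> forall j : 'I_l, (j < i)%N -> `|w i|%:Z <= w j.
  move=> hf il j ji; have h1 : w i <= w j by exact: anti hw v0 _.
  have hg := flip_HW eps_sq eps_rev half fl_eta nfl hf il hw.
  have [_ e1] := fl_eta hf.
  have g0 : ext_act (mono (wfl m i) (fun=> 1)) v != 0.
    apply: contraNneq v0 => z.
    have og : orth eps (mono (wfl m i) (fun=> 1)).
      by apply: mono_orth => a; [exact: wfl_rev|rewrite !e1 !mulr1].
    by rewrite -(ext_act1 v) -og ext_actM z act0r.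
  have := anti _ _ _ _ _ hg g0 ji; rewrite /flipw hf il eqxx /=.
  have -> : (j.+1 == l) = false by apply/negbTE/eqP; lia.
  by lia.
have [lam hl] : exists lam : intpart l, parts lam =1 (fun i => `|w i|%N).
  apply: intpart_of => i j ij.
  have h1 : w j <= w i by exact: anti hw v0 _.
  have [hf|nf] := boolP fl; last by have := ge0 nf j; lia.
  have [jl|jl] := eqVneq j.+1 l; first by have := flip j hf jl i ij; lia.
  have jl' : (l.-1 < l)%N by rewrite prednK // (leq_ltn_trans _ (ltn_ord j)).
  have lal : (Ordinal jl').+1 = l by rewrite /= prednK // (leq_ltn_trans _ (ltn_ord j)).
  have := flip (Ordinal jl') hf lal j; have -> : (j < Ordinal jl')%N.
    by move: jl lal => /= jl lal; have := ltn_ord j; lia.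
  by move=> /(_ isT); lia.
exists lam; split; first by apply/forallP => i; rewrite hl; exact: wt_le.
have [hf|nf] := boolP fl; last first.
  by left; apply: HW_ext hw => i; rewrite /weight hl; have := ge0 nf i; lia.
have pos (i : 'I_l) : i.+1 != l -> 0 <= w i.
  move=> il; have jl' : (l.-1 < l)%N by rewrite prednK // (leq_ltn_trans _ (ltn_ord i)).
  have lal : (Ordinal jl').+1 = l by rewrite /= prednK // (leq_ltn_trans _ (ltn_ord i)).
  have := flip (Ordinal jl') hf lal i; have -> : (i < Ordinal jl')%N.
    by move: il lal => /= il lal; have := ltn_ord i; lia.
  by move=> /(_ isT); lia.
have [/existsP[i /andP[/eqP il wi]]|] := boolP [exists i : 'I_l, (i.+1 == l) && (w i <= 0)].
  right; apply: HW_ext hw => j; rewrite /flipw /weight hl /=.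
  case: eqP => [jl|/eqP/pos]; last by lia.
  have -> : j = i by apply: val_inj => /=; lia.
  by lia.
rewrite negb_exists => /forallP h; left; apply: HW_ext hw => j; rewrite /weight hl.
by have := h j; have := pos j; case: eqP => //= _; lia.
Qed.

(** The common orthogonal complement of the components is stable. Were it nonzero, it would contain
    a highest weight vector, which by [HW_part] also lies in one of the components. *)
Lemma comp_sum_acoef S : \sum_(lam <- fset_set (box l k)) acoef (comp lam) S = 1.
Proof.
rewrite big_seq_fsetE /=.
apply: (@acoef_total _ _ _ (fset_set (box l k)) (fun j => comp (val j))) => [i j ij|u hu].
  by apply: comp_perp; rewrite (inj_eq val_inj).
have [U hU] : exists U : {vspace W}, forall x, x \in U <-> forall j : fset_set (box l k), perp (comp (val j)) x.
  apply: pred_vspace => [j x _|a x y hx hy j z zj]; first by rewrite dot0l.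
  by rewrite dotDl dotZl (hx j z zj) (hy j z zj) mulr0 addr0.
have sU : lie_stable U.
  move=> i j x /hU hx; apply/hU => z; apply: (perp_stable eps_sq eps_rev) => //.
  exact: comp_stable.
have [U0|U0] := eqVneq U 0%VS; first by have /hU := hu; rewrite U0 memv0 => /eqP.
have [mu [v [/hU vU v0 hv]]] := stable_HW eps_sq eps_rev sU U0.
have [lam [lk h2]] := HW_part v0 hv.
have lb : lam \in fset_set (box l k) by rewrite in_fset_set; [exact: mem_set|exact: box_finite].
have : v \in comp lam by apply/(genP eps)/lowgen_in.
by move/(vU [` lb]%fset)/eqP; rewrite dotuu_eq0 (negbTE v0).
Qed.

Lemma comp_psum lam r S : (r <= l)%N -> acoef (comp lam) S != 0 ->
  psum (l := l) (m := m) r S <= \sum_(i < l | (i < r)%N) (parts lam i)%:Z.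
Proof.
move=> rl; apply: (acoef_psum eps_sq eps_rev half fl_eta nfl rl) => v hv T vT.
case: hv => hv; rewrite (HW_psum _ hv vT); apply: ler_sum => i _; rewrite /weight //.
by rewrite /flipw; case: ifP => // _; lia.
Qed.

Lemma comp_isotypic (G : set 'M[C]_n) lam : (forall g, G g <-> ggen eps g) ->
  comp lam = (ext_isotypic k G (weight lam) + ext_isotypic k G (flipw fl (weight lam)))%VS.
Proof.
move=> hG; rewrite !(isotypic_gen _ eps_sq eps_rev half hG).
apply/eqP; rewrite eqEsubv; apply/andP; split.
  apply: gen_min => [i j u /memv_addP[a aU [b bV ->]]|v].
    by rewrite drDr memv_add // (gen_stable eps_sq eps_rev) // => x hx; eexists; exact: hx.
  by case=> hv; [apply: (subvP (addvSl _ _))|apply: (subvP (addvSr _ _))]; apply/(genP eps)/lowgen_in.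
rewrite subv_add; apply/andP; split; apply: gen_min => [|v hv].
- exact: comp_stable.
- by apply/(genP eps)/lowgen_in; left.
- exact: comp_stable.
- by apply/(genP eps)/lowgen_in; right.
Qed.

(** Twice the classical eigenvalue [(lam, lam + 2 rho)], with [2 rho_i = n - 1 - 2 i - eta] for [i]
    counted from 0. *)
Definition casc (lam : 'I_l -> int) : C :=
  2 * \sum_(i < l) ((lam i)%:~R ^+ 2 + (lam i)%:~R * ((l + m)%:R - 1 - 2 * i%:R - eta)).

Lemma count_lt (a : 'I_n) : \sum_(b < n | (b < a)%N) (1 : C) = a%:R.
Proof.
rewrite -(big_ord_widen n (fun=> 1) (ltnW (ltn_ord a))) sumr_const card_ord.
by [].
Qed.

Lemma count_gt (a : 'I_n) : \sum_(b < n | (a < b)%N) (1 : C) = n%:R - 1 - a%:R.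
Proof.
have := sumr_const 'I_n (1 : C); rewrite card_ord (bigID (fun b : 'I_n => (b < a)%N)) /= count_lt.
rewrite (bigD1 a) ?ltnn //= (eq_bigl (fun b : 'I_n => (a < b)%N)) => [<-|b]; first by ring.
by rewrite -leqNgt ltn_neqAle andbC eq_sym.
Qed.

Lemma cas_valE (lam : 'I_l -> int) : cas_val eta (full (m := m) lam) = casc lam.
Proof.
pose L a : C := (full (m := m) lam a)%:~R.
pose K (a : 'I_n) : C := \sum_(b < n | (a < b)%N) kap eta a b - \sum_(b < n | (b < a)%N) kap eta a b.
have KE a : K a = n%:R - 1 - 2 * a%:R - ((a < rev_ord a)%N%:R - (rev_ord a < a)%N%:R) * eta.
  rewrite /K /kap !sumrB count_gt count_lt.
  have P (Q : pred 'I_n) : \sum_(b < n | Q b) (b == rev_ord a)%:R * eta = (Q (rev_ord a))%:R * eta.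
    rewrite big_mkcond (bigD1 (rev_ord a)) //= big1 ?addr0 => [|b /negbTE ->]; last by rewrite mul0r if_same.
    by rewrite eqxx; case: (Q _); rewrite ?mul1r ?mul0r.
  rewrite !P; ring.
have kC a b : kap eta a b = kap eta b a.
  by rewrite /kap -(inj_eq rev_ord_inj b) rev_ordK eq_sym.
have -> : cas_val eta (full (m := m) lam) = \sum_a (L a ^+ 2 + L a * K a).
  rewrite /cas_val big_split [RHS]big_split /=; congr (_ + _).
  rewrite (eq_bigr (fun a : 'I_n => \sum_(b < n | (a < b)%N) kap eta a b * L a - \sum_(b < n | (a < b)%N) kap eta a b * L b)); last first.
    by move=> a _; rewrite -sumrB; apply: eq_bigr => b _; rewrite mulrBr.
  rewrite sumrB [X in _ - X](exchange_big_dep xpredT) //= -sumrB; apply: eq_bigr => a _.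
  rewrite /K mulrBr !mulr_sumr; congr (_ - _); apply: eq_bigr => b _; first exact: mulrC.
  by rewrite kC mulrC.
have Lo a : L (rev_ord a) = - L a by rewrite /L (full_odd half) rmorphN.
rewrite (sum_half half) => [|a ra]; last first.
  by rewrite /L (odd_eps_mid (full_odd half lam) ra) mul0r expr0n addr0.
rewrite /casc mulr_sumr; apply: eq_bigr => i _.
have h1 : (lsh i < rev_ord (lsh i))%N by rewrite half; exact: (ltn_ord i).
have h2 : (rev_ord (lsh i) < lsh i)%N = false by apply/negbTE; rewrite -leqNgt ltnW.
have Kl : K (lsh i) = n%:R - 1 - 2 * i%:R - eta by rewrite KE h1 h2 subr0 mul1r.
have Kr : K (rev_ord (lsh i)) = - K (lsh i).
  have e : (rev_ord (lsh i))%:R = n%:R - i%:R - 1 :> C.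
    by rewrite /= natrB ?(leq_ltn_trans _ (ltn_ord (lsh i))) // -natr1 opprD addrA.
  rewrite KE Kl rev_ordK h1 h2 e -[true%:R]/(1 : C) -[false%:R]/(0 : C); ring.
rewrite Lo Kr Kl {1 2 3 4}/L (full_lshift (l := l)) //.
ring.
Qed.

(** In the even orthogonal case the last coordinate of [rho] is zero. This is why the Casimir
    operator is a scalar on the merged component. *)
Lemma casc_flip (lam : 'I_l -> int) : casc (flipw fl lam) = casc lam.
Proof.
congr (_ * _); apply: eq_bigr => i _; rewrite /flipw.
case: ifP => // /andP[hf /eqP il]; rewrite rmorphN sqrrN; congr (_ + _).
have [ml e1] := fl_eta hf.
have -> : eta = 1 by have := eps_rev (lsh i); rewrite !e1 mulr1.
have -> : (l + m)%:R - 1 - 2 * i%:R - 1 = 0 :> C; last by rewrite !mulr0.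
have -> : (l + m)%:R = 2 * (i%:R + 1) :> C by rewrite natr1 -natrM; congr _%:R; lia.
by ring.
Qed.

Lemma comp_casimir lam u : u \in comp lam -> casimir eps u = casc (weight lam) *: u.
Proof.
move=> hu; rewrite -cas_valE.
apply: (casimir_gen eps_sq eps_rev _ hu) => v [] hv; eexists; split; try exact: hv => //.
by [].
by rewrite !cas_valE casc_flip.
Qed.

End Components.

(** * The radial part of the Casimir operator in the coordinates [x = (z + 1/z) / 2] *)

Section Radial.

Variables (F : numFieldType) (l m dl : nat).
Local Notation n := (l + m)%N.
Hypothesis half : forall j : 'I_n, (j < rev_ord j)%N = (j < l)%N.
Hypothesis mE : m = (l + dl)%N.
Hypothesis dl1 : (dl <= 1)%N.
Local Notation lsh := (@lsh l m).
Variables (eta : F) (d h A : 'I_n -> F).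
Hypothesis d0 : forall a, d a != 0.
Hypothesis d_rev : forall a, d (rev_ord a) = (d a)^-1.
Hypothesis d_mid : forall a, rev_ord a = a -> d a = 1.
Hypothesis d_inj : forall a b, a != b -> d a != d b.
Hypothesis h_rev : forall a, h (rev_ord a) = - h a.
Hypothesis A_rev : forall a, A (rev_ord a) = A a.
Hypothesis A_mid : forall a, rev_ord a = a -> A a = 0.
Let x i := (d (lsh i) + (d (lsh i))^-1) / 2.
Let y i := (d (lsh i) - (d (lsh i))^-1) / 2.

Lemma sum_mid (f : 'I_n -> F) c : (forall a, rev_ord a = a -> f a = c) ->
  \sum_(a < n | rev_ord a == a) f a = dl%:R * c.
Proof.
move=> fc; case: dl dl1 mE => [|[|//]] _ e.
  rewrite big_pred0 ?mul0r // => a; apply/negbTE/eqP => /(congr1 val) /=.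
  by have := ltn_ord a; lia.
have ln : (l < n)%N by lia.
have midE a : (rev_ord a == a :> 'I_n) = (a == Ordinal ln).
  by apply/eqP/eqP => [/(congr1 val) /= hh|->]; apply: val_inj => /=; have := ltn_ord a; lia.
by rewrite (big_pred1 (Ordinal ln)) ?fc ?mul1r //; apply/eqP; rewrite midE.
Qed.

Lemma sum_split (f : 'I_n -> F) : \sum_a f a = \sum_(i < l) (f (lsh i) + f (rev_ord (lsh i)))
  + \sum_(a < n | rev_ord a == a) f a.
Proof.
rewrite (bigID (fun a => rev_ord a == a)) addrC /=; congr (_ + _).
rewrite big_mkcond (sum_half half) => [|a ->]; last by rewrite eqxx.
apply: eq_bigr => i _; rewrite rev_ordK (negbTE (rev_lsh half i i)) eq_sym.
by rewrite (negbTE (rev_lsh half i i)).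
Qed.

(** Exchanging [a] and [b] collects the coefficient of [h a] as [(d a + d b) / (d a - d b)]. The
    terms of an index and of its opposite then add up to [2 y / (x_i - x_j)]; the index opposite to
    [a] gives [(1 - eta) x / y], and a middle index, where [d = 1], gives [(x + 1) / y]. *)
Lemma radial :
  \sum_a (A a + \sum_(b | b != a) (1 - (b == rev_ord a)%:R * eta) * (d a / (d a - d b)) * (h a - h b)) =
  2 * \sum_(i < l) (A (lsh i) + h (lsh i) * (\sum_(j < l | j != i) 2 * y i / (x i - x j)
     + (1 - eta) * x i / y i + dl%:R * (x i + 1) / y i)).
Proof.
have dd a b : b != a -> d a - d b != 0 by move=> ne; rewrite subr_eq0 d_inj // eq_sym.
have kC a b : 1 - (b == rev_ord a)%:R * eta = 1 - (a == rev_ord b)%:R * eta.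
  by rewrite -(inj_eq rev_ord_inj b) rev_ordK eq_sym.
pose kp (a b : 'I_n) := 1 - (b == rev_ord a)%:R * eta.
pose g a b := kp a b * ((d a + d b) / (d a - d b)).
pose Y a := \sum_(b | b != a) g a b.
transitivity (\sum_a (A a + h a * Y a)).
  rewrite !big_split /=; congr (_ + _).
  under eq_bigr => a _.
    under eq_bigr => b _ do rewrite mulrBr.
    rewrite sumrB; over.
  rewrite sumrB [X in _ - X](exchange_big_dep xpredT) //= -sumrB; apply: eq_bigr => a _.
  rewrite (eq_bigl (fun b => b != a)) => [|b]; last by rewrite eq_sym.
  rewrite [X in _ - X](eq_bigl (fun b => b != a)) => [|b]; last by rewrite eq_sym.
  rewrite -sumrB mulr_sumr; apply: eq_bigr => b ba.
  have h1 := dd _ _ ba; have h2 : d b - d a != 0 by rewrite dd // eq_sym.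
  rewrite /g /kp [in X in _ - X]kC; field.
  by rewrite h1 h2.
have Yr a : Y (rev_ord a) = - Y a.
  rewrite /Y (reindex_inj rev_ord_inj) /= -sumrN; apply: eq_big => b; first by rewrite (inj_eq rev_ord_inj).
  move=> ba; rewrite (inj_eq rev_ord_inj) in ba; rewrite /g /kp rev_ordK -[RHS]mulrN.
  congr ((1 - _%:R * _) * _); first by rewrite -(inj_eq rev_ord_inj) rev_ordK.
  have h1 := dd _ _ ba; have h2 : d b - d a != 0 by rewrite dd // eq_sym.
  rewrite !d_rev; field.
  by rewrite mulN1r h1 h2 !d0.
rewrite sum_split [X in _ + X]big1 ?addr0 => [|a /eqP ra]; last first.
  have : h a = 0 by have := h_rev a; rewrite ra => /eqP; rewrite -addr_eq0 -mulr2n mulrn_eq0 => /eqP.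
  by rewrite A_mid // add0r => ->; rewrite mul0r.
rewrite mulr_sumr; apply: eq_bigr => i _; rewrite A_rev h_rev Yr mulrNN -mulr2n mulr_natl; congr ((_ + _ * _) *+ _).
have ni := negbTE (rev_lsh half i i); have ni' : (lsh i == rev_ord (lsh i)) = false by rewrite eq_sym.
have y0 : y i != 0.
  by rewrite mulf_neq0 ?invr_neq0 ?pnatr_eq0 // -d_rev dd ?ni.
have -> : Y (lsh i) = \sum_b (if b == lsh i then 0 else g (lsh i) b).
  by rewrite /Y big_mkcond /=; apply: eq_bigr => b _; case: eqP.
have G (p q : F) : p != 0 -> q != 0 -> p - q != 0 -> p - q^-1 != 0 ->
    (p + q) / (p - q) + (p + q^-1) / (p - q^-1) = 2 * ((p - p^-1) / 2) / ((p + p^-1) / 2 - (q + q^-1) / 2).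
  move=> p0 q0 h1 h2; have -> : (p + p^-1) / 2 - (q + q^-1) / 2 = (p - q) * (p - q^-1) / (2 * p) by field; rewrite p0 q0.
  have h3 : p * q - 1 != 0 by rewrite (_ : _ - 1 = q * (p - q^-1)) ?mulf_neq0 //; field.
  by field; rewrite ?h1 ?h3 ?p0 ?q0.
have G1 (p : F) : p != 0 -> p - p^-1 != 0 -> (p + p^-1) / (p - p^-1) = ((p + p^-1) / 2) / ((p - p^-1) / 2).
  move=> p0 h2; have h3 : p * p - 1 != 0 by rewrite (_ : _ - 1 = p * (p - p^-1)) ?mulf_neq0 //; field.
  by field; rewrite ?h3 ?p0.
have G2 (p : F) : p != 0 -> p - p^-1 != 0 -> p - 1 != 0 -> (p + 1) / (p - 1) = ((p + p^-1) / 2 + 1) / ((p - p^-1) / 2).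
  move=> p0 h2 h1; have h3 : p * p - 1 != 0 by rewrite (_ : _ - 1 = p * (p - p^-1)) ?mulf_neq0 //; field.
  by field; rewrite ?h1 ?h3 ?p0.
have y0' : d (lsh i) - (d (lsh i))^-1 != 0 by rewrite -d_rev dd ?ni.
rewrite sum_split (bigD1 i) //= eqxx add0r ni [X in X + _]addrC; congr (_ + _ + _).
- apply: eq_bigr => j ji; have lij : (lsh j == lsh i) = false by rewrite lsh_inj (negbTE ji).
  rewrite lij (negbTE (rev_lsh half j i)) /g /kp.
  have -> : (lsh j == rev_ord (lsh i)) = false by rewrite eq_sym; exact/negbTE/(rev_lsh half).
  rewrite (inj_eq rev_ord_inj) lij !mul0r !subr0 !mul1r d_rev; apply: G => //; first by rewrite dd // lij.
  by rewrite -d_rev dd //; exact: (rev_lsh half).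
- by rewrite /g /kp eqxx mul1r d_rev G1 // mulrA.
rewrite (@sum_mid _ ((x i + 1) / y i)) ?mulrA // => a ra.
have ai : a != lsh i by apply: contraNneq (rev_lsh half i i) => <-; rewrite ra.
rewrite (negbTE ai) /g /kp (d_mid ra).
have -> : (a == rev_ord (lsh i)) = false.
  by apply: contraNF ai => /eqP e; rewrite -ra e rev_ordK.
rewrite mul0r subr0 mul1r.
apply: G2 => //.
by rewrite -(d_mid ra) dd.
Qed.

End Radial.

Section RealData.

Variables (R : realType) (l m k dl : nat) (fl : bool).
Local Notation C := R[i].
Local Notation n := (l + m)%N.
Variables (eps : 'I_n -> C) (etaR : R).
Local Notation eta := (etaR%:C)%C.
Hypothesis eps_sq : forall i, eps i * eps i = 1.
Hypothesis eps_rev : forall i, eps (rev_ord i) = eta * eps i.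
Hypothesis half : forall j : 'I_n, (j < rev_ord j)%N = (j < l)%N.
Hypothesis eps_l : forall i j : 'I_n, (i < l)%N -> (j < l)%N -> eps i = eps j.
Hypothesis fl_eta : fl -> m = l /\ forall i, eps i = 1.
Hypothesis nfl : ~~ fl -> eta = 1 -> m = l.+1.
Hypothesis mE : m = (l + dl)%N.
Hypothesis dl1 : (dl <= 1)%N.
Local Notation I := ('I_n * 'I_k)%type.
Implicit Types (lam : intpart l) (S : {set I}).
Local Notation comp lam := (comp k fl eps (weight lam)).
Implicit Types (U : {vspace exterior C I}).
Local Notation lsh := (@lsh l m).

Definition mult U S : R := complex.Re (acoef U S).

Lemma multE U S : (mult U S)%:C%C = acoef U S.
Proof.
have := acoef_ge0 U S; rewrite /mult.
by case: (acoef _ _) => a b; rewrite lecE /= => /andP[/eqP -> _].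
Qed.

Lemma realC_inj : injective (fun x : R => x%:C%C).
Proof. by move=> x y []. Qed.

Lemma mult_dim U : \sum_S mult U S = (\dim U)%:R.
Proof.
apply: realC_inj; rewrite /= rmorph_sum rmorph_nat -acoef_sum.
by apply: eq_bigr => S _; exact: multE.
Qed.

Lemma mult_wtr U i j S : lie_stable eps U -> i != j -> mult U (simg (wtr m i j) S) = mult U S.
Proof.
move=> sU ij; apply: realC_inj; rewrite /= !multE.
exact: (acoef_wtr eps_sq eps_rev half eps_l).
Qed.

Lemma mult_wfl_stable U i S : ~~ fl -> lie_stable eps U -> mult U (simg (wfl m i) S) = mult U S.
Proof.
move=> nf sU; apply: realC_inj; rewrite /= !multE.
exact: (acoef_wfl eps_sq eps_rev half fl_eta nfl i S nf sU).
Qed.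

Lemma mult_wfl lam i S : mult (comp lam) (simg (wfl m i) S) = mult (comp lam) S.
Proof.
apply: realC_inj; rewrite /= !multE.
exact: (acoef_comp_wfl eps_sq eps_rev half eps_l fl_eta nfl).
Qed.

Lemma mult_psum U lam r S : (U <= comp lam)%VS -> (r <= l)%N -> mult U S != 0 ->
  \sum_(i < l | (i < r)%N) wt (lsh i) S <= \sum_(i < l | (i < r)%N) (parts lam i)%:Z.
Proof.
move=> Uc rl; have -> : (mult U S != 0) = (acoef U S != 0).
  by rewrite -multE -(inj_eq realC_inj).
apply: (@acoef_supp _ _ _ U (fun S => \sum_(i < l | (i < r)%N) wt (lsh i) S <= \sum_(i < l | (i < r)%N) (parts lam i)%:Z)).
move=> u uU T uT; apply: (comp_psum eps_sq eps_rev half fl_eta nfl rl).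
by apply: acoef_neq0 uT; exact: (subvP Uc).
Qed.

Lemma mult_total S : \sum_(lam <- fset_set (box l k)) mult (comp lam) S = 1.
Proof.
apply: realC_inj; rewrite /= rmorph_sum rmorph1.
rewrite -(comp_sum_acoef eps_sq eps_rev half eps_l fl_eta nfl S).
by apply: eq_bigr => lam _; exact: multE.
Qed.

(** [casimir_trace] at the torus element with entries [z], their inverses, and possibly 1, brought
    back to real numbers. The conditions on [z] make all these entries distinct. A subspace [U] of
    the component is allowed, so that one irreducible constituent can be treated later. *)
Lemma mult_casimir U lam (z : 'I_l -> R) : lie_stable eps U -> (U <= comp lam)%VS ->
  (forall i, 1 < z i) -> injective z ->
  let t S := \prod_(i < l) z i ^ wt (lsh i) S in
  let x i := (z i + (z i)^-1) / 2 in let y i := (z i - (z i)^-1) / 2 in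
  let h i := \sum_S mult U S * ((wt (lsh i) S)%:~R * t S) in
  (\sum_(i < l) ((parts lam i)%:R ^+ 2 + (parts lam i)%:R * (n%:R - 1 - 2 * i%:R - etaR))) *
    (\sum_S mult U S * t S) =
  \sum_(i < l) (\sum_S mult U S * ((wt (lsh i) S)%:~R ^+ 2 * t S) +
    h i * (\sum_(j < l | j != i) 2 * y i / (x i - x j) + (1 - etaR) * x i / y i + dl%:R * (x i + 1) / y i)).
Proof.
move=> sU Uc z1 zi t x y h.
have z0 i : 0 < z i by apply: lt_trans (z1 i).
pose d (a : 'I_n) : R := match fintype.split a with inl i => z i
  | inr _ => match fintype.split (rev_ord a) with inl i => (z i)^-1 | inr _ => 1 end end.
have dl_ i : d (lsh i) = z i.
  by rewrite /d (split_inl (i := lsh i) (ltn_ord i)); congr z; exact: val_inj.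
have dr_ i : d (rev_ord (lsh i)) = (z i)^-1.
  rewrite /d; have [j ->] := split_inr (rev_lsh_ge half i).
  by rewrite rev_ordK (split_inl (i := lsh i) (ltn_ord i)); congr (z _)^-1; exact: val_inj.
have dm a : rev_ord a = a -> d a = 1.
  move=> ra; have la : (l <= a)%N by rewrite leqNgt -half ra ltnn.
  by rewrite /d ra; have [j ->] := split_inr la.
have d_rev a : d (rev_ord a) = (d a)^-1.
  have [[i ->]|[[i ->]|ra]] := ordcase half a; first by rewrite dr_ dl_.
    by rewrite rev_ordK dr_ dl_ invrK.
  by rewrite ra (dm _ ra) invr1.
have d0 a : d a != 0.
  have [[i ->]|[[i ->]|ra]] := ordcase half a; first by rewrite dl_ gt_eqF.
    by rewrite dr_ invr_eq0 gt_eqF.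
  by rewrite dm // oner_eq0.
have zV i : (z i)^-1 < 1 by rewrite invf_lt1.
have d_inj a b : a != b -> d a != d b.
  move=> ab; have [[i ea]|[[i ea]|ra]] := ordcase half a; have [[j eb]|[[j eb]|rb]] := ordcase half b;
    rewrite ?ea ?eb ?dl_ ?dr_ ?(dm _ ra) ?(dm _ rb).
  - by apply: contraNneq ab => /zi ij; rewrite ea eb ij.
  - by rewrite gt_eqF // (lt_trans (zV j)).
  - by rewrite gt_eqF.
  - by rewrite lt_eqF // (lt_trans (zV i)).
  - by apply: contraNneq ab => /invr_inj/zi ij; rewrite ea eb ij.
  - by rewrite lt_eqF.
  - by rewrite lt_eqF.
  - by rewrite gt_eqF.
  - case/eqP: ab; apply: val_inj; move: ra rb => /(congr1 val) /= ra /(congr1 val) /= rb.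
    by have := ltn_ord a; have := ltn_ord b; lia.
pose dC : 'rV[C]_n := \row_a (d a)%:C%C.
have td : is_tor dC.
  move=> a; rewrite !mxE; split => [|/dm ->]; last by rewrite rmorph1.
  by rewrite -rmorphM d_rev divff // rmorph1.
have tE S : \prod_(p in S) dC 0 p.1 = (t S)%:C%C.
  rewrite torus_wt // prod_half // rmorph_prod; apply: eq_bigr => i _.
  by rewrite mxE -/(lsh i) dl_ fmorphXz.
have Ecas u : u \in U -> casimir eps u = casc m eta (weight lam) *: u.
  by move=> uU; have := subvP Uc _ uU; exact: (comp_casimir eps_sq eps_rev half fl_eta).
have := casimir_trace eps_sq eps_rev sU Ecas td.
have di' a b : a != b -> dC 0 a != dC 0 b by move=> /d_inj; rewrite !mxE (inj_eq realC_inj).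
move=> /(_ di') /=.
pose H (a : 'I_n) : R := \sum_S mult U S * ((wt a S)%:~R * t S).
pose A (a : 'I_n) : R := \sum_S mult U S * ((wt a S)%:~R ^+ 2 * t S).
have HE a b : \sum_S acoef U S * (((wt a S)%:~R - (wt b S)%:~R) * \prod_(p in S) dC 0 p.1) = (H a - H b)%:C%C.
  rewrite /H -sumrB rmorph_sum; apply: eq_bigr => S _; rewrite -mulrBr -mulrBl tE !(rmorphM (real_complex R)) (rmorphB (real_complex R)) !(rmorph_int (real_complex R)); congr (_ * _).
  by rewrite -multE.
rewrite [X in X = _ -> _](_ : _ = (2 * (\sum_(i < l) ((parts lam i)%:R ^+ 2 + (parts lam i)%:R * (n%:R - 1 - 2 * i%:R - etaR))) *
    (\sum_S mult U S * t S))%:C%C); last first.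
  rewrite rmorphM; congr (_ * _); last first.
    by rewrite rmorph_sum; apply: eq_bigr => S _; rewrite tE rmorphM; congr (_ * _); rewrite -multE.
  rewrite /casc rmorphM rmorph_nat rmorph_sum; congr (_ * _); apply: eq_bigr => i _.
  rewrite /weight -!pmulrn (rmorphD (real_complex R)) (rmorphXn (real_complex R)) (rmorphM (real_complex R)).
  by rewrite !(rmorphB (real_complex R)) (rmorphM (real_complex R)) !(rmorph_nat (real_complex R)) rmorph1.
rewrite [X in _ = X -> _](_ : _ = (\sum_a (A a + \sum_(b | b != a) (1 - (b == rev_ord a)%:R * etaR) * (d a / (d a - d b)) * (H a - H b)))%:C%C); last first.
  rewrite rmorph_sum; apply: eq_bigr => a _; rewrite rmorphD; congr (_ + _).
    rewrite /A rmorph_sum; apply: eq_bigr => S _; rewrite -multE tE -(rmorph_int (real_complex R)).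
    by rewrite -(rmorphXn (real_complex R)) -!(rmorphM (real_complex R)).
  rewrite rmorph_sum; apply: eq_bigr => b _; rewrite HE !(rmorphM (real_complex R)) (fmorphV (real_complex R)) !(rmorphB (real_complex R)) rmorph1 (rmorphM (real_complex R)) rmorph_nat !mxE.
  by [].
move=> /realC_inj; rewrite (radial half mE dl1 etaR d0 d_rev dm d_inj); last 3 first.
- by move=> a; rewrite /H -sumrN; apply: eq_bigr => S _; rewrite wt_rev rmorphN mulNr mulrN.
- by move=> a; apply: eq_bigr => S _; rewrite wt_rev rmorphN sqrrN.
- move=> a ra; rewrite /A big1 // => S _.
  have -> : wt a S = 0 by have := wt_rev a S; rewrite ra; lia.
  by rewrite expr0n mul0r mulr0.
have t2 : (2 : R) != 0 by rewrite pnatr_eq0.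
rewrite -mulrA => /(mulfI t2) ->.
apply: eq_bigr => i _; rewrite !dl_ (eq_bigr (fun j => 2 * y i / (x i - x j))) // => j _.
by rewrite !dl_.
Qed.

End RealData.

(** * Jacobi polynomials *)

Section JacobiWeight.

Local Open Scope classical_set_scope.
Variables (R : realType) (al be : R).
Hypotheses (al1 : -1 < al) (be1 : -1 < be).
Local Notation mu := (@lebesgue_measure R).
Local Notation a := (al + 1).
Local Notation b := (be + 1).

Definition jw (x : R) : R := (1 - x) `^ al * (1 + x) `^ be.

Lemma al1_gt0 : 0 < a. Proof. by rewrite -ltrBlDr sub0r. Qed.
Lemma be1_gt0 : 0 < b. Proof. by rewrite -ltrBlDr sub0r. Qed.

Lemma is_derive_1m (x : R) : is_derive x 1 (fun y : R => 1 - y) (-1).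
Proof.
have := is_derive_poly (1 - 'X) x; rewrite derivB derivX -polyC1 derivC sub0r hornerN hornerC polyC1.
by congr (is_derive _ _ _ _); apply/funext => y; rewrite !hornerE.
Qed.

Lemma is_derive_1p (x : R) : is_derive x 1 (fun y : R => 1 + y) 1.
Proof.
have := is_derive_poly (1 + 'X) x; rewrite derivD derivX -polyC1 derivC add0r hornerC polyC1.
by congr (is_derive _ _ _ _); apply/funext => y; rewrite !hornerE.
Qed.

Lemma is_derive_powRm (c x : R) : x < 1 -> is_derive x 1 (fun y => (1 - y) `^ c) (- (c * (1 - x) `^ (c - 1))).
Proof.
move=> x1; have p : 0 < 1 - x by rewrite subr_gt0.
have d1 := is_derive_1m x.
have d2 := is_derive1_powR c p.
have := is_derive1_comp (g := fun y => 1 - y) d2 d1.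
by rewrite mulrN1.
Qed.

Lemma is_derive_powRp (c x : R) : -1 < x -> is_derive x 1 (fun y => (1 + y) `^ c) (c * (1 + x) `^ (c - 1)).
Proof.
move=> x1; have p : 0 < 1 + x by rewrite addrC -ltrBlDr sub0r.
have d1 := is_derive_1p x.
have d2 := is_derive1_powR c p.
have := is_derive1_comp d2 d1.
by rewrite mulr1.
Qed.

Lemma jw_ge0 x : 0 <= jw x.
Proof. by rewrite mulr_ge0 // powR_ge0. Qed.

(** Chosen so that [jop r * jw] is the derivative of [(1 - x) ^ (al + 1) (1 + x) ^ (be + 1) r]
    ([is_derive_jw]); on a derivative it gives the Jacobi operator. *)
Definition jop (r : {poly R}) : {poly R} :=
  (1 - 'X^2) * r^`() + ((be - al)%:P - (al + be + 2) *: 'X) * r.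

Lemma powRS (x c : R) : 0 < x -> x `^ (c + 1) = x * x `^ c.
Proof. by move=> x0; rewrite powRD ?(gt_eqF x0) ?implybT // [x `^ 1]powRr1 1?ltW // mulrC. Qed.

Lemma is_derive_jw (r : {poly R}) (x : R) : -1 < x < 1 ->
  is_derive x 1 (fun y => (1 - y) `^ a * (1 + y) `^ b * r.[y]) ((jop r).[x] * jw x).
Proof.
move=> /andP[x1 x2].
have d1 := is_derive_powRm a x2; have d2 := is_derive_powRp b x1.
have d3 : is_derive x 1 (fun y => r.[y]) (r^`()).[x] by exact: is_derive_poly.
have d12 := is_deriveM d1 d2; have := is_deriveM d12 d3.
move=> h; apply: (is_derive_eq h); rewrite /jop /jw !hornerE /=.
have -> : a - 1 = al by rewrite addrK.
have -> : b - 1 = be by rewrite addrK.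
have p1 : 0 < 1 - x by rewrite subr_gt0.
have p2 : 0 < 1 + x by rewrite addrC -ltrBlDr sub0r.
rewrite !powRS // /GRing.scale /=.
set A := _ `^ al; set B := _ `^ be.
have -> : ((fun y : R => (1 - y) `^ a) * (fun y : R => (1 + y) `^ b)) x = (1 - x) * A * ((1 + x) * B).
  by rewrite -!powRS.
ring.
Qed.

(** An explicit primitive of a majorant of the weight. Writing 1 as [((1 - x) + (1 + x)) / 2] splits
    the weight into two terms, each singular at one endpoint at most; the regular factor is bounded
    by a power of 2. *)
Definition jH (x : R) : R := 2^-1 * (2 `^ a * ((1 + x) `^ b / b) - 2 `^ b * ((1 - x) `^ a / a)).
Definition jh (x : R) : R := 2^-1 * (2 `^ a * (1 + x) `^ be + 2 `^ b * (1 - x) `^ al).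

Lemma jH_derive (x : R) : -1 < x < 1 -> is_derive x 1 jH (jh x).
Proof.
move=> /andP[x1 x2].
have d1 := is_derive_powRm a x2; have d2 := is_derive_powRp b x1.
rewrite /jH; apply: is_derive_eq; rewrite /jh /GRing.scale /=.
have -> : a - 1 = al by rewrite addrK.
have -> : b - 1 = be by rewrite addrK.
field.
by rewrite !gt_eqF // ?al1_gt0 ?be1_gt0.
Qed.

Lemma jw_le (x : R) : -1 < x < 1 -> jw x <= jh x.
Proof.
move=> /andP[x1 x2].
have p1 : 0 < 1 - x by rewrite subr_gt0.
have p2 : 0 < 1 + x by rewrite addrC -ltrBlDr sub0r.
have e : jw x = 2^-1 * ((1 - x) `^ a * (1 + x) `^ be + (1 + x) `^ b * (1 - x) `^ al).
  by rewrite !powRS // /jw; field.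
rewrite e /jh ler_pM2l ?invr_gt0 //; apply: lerD; rewrite ler_wpM2r ?powR_ge0 //.
  by apply: ge0_ler_powR; rewrite ?nnegrE ?ltW ?al1_gt0 //; lra.
by apply: ge0_ler_powR; rewrite ?nnegrE ?ltW ?be1_gt0 //; lra.
Qed.

Lemma measurable_jw (D : set R) : measurable D -> measurable_fun D jw.
Proof.
move=> mD; apply: (measurable_funS measurableT) => //.
apply: measurable_funM; apply: (@measurableT_comp _ _ _ _ _ _ (@powR R ^~ _)) => //.
  exact: measurable_funB.
exact: measurable_funD.
Qed.

Lemma is_derive_continuous (f : R -> R) (x d : R) : is_derive x 1 f d -> {for x, continuous f}.
Proof. by move=> [df _]; apply: differentiable_continuous; apply/derivable1_diffP. Qed.

Lemma jH_continuous (x : R) : -1 < x < 1 -> {for x, continuous jH}.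
Proof. by move=> hx; exact: is_derive_continuous (jH_derive hx). Qed.

Lemma jh_continuous (x : R) : -1 < x < 1 -> {for x, continuous jh}.
Proof.
move=> /andP[x1 x2].
have c1 := is_derive_continuous (is_derive_powRm al x2).
have c2 := is_derive_continuous (is_derive_powRp be x1).
apply: continuousM; first exact: cst_continuous.
by apply: continuousD; apply: continuousM => //; exact: cst_continuous.
Qed.

Lemma in_oo (c d x : R) : -1 < c -> d < 1 -> x \in `[c, d]%R -> -1 < x < 1.
Proof. by move=> c1 d1; rewrite in_itv /= => /andP[cx xd]; rewrite (lt_le_trans c1 cx) (le_lt_trans xd d1). Qed.

Lemma jw_integral_le (c d : R) : -1 < c -> c < d -> d < 1 ->
  (\int[mu]_(x in `[c, d]) (jw x)%:E <= (jH d - jH c)%:E)%E.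
Proof.
move=> c1 cd d1.
have FT : (\int[mu]_(x in `[c, d]) (jh x)%:E = (jH d)%:E - (jH c)%:E)%E.
  apply: continuous_FTC2 => //.
  - apply: continuous_in_subspaceT => x /[!classical_sets.inE] /(in_oo c1 d1).
    exact: jh_continuous.
  - split.
    + move=> x xcd; have [] := jH_derive (in_oo c1 d1 (subset_itv_oo_cc xcd)).
      by [].
    + apply: cvg_at_right_filter; apply: jH_continuous.
      by rewrite c1 (lt_trans cd d1).
    + apply: cvg_at_left_filter; apply: jH_continuous.
      by rewrite d1 (lt_trans c1 cd).
  - move=> x xcd; have h := jH_derive (in_oo c1 d1 (subset_itv_oo_cc xcd)).
    by rewrite derive1E; exact: derive_val.
rewrite EFinB -FT; apply: ge0_le_integral => //.
- by move=> x _; rewrite lee_fin jw_ge0.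
- by apply/measurable_EFinP; exact: measurable_jw.
- apply/measurable_EFinP; apply: subspace_continuous_measurable_fun => //.
  apply: continuous_in_subspaceT => x /[!classical_sets.inE] /(in_oo c1 d1).
  exact: jh_continuous.
by move=> x /(in_oo c1 d1) hx; rewrite lee_fin jw_le.
Qed.

Lemma jH_bound (c d : R) : -1 < c -> c < d -> d < 1 -> jH d - jH c <= 2 `^ a * 2 `^ b * (a^-1 + b^-1).
Proof.
move=> c1 cd d1; have := al1_gt0; have := be1_gt0 => b0 a0.
have p z : 0 <= z -> z <= 2 -> z `^ b / b <= 2 `^ b / b.
  by move=> z0 z2; rewrite ler_pM2r ?invr_gt0 //; apply: ge0_ler_powR; rewrite ?nnegrE ?(ltW b0) //.
have q z : 0 <= z -> z <= 2 -> z `^ a / a <= 2 `^ a / a.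
  by move=> z0 z2; rewrite ler_pM2r ?invr_gt0 //; apply: ge0_ler_powR; rewrite ?nnegrE ?(ltW a0) //.
have h1 : (1 + d) `^ b / b <= 2 `^ b / b by apply: p; lra.
have h2 : (1 - c) `^ a / a <= 2 `^ a / a by apply: q; lra.
have h3 : 0 <= (1 - d) `^ a / a by rewrite mulr_ge0 ?powR_ge0 ?invr_ge0 ?ltW.
have h4 : 0 <= (1 + c) `^ b / b by rewrite mulr_ge0 ?powR_ge0 ?invr_ge0 ?ltW.
have A0 : 0 <= 2 `^ a by rewrite powR_ge0.
have B0 : 0 <= 2 `^ b by rewrite powR_ge0.
have AB : 0 <= 2 `^ a * 2 `^ b by rewrite mulr_ge0.
have k1 := ler_wpM2l A0 h1; have k2 := ler_wpM2l B0 h2.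
have k3 := mulr_ge0 B0 h3; have k4 := mulr_ge0 A0 h4.
have ia : 0 <= 2 `^ a * 2 `^ b / a by rewrite mulr_ge0 ?invr_ge0 ?ltW.
have ib : 0 <= 2 `^ a * 2 `^ b / b by rewrite mulr_ge0 ?invr_ge0 ?ltW.
rewrite /jH mulrDr.
move: k1 k2; rewrite !mulrA [2 `^ b * 2 `^ a]mulrC => k1 k2.
move: k3 k4; rewrite !mulrA => k3 k4.
lra.
Qed.

Lemma oo_bigcup : `]-1, 1[%classic = \bigcup_i `[-1 + i.+2%:R^-1, 1 - i.+2%:R^-1]%classic :> set R.
Proof.
apply/seteqP; split => x /=; rewrite ?in_itv /=.
  move=> /andP[x1 x2]; have p1 : 0 < 1 - x by rewrite subr_gt0.
  have p2 : 0 < 1 + x by rewrite addrC -ltrBlDr sub0r.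
  pose N := Num.bound ((1 - x)^-1 + (1 + x)^-1).
  have i1 : 0 < (1 - x)^-1 by rewrite invr_gt0.
  have i2 : 0 < (1 + x)^-1 by rewrite invr_gt0.
  have hN : (1 - x)^-1 + (1 + x)^-1 < N.+2%:R.
    apply: lt_le_trans (archi_boundP (ltW (addr_gt0 i1 i2))) _.
    by rewrite ler_nat -/N; lia.
  have n0 : 0 < N.+2%:R :> R by rewrite ltr0n.
  exists N => //=; rewrite in_itv /=; apply/andP; split.
    rewrite -lerBrDl opprK [x + 1]addrC.
    by rewrite -[1 + x]invrK lef_pV2 ?posrE //; lra.
  rewrite lerBrDr -lerBrDl.
  by rewrite -[1 - x]invrK lef_pV2 ?posrE //; lra.
case=> i _ /=; rewrite in_itv /= => /andP[h1 h2].
have p : 0 < i.+2%:R^-1 :> R by rewrite invr_gt0 ltr0n.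
by move: (i.+2%:R^-1) p h1 h2 => e p h1 h2; apply/andP; split; lra.
Qed.

(** Monotone convergence along compact subintervals: the weight may blow up at both ends, but the
    increments of [jH] are bounded there. *)
Lemma jw_integral_lt : (\int[mu]_(x in `](-1)%R, 1%R[) (jw x)%:E < +oo)%E.
Proof.
pose F i := `[-1 + i.+2%:R^-1, 1 - i.+2%:R^-1]%classic : set R.
have e_gt i : 0 < i.+2%:R^-1 :> R by rewrite invr_gt0 ltr0n.
have e_lt i : i.+2%:R^-1 <= 2^-1 :> R by rewrite lef_pV2 ?posrE ?ltr0n // ler_nat.
have ndF : nondecreasing_seq F.
  apply/nondecreasing_seqP => i; rewrite subsetEset; apply: subset_itv; rewrite bnd_simp.
    by rewrite lerD2l lef_pV2 ?posrE ?ltr0n // ler_nat.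
  by rewrite lerD2l lerN2 lef_pV2 ?posrE ?ltr0n // ler_nat.
have cv : ((\int[mu]_(x in F i) (jw x)%:E) @[i --> \oo] --> \int[mu]_(x in \bigcup_i F i) (jw x)%:E)%E.
  apply: ge0_nondecreasing_set_cvg_integral => // i; first by exact: measurable_itv.
    by apply/measurable_EFinP; apply: measurable_jw; exact: measurable_itv.
  by move=> x _; rewrite lee_fin jw_ge0.
rewrite oo_bigcup -/F -(cvg_lim _ cv) //.
apply: (@le_lt_trans _ _ (2 `^ a * 2 `^ b * (a^-1 + b^-1))%:E); last exact: ltry.
apply: lime_le; first by apply/cvg_ex; eexists; exact: cv.
near=> i.
have h1 : -1 < -1 + i.+2%:R^-1 :> R by rewrite ltrDl.
have h2 : 1 - i.+2%:R^-1 < 1 :> R by rewrite ltrBlDr ltrDl.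
have h3 : -1 + i.+2%:R^-1 < 1 - i.+2%:R^-1 :> R.
  by apply: (@le_lt_trans _ _ (-1 + 2^-1)); [rewrite lerD2l|apply: (@lt_le_trans _ _ (1 - 2^-1)); [lra|rewrite lerD2l lerN2]].
apply: (le_trans (jw_integral_le h1 h3 h2)).
by rewrite lee_fin; exact: jH_bound.
Unshelve. all: by end_near. Qed.

Lemma jw_integrable : mu.-integrable `[-1, 1] (EFin \o jw).
Proof.
apply/integrableP; split; first by apply/measurable_EFinP; exact: measurable_jw.
rewrite (integral_itv_bndoo); last first.
  by apply: measurableT_comp => //; apply/measurable_EFinP; exact: measurable_jw.
apply: le_lt_trans jw_integral_lt; apply: ge0_le_integral => //.
- by apply: measurableT_comp => //; apply/measurable_EFinP; exact: measurable_jw.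
- by apply/measurable_EFinP; exact: measurable_jw.
by move=> x _ /=; rewrite ger0_norm // jw_ge0.
Qed.

Lemma horner_bounded (p : {poly R}) : exists2 B, 0 <= B & forall x, -1 <= x <= 1 -> `|p.[x]| <= B.
Proof.
exists (\sum_(i < size p) `|p`_i|); first by apply: sumr_ge0.
move=> x hx; rewrite horner_coef; apply: le_trans (ler_norm_sum _ _ _) _.
apply: ler_sum => i _; rewrite normrM ler_piMr // normrX exprn_ile1 // ler_norml.
by [].
Qed.

Lemma jint (p : {poly R}) : mu.-integrable `[-1, 1] (EFin \o (fun x => p.[x] * jw x)).
Proof.
have [B B0 hB] := horner_bounded p.
have mp : measurable_fun (`[-1, 1] : set R) (fun x => p.[x] * jw x).
  apply: measurable_funM; last exact: measurable_jw.
  by apply: subspace_continuous_measurable_fun => //; apply: continuous_subspaceT; exact: continuous_horner.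
apply: (@le_integrable _ _ _ mu _ _ _ (EFin \o (fun x => B * jw x))) => //.
- by apply/measurable_EFinP.
- move=> x /=; rewrite in_itv /= => hx; rewrite lee_fin !normrM ler_wpM2r // (ger0_norm B0).
  exact: hB.
by have := integrableZl _ B jw_integrable; apply.
Qed.

Definition jL (p : {poly R}) : R := \int[mu]_(x in `[(-1)%R, 1%R]) (p.[x] * jw x).

Lemma jL_is_linear : linear_for *%R jL.
Proof.
move=> c p q; rewrite /jL -RintegralZl //; last exact: jint.
rewrite -RintegralD //; last first.
- exact: jint.
- by have := integrableZl _ c (jint p); apply.
apply: eq_Rintegral => x _; rewrite hornerD hornerZ mulrDl; congr (_ + _).
exact/esym/mulrA.
Qed.
HB.instance Definition _ := GRing.isLinear.Build R {poly R} R *%R jL jL_is_linear.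

Lemma jLE p : (\int[mu]_(x in `[(-1)%R, 1%R]) (p.[x] * jw x)%:E = (jL p)%:E)%E.
Proof. by rewrite /jL /Rintegral fineK //; apply: integrable_fin_num; [|exact: jint]. Qed.

Lemma jL_bound p (e : R) : (forall x, -1 <= x <= 1 -> `|p.[x]| <= e) -> `|jL p| <= e * jL 1.
Proof.
move=> h; apply: le_trans (le_normr_Rintegral _ _) _ => //; first exact: jint.
have -> : e * jL 1 = jL e%:P by rewrite -[e%:P]mulr1 mul_polyC linearZ.
apply: le_Rintegral => //.
- by apply: integrable_norm; exact: jint.
- exact: jint.
move=> x /=; rewrite in_itv /= => hx; rewrite normrM hornerC (ger0_norm (jw_ge0 x)) ler_wpM2r ?jw_ge0 //.
exact: h.
Qed.

Lemma jL_ge0 p : (forall x, -1 <= x <= 1 -> 0 <= p.[x]) -> 0 <= jL p.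
Proof.
move=> h; apply: Rintegral_ge0 => x /=; rewrite in_itv /= => hx.
by rewrite mulr_ge0 ?jw_ge0 // h.
Qed.

(** If the integral were zero, the integrand would vanish almost everywhere. As the weight is
    positive inside, the open interval would be covered by a null set and the finitely many roots of
    [p]. *)
Lemma jL_sq_gt0 p : p != 0 -> 0 < jL (p * p).
Proof.
move=> p0; rewrite lt_def jL_ge0 ?andbT => [|x _]; last by rewrite hornerM -expr2 sqr_ge0.
apply/eqP => L0.
have : (\int[mu]_(x in `[(-1)%R, 1%R]) `|(((p * p).[x] * jw x)%:E)| = 0)%E.
  rewrite -[RHS]/(0%:E) -L0 -jLE; apply: eq_integral => x _.
  by rewrite gee0_abs // lee_fin mulr_ge0 ?jw_ge0 // hornerM -expr2 sqr_ge0.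
move/ae_eq_integral_abs => /(_ _ _)[//| |].
  by apply/measurable_EFinP; have /integrableP[/measurable_EFinP] := jint (p * p).
move=> N [mN N0 hN].
have rts : finite_set [set x | x \in polyrcf.rootsR p] by exact: finite_seq.
have nul : mu.-negligible (N `|` [set x | x \in polyrcf.rootsR p]).
  apply: negligibleU; first by exists N; split.
  exists [set x | x \in polyrcf.rootsR p]; split => //; first exact: countable_measurable (finite_set_countable rts).
  exact: countable_lebesgue_measure0 (finite_set_countable rts).
have : mu.-negligible (`](-1)%R, 1%R[)%classic.
  apply: negligibleS nul => x /=; rewrite in_itv /= => /andP[x1 x2].
  have [xr|xr] := boolP (x \in polyrcf.rootsR p); [by right|left].
  apply: contrapT => nx.
  have h : `[(-1)%R, 1%R]%classic x -> ((p * p).[x] * jw x)%:E = 0%E.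
    by apply: contrapT => nh; apply: nx; exact: hN.
  have /h[/eqP] : `[(-1)%R, 1%R]%classic x by rewrite /= in_itv /= !ltW.
   rewrite mulf_eq0 hornerM mulf_eq0 orbb => /orP[px|].
    by move: xr; rewrite (polyrcf.root_roots_on (polyrcf.roots_on_rootsR p0)) // in_itv.
  by rewrite mulf_eq0 !powR_eq0 subr_eq0 addr_eq0 [1 == x]gt_eqF // [1 == - x]gt_eqF // ltrNl.
move=> [B [mB B0 sub]].
have mI : measurable (`](-1)%R, 1%R[%classic : set (measurableTypeR R)) := measurable_itv _.
have mono (A A' : set (measurableTypeR R)) : measurable A -> measurable A' ->
    (A `<=` A')%classic -> (mu A <= mu A')%E.
  by move=> mA mA' s; apply: le_measure => //; exact: mem_set.
have := mono _ _ mI mB sub.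
have -> : mu B = 0%E by exact: B0.
rewrite lebesgue_measure_itv /= lte_fin.
have -> : (-1 < 1 :> R) by lra.
by rewrite -EFinB lee_fin; lra.
Qed.

Lemma powRm_cvg (c : R) : 0 < c -> (1 - x) `^ c @[x --> 1^'-] --> (0 : R).
Proof.
move=> c0 A /(powR_cvg0 c0) hA.
have h1 := is_derive_continuous (is_derive_1m 1).
have : nbhs (1 - 1 : R) [set u | 0 < u -> A (u `^ c)].
  by rewrite subrr; exact: hA.
move/h1 => hB; have {}hB : \forall u \near (1 : R), 0 < 1 - u -> A ((1 - u) `^ c) := hB.
have : \forall u \near (1 : R), u < 1 -> A ((1 - u) `^ c).
  near=> u; move=> u1; have : 0 < 1 - u -> A ((1 - u) `^ c) by near: u.
  by apply; rewrite subr_gt0.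
by [].
Unshelve. all: by end_near. Qed.

Lemma powRp_cvg (c : R) : 0 < c -> (1 + x) `^ c @[x --> (-1)^'+] --> (0 : R).
Proof.
move=> c0 A /(powR_cvg0 c0) hA.
have h1 := is_derive_continuous (is_derive_1p (-1)).
have : nbhs (1 + -1 : R) [set u | 0 < u -> A (u `^ c)].
  by rewrite subrr; exact: hA.
move/h1 => hB; have {}hB : \forall u \near (-1 : R), 0 < 1 + u -> A ((1 + u) `^ c) := hB.
have : \forall u \near (-1 : R), -1 < u -> A ((1 + u) `^ c).
  near=> u; move=> u1; have : 0 < 1 + u -> A ((1 + u) `^ c) by near: u.
  by apply; rewrite -ltrBlDl sub0r.
by [].
Unshelve. all: by end_near. Qed.

(** The integral of an exact derivative; the boundary terms vanish because [al + 1] and [be + 1] are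
    positive. The integrand may be unbounded at the endpoints, so the mean value theorem is applied
    to the running integral minus the primitive, which is continuous on the closed interval. *)
Lemma jL_jop r : jL (jop r) = 0.
Proof.
pose g x := (jop r).[x] * jw x.
pose G x := (1 - x) `^ a * (1 + x) `^ b * r.[x].
pose F x := \int[mu]_(t in `[(-1)%R, x]) g t.
have gi : mu.-integrable `[(-1)%R, 1%R] (EFin \o g) by exact: jint.
have gc (x : R) : -1 < x < 1 -> {for x, continuous g}.
  move=> /andP[x1 x2]; apply: continuousM; first exact: continuous_horner.
  apply: continuousM.
    exact: is_derive_continuous (is_derive_powRm al x2).
  exact: is_derive_continuous (is_derive_powRp be x1).
have Fd (x : R) : -1 < x < 1 -> is_derive x 1 F (g x).
  move=> /andP[x1 x2].
  have hx : -1 < x < 1 by rewrite x1.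
  have [d e] := continuous_FTC1_closed x2 gi x1 (gc x hx).
  by apply: DeriveDef; [exact: d|rewrite -derive1E; exact: e].
have n11 : -1 < 1 :> R by lra.
have [c _] : exists2 c : R, c \in `]-1, 1[%R & (F 1 - G 1) - (F (-1) - G (-1)) = 0 * (1 - -1).
  apply: (@MVT R (fun x => F x - G x) (fun=> 0)) => //.
    move=> x; rewrite in_itv /= => hx.
    by rewrite -(subrr (g x)); apply: is_deriveB; [exact: Fd|exact: is_derive_jw].
  have cF := parameterized_integral_continuous (ltW n11) gi.
  have cG : {within `[(-1)%R, 1%R], continuous G}.
    apply/(continuous_within_itvP _ n11); split.
    - move=> x; rewrite in_itv /= => hx; exact: is_derive_continuous (is_derive_jw r hx).
    - have -> : G (-1) = (1 - -1) `^ a * 0 * r.[-1] by rewrite /G subrr powR0 ?gt_eqF ?be1_gt0.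
      apply: cvgM; last exact: cvg_at_right_filter (@continuous_horner _ r (-1)).
      apply: cvgM; last exact: powRp_cvg be1_gt0.
      by apply: cvg_at_right_filter; apply: is_derive_continuous (is_derive_powRm a _).
    - have -> : G 1 = 0 * (1 + 1) `^ b * r.[1] by rewrite /G subrr powR0 ?gt_eqF ?al1_gt0.
      apply: cvgM; last exact: cvg_at_left_filter (@continuous_horner _ r 1).
      apply: cvgM; first exact: powRm_cvg al1_gt0.
      by apply: cvg_at_left_filter; apply: is_derive_continuous (is_derive_powRp b _).
  move=> x; apply: cvgB; [exact: cF|exact: cG].
rewrite mul0r => /eqP; rewrite subr_eq0 => /eqP.
have -> : F (-1) = 0 by rewrite /F set_itv1 Rintegral_set1.
have G1 : G 1 = 0 by rewrite /G subrr powR0 ?gt_eqF ?al1_gt0 // !mul0r.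
have G2 : G (-1) = 0 by rewrite /G addrN [0 `^ b]powR0 ?gt_eqF ?be1_gt0 // mulr0 mul0r.
by rewrite G1 G2 !subr0.
Qed.

End JacobiWeight.

Section JacobiPolynomials.
Variables (R : realType) (al be : R).
Hypotheses (al1 : -1 < al) (be1 : -1 < be).

Local Notation L := (jL al be).
Local Notation sg := (al + be + 1).

Definition jev (n : nat) : R := n%:R * (n%:R + sg).

Lemma jevB m n : jev m - jev n = (m%:R - n%:R) * (m%:R + n%:R + sg).
Proof. by rewrite /jev; ring. Qed.

Lemma jev_inj m n : jev m = jev n -> m = n.
Proof.
wlog mn : m n / (m <= n)%N.
  by move=> h e; case: (leqP m n) => [/h|/ltnW /h] -> //.
move/eqP; rewrite -subr_eq0 jevB mulf_eq0 => /orP[|/eqP e].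
  by rewrite subr_eq0 eqr_nat => /eqP.
case: n mn e => [|n] mn e; first by lia.
have h : 0 <= (m + n)%:R :> R by rewrite ler0n.
exfalso; move: e h al1 be1; rewrite -[n.+1%:R]natr1 natrD.
by move: (m%:R : R) (n%:R : R) => x y; lra.
Qed.

Definition jD (q : {poly R}) : {poly R} := jop al be q^`().

Lemma jD_is_linear : linear jD.
Proof.
by move=> c p q; rewrite /jD /jop !derivD !derivZ -!mul_polyC; ring.
Qed.

HB.instance Definition _ := GRing.isLinear.Build R {poly R} {poly R} *:%R jD jD_is_linear.

(** The difference of the two sides is [jop] of the Wronskian of [p] and [q]. *)
Lemma jL_jD_sym p q : L (jD p * q) = L (p * jD q).
Proof.
apply/eqP; rewrite -subr_eq0 -linearB /= -(jL_jop al1 be1 (p^`() * q - p * q^`())).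
by apply/eqP; congr (jL _ _ _); rewrite /jD /jop !(derivB, derivM); ring.
Qed.

Local Notation u := ('X - 1 : {poly R}).

(** The coefficients of the hypergeometric series [2F1(-n, n + al + be + 1; al + 1; (1 - x) / 2)] in
    powers of [x - 1]. In this form each is a polynomial of degree [r] in [jev n], as [det_taylor]
    requires. *)
Definition jcoef (n r : nat) : R :=
  \prod_(s < r) ((jev n - jev s) / (2 * s.+1%:R * (s.+1%:R + al))).

Lemma jD_exp r : jD (u ^+ r) = - (jev r *: u ^+ r) - (2 * r%:R * (r%:R + al)) *: u ^+ r.-1.
Proof.
have du : (u : {poly R})^`() = 1 by rewrite derivB derivX derivC subr0.
case: r => [|r].
  by rewrite expr0 /jev !mulr0 !mul0r !scale0r oppr0 addr0 /jD /jop -[1 in LHS]/(1%:P) !derivC !mulr0 addr0.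
rewrite /jD /jop deriv_exp du mul1r derivMn /=.
case: r => [|r].
  rewrite expr0 expr1 mulr1n -[1]/(1%:P) derivC /jev.
  rewrite -!mul_polyC !(polyCD, polyCB, polyCM); ring.
rewrite deriv_exp du mul1r /= !exprS -!mul_polyC /jev -(mulr_natl _ r.+1) -2!(mulr_natl _ r.+2).
rewrite -[r.+2]addn2 -[r.+1]addn1 !natrD !(polyCD, polyCB, polyCM, polyC_natr); ring.
Qed.

Definition jnorm (n : nat) : R := \prod_(i < n) ((al + i.+1%:R) / i.+1%:R).

Lemma jnorm_gt0 n : 0 < jnorm n.
Proof.
apply: prodr_gt0 => i _; rewrite divr_gt0 ?ltr0Sn //.
have : 1 <= i.+1%:R :> R by rewrite ler1n.
by move: al1; lra.
Qed.

Definition jpol (n : nat) : {poly R} := jnorm n *: \sum_(r < n.+1) jcoef n r *: u ^+ r.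

Lemma jcoefS n r : jcoef n r.+1 * (2 * r.+1%:R * (r.+1%:R + al)) = (jev n - jev r) * jcoef n r.
Proof.
rewrite /jcoef big_ord_recr /= mulrC mulrCA [RHS]mulrC.
have h : r.+1%:R + al != 0.
  have : 1 <= r.+1%:R :> R by rewrite ler1n.
  by move=> h; rewrite gt_eqF //; move: al1; lra.
by congr (_ * _); rewrite mulrC divfK // !mulf_neq0 // pnatr_eq0.
Qed.

Lemma jcoef_neq0 n : jcoef n n != 0.
Proof.
apply/prodf_neq0 => s _; rewrite mulf_neq0 ?invr_eq0 ?mulf_neq0 ?pnatr_eq0 //.
  by rewrite subr_eq0; apply/eqP => /jev_inj e; move: (ltn_ord s); rewrite -e ltnn.
have : 1 <= s.+1%:R :> R by rewrite ler1n.
by move=> h; rewrite gt_eqF //; move: al1; lra.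
Qed.

Lemma jpol_eigen n : jD (jpol n) = - jev n *: jpol n.
Proof.
rewrite /jpol linearZ /= scalerA mulrC -scalerA; congr (_ *: _).
rewrite linear_sum /= scaler_sumr.
under eq_bigr do rewrite linearZ /= jD_exp scalerBr scalerN !scalerA.
rewrite sumrB [X in _ - X]big_ord_recl /= mulr0 mul0r mulr0 scale0r add0r.
under [X in _ - X]eq_bigr do rewrite /bump /= add1n.
have -> : \sum_(i < n) (jcoef n i.+1 * (2 * i.+1%:R * (i.+1%:R + al))) *: u ^+ i =
          \sum_(i < n.+1) ((jev n - jev i) * jcoef n i) *: u ^+ i.
  rewrite [RHS]big_ord_recr /= subrr mul0r scale0r addr0.
  by apply: eq_bigr => i _; rewrite jcoefS.
rewrite -sumrB; apply: eq_bigr => i _.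
by rewrite scalerA -scaleNr -scalerBl; congr (_ *: _); ring.
Qed.

Lemma size_jpol n : size (jpol n) = n.+1.
Proof.
rewrite /jpol size_scale ?gt_eqF ?jnorm_gt0 // big_ord_recr /= addrC.
have h : size (jcoef n n *: u ^+ n) = n.+1.
  by rewrite size_scale ?jcoef_neq0 // -[1]/(1%:P) size_exp_XsubC.
rewrite size_polyDl // h ltnS; apply: (leq_trans (size_sum _ _ _)); apply/bigmax_leqP => i _.
by rewrite (leq_trans (size_scale_leq _ _)) // -[1]/(1%:P) size_exp_XsubC.
Qed.

Lemma jpol1 n : (jpol n).[1] = jnorm n.
Proof.
rewrite hornerZ horner_sum big_ord_recl big1 ?addr0 => [|i _].
  by rewrite /jcoef big_ord0 expr0 scale1r hornerC mulr1.
by rewrite hornerZ horner_exp !hornerE subrr expr0n mulr0.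
Qed.

Lemma jpol_span n (q : {poly R}) : (size q <= n)%N ->
  exists c : nat -> R, q = \sum_(m < n) c m *: jpol m.
Proof.
elim: n q => [|n IH] q hq.
  by exists (fun=> 0); rewrite big_ord0; apply/eqP; rewrite -size_poly_eq0 -leqn0.
have ln : (jpol n)`_n != 0 by rewrite -[n in _`_n]/(n.+1.-1) -(size_jpol n) lead_coef_eq0 -size_poly_eq0 size_jpol.
have [|c hc] := IH (q - (q`_n / (jpol n)`_n) *: jpol n).
  apply/leq_sizeP => j; rewrite leq_eqVlt => /orP[/eqP <-|nj].
    by rewrite coefB coefZ divfK ?subrr.
  have h : (jpol n)`_j = 0 by rewrite nth_default ?size_jpol.
    by rewrite coefB coefZ h (nth_default _ (leq_trans hq nj)) mulr0 subr0.
exists (fun m => if m == n then q`_n / (jpol n)`_n else c m).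
rewrite big_ord_recr /= eqxx -[LHS](subrK ((q`_n / (jpol n)`_n) *: jpol n)) hc.
congr (_ + _); apply: eq_bigr => i _.
by rewrite (ltn_eqF (ltn_ord i)).
Qed.

Lemma jpol_orth m n : m != n -> L (jpol m * jpol n) = 0.
Proof.
move=> mn; have := jL_jD_sym (jpol m) (jpol n).
rewrite !jpol_eigen; move: (jpol m) (jpol n) => P Q.
move: (jev m) (jev n) (@jev_inj m n) => a b inj.
rewrite -scalerAl -scalerAr !linearZ /= => /eqP.
rewrite -subr_eq0 -mulrBl mulf_eq0 => /orP[|/eqP //].
by rewrite opprK addrC subr_eq0 => /eqP/esym/inj e; rewrite e eqxx in mn.
Qed.

Lemma jpol_orth_size n (q : {poly R}) : (size q <= n)%N -> L (jpol n * q) = 0.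
Proof.
move=> /jpol_span[c ->]; rewrite mulr_sumr linear_sum big1 //= => i _.
rewrite -scalerAr linearZ /= jpol_orth ?mulr0 //.
by rewrite gtn_eqF.
Qed.

Lemma is_jacobiP n p : is_jacobi al be n p <->
  [/\ size p = n.+1, forall q : {poly R}, (size q <= n)%N -> L (p * q) = 0 & p.[1] = jnorm n].
Proof.
have e (q : {poly R}) : (\int[lebesgue_measure]_(x in `[(-1)%R, 1%R])
    (p.[x] * q.[x] * (1 - x) `^ al * (1 + x) `^ be)%:E = (L (p * q))%:E)%E.
  rewrite -jLE //; apply: eq_integral => x _.
  by rewrite hornerM /jw mulrA.
split=> -[h1 h2 h3]; split => // q /h2; last by rewrite e => ->.
by rewrite e => -[].
Qed.

Lemma jpol_jacobi n : is_jacobi al be n (jpol n).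
Proof.
apply/is_jacobiP; split; [exact: size_jpol|exact: jpol_orth_size|exact: jpol1].
Qed.

Lemma is_jacobi_unique n p : is_jacobi al be n p -> p = jpol n.
Proof.
move/is_jacobiP => [sp op p1].
pose c := lead_coef p / lead_coef (jpol n).
have lj : lead_coef (jpol n) != 0 by rewrite lead_coef_eq0 -size_poly_eq0 size_jpol.
pose d := p - c *: jpol n.
have sd : (size d <= n)%N.
  apply/leq_sizeP => j; rewrite leq_eqVlt => /orP[/eqP <-|nj].
    rewrite coefB coefZ; move: (divfK lj (lead_coef p)).
    by rewrite -/c !lead_coefE sp size_jpol /= => ->; rewrite subrr.
  by rewrite coefB coefZ !nth_default ?mulr0 ?subr0 ?size_jpol ?sp.
have d0 : d = 0.
  apply/eqP; apply: contraT => /(jL_sq_gt0 al1 be1); rewrite {1}/d mulrBl linearB /= op //.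
  by rewrite -scalerAl linearZ /= jpol_orth_size // mulr0 subrr ltxx.
have /eqP := d0; rewrite subr_eq0 => /eqP e.
move: p1; rewrite e hornerZ jpol1 => /eqP; rewrite -subr_eq0 -{2}[jnorm n]mul1r -mulrBl mulf_eq0.
by rewrite [jnorm n == 0]gt_eqF ?jnorm_gt0 // orbF subr_eq0 => /eqP ->; rewrite scale1r.
Qed.

Lemma jacobiE n : jacobi al be n = jpol n.
Proof. by apply: is_jacobi_unique; apply: (xgetPex 0); exists (jpol n); exact: jpol_jacobi. Qed.

Lemma jpol_sq_gt0 n : 0 < L (jpol n * jpol n).
Proof. by apply: jL_sq_gt0 => //; rewrite -size_poly_eq0 size_jpol. Qed.

End JacobiPolynomials.

Lemma phi_omega (R : realType) (k : nat) (x : R) : phi (omega R k) x = ((1 + x) / 2) ^+ k.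
Proof.
have cst (f : nat -> R) c : (forall N, (k <= N)%N -> f N = c) -> limn f = c.
  move=> h; apply: cvg_lim => //; apply: cvg_near_cst.
  by near=> N; apply: h; near: N; exists k.
rewrite /phi /ep_gamma /=.
rewrite (cst (fun N => \sum_(0 <= i < N) (0 + (i < k)%:R)) k%:R) => [|N kN]; last first.
  rewrite (big_cat_nat (leq0n k) kN) //= [X in _ + X]big1_seq ?addr0 => [|i /andP[_]]; last first.
    by rewrite mem_index_iota => /andP[ki _]; rewrite ltnNge ki addr0.
  rewrite big_nat_cond (eq_bigr (fun=> 1)) => [|i /andP[/andP[_ ik] _]]; last by rewrite ik add0r.
  by rewrite -big_nat_cond big_const_nat subn0 iter_addr_0.
rewrite subrr mul0r expR0 mul1r; apply: cst => N kN.
rewrite (big_cat_nat (leq0n k) kN) //= [X in _ * X]big1_seq ?mulr1 => [|i /andP[_]]; last first.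
  by rewrite mem_index_iota => /andP[ki _]; rewrite ltnNge ki !mul0r addr0 subr0 divr1.
rewrite big_nat_cond (eq_bigr (fun=> (1 + x) / 2)) => [|i /andP[/andP[_ ik] _]]; last first.
  by rewrite ik /=; field.
by rewrite -big_nat_cond big_const_nat subn0 iter_mulr_1.
Unshelve. all: by end_near. Qed.

(** * Multivariate Jacobi polynomials *)

Section Functionals.
Variables (R : realType) (l : nat).
Implicit Types (p q : mpoly l R) (f : 'I_l -> {poly R} -> R) (u : 'I_l -> {poly R}).

Definition plin (phi : {poly R} -> R) : Prop :=
  forall c (p q : {poly R}), phi (c *: p + q) = c * phi p + phi q.

Lemma plin_sum phi (I : Type) (r : seq I) (P : pred I) (c : I -> R) (p : I -> {poly R}) :
  plin phi -> phi (\sum_(i <- r | P i) c i *: p i) = \sum_(i <- r | P i) c i * phi (p i).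
Proof.
move=> lin; have l0 : phi 0 = 0 by have := lin (-1) 0 0; rewrite scaler0 addr0 mulN1r addNr.
by elim/big_rec2: _ => // i y1 y2 _ <-; rewrite lin.
Qed.

Lemma plin_horner (x : R) : plin (fun p : {poly R} => p.[x]).
Proof. by move=> c p q; rewrite hornerD hornerZ. Qed.

Lemma plin_coef (n : nat) : plin (fun p : {poly R} => p`_n).
Proof. by move=> c p q; rewrite coefD coefZ. Qed.

(** The tensor product of one-variable functionals. Evaluations give [meval], coefficients give
    [mcoeff], and Jacobi integrals give [Phi], so that no integration in several variables is
    needed. *)
Definition mfun f p : R :=
  \sum_(m <- mpoly.msupp p) mpoly.mcoeff m p * \prod_i f i ('X^(m i)).

Lemma msum_sub (c : multinom l -> R) p (r : seq (multinom l)) : uniq r ->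
  {subset mpoly.msupp p <= r} ->
  \sum_(m <- mpoly.msupp p) mpoly.mcoeff m p * c m = \sum_(m <- r) mpoly.mcoeff m p * c m.
Proof.
move=> ur sub; rewrite [RHS](bigID (fun m => m \in mpoly.msupp p)) /=.
rewrite [X in _ + X]big1 ?addr0 => [|m mp]; last by rewrite mpoly.memN_msupp_eq0 ?mul0r.
rewrite -[RHS]big_filter; apply: perm_big; apply: uniq_perm; rewrite ?filter_uniq ?mpoly.msupp_uniq //.
by move=> m; rewrite mem_filter; case: (boolP (m \in mpoly.msupp p)) => //= /sub ->.
Qed.

Lemma mfunE f p (r : seq (multinom l)) : uniq r -> {subset mpoly.msupp p <= r} ->
  mfun f p = \sum_(m <- r) mpoly.mcoeff m p * \prod_i f i ('X^(m i)).
Proof. exact: msum_sub. Qed.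

Lemma mfun_lin f c p q : mfun f (c *: p + q) = c * mfun f p + mfun f q.
Proof.
pose r := undup (mpoly.msupp p ++ mpoly.msupp q ++ mpoly.msupp (c *: p + q)).
have ur : uniq r by rewrite undup_uniq.
rewrite !(@mfunE f _ r) // => [|m mp|m mp|m mp]; rewrite ?mem_undup ?mem_cat ?mp ?orbT //.
rewrite mulr_sumr -big_split /=; apply: eq_bigr => m _.
by rewrite mpoly.mcoeffD mpoly.mcoeffZ mulrDl mulrA.
Qed.

Lemma mfun0 f : mfun f 0 = 0.
Proof. by rewrite /mfun mpoly.msupp0 big_nil. Qed.

Lemma mfunZ f c p : mfun f (c *: p) = c * mfun f p.
Proof. by have := mfun_lin f c p 0; rewrite mfun0 !addr0. Qed.

Lemma mfunD f p q : mfun f (p + q) = mfun f p + mfun f q.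
Proof. by have := mfun_lin f 1 p q; rewrite scale1r mul1r. Qed.

Lemma mfunB f p q : mfun f (p - q) = mfun f p - mfun f q.
Proof. by rewrite mfunD -scaleN1r mfunZ mulN1r. Qed.

Lemma mfun_sum f (I : Type) (r : seq I) (P : pred I) (F : I -> mpoly l R) :
  mfun f (\sum_(i <- r | P i) F i) = \sum_(i <- r | P i) mfun f (F i).
Proof. by elim/big_rec2: _ => [|i y1 y2 _ <-]; rewrite ?mfun0 ?mfunD. Qed.

Lemma mfunX f m : mfun f (mpolyX R m) = \prod_i f i ('X^(m i)).
Proof. by rewrite /mfun mpoly.msuppX big_seq1 mpoly.mcoeffX eqxx mul1r. Qed.

Lemma mfun_meval (x : 'I_l -> R) p : mfun (fun i r => r.[x i]) p = meval x p.
Proof.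
by rewrite mpoly.mevalE; apply: eq_bigr => m _; congr (_ * _); apply: eq_bigr => i _; rewrite hornerXn.
Qed.

Lemma mfun_mcoeff (m : multinom l) p : mfun (fun i r => r`_(m i)) p = mpoly.mcoeff m p.
Proof.
pose r := undup (m :: mpoly.msupp p).
rewrite (@mfunE _ _ r) ?undup_uniq // => [|m' h]; last by rewrite mem_undup inE h orbT.
rewrite (bigD1_seq m) ?undup_uniq ?mem_undup ?inE ?eqxx //=.
rewrite big1 ?mulr1 => [|i _]; last by rewrite coefXn eqxx.
rewrite big1 ?addr0 // => m' /eqP mm'.
have [i hi] : exists i, m' i != m i.
  apply: contrapT => h; apply: mm'; apply/mpoly.mnmP => i.
  by apply/eqP; apply: contrapT => /negP hi; apply: h; exists i.
by rewrite (bigD1 i) //= coefXn eq_sym (negbTE hi) mul0r mulr0.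
Qed.

Definition upd (T : Type) (u : 'I_l -> T) (i : 'I_l) (v : T) (j : 'I_l) : T :=
  if j == i then v else u j.

Lemma upd_id (T : Type) (u : 'I_l -> T) i : upd u i (u i) = u.
Proof. by apply/funext => j; rewrite /upd; case: eqP => [->|]. Qed.

Lemma mfun_slice f i p : exists s : {poly R}, forall psi, plin psi -> psi s = mfun (upd f i psi) p.
Proof.
exists (\sum_(m <- mpoly.msupp p) (mpoly.mcoeff m p * \prod_(j | j != i) f j ('X^(m j))) *: 'X^(m i)).
move=> psi lin; rewrite plin_sum //; apply: eq_bigr => m _.
rewrite -mulrA; congr (_ * _); rewrite [RHS](bigD1 i) //= mulrC /upd eqxx; congr (_ * _).
by apply: eq_bigr => j /negbTE ->.
Qed.

(** One variable is changed from class [A] to class [B] at a time, the others being frozen by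
    [mfun_slice]; [e] records the loss at each change. With zero bounds it turns separation
    properties in one variable into separation in several. *)
Lemma mfun_transfer (A B : ({poly R} -> R) -> Prop) (e : nat -> R) p :
  (forall phi, A phi -> plin phi) -> (forall phi, B phi -> plin phi) ->
  (forall j (s : {poly R}), (forall phi, A phi -> `|phi s| <= e j) ->
     forall psi, B psi -> `|psi s| <= e j.+1) ->
  (forall f, (forall i, A (f i)) -> `|mfun f p| <= e 0%N) ->
  forall f, (forall i, B (f i)) -> `|mfun f p| <= e l.
Proof.
move=> linA linB H h0 f hf.
suff main (j : nat) : (j <= l)%N -> forall f : 'I_l -> {poly R} -> R,
    (forall i : 'I_l, if (i < j)%N then B (f i) else A (f i)) -> `|mfun f p| <= e j.
  by apply: (main l) => // i; rewrite ltn_ord.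
elim: j => [|j IH] jl g hg; first exact: h0.
have [s hs] := mfun_slice g (Ordinal jl) p.
have Bj : B (g (Ordinal jl)) by have := hg (Ordinal jl); rewrite /= ltnSn.
rewrite -[g](upd_id g (Ordinal jl)) -hs; last exact: linB.
apply: H Bj => phi Aphi; rewrite hs; last exact: linA.
apply: IH; first exact: ltnW.
move=> i; rewrite /upd; case: eqP => [->|ne] /=; first by rewrite ltnn.
by have := hg i; rewrite ltnS leq_eqVlt (_ : (nat_of_ord i == j) = false) //; apply/eqP => e1; apply: ne; apply: val_inj.
Qed.

Lemma mpoly_eq0_gt1 p : (forall x : 'I_l -> R, (forall i, 1 < x i) -> meval x p = 0) -> p = 0.
Proof.
move=> h; apply/mpoly.mpolyP => m; rewrite mpoly.mcoeff0 -mfun_mcoeff; apply/normr0_eq0/le_anti.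
rewrite normr_ge0 andbT.
pose A (phi : {poly R} -> R) := exists2 x : R, 1 < x & phi = fun r => r.[x].
pose B (phi : {poly R} -> R) := exists n, phi = fun r => r`_n.
apply: (@mfun_transfer A B (fun=> 0) p).
- by move=> phi [x _ ->]; exact: plin_horner.
- by move=> phi [n ->]; exact: plin_coef.
- move=> _ s hs psi [n ->]; suff -> : s = 0 by rewrite coef0 normr0.
  apply: (@roots_geq_poly_eq0 R s [seq i.+2%:R | i <- iota 0 (size s)]).
  + apply/allP => x /mapP[i _ ->]; rewrite /root -normr_le0.
    by apply: (hs (fun r => r.[i.+2%:R])); exists i.+2%:R; rewrite // ltr1n.
  + by rewrite map_inj_uniq ?iota_uniq // => i j /eqP; rewrite eqr_nat => /eqP[].
  + by rewrite size_map size_iota.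
- move=> f hf; have /choice[x hx] : forall i, exists x : R, 1 < x /\ f i = fun r => r.[x].
    by move=> i; have [x x1 e] := hf i; exists x.
  have -> : f = fun i r => r.[x i] by apply/funext => i; have [_ ->] := hx i.
  by rewrite mfun_meval h ?normr0 // => i; have [] := hx i.
- by move=> i; exists (m i).
Qed.

Definition emb (i : 'I_l) (r : {poly R}) : mpoly l R :=
  (map_poly (@mpolyC l R) r).[mpolyX R (mnm1 i)].

Lemma embE i (r : {poly R}) n : (size r <= n)%N -> emb i r = \sum_(j < n) r`_j *: mpolyX R (mnm1 i) ^+ j.
Proof.
move=> sr; rewrite /emb (horner_coef_wide _ (_ : size _ <= n)%N); last first.
  exact: leq_trans (size_poly _ _) sr.
by apply: eq_bigr => j _; rewrite coef_map mpoly.mul_mpolyC.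
Qed.

Lemma embM i r s : emb i (r * s) = emb i r * emb i s.
Proof. by rewrite /emb rmorphM hornerM. Qed.

Lemma embD i r s : emb i (r + s) = emb i r + emb i s.
Proof. by rewrite /emb rmorphD hornerD. Qed.

Lemma embX i : emb i 'X = mpolyX R (mnm1 i).
Proof. by rewrite /emb map_polyX hornerX. Qed.

Lemma embC i c : emb i c%:P = mpolyC l c.
Proof. by rewrite /emb map_polyC hornerC. Qed.

Lemma emb_exp i r n : emb i (r ^+ n) = emb i r ^+ n.
Proof. by elim: n => [|n IH]; rewrite ?expr0 ?exprS ?embM ?IH // -[1]/(1%:P) embC. Qed.

Lemma embN i r : emb i (- r) = - emb i r.
Proof. by rewrite /emb rmorphN hornerN. Qed.

Lemma meval_emb x i r : meval x (emb i r) = r.[x i].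
Proof.
rewrite (embE i (leqnn _)) (raddf_sum (meval x)) horner_coef; apply: eq_bigr => j _ /=.
by rewrite mpoly.mevalZ rmorphXn /= mpoly.mevalXU.
Qed.

Lemma mderiv_emb i j r : mpoly.mderiv i (emb j r) = if i == j then emb j r^`() else 0.
Proof.
elim/poly_ind: r => [|r c IH].
  by rewrite deriv0 -[0]/(0%:P) embC mpoly.mderivC; case: ifP => //; rewrite mpoly.mpolyC0.
rewrite embD embM embX embC mpoly.mderivD mpoly.mderivC addr0 mpoly.mderivM IH.
rewrite derivD derivM derivX derivC mulr1 addr0 embD embM embX.
have -> : mpoly.mderiv i (mpolyX R (mnm1 j)) = (i == j)%:R.
  rewrite mpoly.mderivX mpoly.mnm1E eq_sym; case: eqP => [->|_]; last by rewrite scale0r.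
  have -> : mpoly.mnm_sub (mnm1 j) (mnm1 j) = mpoly.mnm0 by apply/mpoly.mnmP => k; rewrite mpoly.mnmBE subnn mpoly.mnm0E.
  by rewrite mpoly.mpolyX0 scale1r.
by case: eqP => _; rewrite ?mulr1 // mul0r mulr0 addr0.
Qed.

Definition mprod u : mpoly l R := \prod_i emb i (u i).

Lemma meval_mprod x u : meval x (mprod u) = \prod_i (u i).[x i].
Proof. by rewrite /mprod (rmorph_prod (meval x)); apply: eq_bigr => i _; exact: meval_emb. Qed.

Lemma mprodM u v : mprod u * mprod v = mprod (fun i => u i * v i).
Proof. by rewrite /mprod -big_split; apply: eq_bigr => i _; rewrite embM. Qed.

Lemma mprod_upd u i r : mprod (upd u i r) = emb i r * \prod_(j | j != i) emb j (u j).
Proof.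
rewrite /mprod (bigD1 i) //= /upd eqxx; congr (_ * _).
by apply: eq_bigr => j /negbTE ->.
Qed.

Lemma mderiv_mprod i u : mpoly.mderiv i (mprod u) = mprod (upd u i (u i)^`()).
Proof.
rewrite mprod_upd /mprod (bigD1 i) //= mpoly.mderivM mderiv_emb eqxx.
rewrite [X in _ + X](_ : _ = 0) ?addr0 //.
suff -> : mpoly.mderiv i (\prod_(j < l | j != i) emb j (u j)) = 0 by rewrite mulr0.
elim/big_rec: _ => [|j y ji IH]; first by rewrite -[1](mpoly.mpolyC1 l) mpoly.mderivC.
by rewrite mpoly.mderivM IH mulr0 addr0 mderiv_emb eq_sym (negbTE ji) mul0r.
Qed.

Lemma mpolyX_mprod (m : multinom l) : mpolyX R m = mprod (fun i => 'X^(m i)).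
Proof. by rewrite mpoly.mpolyXE_id; apply: eq_bigr => i _; rewrite emb_exp embX. Qed.

Lemma mfun_mprod f u : (forall i, plin (f i)) -> mfun f (mprod u) = \prod_i f i (u i).
Proof.
move=> lin; pose N := \max_i size (u i).
have sN i : (size (u i) <= N)%N by exact: (leq_bigmax i).
rewrite /mprod; under eq_bigr do rewrite (embE _ (sN _)).
rewrite bigA_distr_bigA mfun_sum.
transitivity (\prod_i \sum_(j < N) (u i)`_j * f i 'X^j); last first.
  apply: eq_bigr => i _; rewrite -plin_sum //; congr (f i _).
  apply/polyP => k; rewrite coef_sum; case: (ltnP k N) => kN; last first.
    rewrite (nth_default _ (leq_trans (sN i) kN)) big1 // => j _.
    by rewrite coefZ coefXn gtn_eqF ?mulr0 // (leq_trans (ltn_ord j)).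
  rewrite (bigD1 (Ordinal kN)) //= coefZ coefXn eqxx mulr1 big1 ?addr0 // => j jk.
  by rewrite coefZ coefXn eq_sym (_ : (nat_of_ord j == k) = false) ?mulr0 //; apply/eqP => e; case/eqP: jk; apply: val_inj.
rewrite bigA_distr_bigA; apply: eq_bigr => g _.
rewrite scaler_prod mfunZ big_split; congr (_ * _).
pose m := mpoly.Multinom [tuple (g i : nat) | i < l].
have -> : \prod_(i < l) mpolyX R (mnm1 i) ^+ g i = mpolyX R m.
  by rewrite mpoly.mpolyXE_id; apply: eq_bigr => i _; rewrite mpoly.mnmE.
by rewrite mfunX; apply: eq_bigr => i _; rewrite mpoly.mnmE.
Qed.

End Functionals.

Section VandermondeQuotient.
Variables (A : comNzRingType) (l : nat).

Definition vdm (a : 'I_l -> A) : A := \prod_(i < l) \prod_(j < l | (i < j)%N) (a i - a j).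

(** Negating the nodes reverses every difference, which accounts for the order [a i - a j] with
    [i < j]. *)
Lemma vdmE a : vdm a = \det (\matrix_(i < l, k < l) (- a i) ^+ k).
Proof.
have := det_Vandermonde (\row_(i < l) - a i); rewrite -det_tr.
rewrite (_ : (Vandermonde _ _)^T = \matrix_(i < l, k < l) (- a i) ^+ k).
  by move=> ->; apply: eq_bigr => i _; apply: eq_bigr => j _; rewrite !mxE opprK addrC.
by apply/matrixP => i j; rewrite !mxE.
Qed.

Lemma det_horner_small (p : 'I_l -> {poly A}) a : (forall j, size (p j) <= l)%N ->
  \det (\matrix_(i, j) (p j).[a i]) = vdm a * \det (\matrix_(k < l, j < l) ((-1) ^+ k * (p j)`_k)).
Proof.
move=> sp; rewrite vdmE -det_mulmx; congr (\det _); apply/matrixP => i j; rewrite !mxE.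
rewrite (horner_coef_wide _ (sp j)); apply: eq_bigr => k _; rewrite !mxE.
by rewrite mulrA -exprMn mulrN1 opprK mulrC.
Qed.

Lemma det_horner_tri (p : 'I_l -> {poly A}) a : (forall j : 'I_l, size (p j) <= j.+1)%N ->
  \det (\matrix_(i, j) (p j).[a i]) = vdm a * \prod_(j < l) ((-1) ^+ j * (p j)`_j).
Proof.
move=> sp; rewrite det_horner_small => [|j]; last exact: leq_trans (sp j) _.
congr (_ * _); rewrite -det_tr det_trig.
  by apply: eq_bigr => j _; rewrite !mxE.
apply/is_trig_mxP => i j ij; rewrite !mxE nth_default ?mulr0 //.
exact: leq_trans (sp i) _.
Qed.

(* Euclidean division by [\prod_i ('X - a i)] does not change the values at the
   points [a i]. *)
Lemma det_horner_rem (p : 'I_l -> {poly A}) a : exists q r : 'I_l -> {poly A},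
  [/\ forall j, p j = q j * \prod_(i < l) ('X - (a i)%:P) + r j, forall j, (size (r j) <= l)%N
    & \det (\matrix_(i, j) (p j).[a i]) = vdm a * \det (\matrix_(k < l, j < l) ((-1) ^+ k * (r j)`_k))].
Proof.
pose chi := \prod_(i < l) ('X - (a i)%:P).
have mchi : chi \is monic by exact: monic_prod_XsubC.
pose q j := Pdiv.Ring.rdivp (p j) chi; pose r j := Pdiv.Ring.rmodp (p j) chi.
have e j : p j = q j * chi + r j by exact: Pdiv.RingMonic.rdivp_eq.
have sr j : (size (r j) <= l)%N.
  by have := Pdiv.Ring.ltn_rmodpN0 (p j) (monic_neq0 mchi); rewrite {2}/chi size_prod_XsubC -[index_enum _]/(Finite.enum _) -enumT -cardE card_ord ltnS.
exists q, r; split => //; rewrite -det_horner_small //; congr (\det _); apply/matrixP => i j.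
rewrite !mxE e hornerD hornerM [chi.[_]](_ : _ = 0) ?mulr0 ?add0r //.
by rewrite horner_prod (bigD1 i) //= !hornerE subrr mul0r.
Qed.

End VandermondeQuotient.

Definition jpos (l : nat) (lam : intpart l) (j : 'I_l) : nat := (parts lam j + (l - j.+1))%N.

Lemma jpos_anti (l : nat) (lam : intpart l) (i j : 'I_l) : (i < j)%N -> (jpos lam j < jpos lam i)%N.
Proof.
move=> ij; have := parts_antitone lam (ltnW ij); rewrite /jpos.
by have := ltn_ord j; lia.
Qed.

Lemma jpos_inj (l : nat) (lam : intpart l) : injective (jpos lam).
Proof.
move=> i j e; apply/val_inj; case: (ltngtP i j) => // /(jpos_anti lam); rewrite e ltnn //.
Qed.

Section JacobiQuotient.
Variables (R : realType) (l : nat).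

Lemma vandermonde_vdm : vandermonde_mpoly R l = vdm (fun i : 'I_l => mpolyX R (mnm1 i)).
Proof. by []. Qed.

Lemma meval_vandermonde (x : 'I_l -> R) : meval x (vandermonde_mpoly R l) = vdm x.
Proof.
rewrite (rmorph_prod (meval x)); apply: eq_bigr => i _; rewrite (rmorph_prod (meval x)).
by apply: eq_bigr => j _; rewrite (rmorphB (meval x)) /= !mpoly.mevalXU.
Qed.

Lemma vdm_neq0 (x : 'I_l -> R) : injective x -> vdm x != 0.
Proof.
move=> inj; apply/prodf_neq0 => i _; apply/prodf_neq0 => j ij.
by rewrite subr_eq0; apply/eqP => /inj e; rewrite e ltnn in ij.
Qed.

Lemma vandermonde_neq0 : vandermonde_mpoly R l != 0.
Proof.
apply/eqP => e; have := meval_vandermonde (fun i : 'I_l => i%:R); rewrite e mpoly.meval0.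
move/esym/eqP; apply/negP/vdm_neq0 => i j /eqP; rewrite eqr_nat => /eqP; exact: val_inj.
Qed.

Lemma vandermonde_mprod : vandermonde_mpoly R l =
  \sum_(s : 'S_l) (-1) ^+ s *: mprod (fun i => (- 'X) ^+ s i : {poly R}).
Proof.
rewrite vandermonde_vdm vdmE; apply: eq_bigr => s _; rewrite -mpoly.mul_mpolyC; congr (_ * _).
  by rewrite rmorphXn rmorphN1.
by apply: eq_bigr => i _; rewrite mxE emb_exp embN embX.
Qed.

(** The variables are shifted by 1 so that at the point [(1, ..., 1)] the divisor of
    [det_horner_rem] becomes ['X^l]: the remainders then consist of the first [l] Taylor
    coefficients at 1. *)
Lemma det_emb_quotient (p : 'I_l -> {poly R}) : exists q : mpoly l R,
  \det (\matrix_(i, j) emb i (p j)) = q * vandermonde_mpoly R l /\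
  meval (fun=> 1) q = \det (\matrix_(k < l, j < l) ((-1) ^+ k * (p j \Po ('X + 1))`_k)).
Proof.
pose b (i : 'I_l) : mpoly l R := mpolyX R (mnm1 i) - 1.
pose pt j := map_poly (@mpolyC l R) (p j \Po ('X + 1)).
have [q [r [e sr hdet]]] := det_horner_rem pt b.
exists (\det (\matrix_(k < l, j < l) ((-1) ^+ k * (r j)`_k))); split.
  have -> : vandermonde_mpoly R l = vdm b.
    by apply: eq_bigr => i _; apply: eq_bigr => j _; rewrite /b opprB addrA subrK.
  rewrite mulrC -hdet; congr (\det _); apply/matrixP => i j; rewrite !mxE /emb /pt map_comp_poly.
  by rewrite horner_comp (rmorphD (map_poly _)) /= rmorph1 map_polyX !hornerE /b subrK.
rewrite -(det_map_mx (meval (fun=> 1))); congr (\det _); apply/matrixP => k j; rewrite !mxE.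
rewrite (rmorphM (meval (fun=> 1))) /=.
rewrite rmorphXn rmorphN1; congr (_ * _).
have := congr1 (map_poly (meval (fun=> 1 : R))) (e j).
rewrite rmorphD rmorphM rmorph_prod /= (eq_bigr (fun=> 'X)) => [|i _]; last first.
  by rewrite map_polyXsubC /b (rmorphB (meval (fun=> 1))) /= mpoly.mevalXU mpoly.meval1 subrr subr0.
rewrite prodr_const card_ord => /(congr1 (fun s : {poly R} => s`_k)).
rewrite coefD coefMXn ltn_ord add0r !coef_map /= mpoly.mevalC => ->.
by [].
Qed.

Variables (al be : R).
Hypotheses (al1 : -1 < al) (be1 : -1 < be).

Definition jdet_const : R := \prod_(k < l) \prod_(s < k) (2 * s.+1%:R * (s.+1%:R + al))^-1.

Lemma jdet_const_gt0 : 0 < jdet_const.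
Proof.
apply: prodr_gt0 => k _; apply: prodr_gt0 => s _; rewrite invr_gt0 !mulr_gt0 ?ltr0Sn //.
have : 1 <= s.+1%:R :> R by rewrite ler1n.
by move: al1; lra.
Qed.

Lemma jpol_comp n : jpol al be n \Po ('X + 1) = jnorm al n *: \sum_(r < n.+1) jcoef al be n r *: 'X^r.
Proof.
rewrite /jpol comp_polyZ; congr (_ *: _); rewrite (raddf_sum (comp_poly ('X + 1))) /=.
apply: eq_bigr => r _; rewrite comp_polyZ rmorphXn /= rmorphB /= comp_polyX -[1]/(1%:P) comp_polyC.
by rewrite addrK.
Qed.

Lemma jpol_comp_coef n k : (jpol al be n \Po ('X + 1))`_k = jnorm al n * jcoef al be n k.
Proof.
rewrite jpol_comp coefZ coef_sum; congr (_ * _); case: (ltnP k n.+1) => kn.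
  rewrite (bigD1 (Ordinal kn)) //= coefZ coefXn eqxx mulr1 big1 ?addr0 // => j jk.
  by rewrite coefZ coefXn eq_sym (_ : (nat_of_ord j == k) = false) ?mulr0 //; apply/eqP => e; case/eqP: jk; apply: val_inj.
rewrite big1 => [|j _]; last by rewrite coefZ coefXn gtn_eqF ?mulr0 // (leq_trans (ltn_ord j)).
by rewrite /jcoef (bigD1 (Ordinal kn)) //= subrr !mul0r.
Qed.

Lemma jacobi_det_emb (lam : intpart l) : jacobi_det al be lam = \det (\matrix_(i, j) emb i (jpol al be (jpos lam j))).
Proof. by congr (\det _); apply/matrixP => i j; rewrite !mxE jacobiE. Qed.

(** Up to normalisation, the [k]-th Taylor coefficient at 1 of a Jacobi polynomial is a polynomial
    of degree [k] in its eigenvalue, so the determinant is a Vandermonde determinant in the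
    eigenvalues. *)
Lemma det_taylor (n : 'I_l -> nat) :
  \det (\matrix_(k < l, j < l) ((-1) ^+ k * (jpol al be (n j) \Po ('X + 1))`_k)) =
  (\prod_j jnorm al (n j)) * jdet_const * vdm (fun j => jev al be (n j)).
Proof.
pose q (k : 'I_l) : {poly R} := \prod_(s < k) ((2 * s.+1%:R * (s.+1%:R + al))^-1 *: ('X - (jev al be s)%:P)).
have qE (k : 'I_l) : q k = (\prod_(s < k) (2 * s.+1%:R * (s.+1%:R + al))^-1) *: \prod_(s < k) ('X - (jev al be s)%:P).
  by rewrite /q scaler_prod.
have sP (k : 'I_l) : size (\prod_(s < k) ('X - (jev al be s)%:P)) = k.+1.
  by rewrite size_prod_XsubC -[index_enum _]/(Finite.enum _) -enumT -cardE card_ord.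
have -> : \matrix_(k < l, j < l) ((-1) ^+ k * (jpol al be (n j) \Po ('X + 1))`_k) =
    (\matrix_(j < l, k < l) ((-1) ^+ k *: q k).[jev al be (n j)])^T *m diag_mx (\row_j jnorm al (n j)).
  apply/matrixP => k j; rewrite mul_mx_diag !mxE jpol_comp_coef hornerZ -mulrA; congr (_ * _).
  rewrite mulrC; congr (_ * _); rewrite horner_prod; apply: eq_bigr => s _.
  by rewrite hornerZ !hornerE mulrC.
rewrite det_mulmx det_tr det_diag mulrC -mulrA; congr (_ * _).
  by apply: eq_bigr => j _; rewrite mxE.
rewrite det_horner_tri => [|k]; last first.
  by rewrite (leq_trans (size_scale_leq _ _)) // qE (leq_trans (size_scale_leq _ _)) // sP.
rewrite mulrC; congr (_ * _); apply: eq_bigr => k _.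
rewrite coefZ mulrA -exprMn mulrNN mulr1 expr1n mul1r qE coefZ.
have /monicP := monic_prod_XsubC (index_enum 'I_k) predT (fun s : 'I_k => jev al be s).
by rewrite lead_coefE sP /= => ->; rewrite mulr1.
Qed.

Lemma jev_pos_inj (lam : intpart l) : injective (fun j => jev al be (jpos lam j)).
Proof. by move=> i j /jev_inj e; apply: (@jpos_inj l lam); exact: e. Qed.

Lemma jacobiP_spec (lam : intpart l) : jacobiP al be lam * vandermonde_mpoly R l = jacobi_det al be lam.
Proof.
have [q [e _]] := det_emb_quotient (fun j => jpol al be (jpos lam j)).
by apply: (xgetPex 0 (P := [set p | p * vandermonde_mpoly R l = jacobi_det al be lam]%classic));
   exists q; rewrite /= jacobi_det_emb.
Qed.

Lemma jacobiP1 (lam : intpart l) : meval (fun=> 1) (jacobiP al be lam) =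
  (\prod_j jnorm al (jpos lam j)) * jdet_const * vdm (fun j => jev al be (jpos lam j)).
Proof.
have [q [e eq1]] := det_emb_quotient (fun j => jpol al be (jpos lam j)).
have -> : jacobiP al be lam = q.
  by apply: (mulIf vandermonde_neq0); rewrite jacobiP_spec jacobi_det_emb e.
by rewrite eq1 det_taylor.
Qed.

Lemma jacobiP1_neq0 (lam : intpart l) : meval (fun=> 1) (jacobiP al be lam) != 0.
Proof.
rewrite jacobiP1 !mulf_neq0 ?(gt_eqF jdet_const_gt0) //.
  by rewrite gt_eqF // prodr_gt0 // => j _; rewrite jnorm_gt0.
exact/vdm_neq0/jev_pos_inj.
Qed.

End JacobiQuotient.

(** * Dominance order and sums of eigenvalues *)

Section Majorization.

Lemma sum_uniq_ge (s : seq nat) : uniq s -> (\sum_(i < size s) i <= \sum_(x <- s) x)%N.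
Proof.
elim: {s}(size s) {-2}s (erefl (size s)) => [|r IH] s es us; first by rewrite es big_ord0.
have [x xs hx] : exists2 x, x \in s & (r <= x)%N.
  apply: contrapT => h; have sub : {subset s <= iota 0 r}.
    by move=> x xs; rewrite mem_iota add0n ltnNge; apply/negP => rx; apply: h; exists x.
  by have := uniq_leq_size us sub; rewrite es size_iota ltnn.
rewrite (perm_big _ (perm_to_rem xs)) big_cons /= es big_ord_recr /= addnC leq_add //.
have er : size (rem x s) = r by rewrite size_rem // es.
by have := IH (rem x s) er (rem_uniq x us); rewrite er.
Qed.

Lemma sum_perm_le (l : nat) (s : {perm 'I_l}) (r : nat) :
  (\sum_(i < l | i < r) s i <= \sum_(i < l | i < r) (l - i.+1))%N.
Proof.
pose t := [seq (l - (nat_of_ord (s i)).+1)%N | i : 'I_l <- [seq i : 'I_l <- enum 'I_l | (i < r)%N]].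
have ut : uniq t.
  rewrite map_inj_in_uniq => [|i j _ _ e]; first by rewrite filter_uniq ?enum_uniq.
 
  by apply: (@perm_inj _ s); apply: ord_inj; have := ltn_ord (s i); have := ltn_ord (s j); lia.
have h := sum_uniq_ge ut.
have e1 : (\sum_(x <- t) x = \sum_(i < l | i < r) (l - (s i).+1))%N.
  by rewrite big_map big_filter big_enum_cond.
have st : size t = #|[pred i : 'I_l | (i < r)%N]|.
  by rewrite size_map -sum1_size big_filter big_enum_cond -sum1_card; apply: eq_bigl => i; rewrite inE.
have e2 : (\sum_(i < size t) i = \sum_(i < l | i < r) i)%N.
  have [rl|lr] := leqP r l.
    have -> : size t = r by rewrite st; have := card_ord r; rewrite -!sum1_card (big_ord_narrow rl).
    by rewrite (big_ord_narrow rl).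
  have -> : size t = l by rewrite st -[RHS]card_ord; apply: eq_card => i; rewrite !inE (leq_trans (ltn_ord i) (ltnW lr)).
  by apply: eq_bigl => i; rewrite (leq_trans (ltn_ord i) (ltnW lr)).
rewrite e1 e2 in h.
have h3 : (\sum_(i < l | i < r) s i + \sum_(i < l | i < r) (l - (s i).+1) =
    \sum_(i < l | i < r) (l - i.+1) + \sum_(i < l | i < r) i)%N.
  by rewrite -!big_split /=; apply: eq_bigr => i _; have := ltn_ord i; have := ltn_ord (s i); lia.
lia.
Qed.

Lemma abel_sum (R : numDomainType) (d c : nat -> R) (l : nat) :
  \sum_(i < l.+1) d i * c i =
  \sum_(r < l) (\sum_(i < r.+1) d i) * (c r - c r.+1) + (\sum_(i < l.+1) d i) * c l.
Proof.
elim: l => [|l IH]; first by rewrite big_ord0 !big_ord1 add0r.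
have e : \sum_(i < l.+2) d i = \sum_(i < l.+1) d i + d l.+1 by rewrite big_ord_recr.
rewrite big_ord_recr /= IH [in RHS]big_ord_recr /= e.
by move: (\sum_(i < l.+1) d i) (\sum_(r < l) _) => x y; ring.
Qed.

(** The difference of two eigenvalues is [(m - n) (m + n + al + be + 1)]. Abel summation writes the
    total difference with the nonnegative partial sums of [m - n] and the decrements of the second
    factor, which are positive; the sign of [al + be + 1] serves for the last term. *)
Lemma major_eq (R : realType) (al be : R) (l : nat) (n m : 'I_l -> nat) : 0 <= al + be + 1 ->
  (forall i j : 'I_l, (i < j)%N -> (n j < n i)%N) -> (forall i j : 'I_l, (i < j)%N -> (m j < m i)%N) ->
  (forall r, (r <= l)%N -> \sum_(i < l | (i < r)%N) n i <= \sum_(i < l | (i < r)%N) m i)%N ->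
  \sum_i jev al be (n i) = \sum_i jev al be (m i) -> n =1 m.
Proof.
case: l n m => [|l] n m sg0 hn hm hle; first by move=> _ [].
set sg := al + be + 1 in sg0.
pose d i : R := (m (inord i))%:R - (n (inord i))%:R.
pose c i : R := (m (inord i))%:R + (n (inord i))%:R + sg.
move/esym/eqP; rewrite -subr_eq0 -sumrB.
have -> : \sum_i (jev al be (m i) - jev al be (n i)) = \sum_(i < l.+1) d i * c i.
  by apply: eq_bigr => i _; rewrite jevB /d /c inord_val.
have D0 r : (r <= l.+1)%N -> 0 <= \sum_(i < r) d i.
  move=> rl; have e (f : 'I_l.+1 -> nat) : \sum_(i < r) (f (inord i))%:R = (\sum_(i < l.+1 | (i < r)%N) f i)%:R :> R.
    by rewrite (big_ord_narrow rl) natr_sum; apply: eq_bigr => i _; congr (f _)%:R; apply: val_inj; rewrite /= inordK // (leq_trans (ltn_ord i)).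
  by rewrite sumrB !e subr_ge0 ler_nat hle.
have cS (r : nat) : (r < l)%N -> 0 < c r - c r.+1.
  move=> rl; have h : ((inord r : 'I_l.+1) < (inord r.+1 : 'I_l.+1))%N by rewrite !inordK // ltnS ltnW.
  have := hn _ _ h; have := hm _ _ h; rewrite /c -!(ltr_nat R).
  by move: (_%:R) (_%:R) (_%:R) (_%:R) => a1 a2 a3 a4; lra.
have cl : 0 <= c l by rewrite /c -natrD addr_ge0 // ler0n.
rewrite abel_sum paddr_eq0; last first.
- by rewrite mulr_ge0 ?D0.
- by apply: sumr_ge0 => r _; rewrite mulr_ge0 ?D0 ?ltW ?cS // ltnS ltnW.
case/andP; rewrite psumr_eq0 => [/allP h1|r _]; last by rewrite mulr_ge0 ?D0 ?ltW ?cS // ltnS ltnW.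
have Dr r : (r < l)%N -> \sum_(i < r.+1) d i = 0.
  move=> rl; have := h1 (Ordinal rl) (mem_index_enum _) => /implyP/(_ isT).
  by rewrite mulf_eq0 (gt_eqF (cS _ _)) // orbF => /eqP.
have Dr' r : (r <= l)%N -> \sum_(i < r) d i = 0.
  by case: r => [|r] h; [rewrite big_ord0|exact: Dr].
have d0 r : (r < l)%N -> d r = 0.
  by move=> rl; have := Dr _ rl; rewrite big_ord_recr /= Dr' ?add0r // ltnW.
rewrite big_ord_recr /= Dr' // add0r mulf_eq0 => h2.
have dl : d l = 0.
  case/orP: h2 => /eqP // h2; move: h2; rewrite /c /d.
  have a1 : 0 <= (m (inord l))%:R :> R by []; have a2 : 0 <= (n (inord l))%:R :> R by [].
  by move: a1 a2 sg0; move: (_%:R) (_%:R) (sg) => u v w; lra.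
move=> i; have : d i = 0.
  by have := ltn_ord i; rewrite ltnS leq_eqVlt => /orP[/eqP ->|/d0].
by rewrite /d inord_val => /eqP; rewrite subr_eq0 eqr_nat => /eqP.
Qed.

(** The induced map of indices is strictly increasing from a finite ordinal to itself, hence the
    identity. *)
Lemma decr_image (l : nat) (n' n : 'I_l -> nat) :
  (forall i j : 'I_l, (i < j)%N -> (n' j < n' i)%N) -> (forall i j : 'I_l, (i < j)%N -> (n j < n i)%N) ->
  (forall i, exists j, n' i = n j) -> n' = n.
Proof.
move=> hn' hn /choice[f hf].
have fmono (i j : 'I_l) : (i < j)%N -> (f i < f j)%N.
  move=> /hn'; rewrite !hf => lt; rewrite ltnNge; apply/negP; rewrite leq_eqVlt => /orP[/eqP/val_inj e|].
    by rewrite e ltnn in lt.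
  by move/hn; lia.
have ge (i : 'I_l) : (i <= f i)%N.
  case: i => i; elim: i => [|i IH] // il; have := IH (ltnW il).
  by have := @fmono (Ordinal (ltnW il)) (Ordinal il) (ltnSn i); rewrite /=; lia.
have le (i : 'I_l) : (f i <= i)%N.
  have main j (jl : (l - j.+1 < l)%N) : (f (Ordinal jl) <= l - j.+1)%N.
    elim: j jl => [|j IH] jl; first by have := ltn_ord (f (Ordinal jl)); lia.
    have jl' : (l - j.+1 < l)%N by lia.
    have := IH jl'; have [e|lt] := eqVneq (l - j.+2)%N (l - j.+1)%N.
      have -> : Ordinal jl' = Ordinal jl by apply: val_inj.
      by move=> h; apply: leq_trans h _; rewrite e.
    by have := @fmono (Ordinal jl) (Ordinal jl'); rewrite /=; move/eqP: lt; lia.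
  have jl : (l - (l - i.+1).+1 < l)%N by have := ltn_ord i; lia.
  have {1}-> : i = Ordinal jl by apply: val_inj; rewrite /=; have := ltn_ord i; lia.
  by apply: leq_trans (main _ jl) _; lia.
apply/funext => i; rewrite hf; congr n; apply: val_inj; apply/eqP.
by rewrite eqn_leq ge le.
Qed.

End Majorization.

(** * Integrals against products of Jacobi polynomials, and alternating polynomials *)

Section JacobiFunctional.
Variables (R : realType) (l : nat) (al be : R).
Hypotheses (al1 : -1 < al) (be1 : -1 < be).
Implicit Types (p q : mpoly l R) (n : 'I_l -> nat) (u : 'I_l -> {poly R}).

Definition phin (n : nat) (q : {poly R}) : R := jL al be (q * jpol al be n).

Lemma plin_phin (n : nat) : plin (phin n).
Proof. by move=> c p q; rewrite /phin mulrDl -scalerAl linearD linearZ. Qed.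

Lemma phin_small (n : nat) (q : {poly R}) : (size q <= n)%N -> phin n q = 0.
Proof. by move=> h; rewrite /phin mulrC jpol_orth_size. Qed.

Definition Phi n p : R := mfun (fun i => phin (n i)) p.

Lemma PhiZ n c p : Phi n (c *: p) = c * Phi n p.
Proof. exact: mfunZ. Qed.

Lemma Phi_sum n (I : Type) (r : seq I) (P : pred I) (F : I -> mpoly l R) :
  Phi n (\sum_(i <- r | P i) F i) = \sum_(i <- r | P i) Phi n (F i).
Proof. exact: mfun_sum. Qed.

Lemma Phi_mprod n u : Phi n (mprod u) = \prod_i phin (n i) (u i).
Proof. by apply: mfun_mprod => i; exact: plin_phin. Qed.

Lemma Phi_det n (p : 'I_l -> {poly R}) :
  Phi n (\det (\matrix_(i, j) emb i (p j))) = \det (\matrix_(i, j) phin (n i) (p j)).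
Proof.
rewrite /Phi mfun_sum; apply: eq_bigr => s _.
have -> : \prod_i (\matrix_(i0, j) emb i0 (p j)) i (s i) = mprod (fun i => p (s i)).
  by apply: eq_bigr => i _; rewrite mxE.
have -> : (-1) ^+ s * mprod (fun i => p (s i)) = (-1) ^+ s *: mprod (fun i => p (s i)) :> mpoly l R.
  by rewrite -mpoly.mul_mpolyC rmorphXn rmorphN1.
rewrite mfunZ -/(Phi _ _) Phi_mprod; congr (_ * _).
by apply: eq_bigr => i _; rewrite mxE.
Qed.

Definition mD p : mpoly l R :=
  \sum_i (emb i (1 - 'X^2) * mpoly.mderiv i (mpoly.mderiv i p) +
          emb i ((be - al)%:P - (al + be + 2) *: 'X) * mpoly.mderiv i p).

Lemma mD_lin c p q : mD (c *: p + q) = c *: mD p + mD q.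
Proof.
rewrite /mD scaler_sumr -big_split /=; apply: eq_bigr => i _.
rewrite !(mpoly.mderivD, mpoly.mderivZ) !mulrDr scalerDr -!scalerAr addrACA; ring.
Qed.

Lemma mD0 : mD 0 = 0.
Proof. by have := mD_lin (-1) 0 0; rewrite scaler0 addr0 scaleN1r addNr. Qed.

Lemma mDZ c p : mD (c *: p) = c *: mD p.
Proof. by have := mD_lin c p 0; rewrite mD0 !addr0. Qed.

Lemma mD_sum (I : Type) (r : seq I) (P : pred I) (F : I -> mpoly l R) :
  mD (\sum_(i <- r | P i) F i) = \sum_(i <- r | P i) mD (F i).
Proof.
elim/big_rec2: _ => [|i y1 y2 _ <-]; first exact: mD0.
by have := mD_lin 1 (F i) y2; rewrite !scale1r.
Qed.

Lemma mD_mprod u : mD (mprod u) = \sum_i mprod (upd u i (jD al be (u i))).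
Proof.
apply: eq_bigr => i _; rewrite !mderiv_mprod.
rewrite [X in upd _ _ X^`()](_ : _ = (u i)^`()); last by rewrite /upd eqxx.
have -> v : upd (upd u i (u i)^`()) i v = upd u i v.
  by apply/funext => j; rewrite /upd; case: eqP.
by rewrite !mprod_upd !mulrA -mulrDl -!embM -embD.
Qed.

Definition Ev n : R := \sum_i jev al be (n i).

Lemma Phi_mD n p : Phi n (mD p) = - Ev n * Phi n p.
Proof.
rewrite {1 2}[p]mpoly.mpolyE mD_sum /Phi !mfun_sum mulr_sumr; apply: eq_bigr => m _.
rewrite mDZ !mfunZ mulrCA; congr (_ * _); rewrite mpolyX_mprod mD_mprod mfun_sum -!/(Phi _ _).
rewrite Phi_mprod -sumrN mulr_suml; apply: eq_bigr => i _; rewrite -/(Phi _ _) Phi_mprod.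
rewrite (bigD1 i) //= [in RHS](bigD1 i) //= /upd eqxx mulrA; congr (_ * _).
  by rewrite /phin jL_jD_sym // jpol_eigen // -scalerAr linearZ.
by apply: eq_bigr => j /negbTE ->.
Qed.

Lemma Phi_complete p : (forall n, Phi n p = 0) -> p = 0.
Proof.
move=> h; apply/mpoly.mpolyP => m; rewrite mpoly.mcoeff0 -mfun_mcoeff; apply/normr0_eq0/le_anti.
rewrite normr_ge0 andbT.
pose A (phi : {poly R} -> R) := exists n : nat, phi = phin n.
pose B (phi : {poly R} -> R) := exists n : nat, phi = fun r => r`_n.
apply: (@mfun_transfer R l A B (fun=> 0) p).
- by move=> phi [n ->]; exact: plin_phin.
- by move=> phi [n ->]; exact: plin_coef.
- move=> _ s hs psi [n ->]; suff -> : s = 0 by rewrite coef0 normr0.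
  have hs' j : phin j s = 0 by apply/normr0_eq0/le_anti; rewrite normr_ge0 hs //; exists j.
  have [c e] := jpol_span al1 be1 (leqnn (size s)).
  rewrite e big1 // => j _; suff -> : c j = 0 by rewrite scale0r.
  have := hs' j; rewrite [X in phin j X = _]e (plin_sum _ _ _ _ (plin_phin j)) (bigD1 j) //= big1 ?addr0 => [/eqP|i ij].
    by rewrite mulf_eq0 [phin _ _ == 0]gt_eqF ?orbF ?jpol_sq_gt0 // => /eqP.
  by rewrite /phin jpol_orth ?mulr0.
- move=> f hf; have /choice[n hn] : forall i, exists n : nat, f i = phin n by move=> i; have [n e] := hf i; exists n.
  have -> : f = fun i => phin (n i) by apply/funext => i; exact: hn.
  by rewrite -/(Phi n p) h normr0.
- by move=> i; exists (m i).
Qed.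

(** [mfun_transfer] from evaluations on the cube to the integrals, losing a constant factor for each
    variable. It lets uniform convergence pass to coefficients in the uniqueness argument. *)
Lemma Phi_bound n : exists C : R, forall p (e : R),
  (forall x : 'I_l -> R, (forall i, -1 <= x i <= 1) -> `|meval x p| <= e) -> `|Phi n p| <= e * C.
Proof.
have /choice[b hb] : forall i, exists b : R, 0 <= b /\ forall x, -1 <= x <= 1 -> `|(jpol al be (n i)).[x]| <= b.
  by move=> i; have [b b0 h] := horner_bounded (jpol al be (n i)); exists b.
pose c := (\sum_i b i) * jL al be 1.
have L1 : 0 <= jL al be 1 by apply: jL_ge0 => // x _; rewrite hornerC.
exists (c ^+ l) => p e he.
pose A (phi : {poly R} -> R) := exists2 x : R, -1 <= x <= 1 & phi = fun r => r.[x].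
pose B (phi : {poly R} -> R) := exists i, phi = phin (n i).
apply: (@mfun_transfer R l A B (fun j => e * c ^+ j) p) => [phi [x _ ->]|phi [i ->]|j s hs psi [i ->]|f hf|i].
- exact: plin_horner.
- exact: plin_phin.
- rewrite exprSr mulrA /c [X in _ <= X]mulrA; apply: jL_bound => // x x1.
  rewrite hornerM normrM ler_pM //; first by apply: (hs (fun r => r.[x])); exists x.
  have [b0 hx] := hb i; apply: le_trans (hx x x1) _; rewrite (bigD1 i) //= lerDl.
  by apply: sumr_ge0 => j' _; have [] := hb j'.
- rewrite expr0 mulr1.
  have /choice[x hx] : forall i, exists x : R, -1 <= x <= 1 /\ f i = fun r => r.[x].
    by move=> i; have [x x1 e1] := hf i; exists x.
  have -> : f = fun i r => r.[x i] by apply/funext => i; have [_ ->] := hx i.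
  by rewrite mfun_meval he // => i; have [] := hx i.
- by exists i.
Qed.

(** Antisymmetry is tested on the coefficients [Phi] instead of through an action on the
    variables. *)
Definition alternating p := forall n (i j : 'I_l), i != j -> Phi (fun k => n (tperm i j k)) p = - Phi n p.

Lemma alternating_perm p n (s : 'S_l) : alternating p -> `|Phi (fun i => n (s i)) p| = `|Phi n p|.
Proof.
move=> ap; have [ts -> /allP hts] := prod_tpermP s.
elim: ts n hts => [|[a b] ts IH] n hts.
  by rewrite big_nil; congr (`|Phi _ p|); apply/funext => i; rewrite perm1.
rewrite big_cons /=.
have ab : a != b by have := hts (a, b); rewrite inE eqxx => /(_ isT).
rewrite -[RHS]IH => [|x xs]; last by apply: hts; rewrite inE xs orbT.
rewrite -[RHS]normrN -(ap _ _ _ ab).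
by congr (`|Phi _ p|); apply/funext => i; rewrite permM.
Qed.

(** A repeated degree makes [Phi n p] equal to its opposite; distinct degrees can be sorted, which
    changes [Phi] only by a sign. *)
Lemma alternating_eq0 p : alternating p ->
  (forall n, (forall i j : 'I_l, (i < j)%N -> (n j < n i)%N) -> Phi n p = 0) -> p = 0.
Proof.
move=> ap h; apply: Phi_complete => n.
have [inj|] := boolP (injectiveb n); last first.
  move/injectivePn => [i [j ij e]]; have := ap n i j ij.
  have -> : (fun k => n (tperm i j k)) = n.
    by apply/funext => k; case: tpermP => [->|->|].
  by move/eqP; rewrite -addr_eq0 -mulr2n mulrn_eq0 /= => /eqP.
have /injectiveP ninj := inj.
pose t := [tuple n i | i < l].
have /tuple_permP[s hs] : perm_eq (sort geq t) t by rewrite perm_sort.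
apply/eqP; rewrite -normr_eq0 -(alternating_perm n s ap) normr_eq0; apply/eqP/h => i j ij.
have srt : sorted geq (sort geq t) by apply: sort_sorted => x y; exact: leq_total.
have gt : transitive geq by move=> a b c ba cb; apply: leq_trans cb ba.
have e (a : 'I_l) : nth 0%N (sort geq t) a = n (s a).
  rewrite hs -[LHS]/(nth 0%N [tuple tnth t (s i) | i < l] a) -tnth_nth tnth_mktuple.
  by rewrite /t tnth_mktuple.
have le : (n (s j) <= n (s i))%N.
  have sz : size (sort geq t) = l by rewrite size_sort size_tuple.
  rewrite -!e; apply: (sorted_leq_nth gt leqnn 0%N srt); [by rewrite inE sz|by rewrite inE sz|exact: ltnW].
by rewrite ltn_neqAle le andbT; apply/eqP => /ninj/perm_inj e1; rewrite e1 ltnn in ij.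
Qed.

Definition jdet n : mpoly l R := \det (\matrix_(i, j) emb i (jpol al be (n j))).

Lemma alternating_det (p : 'I_l -> {poly R}) : alternating (\det (\matrix_(i, j) emb i (p j))).
Proof.
move=> n i j ij; rewrite !Phi_det.
have -> : \matrix_(a < l, b < l) phin (n (tperm i j a)) (p b) = row_perm (tperm i j) (\matrix_(a, b) phin (n a) (p b)).
  by apply/matrixP => a b; rewrite !mxE.
by rewrite row_permE det_mulmx det_perm odd_tperm ij expr1 mulN1r.
Qed.

Lemma det_phin_supp n' n : \det (\matrix_(i, j) phin (n' i) (jpol al be (n j))) != 0 ->
  injective n' /\ forall i, exists j, n' i = n j.
Proof.
move=> d0; split => [i j e|i].
  apply/eqP; apply: contraT => ij; case/eqP: d0; apply: (determinant_alternate ij) => b.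
  by rewrite !mxE e.
apply: contrapT => h; case/eqP: d0; rewrite (expand_det_row _ i) big1 // => j _.
rewrite !mxE /phin jpol_orth ?mul0r //; apply/eqP => e; apply: h.
by exists j.
Qed.

Lemma Phi_jdet_neq n' n : (forall i j : 'I_l, (i < j)%N -> (n' j < n' i)%N) ->
  (forall i j : 'I_l, (i < j)%N -> (n j < n i)%N) -> n' != n -> Phi n' (jdet n) = 0.
Proof.
move=> hn' hn ne; rewrite /jdet Phi_det; apply/eqP; apply: contraT => /det_phin_supp[_ h].
by case/eqP: ne; exact: decr_image.
Qed.

Lemma Phi_jdet_diag n : injective n -> Phi n (jdet n) = \prod_i phin (n i) (jpol al be (n i)).
Proof.
move=> ninj; rewrite /jdet Phi_det det_trig; first by apply: eq_bigr => i _; rewrite mxE.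
apply/is_trig_mxP => i j ij; rewrite mxE /phin jpol_orth //; apply/eqP => /ninj e.
by rewrite e ltnn in ij.
Qed.

Lemma mD_jdet n : mD (jdet n) = - Ev n *: jdet n.
Proof.
apply/eqP; rewrite -subr_eq0; apply/eqP/Phi_complete => n'.
rewrite /Phi mfunB mfunZ -!/(Phi _ _) Phi_mD -mulrBl /jdet Phi_det; apply/eqP; rewrite mulf_eq0.
apply/orP; case: (boolP (\det _ == 0)) => [_|/det_phin_supp[ninj h]]; [by right|left].
have /choice[f hf] := h.
have finj : injective f by move=> i j e; apply: ninj; rewrite !hf e.
rewrite opprK addrC subr_eq0 /Ev (reindex_inj finj) /=; apply/eqP; apply: eq_bigr => i _.
by rewrite hf.
Qed.

(** Up to a nonzero constant, the Vandermonde polynomial is the determinant of the Jacobi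
    polynomials of degrees [0, ..., l - 1]. *)
Lemma mD_vandermonde : mD (vandermonde_mpoly R l) = - Ev (fun i => i : nat) *: vandermonde_mpoly R l.
Proof.
have := mD_jdet (fun i => i : nat); rewrite /jdet.
have -> : \matrix_(i < l, j < l) emb i (jpol al be j) =
    \matrix_(i < l, j < l) (map_poly (@mpolyC l R) (jpol al be j)).[mpolyX R (mnm1 i)] by [].
rewrite det_horner_tri => [|j]; last by rewrite (leq_trans (size_poly _ _)) // size_jpol.
rewrite -vandermonde_vdm; set c := \prod_(j < l) _.
have [d d0 ->] : exists2 d : R, d != 0 & c = mpolyC l d.
  exists (\prod_(j < l) ((-1) ^+ j * (jpol al be j)`_j)).
    apply/prodf_neq0 => j _; rewrite mulf_neq0 ?expf_neq0 ?oppr_eq0 ?oner_eq0 //.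
    have := lead_coef_eq0 (jpol al be j); rewrite lead_coefE size_jpol //= => ->.
    by rewrite -size_poly_eq0 size_jpol.
  rewrite rmorph_prod; apply: eq_bigr => j _.
  by rewrite rmorphM rmorphXn rmorphN1 coef_map.
rewrite mulrC mpoly.mul_mpolyC mDZ scalerA mulrC -scalerA => e.
exact: scalerI d0 _ _ e.
Qed.

Section Weyl.
Variables (K : finType) (c : K -> R) (u : K -> 'I_l -> {poly R}) (lam : intpart l).
Hypothesis sg0 : 0 <= al + be + 1.
Local Notation V := (vandermonde_mpoly R l).
Local Notation F := (\sum_S c S *: mprod (u S)).
Hypothesis Hsym : forall i j : 'I_l, i != j -> exists2 sg : K -> K, bijective sg &
  forall S, c (sg S) = c S /\ forall k, u (sg S) k = u S (tperm i j k).
Hypothesis Hdeg : forall S r, c S != 0 -> (r <= l)%N ->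
  (\sum_(i < l | i < r) (size (u S i)).-1 <= \sum_(i < l | i < r) parts lam i)%N.
Hypothesis Heig : mD (V * F) = - Ev (jpos lam) *: (V * F).

Lemma Phi_VF n : Phi n (V * F) =
  \sum_S c S * \det (\matrix_(i < l, k < l) phin (n i) ((- 'X) ^+ k * u S i)).
Proof.
rewrite mulr_sumr /Phi mfun_sum; apply: eq_bigr => S _; rewrite -scalerAr mfunZ; congr (_ * _).
rewrite vandermonde_mprod mulr_suml mfun_sum; apply: eq_bigr => s _.
rewrite -scalerAl mfunZ mprodM -/(Phi _ _) Phi_mprod; congr (_ * _).
by apply: eq_bigr => i _; rewrite mxE.
Qed.

Lemma alternating_VF : alternating (V * F).
Proof.
move=> n i j ij; rewrite !Phi_VF; have [sg bij hsg] := Hsym ij.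
rewrite (reindex sg) /=; last exact: onW_bij.
rewrite -sumrN; apply: eq_bigr => S _; have [-> hu] := hsg S; rewrite -mulrN; congr (_ * _).
have -> : \matrix_(a < l, b < l) phin (n (tperm i j a)) ((- 'X) ^+ b * u (sg S) a) =
    row_perm (tperm i j) (\matrix_(a < l, b < l) phin (n a) ((- 'X) ^+ b * u S a)).
  by apply/matrixP => a b; rewrite !mxE hu.
by rewrite row_permE det_mulmx det_perm odd_tperm ij expr1 mulN1r.
Qed.

(** A nonzero coefficient forces [n i] to be at most the degree in the variable [i] of some product,
    which gives dominance by [jpos lam]; the eigenvector property gives equal eigenvalue sums, and
    [major_eq] concludes. *)
Lemma Phi_VF_supp n : (forall i j : 'I_l, (i < j)%N -> (n j < n i)%N) -> Phi n (V * F) != 0 -> n = jpos lam.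
Proof.
move=> hn h0; apply/funext; apply: (major_eq sg0 hn (@jpos_anti l lam)); last first.
  have := Phi_mD n (V * F); rewrite Heig /Phi mfunZ -!/(Phi _ _) => /(mulIf h0)/oppr_inj e.
  by rewrite -/(Ev n) -e.
move=> r rl; move: h0; rewrite Phi_VF => h0.
have [S hS] : exists S, c S * \det (\matrix_(i < l, k < l) phin (n i) ((- 'X) ^+ k * u S i)) != 0.
  apply: contrapT => h; case/eqP: h0; apply: big1 => S _.
  by apply/eqP; apply: contrapT => /negP hS; apply: h; exists S.
move: hS; rewrite mulf_eq0 negb_or => /andP[cS hd].
have [s hs] : exists s : 'S_l, \prod_i (\matrix_(i < l, k < l) phin (n i) ((- 'X) ^+ k * u S i)) i (s i) != 0.
  apply: contrapT => h; case/eqP: hd; apply: big1 => s _.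
  apply/eqP; rewrite mulf_eq0; apply/orP; right.
  by apply: contrapT => /negP hs; apply: h; exists s.
have hi i : (n i <= s i + (size (u S i)).-1)%N.
  rewrite leqNgt; apply/negP => lt; case/eqP: hs; rewrite (bigD1 i) //= mxE phin_small ?mul0r //.
  apply: leq_trans (size_polyMleq _ _) _; rewrite exprNn -signr_odd.
  have sX : size ((-1) ^+ (odd (s i)) * 'X^(s i) : {poly R}) = (s i).+1.
    by rewrite mulr_sign; case: ifP => _; rewrite ?size_polyN size_polyXn.
  by move: lt; rewrite mulr_sign; case: ifP => _; rewrite ?size_polyN size_polyXn; lia.
apply: (leq_trans (leq_sum _ (fun i _ => hi i))); rewrite /jpos big_split /= [X in (_ <= X)%N]big_split /= addnC leq_add ?sum_perm_le ?Hdeg //.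
Qed.

Lemma weyl_formula : exists2 d : R, F = d *: jacobiP al be lam & d * meval (fun=> 1) (jacobiP al be lam) = meval (fun=> 1) F.
Proof.
pose n := jpos lam; pose D := \prod_i phin (n i) (jpol al be (n i)).
have D0 : D != 0 by apply/prodf_neq0 => i _; rewrite gt_eqF // jpol_sq_gt0.
pose d := Phi n (V * F) / D.
have e : V * F = d *: jdet n.
  apply/eqP; rewrite -subr_eq0; apply/eqP/alternating_eq0.
    move=> n' i j ij; rewrite /Phi !mfunB !mfunZ -!/(Phi _ _) alternating_VF // (alternating_det _ _ ij).
    by rewrite mulrN opprK opprB addrC.
  move=> n' hn'; rewrite /Phi !mfunB !mfunZ -!/(Phi _ _).
  have [->|ne] := eqVneq n' n; first by rewrite Phi_jdet_diag /d ?divfK ?subrr //; exact: jpos_inj.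
  rewrite Phi_jdet_neq //; last exact: jpos_anti.
  rewrite mulr0 subr0; apply/eqP; apply: contraT => /(Phi_VF_supp hn') e.
  by rewrite -/n in e; rewrite e eqxx in ne.
have FE : F = d *: jacobiP al be lam.
  apply: (mulfI (vandermonde_neq0 R l)); rewrite e; have := jacobiP_spec al1 be1 lam.
  move: (jacobiP al be lam) => P hP.
  by rewrite -scalerAr (mulrC V P) hP jacobi_det_emb.
by exists d; rewrite // FE mpoly.mevalZ.
Qed.

End Weyl.

End JacobiFunctional.

(** * The character formula *)

Section Chebyshev.
Variable R : realType.

(** The Chebyshev polynomials [T_n] and [U_(n-1)], carried together so that the recursion has one
    step. In the variable [z] they are the even and the odd part of [z ^ n] under inversion. *)
Fixpoint cheb (n : nat) : {poly R} * {poly R} :=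
  if n is n'.+1 then let: (p, q) := cheb n' in ('X * p + ('X^2 - 1) * q, p + 'X * q) else (1, 0).

Lemma cheb_eval n (z : R) : z != 0 ->
  let x := (z + z^-1) / 2 in let y := (z - z^-1) / 2 in
  (cheb n).1.[x] = (z ^+ n + z ^- n) / 2 /\ y * (cheb n).2.[x] = (z ^+ n - z ^- n) / 2.
Proof.
move=> z0 /=; elim: n => [|n] /=; first by rewrite !hornerE expr0 invr1; split; field.
case: (cheb n) => T S /= [hT hS].
rewrite !hornerE -!exprVn; rewrite ![_ ^+ n.+1]exprS; rewrite -!exprVn in hT hS.
have zz : z * z^-1 = 1 by rewrite divff.
move: hT hS; move: (z^-1) zz (T.[_]) (S.[_]) (z ^+ n) => v zv t s a; move: (v ^+ n) => b hT hS.
split.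
  have -> : (z + v) / 2 * t + (((z + v) / 2) ^+ 2 - 1) * s =
      (z + v) / 2 * t + (z - v) / 2 * ((z - v) / 2 * s) + (z * v - 1) * s by field.
  by rewrite zv subrr mul0r addr0 hT hS; field.
by rewrite mulrDr [X in _ + X]mulrCA hS hT; field.
Qed.

Lemma cheb_deriv n : (cheb n).1^`() = n%:R *: (cheb n).2 /\
  ('X^2 - 1) * (cheb n).2^`() + 'X * (cheb n).2 = n%:R *: (cheb n).1.
Proof.
elim: n => [|n] /=; first by rewrite derivC deriv0 !mulr0 addr0 !scale0r.
case: (cheb n) => T S /= [hT hS].
rewrite -!mul_polyC in hT hS *; rewrite -natr1 polyCD.
have d1 : (1 : {poly R})^`() = 0 by rewrite -[1]/(1%:P) derivC.
rewrite !(derivD, derivM, derivX, derivB, derivXn, d1, derivN) hT; split.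
  rewrite [RHS](_ : _ = n%:R%:P * (T + 'X * S) + (T + 'X * S)); last by ring.
  rewrite mulrDr -hS; ring.
rewrite [RHS](_ : _ = 'X * (n%:R%:P * T) + n%:R%:P * (('X^2 - 1) * S) + ('X * T + ('X^2 - 1) * S)); last by ring.
rewrite -hS; ring.
Qed.

Lemma size_cheb n : (size (cheb n).1 <= n.+1)%N /\ (size (cheb n).2 <= n)%N.
Proof.
elim: n => [|n] /=; first by rewrite size_poly1 size_poly0.
case: (cheb n) => T S /= [hT hS].
have sX (p : {poly R}) : (size ('X * p)%R <= (size p).+1)%N.
  by apply: leq_trans (size_polyMleq _ _) _; rewrite size_polyX.
split; apply: leq_trans (size_polyD _ _) _; rewrite geq_max; apply/andP; split.
- exact: leq_trans (sX _) _.
- apply: leq_trans (size_polyMleq _ _) _; rewrite -[1]/(1%:P) size_XnsubC //=; lia.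
- exact: leq_trans hT _.
- exact: leq_trans (sX _) _.
Qed.

Definition chebT n := (cheb n).1.

Lemma cheb_lead n : (cheb n.+1).1`_n.+1 = 2 ^+ n /\ (cheb n.+1).2`_n = 2 ^+ n.
Proof.
have coefXM (p : {poly R}) i : ('X * p)`_i.+1 = p`_i by rewrite mulrC coefMX.
elim: n => [|n].
  rewrite /= !mulr0 mulr1 !addr0 expr0; split; first by rewrite coefX.
  by rewrite -[1]/(1%:P) coefC.
have := size_cheb n.+1; rewrite -[cheb n.+2]/(let: (p, q) := cheb n.+1 in ('X * p + ('X^2 - 1) * q, p + 'X * q)).
case: (cheb n.+1) => p q /= [sp sq] [hp hq]; split.
  rewrite coefD coefXM hp mulrBl mul1r coefB (_ : q`_n.+2 = 0) ?subr0; last first.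
    by rewrite nth_default // (leq_trans sq).
  by rewrite expr2 -mulrA !coefXM hq exprS mulr_natl mulr2n.
by rewrite coefD coefXM hp hq exprS mulr_natl mulr2n.
Qed.

Lemma chebT_lead n : (chebT n)`_n * (if n is 0 then 1 else 2) = 2 ^+ n.
Proof.
case: n => [|n]; first by rewrite /chebT /= -[1]/(1%:P) coefC mulr1 expr0.
by rewrite /chebT; have [-> _] := cheb_lead n; rewrite mulrC exprS.
Qed.

Lemma chebT1 n : (chebT n).[1] = 1.
Proof.
have [+ _] := cheb_eval n (oner_neq0 R); rewrite /= invr1 expr1n invr1.
by rewrite (_ : (1 + 1) / 2 = 1 :> R) //; field.
Qed.

Lemma exprz_abs (z : R) (w : int) : z != 0 -> (z ^+ `|w| + z ^- `|w|) / 2 = (z ^ w + z ^ (- w)) / 2.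
Proof.
move=> z0; case: w => n; first by rewrite absz_nat exprnN -exprnP.
by rewrite NegzE abszN absz_nat opprK exprnN -exprnP addrC.
Qed.

Lemma chebT_eval (z : R) (w : int) : z != 0 ->
  (chebT `|w|).[(z + z^-1) / 2] = (z ^ w + z ^ (- w)) / 2.
Proof. by move=> z0; rewrite -exprz_abs //; have [] := cheb_eval `|w| z0. Qed.

Lemma chebT_deriv_eval (z : R) (w : int) : z != 0 ->
  (z - z^-1) / 2 * (chebT `|w|)^`().[(z + z^-1) / 2] = (w%:~R * z ^ w + (- w)%:~R * z ^ (- w)) / 2.
Proof.
move=> z0; have [-> _] := cheb_deriv `|w|; rewrite hornerZ mulrCA; have [_ ->] := cheb_eval `|w| z0.
case: w => n; rewrite ?NegzE ?abszN absz_nat ?opprK exprnN -exprnP !mulrNz -!pmulrn.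
  by move: (z ^+ n) (z ^- n) => a b; field.
by move: (z ^+ n.+1) (z ^ (- n.+1%:Z)) (n.+1%:R : R) => a b d; field.
Qed.

Lemma chebT_deriv2_eval (z : R) (w : int) : z != 0 ->
  let x := (z + z^-1) / 2 in
  (x ^+ 2 - 1) * (chebT `|w|)^`()^`().[x] + x * (chebT `|w|)^`().[x] =
  (w%:~R ^+ 2 * z ^ w + (- w)%:~R ^+ 2 * z ^ (- w)) / 2.
Proof.
have aw : `|w|%:R ^+ 2 = w%:~R ^+ 2 :> R by case: w => n; rewrite ?NegzE ?abszN absz_nat // mulrNz sqrrN.
move=> z0 x; have [-> e] := cheb_deriv `|w|; rewrite derivZ !hornerZ.
have /(congr1 (horner^~ x)) := e; rewrite hornerD !hornerM hornerX hornerZ hornerD hornerN hornerXn hornerC => e'.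
have -> (a b c : R) : (x ^+ 2 - 1) * (a * b) + x * (a * c) = a * ((x ^+ 2 - 1) * b + x * c) by ring.
rewrite e' -/(chebT _) chebT_eval // mulrNz sqrrN -mulrDr !mulrA; congr (_ * _ / _).
by rewrite -expr2.
Qed.

Lemma joukowski (x : R) : 1 < x -> exists z : R, [/\ 1 < z & x = (z + z^-1) / 2].
Proof.
move=> x1; pose s := Num.sqrt (x ^+ 2 - 1).
have x2 : 0 < x ^+ 2 - 1 by rewrite subr_gt0 expr_gt1 // ltW // (lt_trans ltr01).
have s0 : 0 < s by rewrite sqrtr_gt0.
have ss : s ^+ 2 = x ^+ 2 - 1 by rewrite sqr_sqrtr // ltW.
exists (x + s); split; first by rewrite ltr_wpDr ?ltW.
have z0 : x + s != 0 by rewrite gt_eqF // addr_gt0 // (lt_trans ltr01).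
have -> : (x + s)^-1 = x - s.
  apply: (mulfI z0); rewrite divff // mulrC -subr_sqr ss; ring.
by field.
Qed.

End Chebyshev.

Section CharacterFormula.
Variables (R : realType) (l : nat) (al be : R).
Hypotheses (al1 : -1 < al) (be1 : -1 < be) (sg0 : 0 <= al + be + 1).
Variables (K : finType) (w : 'I_l -> K -> int) (c : K -> R) (lam : intpart l).
Hypothesis Hfl : forall i, exists2 sg : K -> K, bijective sg & forall S, c (sg S) = c S /\
  forall j, w j (sg S) = if j == i then - w j S else w j S.
Hypothesis Htr : forall i j : 'I_l, i != j -> exists2 sg : K -> K, bijective sg & forall S, c (sg S) = c S /\
  forall k, w k (sg S) = w (tperm i j k) S.
Hypothesis Hps : forall r S, (r <= l)%N -> c S != 0 ->
  \sum_(i < l | (i < r)%N) w i S <= \sum_(i < l | (i < r)%N) (parts lam i)%:Z.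
(* The radial part of the Casimir operator, in the coordinates [x = (z + 1/z) / 2]. *)
Hypothesis Hcas : forall z : 'I_l -> R, (forall i, 1 < z i) -> injective z ->
  let t S := \prod_(i < l) z i ^ w i S in
  let x i := (z i + (z i)^-1) / 2 in let y i := (z i - (z i)^-1) / 2 in
  let h i := \sum_S c S * ((w i S)%:~R * t S) in
  (\sum_(i < l) ((parts lam i)%:R ^+ 2 + (parts lam i)%:R * (2 * (l - i.+1)%N%:R + (al + be + 1)))) *
    (\sum_S c S * t S) =
  \sum_(i < l) (\sum_S c S * ((w i S)%:~R ^+ 2 * t S) +
    h i * (\sum_(j < l | j != i) 2 * y i / (x i - x j)
           + ((al + be + 1) * x i + (al - be)) / y i)).

Local Notation T S := (fun i => chebT R `|w i S|).
Local Notation F := (\sum_S c S *: mprod (T S)).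
Local Notation V := (vandermonde_mpoly R l).

(** Averaging over the sign changes of the weights, one coordinate at a time. Applied to powers of
    [z], it replaces them by Chebyshev polynomials in [x]. *)
Lemma flip_sum (u : 'I_l -> int -> R) :
  \sum_S c S * \prod_i u i (w i S) = \sum_S c S * \prod_i ((u i (w i S) + u i (- w i S)) / 2).
Proof.
pose v j (i : 'I_l) a := if (i < j)%N then (u i a + u i (- a)) / 2 else u i a.
suff main j : (j <= l)%N -> \sum_S c S * \prod_i u i (w i S) = \sum_S c S * \prod_i v j i (w i S).
  rewrite (main l) //; apply: eq_bigr => S _; congr (_ * _); apply: eq_bigr => i _.
  by rewrite /v ltn_ord.
elim: j => [|j IH] jl; first by [].
rewrite IH; last exact: ltnW.
have [sg bij hsg] := Hfl (Ordinal jl).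
set A := LHS; have E : A = \sum_S c S * \prod_i v j i (if i == Ordinal jl then - w i S else w i S).
  rewrite /A (reindex sg) /=; last exact: onW_bij.
  apply: eq_bigr => S _; have [-> hw] := hsg S; congr (_ * _).
  by apply: eq_bigr => i _; rewrite hw.
(* One copy is kept and the other is reindexed by the sign change of the coordinate [j]. *)
have -> : A = (A + A) / 2 by field.
rewrite {2}E /A -big_split /= mulr_suml; apply: eq_bigr => S _.
have D (f : 'I_l -> R) : \prod_i f i = f (Ordinal jl) * \prod_(i | i != Ordinal jl) f i by rewrite (bigD1 (Ordinal jl)).
rewrite -mulrDr -mulrA; congr (_ * _); rewrite !D.
have vj a : v j (Ordinal jl) a = u (Ordinal jl) a by rewrite /v /= ltnn.
have vj1 a : v j.+1 (Ordinal jl) a = (u (Ordinal jl) a + u (Ordinal jl) (- a)) / 2 by rewrite /v /= ltnSn.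
rewrite !vj vj1 eqxx.
rewrite [X in _ + _ * X](eq_bigr (fun i => v j i (w i S))) => [|i /negbTE ->] //.
rewrite -mulrDl mulrAC; congr (_ * _); apply: eq_bigr => i ij; rewrite /v.
by rewrite ltnS [(i <= j)%N]leq_eqVlt (_ : (nat_of_ord i == j) = false) //; apply/eqP => e; case/eqP: ij; apply: val_inj.
Qed.

Lemma abs_rep S : exists S', c S' = c S /\ forall i, w i S' = `|w i S|%N.
Proof.
suff main j : (j <= l)%N -> exists S', c S' = c S /\ forall i : 'I_l, w i S' = if (i < j)%N then `|w i S|%N : int else w i S.
  by have [S' [e h]] := main l (leqnn l); exists S'; split => // i; rewrite h ltn_ord.
elim: j => [|j IH] jl; first by exists S.
have [S' [e h]] := IH (ltnW jl).
have hj := h (Ordinal jl); rewrite /= ltnn in hj.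
have ne (i : 'I_l) : i != Ordinal jl -> (i < j.+1)%N = (i < j)%N.
  by move=> ij; rewrite ltnS leq_eqVlt (_ : (nat_of_ord i == j) = false) //; apply/eqP => e1; case/eqP: ij; apply: val_inj.
have [pos|neg] := leP 0 (w (Ordinal jl) S).
  exists S'; split => // i; have [->|ij] := eqVneq i (Ordinal jl); last by rewrite h ne.
  by rewrite hj ltnSn gez0_abs.
have [sg _ hsg] := Hfl (Ordinal jl); have [e1 h1] := hsg S'.
exists (sg S'); split; first by rewrite e1.
move=> i; rewrite h1; have [->|ij] := eqVneq i (Ordinal jl); last by rewrite h ne.
by rewrite hj ltnSn ltz0_abs.
Qed.

Lemma F_deg S r : c S != 0 -> (r <= l)%N ->
  (\sum_(i < l | i < r) (size (T S i)).-1 <= \sum_(i < l | i < r) parts lam i)%N.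
Proof.
move=> cS rl; apply: (@leq_trans (\sum_(i < l | i < r) `|w i S|)%N).
  by apply: leq_sum => i _; have [h _] := size_cheb R `|w i S|; rewrite -subn1 leq_subLR add1n.
have [S' [e h]] := abs_rep S; rewrite -e in cS; have := Hps rl cS.
rewrite (eq_bigr (fun i => `|w i S|%N : int)) => [|i _]; last exact: h.
by rewrite -!(big_morph Posz PoszD (erefl _)) lez_nat.
Qed.

Lemma F_sym (i j : 'I_l) : i != j -> exists2 sg : K -> K, bijective sg &
  forall S, c (sg S) = c S /\ forall k, T (sg S) k = T S (tperm i j k).
Proof.
move=> ij; have [sg bij h] := Htr ij; exists sg => // S.
by have [e1 h1] := h S; split => // k; rewrite h1.
Qed.

Lemma prod_upd (u : 'I_l -> int -> R) i v S :
  \prod_j upd u i v j (w j S) = v (w i S) * \prod_(j | j != i) u j (w j S).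
Proof.
rewrite (bigD1 i) //= /upd eqxx; congr (_ * _); apply: eq_bigr => j /negbTE ->.
by [].
Qed.

Lemma meval_F x : meval x F = \sum_S c S * \prod_i (T S i).[x i].
Proof.
rewrite (rmorph_sum (meval x)); apply: eq_bigr => S _ /=.
by rewrite mpoly.mevalZ meval_mprod.
Qed.

Lemma mderiv_sum i (G : K -> mpoly l R) :
  mpoly.mderiv i (\sum_S G S) = \sum_S mpoly.mderiv i (G S).
Proof. by rewrite (big_morph (mpoly.mderiv i) (mpoly.mderivD i) (mpoly.mderiv0 _ i)). Qed.

Lemma meval_dF i x : meval x (mpoly.mderiv i F) =
  \sum_S c S * ((T S i)^`().[x i] * \prod_(j | j != i) (T S j).[x j]).
Proof.
rewrite mderiv_sum (rmorph_sum (meval x)); apply: eq_bigr => S _ /=.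
rewrite mpoly.mderivZ mpoly.mevalZ mderiv_mprod meval_mprod (bigD1 i) //= /upd eqxx.
by congr (_ * (_ * _)); apply: eq_bigr => j /negbTE ->.
Qed.

Lemma meval_ddF i x : meval x (mpoly.mderiv i (mpoly.mderiv i F)) =
  \sum_S c S * ((T S i)^`()^`().[x i] * \prod_(j | j != i) (T S j).[x j]).
Proof.
rewrite !mderiv_sum (rmorph_sum (meval x)); apply: eq_bigr => S _ /=.
rewrite !mpoly.mderivZ mpoly.mevalZ !mderiv_mprod meval_mprod (bigD1 i) //= /upd !eqxx.
by congr (_ * (_ * _)); apply: eq_bigr => j /negbTE ->.
Qed.

Section Point.
Variable z : 'I_l -> R.
Hypothesis z1 : forall i, 1 < z i.
Let x i := (z i + (z i)^-1) / 2.
Let y i := (z i - (z i)^-1) / 2.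
Let z0 i : z i != 0. Proof. by rewrite gt_eqF // (lt_trans ltr01). Qed.

Lemma F_z : \sum_S c S * \prod_i z i ^ w i S = meval x F.
Proof.
rewrite (flip_sum (fun i a => z i ^ a)) meval_F; apply: eq_bigr => S _; congr (_ * _).
by apply: eq_bigr => i _; rewrite chebT_eval.
Qed.

Lemma prod_weight i (g : int -> R) S : g (w i S) * \prod_j z j ^ w j S =
  \prod_j upd (fun j a => z j ^ a) i (fun a => g a * z i ^ a) j (w j S).
Proof. by rewrite prod_upd (bigD1 i) //= mulrA. Qed.

Lemma prod_weight_flip i (g : int -> R) S :
  \prod_j ((upd (fun j a => z j ^ a) i (fun a => g a * z i ^ a) j (w j S) +
            upd (fun j a => z j ^ a) i (fun a => g a * z i ^ a) j (- w j S)) / 2) =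
  (g (w i S) * z i ^ w i S + g (- w i S) * z i ^ (- w i S)) / 2 * \prod_(j | j != i) (T S j).[x j].
Proof.
rewrite (bigD1 i) //= /upd eqxx; congr (_ * _); apply: eq_bigr => j /negbTE ->.
by rewrite chebT_eval.
Qed.

Lemma dF_z i : \sum_S c S * ((w i S)%:~R * \prod_j z j ^ w j S) = y i * meval x (mpoly.mderiv i F).
Proof.
under eq_bigr do rewrite (prod_weight _ (fun a => a%:~R)).
rewrite flip_sum meval_dF mulr_sumr; apply: eq_bigr => S _.
rewrite (prod_weight_flip i (fun a => a%:~R)) -(chebT_deriv_eval _ (z0 i)) -/(x i) -/(y i).
by move: (\prod_(j | _) _) (_.[_]) => P a; ring.
Qed.

Lemma ddF_z i : \sum_S c S * ((w i S)%:~R ^+ 2 * \prod_j z j ^ w j S) =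
  (x i ^+ 2 - 1) * meval x (mpoly.mderiv i (mpoly.mderiv i F)) + x i * meval x (mpoly.mderiv i F).
Proof.
under eq_bigr do rewrite (prod_weight _ (fun a => a%:~R ^+ 2)).
rewrite flip_sum meval_dF meval_ddF !mulr_sumr -big_split /=; apply: eq_bigr => S _.
rewrite (prod_weight_flip i (fun a => a%:~R ^+ 2)) -(chebT_deriv2_eval _ (z0 i)) -/(x i).
by move: (\prod_(j | _) _) (_.[_]) (_.[_]) => P a b; ring.
Qed.

End Point.

Lemma logderiv (I : Type) (r : seq I) (P : pred I) (f : I -> mpoly l R) i (x : 'I_l -> R) :
  (forall a, P a -> meval x (f a) != 0) ->
  meval x (mpoly.mderiv i (\prod_(a <- r | P a) f a)) =
  meval x (\prod_(a <- r | P a) f a) * \sum_(a <- r | P a) meval x (mpoly.mderiv i (f a)) / meval x (f a).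
Proof.
move=> nz; elim: r => [|a r IH].
  by rewrite !big_nil mulr0 -[1](mpoly.mpolyC1 l) mpoly.mderivC mpoly.meval0.
rewrite !big_cons; case: ifP => // Pa.
rewrite mpoly.mderivM mpoly.mevalD !mpoly.mevalM IH mulrDr; congr (_ + _); last by rewrite mulrA.
by move: (nz a Pa) => fa0; field.
Qed.

Lemma vandermonde_logderiv i (x : 'I_l -> R) : injective x ->
  meval x (mpoly.mderiv i V) = meval x V * \sum_(j < l | j != i) (x i - x j)^-1.
Proof.
move=> xi; have e (a b : 'I_l) : meval x (mpolyX R (mnm1 a) - mpolyX R (mnm1 b)) = x a - x b.
  by rewrite (rmorphB (meval x)) /= !mpoly.mevalXU.
have nz (a b : 'I_l) : (a < b)%N -> x a - x b != 0.
  by move=> ab; rewrite subr_eq0; apply/eqP => /xi h; rewrite h ltnn in ab.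
have d (a b : 'I_l) : meval x (mpoly.mderiv i (mpolyX R (mnm1 a) - mpolyX R (mnm1 b))) = (a == i)%:R - (b == i)%:R.
  have e1 c' : meval x (emb c' 1) = 1 by rewrite meval_emb hornerC.
  rewrite mpoly.mderivB -!embX !mderiv_emb derivX (rmorphB (meval x)) /=.
  by rewrite ![i == _]eq_sym; do 2!case: ifP => _; rewrite ?e1 ?mpoly.meval0.
rewrite /vandermonde_mpoly logderiv => [|a _]; last first.
  rewrite (rmorph_prod (meval x)); apply/prodf_neq0 => b ab.
  by rewrite [X in X != 0]e nz.
congr (_ * _).
transitivity (\sum_(a < l) \sum_(b < l | (a < b)%N) ((a == i)%:R - (b == i)%:R) / (x a - x b)).
  apply: eq_bigr => a _; rewrite logderiv => [|b ab]; last by rewrite e nz.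
  rewrite mulrAC divff ?mul1r; last first.
    by rewrite (rmorph_prod (meval x)); apply/prodf_neq0 => b ab; rewrite [X in X != 0]e nz.
  by apply: eq_bigr => b _; rewrite d e.
transitivity (\sum_(a < l) \sum_(b < l | (a < b)%N) (a == i)%:R / (x a - x b) +
              \sum_(a < l) \sum_(b < l | (a < b)%N) (b == i)%:R / (x b - x a)).
  rewrite -big_split; apply: eq_bigr => a _ /=; rewrite -big_split /=; apply: eq_bigr => b _.
  by rewrite mulrBl -[x a - x b in X in _ - X]opprB invrN mulrN opprK.
rewrite (bigD1 i) //= [X in _ + X + _]big1 ?addr0 => [|a ai]; last first.
  by rewrite big1 // => b _; rewrite (negbTE ai) mul0r.
rewrite (exchange_big_dep predT) //= [X in _ + X](bigD1 i) //= [X in _ + (_ + X)]big1 ?addr0 => [|a ai]; last first.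
  by rewrite big1 // => b _; rewrite (negbTE ai) mul0r.
rewrite [RHS](bigID (fun j : 'I_l => (i < j)%N)) /=; congr (_ + _).
  apply: eq_big => [j|j _]; last by rewrite eqxx mul1r.
  by case: (ltnP i j) => // h; rewrite ?andbF // andbT -val_eqE /= gtn_eqF.
apply: eq_big => [j|j _]; last by rewrite eqxx mul1r.
by rewrite -leqNgt [RHS]andbC -val_eqE /= ltn_neqAle andbC.
Qed.

Lemma Ev_jpos : Ev al be (jpos lam) = Ev al be (fun i : 'I_l => i : nat) +
  \sum_(i < l) ((parts lam i)%:R ^+ 2 + (parts lam i)%:R * (2 * (l - i.+1)%N%:R + (al + be + 1))).
Proof.
have -> : Ev al be (fun i : 'I_l => i : nat) = \sum_(i < l) jev al be (l - i.+1).
  by rewrite /Ev (reindex_inj rev_ord_inj).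
rewrite -big_split /=; apply: eq_bigr => i _.
by rewrite /jpos /jev natrD; ring.
Qed.

(** Conjugation by [V] turns the interaction terms [1 / (x_i - x_j)] of the radial operator into a
    sum of one-variable operators. The identity is tested at points with coordinates above 1, where
    [x = (z + 1/z) / 2] can be solved with [z > 1]. *)
Lemma F_eigen : mD al be (V * F) = - Ev al be (jpos lam) *: (V * F).
Proof.
apply/eqP; rewrite -subr_eq0; apply/eqP; set Q := _ - _.
apply: (mulfI (vandermonde_neq0 R l)); rewrite mulr0; apply: mpoly_eq0_gt1 => x x1.
rewrite mpoly.mevalM meval_vandermonde.
have [inj|] := boolP (injectiveb x); last first.
  move/injectivePn => [i [j ij e]]; apply/eqP; rewrite mulf_eq0; apply/orP; left; apply/eqP.
  rewrite vdmE; apply: (determinant_alternate ij) => b; by rewrite !mxE e.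
have /injectiveP xinj := inj; suff -> : meval x Q = 0 by rewrite mulr0.
have /choice[z hz] : forall i, exists z, [/\ 1 < z & x i = (z + z^-1) / 2].
  by move=> i; exact: joukowski.
have z1 i : 1 < z i by have [] := hz i.
have zinj : injective z by move=> i j e; apply: xinj; have [_ ->] := hz i; have [_ ->] := hz j; rewrite e.
have xE : x = fun i => (z i + (z i)^-1) / 2 by apply/funext => i; have [_ ->] := hz i.
pose y i := (z i - (z i)^-1) / 2.
have z0 i : z i != 0 by rewrite gt_eqF // (lt_trans ltr01).
have yy i : y i * y i = x i ^+ 2 - 1 by rewrite xE /y; field.
have y0 i : y i != 0.
  apply/eqP => e; have : x i ^+ 2 - 1 = 0 by rewrite -yy e mul0r.
  by apply/eqP; rewrite gt_eqF // subr_gt0 expr_gt1 // ltW // (lt_trans ltr01).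
have := Hcas z1 zinj; rewrite /= F_z // -xE.
move=> hc0; set e2 := (\sum_(i < l) (_ + _ * (_ + _))) in hc0.
set f := meval x F in hc0.
have hc : e2 * f = \sum_i ((x i ^+ 2 - 1) * meval x (mpoly.mderiv i (mpoly.mderiv i F)) +
   (2 * (x i ^+ 2 - 1) * (\sum_(j < l | j != i) (x i - x j)^-1) + ((al + be + 2) * x i + (al - be))) *
    meval x (mpoly.mderiv i F)).
  rewrite hc0; apply: eq_bigr => i _; rewrite ddF_z // dF_z // -xE -/(y i).
  have -> : (z i + (z i)^-1) / 2 = x i by rewrite xE.
  rewrite (eq_bigr (fun j => 2 * y i * (x i - x j)^-1)) => [|j _]; last by rewrite xE.
  rewrite -mulr_sumr -yy; move: (y0 i); move: (\sum_(j | _) _) (meval _ _) (meval _ _) => s d1 d2 yi0.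
  by field.
rewrite /Q (rmorphB (meval x)) /= mpoly.mevalZ mpoly.mevalM Ev_jpos mulNr opprK.
(* Leibniz rule for a second order operator; its cross term, with [G = V], gives the logarithmic
   derivative of [V]. *)
have gen (G H : mpoly l R) : mD al be (G * H) = G * mD al be H + H * mD al be G +
    \sum_i 2%:R * emb i (1 - 'X^2) * (mpoly.mderiv i G * mpoly.mderiv i H).
  rewrite /mD !mulr_sumr -!big_split /=; apply: eq_bigr => i _.
  rewrite mpoly.mderivM mpoly.mderivD !mpoly.mderivM.
  move: (mpoly.mderiv i (mpoly.mderiv i G)) (mpoly.mderiv i (mpoly.mderiv i H)) => a1 a2.
  by move: (mpoly.mderiv i H) (mpoly.mderiv i G) (emb _ _) (emb _ _) => a3 a4 a7 a8; ring.
rewrite gen.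
rewrite mD_vandermonde // !(rmorphD (meval x)) /= !mpoly.mevalM mpoly.mevalZ.
rewrite -/f /mD !(rmorph_sum (meval x)) /=.
rewrite (eq_bigr (fun i => (1 - x i ^+ 2) * meval x (mpoly.mderiv i (mpoly.mderiv i F)) +
    ((be - al) - (al + be + 2) * x i) * meval x (mpoly.mderiv i F))) => [|i _]; last first.
  by rewrite (rmorphD (meval x)) /= !(rmorphM (meval x)) /= !meval_emb !hornerE.
rewrite [X in _ + _ + X + _](eq_bigr (fun i => meval x V * (2 * (1 - x i ^+ 2) *
   (\sum_(j < l | j != i) (x i - x j)^-1) * meval x (mpoly.mderiv i F)))) => [|i _]; last first.
  have he : (1 - 'X^2 : {poly R}).[x i] = 1 - x i ^+ 2 by rewrite !hornerE.
  rewrite !(rmorphM (meval x)) /= vandermonde_logderiv // meval_emb he rmorph_nat.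
  by move: (\sum_(j | _) _) (meval _ _) (meval _ _) => s d1 d2; ring.
rewrite -mulr_sumr -/e2 -/f; set e1 := Ev _ _ _; set v := meval x V.
set A := \sum_i _; set B := \sum_i _.
have AB : A + B = - (e2 * f).
  rewrite hc -sumrN -big_split /=; apply: eq_bigr => i _.
  by move: (\sum_(j | _) _) (meval _ _) (meval _ _) => s d1 d2; ring.
have -> : B = - (e2 * f) - A by rewrite -AB addrC addKr.
by ring.
Qed.

Lemma character_formula (x : 'I_l -> R) : \sum_S c S * \prod_i (T S i).[x i] =
  (\sum_S c S) * normalized_jacobiP al be lam x.
Proof.
have [d e1 e2] := weyl_formula al1 be1 sg0 F_sym F_deg F_eigen.
rewrite -meval_F e1 mpoly.mevalZ /normalized_jacobiP.
have -> : \sum_S c S = meval (fun=> 1) F.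
  by rewrite meval_F; apply: eq_bigr => S _; rewrite big1 ?mulr1 // => i _; rewrite chebT1.
have := jacobiP1_neq0 al1 be1 lam; rewrite -e2; move: (meval _ _) (meval _ _) => a b b0.
by field.
Qed.

Local Notation wpart S := [forall i, w i S == (parts lam i)%:Z].
Local Notation apart S := [forall i, `|w i S|%N == parts lam i].

(** [flip_sum] for indicator functions: a nonzero part has two preimages under the absolute value, a
    zero part has one. *)
Lemma sum_apart : \sum_(S | apart S) c S =
  (\prod_i (if parts lam i is 0 then 1 else 2)) * \sum_(S | wpart S) c S.
Proof.
pose u i (a : int) : R := (if parts lam i is 0 then 1 else 2) * (a == (parts lam i)%:Z)%:R.
have prodb (b : 'I_l -> bool) : \prod_i (b i)%:R = [forall i, b i]%:R :> R.
  have [/forallP h|] := boolP [forall i, b i]; first by rewrite big1 // => i _; rewrite h.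
  by rewrite negb_forall => /existsP[i /negbTE bi]; rewrite (bigD1 i) //= bi mul0r.
transitivity (\sum_S c S * \prod_i ((u i (w i S) + u i (- w i S)) / 2)).
  rewrite [LHS]big_mkcond; apply: eq_bigr => S _.
  rewrite (eq_bigr (fun i => (`|w i S|%N == parts lam i)%:R)) => [|i _].
    by rewrite prodb; case: ifP; rewrite ?mulr1 ?mulr0.
  rewrite /u; case: (parts lam i) => [|p].
    rewrite oppr_eq0 absz_eq0 !mul1r; case: eqP => _ /=; first by field.
    by rewrite addr0 mul0r.
  have -> : (`|w i S|%N == p.+1) = (w i S == p.+1%:Z) || (- w i S == p.+1%:Z) by lia.
  have -> : (- w i S == p.+1%:Z) = (w i S == - p.+1%:Z) by lia.
  have ne : ~~ ((w i S == p.+1%:Z) && (w i S == - p.+1%:Z)) by lia.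
  case: (w i S == p.+1%:Z) ne; case: (w i S == - p.+1%:Z) => //= _;
    by rewrite ?(mulr0, mulr1, addr0, add0r, mul0r) // divff // pnatr_eq0.
rewrite -flip_sum mulr_sumr [RHS]big_mkcond; apply: eq_bigr => S _.
rewrite /u big_split /= prodb mulrCA; case: ifP => _; last by rewrite !mulr0.
by rewrite mulr1 mulrC.
Qed.

Lemma phin_top n (q : {poly R}) : (size q <= n.+1)%N ->
  phin al be n q = q`_n / (jpol al be n)`_n * phin al be n (jpol al be n).
Proof.
move=> sq; have ln : (jpol al be n)`_n != 0.
  by rewrite -[n in _`_n]/(n.+1.-1) -(size_jpol al1 be1 n) lead_coef_eq0 -size_poly_eq0 size_jpol.
set t := q`_n / _; have : phin al be n (q - t *: jpol al be n) = 0.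
  apply: phin_small => //; apply/leq_sizeP => j; rewrite leq_eqVlt => /orP[/eqP <-|nj].
    by rewrite coefB coefZ /t divfK ?subrr.
  have hJ : (jpol al be n)`_j = 0 by rewrite nth_default ?size_jpol.
  by rewrite coefB coefZ hJ (nth_default _ (leq_trans sq nj)) mulr0 subr0.
by rewrite /phin mulrBl -scalerAl linearB linearZ /= => /eqP; rewrite subr_eq0 => /eqP.
Qed.

Lemma partial_sums_eq (f g : 'I_l -> nat) :
  (forall r, (r <= l)%N -> \sum_(i < l | (i < r)%N) f i = \sum_(i < l | (i < r)%N) g i)%N -> f =1 g.
Proof.
move=> h i; have e (f' : 'I_l -> nat) : (\sum_(j < l | (j < i.+1)%N) f' j = f' i + \sum_(j < l | (j < i)%N) f' j)%N.
  rewrite (bigD1 i) //=; congr addn; apply: eq_bigl => j.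
  by rewrite ltnS leq_eqVlt -val_eqE /=; case: (ltngtP j i).
have := h i.+1 (ltn_ord i); rewrite !e (h i (ltnW (ltn_ord i))).
by move/eqP; rewrite eqn_add2r => /eqP.
Qed.

Lemma size_mXn s : size ((- 'X) ^+ s : {poly R}) = s.+1.
Proof.
rewrite exprNn -signr_odd mulr_sign; case: ifP => _; by rewrite ?size_polyN size_polyXn.
Qed.

(* Only the monomial of exponent [jpos lam] of [V * F] is seen by [Phi (jpos lam)]. *)
Lemma dim_lead : exists2 e : R, e * e = 1 &
  \sum_S c S = e * 2 ^+ (\sum_i parts lam i) * (\sum_(S | wpart S) c S) /
    (\prod_i (jpol al be (jpos lam i))`_(jpos lam i)) * meval (fun=> 1) (jacobiP al be lam).
Proof.
pose n := jpos lam; pose rv : 'S_l := perm rev_ord_inj.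
(* The sign of the reversing permutation, with the signs of the negated variables in
   [vandermonde_mprod]. Only its square is recorded; positivity settles it where the formula is
   applied. *)
pose e : R := (-1) ^+ rv * \prod_(i < l) (-1) ^+ rv i; exists e.
  rewrite /e mulrACA -signr_addb addbb expr0 mul1r -big_split big1 //= => i _.
  by rewrite -signr_odd -signr_addb addbb.
have [d FE dE] := weyl_formula al1 be1 sg0 F_sym F_deg F_eigen.
have -> : \sum_S c S = meval (fun=> 1) F.
  by rewrite meval_F; apply: eq_bigr => S _; rewrite big1 ?mulr1 // => i _; rewrite chebT1.
rewrite -dE; congr (_ * _).
pose D := \prod_i phin al be (n i) (jpol al be (n i)).
have D0 : D != 0 by apply/prodf_neq0 => i _; rewrite gt_eqF // jpol_sq_gt0.
have L0 : \prod_i (jpol al be (n i))`_(n i) != 0.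
  apply/prodf_neq0 => i _; rewrite -[X in _`_X]/((n i).+1.-1) -(size_jpol al1 be1 (n i)).
  by rewrite lead_coef_eq0 -size_poly_eq0 size_jpol.
have : Phi al be n (V * F) = d * D.
  rewrite FE; have := jacobiP_spec al1 be1 lam; move: (jacobiP al be lam) => P hP.
  by rewrite -scalerAr (mulrC _ P) hP jacobi_det_emb // PhiZ (Phi_jdet_diag al1 be1 (@jpos_inj l lam)).
rewrite Phi_VF // => h.
apply: (mulIf D0); rewrite -h.
pose Kc := e * (\prod_i (chebT R (parts lam i))`_(parts lam i)) / (\prod_i (jpol al be (n i))`_(n i)) * D.
(* Degrees give [n i <= s i + |w i S|]. Summed over the first [r] indices, this meets the upper
   bounds [sum_perm_le] and [Hps] without any slack, so all partial sums agree. *)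
have termE S (s : 'S_l) : c S != 0 ->
    \prod_i phin al be (n i) ((- 'X) ^+ s i * chebT R `|w i S|) != 0 -> s = rv /\ apart S.
  move=> cS nz.
  have hi i : (n i <= s i + `|w i S|)%N.
    rewrite leqNgt; apply/negP => lt; case/eqP: nz; rewrite (bigD1 i) //= phin_small ?mul0r //.
    apply: leq_trans (size_polyMleq _ _) _; rewrite size_mXn.
    by have [+ _] := size_cheb R `|w i S|; rewrite -/(chebT R _); lia.
  have [S' [eS hS]] := abs_rep S; have cS' : c S' != 0 by rewrite eS.
  have hr r : (r <= l)%N -> (\sum_(i < l | (i < r)%N) s i = \sum_(i < l | (i < r)%N) (l - i.+1))%N /\
      (\sum_(i < l | (i < r)%N) `|w i S| = \sum_(i < l | (i < r)%N) parts lam i)%N.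
    move=> rl; have h1 := sum_perm_le s r.
    have h2 : (\sum_(i < l | (i < r)%N) `|w i S| <= \sum_(i < l | (i < r)%N) parts lam i)%N.
      have := Hps rl cS'; rewrite (eq_bigr (fun i => `|w i S|%N : int)) => [|i _]; last exact: hS.
      by rewrite -!(big_morph Posz PoszD (erefl _)) lez_nat.
    have h3 : (\sum_(i < l | (i < r)%N) n i <= \sum_(i < l | (i < r)%N) (s i + `|w i S|))%N.
      by apply: leq_sum => i _; exact: hi.
    rewrite [X in (_ <= X)%N]big_split /= in h3.
    have : (\sum_(i < l | (i < r)%N) n i = \sum_(i < l | (i < r)%N) parts lam i + \sum_(i < l | (i < r)%N) (l - i.+1))%N.
      by rewrite /n /jpos big_split.
    move: h1 h2 h3; rewrite {1}/n => h1 h2 h3 h4; rewrite h4 in h3.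
    move: h1 h2 h3; move: (\sum_(i < l | (i < r)%N) s i)%N (\sum_(i < l | (i < r)%N) `|w i S|)%N.
    by move: (\sum_(i < l | (i < r)%N) (l - i.+1))%N (\sum_(i < l | (i < r)%N) parts lam i)%N => a1 a2 a3 a4; lia.
  split; last first.
    have e1 : (fun i => `|w i S|%N) =1 parts lam.
      by apply: partial_sums_eq => r rl; have [] := hr r rl.
    by apply/forallP => i; apply/eqP; exact: e1.
  have e2 : (fun i => nat_of_ord (s i)) =1 (fun i : 'I_l => (l - i.+1)%N).
    by apply: partial_sums_eq => r rl; have [] := hr r rl.
  apply/permP => i; apply: ord_inj; rewrite permE /=.
  exact: e2.
have main S : c S * \det (\matrix_(i < l, k < l) phin al be (n i) ((- 'X) ^+ k * chebT R `|w i S|)) =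
    c S * (if apart S then Kc else 0).
  have [->|cS] := eqVneq (c S) 0; first by rewrite !mul0r.
  congr (_ * _); rewrite /determinant.
  have pE s : \prod_i (\matrix_(i < l, k < l) phin al be (n i) ((- 'X) ^+ k * chebT R `|w i S|)) i (s i) =
      \prod_i phin al be (n i) ((- 'X) ^+ s i * chebT R `|w i S|).
    by apply: eq_bigr => i _; rewrite mxE.
  rewrite (eq_bigr (fun s : 'S_l => (-1) ^+ s * \prod_i phin al be (n i) ((- 'X) ^+ s i * chebT R `|w i S|))); last first.
    by move=> s _; rewrite pE.
  rewrite (bigD1 rv) //= [X in _ + X]big1 ?addr0 => [|s srv]; last first.
    apply/eqP; rewrite mulf_eq0; apply/orP; right; apply: contraT => /(termE S s cS)[h1 _].
    by rewrite h1 eqxx in srv.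
  case: ifP => [/forallP hS|hS]; last first.
    apply/eqP; rewrite mulf_eq0; apply/orP; right; apply: contraT => /(termE S rv cS)[_ h1].
    by rewrite h1 in hS.
  rewrite /Kc /e /D -!mulrA; congr (_ * _); rewrite -prodfV -!big_split /=; apply: eq_bigr => i _.
  rewrite (eqP (hS i)) phin_top; last first.
    apply: leq_trans (size_polyMleq _ _) _; rewrite size_mXn permE /=.
    have [hc _] := size_cheb R (parts lam i).
    by apply: leq_trans (leq_add (leqnn _) hc) _; rewrite /n /jpos addnS addnC.
  rewrite !mulrA; congr (_ / _ * _).
  rewrite permE /= (exprNn 'X) -mulrA -signr_odd -[in RHS]signr_odd; move: (odd _) => b.
  have E : ('X^(l - i.+1) * chebT R (parts lam i))`_(n i) = (chebT R (parts lam i))`_(parts lam i).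
    by rewrite mulrC coefMXn /n /jpos ltnNge leq_addl /= addnK.
  by case: b; rewrite ?(expr0, expr1, mul1r, mulN1r) ?coefN E.
rewrite (eq_bigr _ (fun S _ => main S)) -(eq_bigr _ (fun S _ => erefl)).
have -> : \sum_S c S * (if apart S then Kc else 0) = (\sum_(S | apart S) c S) * Kc.
  rewrite mulr_suml [RHS]big_mkcond; apply: eq_bigr => S _.
  by case: ifP; rewrite ?mulr0.
rewrite sum_apart /Kc.
have -> : 2 ^+ (\sum_i parts lam i) = (\prod_i (chebT R (parts lam i))`_(parts lam i)) *
    \prod_i (if parts lam i is 0 then 1 else 2) :> R.
  rewrite -big_split /= -prodrXr; apply: eq_bigr => i _; rewrite -chebT_lead.
  by [].
by move: (\prod_i (if _ is 0 then _ else _)) (\sum_(S | _) _) (\prod_i (chebT R _)`_ _) (\prod_i _) L0 => x1 x2 x3 x4 x40; field.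
Qed.

End CharacterFormula.

(** * Spectral measures and skew Howe duality *)

Section SpectralMeasure.
Variables (R : realType) (l k : nat) (al be : R).
Hypotheses (al1 : -1 < al) (be1 : -1 < be).
Variable mu : intpart l -> R.
Hypothesis mu_ge0 : forall lam, 0 <= mu lam.
Hypothesis mu_box : forall lam, ~~ in_box k lam -> mu lam = 0.
Hypothesis mu_expansion : forall x : 'I_l -> R,
  \sum_(lam <- fset_set (box l k)) mu lam * normalized_jacobiP al be lam x = \prod_i ((1 + x i) / 2) ^+ k.

Lemma meval_bounded (p : mpoly l R) : exists2 B : R, 0 <= B &
  forall x : 'I_l -> R, (forall i, -1 <= x i <= 1) -> `|meval x p| <= B.
Proof.
exists (\sum_(m <- mpoly.msupp p) `|mpoly.mcoeff m p|) => [|x hx]; first exact: sumr_ge0.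
rewrite mpoly.mevalE; apply: le_trans (ler_norm_sum _ _ _) _; apply: ler_sum => m _.
rewrite normrM ler_piMr // normr_prod.
have /andP[] // : 0 <= \prod_i `|x i ^+ m i| <= 1.
apply: (big_ind (fun v : R => 0 <= v <= 1)) => [|a b /andP[a0 a1] /andP[b0 b1]|i _].
- by rewrite ler01 lexx.
- by rewrite mulr_ge0 // mulr_ile1.
- by rewrite normr_ge0 normrX exprn_ile1 // ler_norml.
Qed.

Lemma box_fsbig N (f : intpart l -> R) :
  \sum_(lam \in box l N) f lam = \sum_(lam <- fset_set (box l N)) f lam.
Proof. by rewrite fsbig_finite //; exact: box_finite. Qed.

Lemma box_widen N (f : intpart l -> R) : (k <= N)%N -> (forall lam, ~~ in_box k lam -> f lam = 0) ->
  \sum_(lam <- fset_set (box l N)) f lam = \sum_(lam <- fset_set (box l k)) f lam.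
Proof.
move=> kN f0; rewrite -!box_fsbig; apply/esym/fsbig_widen => lam /=.
  by move=> /forallP h; apply/forallP => i; exact: leq_trans (h i) kN.
by move=> [_ /negP nb]; exact: f0.
Qed.

Lemma normalized_jacobiP1 (lam : intpart l) : normalized_jacobiP al be lam (fun=> 1) = 1.
Proof. by rewrite /normalized_jacobiP divff // jacobiP1_neq0. Qed.

Lemma mu_sum1 : \sum_(lam <- fset_set (box l k)) mu lam = 1.
Proof.
have := mu_expansion (fun=> 1); rewrite [RHS]big1 => [<-|i _]; last first.
  by rewrite (_ : (1 + 1) / 2 = 1 :> R) ?expr1n //; field.
by apply: eq_bigr => lam _; rewrite normalized_jacobiP1 mulr1.
Qed.

Lemma mu_probability : is_probability mu.
Proof.
split=> //; rewrite -[X in esum _ X]/(fun lam => (mu lam)%:E).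
have -> : \esum_(x in [set: intpart l]) (mu x)%:E = \esum_(x in box l k) (mu x)%:E.
  rewrite [RHS]esum_mkcond; apply: eq_esum => lam _; case: ifPn => // h.
  by rewrite mu_box //; apply/negP => hb; case/negP: h; exact: mem_set.
rewrite esum_fset; last 2 first.
- exact: box_finite.
- by move=> lam _; rewrite lee_fin.
by rewrite fsbig_finite ?sumEFin ?mu_sum1 //; exact: box_finite.
Qed.

Lemma mu_spectral_expansion : is_spectral_expansion al be (omega R k) mu.
Proof.
move=> e e0; exists k => // N /= kN x _.
rewrite box_fsbig box_widen // => [|lam h]; last by rewrite mu_box ?mul0r.
rewrite mu_expansion (eq_bigr (fun i => ((1 + x i) / 2) ^+ k)) => [|i _]; last by rewrite phi_omega.
by rewrite subrr normr0 ltW.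
Qed.

(** A competitor [mu'] need not vanish outside the box, and only the uniform convergence of its
    expansion is available. Multiplying by the Vandermonde polynomial and applying [Phi (jpos nu)]
    isolates [mu nu - mu' nu], which [Phi_bound] makes arbitrarily small. *)
Lemma spectral_unique : unique (is_spectral_measure al be (omega R k)) mu.
Proof.
split; first by split; [exact: mu_probability|exact: mu_spectral_expansion].
move=> mu' [_ hexp]; apply/funext => nu.
pose n := jpos nu; pose D := \prod_i phin al be (n i) (jpol al be (n i)).
have D0 : D != 0 by apply/prodf_neq0 => i _; rewrite gt_eqF // jpol_sq_gt0.
pose P1 (lam : intpart l) := meval (fun=> 1) (jacobiP al be lam).
have P1n0 lam : P1 lam != 0 by exact: jacobiP1_neq0.
have [BV BV0 hBV] := meval_bounded (vandermonde_mpoly R l).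
have [C hC] := Phi_bound al1 be1 n.
pose a := (mu nu - mu' nu) / P1 nu * D.
have key e : 0 < e -> `|a| <= BV * e * C.
  move=> e0; have [M _ hM] := hexp e e0.
  pose N := (maxn M k + \sum_i parts nu i)%N.
  have kN : (k <= N)%N by rewrite /N (leq_trans (leq_maxr M k)) // leq_addr.
  have MN : (M <= N)%N by rewrite /N (leq_trans (leq_maxl M k)) // leq_addr.
  have nuN : nu \in fset_set (box l N).
    rewrite in_fset_set; last exact: box_finite.
    apply: mem_set; apply/forallP => i; apply: leq_trans (leq_addl _ _).
    by rewrite (bigD1 i) //= leq_addr.
  pose Q : mpoly l R := \sum_(lam <- fset_set (box l N)) ((mu lam - mu' lam) / P1 lam) *: jacobiP al be lam.
  have QE x : meval x Q = \prod_(i < l) phi (omega R k) (x i) -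
      \sum_(lam \in box l N) mu' lam * normalized_jacobiP al be lam x.
    rewrite box_fsbig (eq_bigr (fun i => ((1 + x i) / 2) ^+ k)) => [|i _]; last by rewrite phi_omega.
    rewrite -mu_expansion -(box_widen kN) => [|lam h]; last by rewrite mu_box ?mul0r.
    rewrite -sumrB (rmorph_sum (meval x)) /=; apply: eq_bigr => lam _.
    by rewrite mpoly.mevalZ /normalized_jacobiP -/(P1 lam) -mulrBl mulrAC mulrA.
  have <- : Phi al be n (vandermonde_mpoly R l * Q) = a.
    have VP lam : vandermonde_mpoly R l * (((mu lam - mu' lam) / P1 lam) *: jacobiP al be lam) =
        ((mu lam - mu' lam) / P1 lam) *: jdet al be (jpos lam).
      have := jacobiP_spec al1 be1 lam; move: (jacobiP al be lam) => P hP.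
      by rewrite -scalerAr (mulrC _ P) hP jacobi_det_emb.
    have hd : Phi al be n (jdet al be (jpos nu)) = D := Phi_jdet_diag al1 be1 (@jpos_inj l nu).
    have hne lam : lam != nu -> Phi al be n (jdet al be (jpos lam)) = 0.
      move=> ne; apply: (Phi_jdet_neq al1 be1 (@jpos_anti l nu) (@jpos_anti l lam)).
      apply/eqP => h; case/eqP: ne; apply: parts_inj => i.
      have /eqP := congr1 (fun f => f i) h; rewrite /jpos eqn_add2r => /eqP e1.
      by rewrite e1.
    rewrite mulr_sumr Phi_sum.
    rewrite (eq_bigr (fun lam => (mu lam - mu' lam) / P1 lam * Phi al be n (jdet al be (jpos lam)))); last first.
      by move=> lam _; rewrite VP PhiZ.
    rewrite (bigD1_seq nu nuN (fset_uniq _)).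
    rewrite big1; last by move=> lam ne; rewrite (hne lam ne) mulr0.
    by rewrite hd; exact: addr0.
  apply: hC => x hx; rewrite mpoly.mevalM normrM ler_pM //; first exact: hBV.
  by rewrite QE; exact: hM.
have a0 : a = 0.
  apply/normr0_eq0/le_anti; rewrite normr_ge0 andbT.
  have C0 : 0 <= `|BV * C| by [].
  apply/ler_addgt0Pr => e e0; rewrite add0r.
  apply: le_trans (key (e / (1 + `|BV * C|)) _) _; first by rewrite divr_gt0 // ltr_wpDr.
  rewrite mulrAC mulrA ler_pdivrMr ?ltr_wpDr // mulrC ler_pM2l //.
  by apply: le_trans (ler_norm _) _; rewrite lerDr.
move/eqP: a0; rewrite !mulf_eq0 invr_eq0 (negbTE (P1n0 nu)) (negbTE D0) !orbF subr_eq0.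
by move/eqP.
Qed.

End SpectralMeasure.

(** * The spectral expansion for the three dualities *)

Section FockExpansion.
Variables (R : realType) (l m k dl : nat) (fl : bool).
Local Notation C := R[i].
Local Notation n := (l + m)%N.
Variables (eps : 'I_n -> C) (etaR al be : R).
Local Notation eta := (etaR%:C)%C.
Hypothesis eps_sq : forall i, eps i * eps i = 1.
Hypothesis eps_rev : forall i, eps (rev_ord i) = eta * eps i.
Hypothesis half : forall j : 'I_n, (j < rev_ord j)%N = (j < l)%N.
Hypothesis eps_l : forall i j : 'I_n, (i < l)%N -> (j < l)%N -> eps i = eps j.
Hypothesis fl_eta : fl -> m = l /\ forall i, eps i = 1.
Hypothesis nfl : ~~ fl -> eta = 1 -> m = l.+1.
Hypothesis mE : m = (l + dl)%N.
Hypothesis dl1 : (dl <= 1)%N.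
Hypotheses (al1 : -1 < al) (be1 : -1 < be) (sg0 : 0 <= al + be + 1).
Hypotheses (albe : al + be = dl%:R - etaR) (albe' : al - be = dl%:R).
Local Notation I := ('I_n * 'I_k)%type.
Implicit Types (lam : intpart l) (S : {set I}).
Local Notation comp lam := (comp k fl eps (weight lam)).
Local Notation lsh := (@lsh l m).
Implicit Types (U : {vspace exterior C I}).
Local Notation w := (fun i S => wt (lsh i) S).

Lemma simg_bij (s : 'S_n) : bijective (@simg n k s).
Proof. exact/injF_bij/simg_inj. Qed.

Lemma wt_simg_fl i j S : wt (lsh j) (simg (wfl m i) S) = if j == i then - wt (lsh j) S else wt (lsh j) S.
Proof.
rewrite wt_wfl; have [e1 e2 e3] := wflE (m := m) i (lsh j).
case: eqP => [->|/eqP ne]; first by rewrite e1 wt_rev.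
by rewrite e3 ?lsh_inj // eq_sym (rev_lsh half).
Qed.

Lemma wt_simg_tr (i j a : 'I_l) S : i != j -> wt (lsh a) (simg (wtr m i j) S) = wt (lsh (tperm i j a)) S.
Proof.
move=> ij; rewrite wt_wtr //; have [e1 e2 _ _ e3] := wtrE half (lsh a) ij.
case: tpermP => [->|->|ai aj]; rewrite ?e1 ?e2 // e3 // !lsh_inj.
by rewrite ![lsh a == _]eq_sym !(negbTE (rev_lsh half _ _)); apply/and4P; split=> //; apply/eqP.
Qed.

Lemma mult_tr U (i j : 'I_l) : lie_stable eps U -> i != j -> exists2 sg : {set I} -> {set I}, bijective sg &
  forall S, mult U (sg S) = mult U S /\ forall a, w a (sg S) = w (tperm i j a) S.
Proof.
move=> sU ij; exists (simg (wtr m i j)); first exact: simg_bij.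
by move=> S; split=> [|a]; [exact: (mult_wtr eps_sq eps_rev half eps_l)|exact: wt_simg_tr].
Qed.

Lemma mult_fl U (i : 'I_l) : (forall S, mult U (simg (wfl m i) S) = mult U S) ->
  exists2 sg : {set I} -> {set I}, bijective sg & forall S, mult U (sg S) = mult U S /\
    forall j, w j (sg S) = if j == i then - w j S else w j S.
Proof.
move=> h; exists (simg (wfl m i)); first exact: simg_bij.
by move=> S; split=> [|j]; [exact: h|exact: wt_simg_fl].
Qed.

(** Matching [(1 - eta) x + dl (x + 1)] with [(al + be + 1) x + (al - be)] is the origin of the
    Jacobi parameters: [(eta, dl)] is [(-1, 0)], [(1, 1)], [(1, 0)] for the symplectic, odd and even
    orthogonal groups. *)
Lemma mult_radial U lam : lie_stable eps U -> (U <= comp lam)%VS ->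
  forall z : 'I_l -> R, (forall i, 1 < z i) -> injective z ->
  let t S := \prod_(i < l) z i ^ w i S in
  let x i := (z i + (z i)^-1) / 2 in let y i := (z i - (z i)^-1) / 2 in
  let h i := \sum_S mult U S * ((w i S)%:~R * t S) in
  (\sum_(i < l) ((parts lam i)%:R ^+ 2 + (parts lam i)%:R * (2 * (l - i.+1)%N%:R + (al + be + 1)))) *
    (\sum_S mult U S * t S) =
  \sum_(i < l) (\sum_S mult U S * ((w i S)%:~R ^+ 2 * t S) +
    h i * (\sum_(j < l | j != i) 2 * y i / (x i - x j)
           + ((al + be + 1) * x i + (al - be)) / y i)).
Proof.
move=> sU Uc z z1 zi t x0 y h.
have := mult_casimir eps_sq eps_rev half fl_eta nfl mE dl1 sU Uc z1 zi; rewrite -/t -/x0 -/y -/h => e.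
transitivity ((\sum_(i < l) ((parts lam i)%:R ^+ 2 + (parts lam i)%:R * (n%:R - 1 - 2 * i%:R - etaR))) *
  (\sum_S mult U S * t S)).
  congr (_ * _); apply: eq_bigr => i _; congr (_ + _ * _).
  rewrite albe mE !natrD natrB // -natr1; ring.
rewrite e; apply: eq_bigr => i _; congr (_ + _ * _); rewrite -addrA; congr (_ + _).
by rewrite -mulrDl; congr (_ / _); rewrite albe albe'; ring.
Qed.

Lemma mult_character lam (x : 'I_l -> R) :
  \sum_(S : {set I}) mult (comp lam) S * \prod_i (chebT R `|wt (lsh i) S|).[x i] =
  (\dim (comp lam))%:R * normalized_jacobiP al be lam x.
Proof.
have sU : lie_stable eps (comp lam) by exact: comp_stable.
rewrite -mult_dim; apply: (@character_formula R l al be al1 be1 sg0 _ w (mult (comp lam)) lam).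
- by move=> i; apply: mult_fl => S; exact: (mult_wfl eps_sq eps_rev half eps_l fl_eta nfl).
- by move=> i j; exact: mult_tr.
- by move=> r S rl; exact: (mult_psum eps_sq eps_rev half fl_eta nfl (subvv _)).
- exact: mult_radial sU (subvv _).
Qed.

Lemma prod_halves (f : 'I_n -> R) (c : R) : (forall a, rev_ord a = a -> f a = c) ->
  \prod_a f a = (\prod_(i < l) (f (lsh i) * f (rev_ord (lsh i)))) * c ^+ dl.
Proof.
move=> fc; pose mid (a : 'I_n) := rev_ord a == a.
have H (g : 'I_n -> R) : \prod_(a < n | (a < rev_ord a)%N) g a = \prod_(i < l) g (lsh i).
  under eq_bigl do rewrite half.
  rewrite big_split_ord /= [X in _ * X]big_pred0 ?mulr1; last by move=> i; rewrite ltnNge leq_addr.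
  by apply: eq_bigl => i; exact: ltn_ord.
rewrite (bigID (fun a : 'I_n => (a < rev_ord a)%N)) /= H big_split /= -mulrA; congr (_ * _).
rewrite (bigID mid) /= mulrC -[\prod_(i < l) f _]/(\prod_(i < l) (fun a => f (rev_ord a)) (lsh i)) -H.
congr (_ * _).
  rewrite (reindex_inj rev_ord_inj) /=; apply: eq_bigl => a; rewrite /mid rev_ordK.
  by rewrite -val_eqE /=; have := ltn_ord a; lia.
transitivity (\prod_(a < n | mid a) c).
  apply: eq_big => [a|a /andP[_ /eqP]]; last exact: fc.
  by rewrite /mid -val_eqE /=; lia.
rewrite prodr_const; congr (_ ^+ _).
have half_eq (a : 'I_n) : mid a = (l <= a < l + dl)%N.
  rewrite /mid -val_eqE /=; have := half a; have := ltn_ord a; rewrite /=.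
  by move: mE dl1; lia.
have h : (l + dl <= n)%N by rewrite mE; lia.
rewrite -sum1_card (eq_bigl (fun a : 'I_n => (l <= a)%N && (a < l + dl)%N)) => [|a]; last exact: half_eq.
rewrite (big_ord_narrow_cond h) /=.
rewrite big_split_ord /= big_pred0 ?add0n => [|i]; last by rewrite leqNgt ltn_ord.
by rewrite (eq_bigl predT) ?sum1_card ?card_ord // => i; rewrite leq_addr.
Qed.

(** The trace on the exterior algebra is the product of [1 + d_a] over the generators: opposite
    indices give [(1 + z) (1 + 1/z) = 4 (1 + x) / 2], a middle index gives 2. Averaging over signs
    makes the left side this trace. *)
Lemma character_sum (x : 'I_l -> R) :
  \sum_(S : {set I}) \prod_i (chebT R `|wt (lsh i) S|).[x i] = 2 ^+ (n * k) * \prod_i ((1 + x i) / 2) ^+ k.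
Proof.
pose P : mpoly l R := \sum_(S : {set I}) 1 *: mprod (fun i => chebT R `|wt (lsh i) S|) -
  2 ^+ (n * k) *: mprod (fun=> (2^-1%:P * (1 + 'X)) ^+ k).
have evP y : meval y P = \sum_(S : {set I}) \prod_i (chebT R `|wt (lsh i) S|).[y i] - 2 ^+ (n * k) * \prod_i ((1 + y i) / 2) ^+ k.
  rewrite (rmorphB (meval y)) /= (rmorph_sum (meval y)) /= mpoly.mevalZ meval_mprod.
  congr (_ - _ * _); first by apply: eq_bigr => S _; rewrite mpoly.mevalZ mul1r meval_mprod.
  by apply: eq_bigr => i _; rewrite horner_exp !hornerE mulrC.
apply/eqP; rewrite -subr_eq0 -evP.
suff -> : P = 0 by rewrite mpoly.meval0.
apply: mpoly_eq0_gt1 => {}x x1.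
have /choice[z hz] : forall i, exists z, [/\ 1 < z & x i = (z + z^-1) / 2] by move=> i; exact: joukowski.
have z1 i : 1 < z i by have [] := hz i.
have z0 i : z i != 0 by rewrite gt_eqF // (lt_trans ltr01).
have xE : x = fun i => (z i + (z i)^-1) / 2 by apply/funext => i; have [_ ->] := hz i.
have Hfl (i : 'I_l) : exists2 sg : {set I} -> {set I}, bijective sg & forall S, (1 : R) = 1 /\
    forall j, w j (sg S) = if j == i then - w j S else w j S.
  by exists (simg (wfl m i)); [exact: simg_bij|move=> S; split=> // j; exact: wt_simg_fl].
have := @F_z R l _ w (fun=> 1) Hfl z z1; rewrite -xE.
rewrite evP; rewrite (rmorph_sum (meval x)) /=.
rewrite [RHS](eq_bigr (fun S => \prod_i (chebT R `|wt (lsh i) S|).[x i])) => [<-|S _]; last first.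
  by rewrite mpoly.mevalZ mul1r meval_mprod.
pose d (a : 'I_n) : R := if insub (a : nat) is Some i then z i else
  if insub (rev_ord a : nat) is Some i then (z i)^-1 else 1.
have dl_ i : d (lsh i) = z i by rewrite /d (valK i : insub (lsh i : nat) = Some i).
have dr i : d (rev_ord (lsh i)) = (z i)^-1.
  rewrite /d rev_ordK insubF; last by rewrite ltnNge (rev_lsh_ge half).
  by rewrite (valK i : insub (lsh i : nat) = Some i).
have dm a : rev_ord a = a -> d a = 1.
  move=> ra; have nl : (a < l)%N = false by rewrite -half ra ltnn.
  by rewrite /d ra !insubF.
have dwt S : \prod_i z i ^ wt (lsh i) S = \prod_(p : I) (if p \in S then d p.1 else 1).
  transitivity (\prod_(a < n) \prod_(j < k) (if (a, j) \in S then d a else 1)); last first.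
    by rewrite pair_bigA; apply: eq_bigr => -[a j].
  have occE (a : 'I_n) : \prod_(j < k) (if (a, j) \in S then d a else 1) = d a ^+ occ a S.
    rewrite -big_mkcond prodr_const; congr (_ ^+ _).
    rewrite /occ -(card_imset (mem [pred j | (a, j) \in S]) (_ : injective (fun j : 'I_k => (a, j)))); last by move=> j j' [].
    apply: eq_card => p; rewrite [in RHS]inE; apply/finset.imsetP/andP => [[j jS ->]|[pS /eqP pa]]; first by split.
    by exists p.2; rewrite ?inE -pa -surjective_pairing.
  rewrite (eq_bigr _ (fun a _ => occE a)).
  rewrite (prod_halves (c := 1)) => [|a ra]; last by rewrite dm // expr1n.
  rewrite expr1n mulr1; apply: eq_bigr => i _.
  by rewrite dl_ dr /wt expfzDr // exprVn exprnN.
under eq_bigr do rewrite mul1r dwt.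
rewrite -(bigA_distr _ _ (fun p : I => d p.1) (fun=> 1)) /=.
have -> : \prod_(p : I) (d p.1 + 1) = \prod_(a < n) \prod_(j < k) (d a + 1).
  by rewrite pair_bigA; apply: eq_bigr => -[a j].
rewrite (eq_bigr (fun a => (d a + 1) ^+ k)) => [|a _]; last by rewrite prodr_const card_ord.
rewrite (prod_halves (c := 2 ^+ k)) => [|a ra]; last by rewrite dm.
rewrite (eq_bigr (fun i => 4 ^+ k * ((1 + x i) / 2) ^+ k)) => [|i _]; last first.
  rewrite dl_ dr -!exprMn; congr (_ ^+ _); have [_ ->] := hz i; move: (z0 i) => zi0; field.
  by [].
rewrite big_split /= prodr_const card_ord mulrAC.
have -> : (4 ^+ k) ^+ l * (2 ^+ k) ^+ dl = 2 ^+ (n * k) :> R.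
  have e4 : 4 = 2 ^+ 2 :> R by rewrite -natrX.
  rewrite e4 -!exprM -exprD; congr (_ ^+ _).
  by rewrite mE; lia.
by rewrite subrr.
Qed.

Lemma dim_expansion (x : 'I_l -> R) :
  \sum_(lam <- fset_set (box l k)) (2 ^- (n * k) * (\dim (comp lam))%:R) * normalized_jacobiP al be lam x =
  \prod_i ((1 + x i) / 2) ^+ k.
Proof.
apply: (mulfI (_ : 2 ^+ (n * k) != 0 :> R)); first by rewrite expf_neq0 // pnatr_eq0.
rewrite -character_sum mulr_sumr.
under eq_bigr do rewrite -mulrA mulVKf ?expf_neq0 ?pnatr_eq0 // -mult_character.
rewrite exchange_big /=; apply: eq_bigr => S _.
by rewrite -mulr_suml (mult_total eps_sq eps_rev half eps_l fl_eta nfl) mul1r.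
Qed.

Lemma howe_unique (mu : intpart l -> R) :
  (forall lam, mu lam = if in_box k lam then 2 ^- (n * k) * (\dim (comp lam))%:R else 0) ->
  unique (is_spectral_measure al be (omega R k)) mu.
Proof.
move=> muE; apply: spectral_unique => // [lam|lam nb|x].
- by rewrite muE; case: ifP => // _; rewrite mulr_ge0 ?invr_ge0 ?exprn_ge0.
- by rewrite muE (negbTE nb).
- rewrite -dim_expansion big_seq [RHS]big_seq; apply: eq_bigr => lam.
  rewrite in_fset_set; last exact: box_finite.
  by move=> /set_mem h; rewrite muE (h : in_box k lam).
Qed.

End FockExpansion.

(** * The matrix groups of the statement as groups generated by root and torus elements *)

Section BilinearForms.
Variable C : numClosedFieldType.

Definition form_mx (n : nat) (eps : 'I_n -> C) : 'M[C]_n := \matrix_(i, j) (eps i * (j == rev_ord i)%:R).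

Section Form.
Variables (n : nat) (eps : 'I_n -> C) (eta : C).
Hypothesis eps_sq : forall i, eps i * eps i = 1.
Hypothesis eps_rev : forall i, eps (rev_ord i) = eta * eps i.

Lemma form_mx_mull (A : 'M[C]_n) i j : (form_mx eps *m A) i j = eps i * A (rev_ord i) j.
Proof.
rewrite mxE (bigD1 (rev_ord i)) //= mxE eqxx mulr1 big1 ?addr0 // => a /negbTE ai.
by rewrite mxE ai mulr0 mul0r.
Qed.

Lemma form_mx_mulr (A : 'M[C]_n) i j : (A *m form_mx eps) i j = A i (rev_ord j) * (eta * eps j).
Proof.
rewrite mxE (bigD1 (rev_ord j)) //= mxE rev_ordK eqxx mulr1 eps_rev big1 ?addr0 // => a /negbTE aj.
by rewrite mxE (_ : (j == rev_ord a) = false) ?mulr0 // -(inj_eq rev_ord_inj) rev_ordK eq_sym.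
Qed.

(** The form matrix squares to [eta], and conjugates the transpose of [g] to [sigma eps g], so
    preserving the form means that [sigma eps g] inverts [g]. *)
Lemma orth_form (g : 'M[C]_n) : orth eps g <-> g^T *m form_mx eps *m g = form_mx eps.
Proof.
have JJ : form_mx eps *m form_mx eps = eta%:M.
  apply/matrixP => i j; rewrite form_mx_mull !mxE rev_ordK eps_rev mulrA mulrCA -mulrA.
  by rewrite eps_sq mul1r eq_sym mulr_natr.
have sg : form_mx eps *m (g^T *m form_mx eps) = eta *: sigma eps g.
  apply/matrixP => i j; rewrite form_mx_mull form_mx_mulr !mxE; ring.
(* An index is needed to see that [eta] is nonzero; without one all matrices are equal. *)
have [n0|[i0 _]] := set_0Vmem [set: 'I_n]%SET.
  have no (i : 'I_n) : False by have := finset.in_setT i; rewrite n0 finset.inE.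
  by split=> _; apply/matrixP => i; case: (no i).
have eta0 : eta != 0.
  by apply/eqP => e; have /eqP := eps_sq (rev_ord i0); rewrite eps_rev e !mul0r eq_sym oner_eq0.
split => [h|h].
  have e1 : form_mx eps *m (g^T *m form_mx eps *m g) = form_mx eps *m form_mx eps.
    by rewrite mulmxA sg -scalemxAl h JJ scale_scalar_mx mulr1.
  have := congr1 (mulmx (form_mx eps)) e1; rewrite !mulmxA JJ !mul_scalar_mx -!scalemxAl.
  exact: (scalerI eta0).
apply: (scalerI eta0); rewrite scalemxAl -sg -mulmxA h JJ.
by rewrite scale_scalar_mx mulr1.
Qed.

End Form.

Lemma Sp_ggen (l : nat) (g : 'M[C]_(l + l)) :
  let eps (i : 'I_(l + l)) : C := if (i < l)%N then 1 else -1 in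
  (forall i, eps (rev_ord i) = -1 * eps i) -> Sp g <-> ggen eps g.
Proof.
move=> eps er; have sq i : eps i * eps i = 1 by rewrite /eps; case: ifP; rewrite ?mulr1 // mulrNN mulr1.
have e : symplectic_mx C l = form_mx eps by apply/matrixP => i j; rewrite !mxE.
rewrite /Sp /= e; split => [h|/(ggen_orth sq er)[h _]]; last exact/(orth_form sq er).
apply: (orth_ggen sq er); first exact/(orth_form sq er).
by move=> /eqP; rewrite eq_sym -addr_eq0 -mulr2n pnatr_eq0.
Qed.

Lemma SO_ggen (n : nat) (g : 'M[C]_n) : SO g <-> ggen (fun=> 1 : C) g.
Proof.
have sq (i : 'I_n) : (1 : C) * 1 = 1 by rewrite mulr1.
have er (i : 'I_n) : (1 : C) = 1 * 1 by rewrite mulr1.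
have e : antidiag_mx C n = form_mx (fun=> 1) by apply/matrixP => i j; rewrite !mxE mul1r.
rewrite /SO /= e; split => [[h d1]|/(ggen_orth sq er)[h d1]].
  by apply: (orth_ggen sq er) => //; exact/(orth_form sq er).
by split=> //; exact/(orth_form sq er).
Qed.

End BilinearForms.

Section HoweMeasures.
Variables (R : realType) (k l : nat).
Local Notation C := R[i].

Lemma howe_Sp_unique : unique (@is_spectral_measure R l 2^-1 2^-1 (omega R k)) (@howe_Sp_Sp R l k).
Proof.
pose eps (i : 'I_(l + l)) : C := if (i < l)%N then 1 else -1.
have er (i : 'I_(l + l)) : eps (rev_ord i) = (-1)%:C%C * eps i.
  rewrite (_ : (-1)%:C%C = -1 :> C) ?rmorphN1 // /eps /=.
  have -> : (l + l - i.+1 < l)%N = ~~ (i < l)%N by have := ltn_ord i; lia.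
  by case: (i < l)%N; rewrite /= ?mulr1 // mulrNN mulr1.
have sq i : eps i * eps i = 1 by rewrite /eps; case: ifP; rewrite ?mulr1 // mulrNN mulr1.
have half (j : 'I_(l + l)) : (j < rev_ord j)%N = (j < l)%N by rewrite /=; have := ltn_ord j; lia.
have [a1 a2 a3 a4] : [/\ -1 < 2^-1 :> R, 0 <= 2^-1 + 2^-1 + 1 :> R, 2^-1 + 2^-1 = 0%:R - -1 :> R &
    2^-1 - 2^-1 = 0%:R :> R] by split; lra.
apply: (@howe_unique R l l k 0 false eps (-1) _ _ sq er half _ _ _ (esym (addn0 l)) _ a1 a1 a2 a3 a4) => //.
- by move=> i j il jl; rewrite /eps il jl.
- move=> _ /eqP; rewrite (_ : (-1)%:C%C = -1 :> C) ?rmorphN1 //.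
  by rewrite eq_sym -addr_eq0 -mulr2n pnatr_eq0.
- move=> lam; rewrite /howe_Sp_Sp (comp_isotypic k false sq er half (G := @Sp C l)); last first.
    by move=> g; apply: Sp_ggen => i; rewrite [LHS]er; congr (_ * _); exact: (rmorphN1 (real_complex R)).
  by rewrite (_ : flipw false (weight lam) = weight lam) ?addvv // ; apply/funext => i; rewrite /flipw.
Qed.

Lemma howe_SOodd_unique : unique (@is_spectral_measure R l 2^-1 (- 2^-1) (omega R k)) (@howe_SOodd_Pin R l k).
Proof.
have er (i : 'I_(l + l.+1)) : (1 : C) = (1 : R)%:C%C * 1 by rewrite rmorph1 mulr1.
have sq (i : 'I_(l + l.+1)) : (1 : C) * 1 = 1 by rewrite mulr1.
have half (j : 'I_(l + l.+1)) : (j < rev_ord j)%N = (j < l)%N by rewrite /=; have := ltn_ord j; lia.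
have [a1 a0 a2 a3 a4] : [/\ -1 < 2^-1 :> R, -1 < - 2^-1 :> R, 0 <= 2^-1 + - 2^-1 + 1 :> R,
    2^-1 + - 2^-1 = 1%:R - 1 :> R & 2^-1 - - 2^-1 = 1%:R :> R] by split; lra.
apply: (@howe_unique R l l.+1 k 1 false (fun=> 1) 1 _ _ sq er half _ _ _ (esym (addn1 l)) _ a1 a0 a2 a3 a4) => //.
move=> lam; rewrite /howe_SOodd_Pin (comp_isotypic k false sq er half (G := @SO C (l + l.+1))); last first.
  by move=> g; exact: SO_ggen.
by rewrite (_ : flipw false (weight lam) = weight lam) ?addvv //; apply/funext => i; rewrite /flipw.
Qed.

Lemma howe_SOeven_unique : unique (@is_spectral_measure R l (- 2^-1) (- 2^-1) (omega R k)) (@howe_Oeven_SO R l k).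
Proof.
have er (i : 'I_(l + l)) : (1 : C) = (1 : R)%:C%C * 1 by rewrite rmorph1 mulr1.
have sq (i : 'I_(l + l)) : (1 : C) * 1 = 1 by rewrite mulr1.
have half (j : 'I_(l + l)) : (j < rev_ord j)%N = (j < l)%N by rewrite /=; have := ltn_ord j; lia.
have [a1 a2 a3 a4] : [/\ -1 < - 2^-1 :> R, 0 <= - 2^-1 + - 2^-1 + 1 :> R, - 2^-1 + - 2^-1 = 0%:R - 1 :> R &
    - 2^-1 - - 2^-1 = 0%:R :> R] by split; lra.
apply: (@howe_unique R l l k 0 true (fun=> 1) 1 _ _ sq er half _ _ _ (esym (addn0 l)) _ a1 a1 a2 a3 a4) => //.
move=> lam; rewrite /howe_Oeven_SO (comp_isotypic k true sq er half (G := @SO C (l + l))); last first.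
  by move=> g; exact: SO_ggen.
by rewrite (_ : flipw true (weight lam) = weight_flip lam) //; apply/funext => i; rewrite /flipw /weight_flip; case: eqP.
Qed.

End HoweMeasures.

(** * Dimensions of irreducible representations *)

Lemma trig0 (V : nmodType) (n : nat) (A : 'M[V]_n) : is_trig_mx A ->
  forall i j : 'I_n, (i < j)%N -> A i j = 0.
Proof. by move/is_trig_mxP. Qed.

Section PolynomialCurves.
Variable C : numFieldType.

Definition polyf (f : C -> C) : Prop := exists r : {poly C}, forall s, f s = r.[s].

Lemma polyf_cst c : polyf (fun=> c).
Proof. by exists c%:P => s; rewrite hornerC. Qed.

Lemma polyf_id : polyf id.
Proof. by exists 'X => s; rewrite hornerX. Qed.

Lemma polyfD f g : polyf f -> polyf g -> polyf (fun s => f s + g s).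
Proof. by move=> [p hp] [q hq]; exists (p + q) => s; rewrite hornerD hp hq. Qed.

Lemma polyfM f g : polyf f -> polyf g -> polyf (fun s => f s * g s).
Proof. by move=> [p hp] [q hq]; exists (p * q) => s; rewrite hornerM hp hq. Qed.

Lemma polyf_sum (I : Type) (r : seq I) (f : I -> C -> C) : (forall i, polyf (f i)) ->
  polyf (fun s => \sum_(i <- r) f i s).
Proof.
move=> /choice[p hp]; exists (\sum_(i <- r) p i) => s; rewrite horner_sum.
by apply: eq_bigr => i _; exact: hp.
Qed.

Lemma polyf_prod (I : Type) (r : seq I) (f : I -> C -> C) : (forall i, polyf (f i)) ->
  polyf (fun s => \prod_(i <- r) f i s).
Proof.
move=> /choice[p hp]; exists (\prod_(i <- r) p i) => s; rewrite horner_prod.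
by apply: eq_bigr => i _; exact: hp.
Qed.

Lemma polyfX f m : polyf f -> polyf (fun s => f s ^+ m).
Proof. by move=> [p hp]; exists (p ^+ m) => s; rewrite horner_exp hp. Qed.

Lemma polyf_meval (n : nat) (y : 'I_n -> C -> C) (q : mpoly n C) : (forall t, polyf (y t)) ->
  polyf (fun s => meval (fun t => y t s) q).
Proof.
move=> hy.
have [r hr] : polyf (fun s => \sum_(m <- mpoly.msupp q) mpoly.mcoeff m q * \prod_i y i s ^+ m i).
  apply: polyf_sum => m; apply: polyfM; first exact: polyf_cst.
  by apply: polyf_prod => i; exact: polyfX.
by exists r => s; rewrite mpoly.mevalE hr.
Qed.

(** A density argument for curves: after a linear map with kernel [U], each coordinate times [del]
    is a polynomial vanishing everywhere. *)
Lemma curve_sub (d : nat) (U : {vspace 'cV[C]_d}) (y : C -> 'cV[C]_d) (del : {poly C}) :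
  (forall i, polyf (fun s => y s i 0)) -> del != 0 -> (forall s, del.[s] != 0 -> y s \in U) ->
  forall s, y s \in U.
Proof.
move=> hy d0 hU s; have [f fU] := vspace_sep U; rewrite fU.
rewrite (coord_vbasis (memvf (f (y s)))) big1 // => j _.
have [r hr] : polyf (fun s => coord (vbasis fullv) j (f (y s))).
  have [r hr] : polyf (fun s => \sum_i y s i 0 * coord (vbasis fullv) j (f (delta_mx i 0))).
    by apply: polyf_sum => i; apply: polyfM; [exact: hy|exact: polyf_cst].
  exists r => t; rewrite -hr {1}[y t]matrix_sum_delta !linear_sum /=; apply: eq_bigr => i _.
  by rewrite big_ord1 !linearZ.
rewrite hr; suff -> : r = 0 by rewrite horner0 scale0r.
apply/eqP; have : r * del == 0.
  apply/eqP/poly_eq0_all => t; rewrite hornerM; have [->|dt] := eqVneq del.[t] 0; first by rewrite mulr0.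
  by rewrite -hr; have /eqP -> : f (y t) == 0; rewrite ?linear0 ?mul0r // -fU hU.
by rewrite mulf_eq0 (negbTE d0) orbF.
Qed.

(** Factorisation into triangular matrices for generic parameter, by Schur complements multiplied by
    the pivot so as to stay polynomial; [del] collects the pivots. At 0 the matrix is lower
    unitriangular, so every pivot takes the value 1 there and is not the zero polynomial. *)
Lemma poly_LU (n : nat) (P : 'M[{poly C}]_n) :
  (forall i j : 'I_n, (i < j)%N -> (P i j).[0] = 0) -> (forall i, (P i i).[0] = 1) ->
  exists del : {poly C}, del != 0 /\ forall s, del.[s] != 0 -> exists L B : 'M[C]_n,
    [/\ is_trig_mx L, forall i, L i i = 1, is_trig_mx B^T & map_mx (horner^~ s) P = L *m B].
Proof.
elim: n P => [|n IH] P hP0 hP1.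
  exists 1; split=> [|s _]; first exact: oner_neq0.
  by exists 0, 0; split; [apply/is_trig_mxP => -[]|move=> []|apply/is_trig_mxP => -[]|apply/matrixP => -[]].
pose Q : 'M[{poly C}]_(1 + n) := P; pose a := Q 0 0.
pose A' := a *: drsubmx Q - dlsubmx Q *m ursubmx Q.
have A'E i j : A' i j = a * Q (rshift 1 i) (rshift 1 j) - Q (rshift 1 i) 0 * Q 0 (rshift 1 j).
  rewrite !mxE big_ord1 !mxE (_ : lshift n 0 = 0) //; exact: val_inj.
have b0 (j : 'I_n) : (Q 0 (rshift 1 j)).[0] = 0 by apply: hP0.
have a0 : a.[0] = 1 by exact: hP1.
have [|i|del' [d0 h]] := IH A'.
- move=> i j ij; rewrite A'E hornerD hornerN !hornerM b0 mulr0 subr0 a0 mul1r; exact: hP0.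
- by rewrite A'E hornerD hornerN !hornerM b0 mulr0 subr0 a0 mul1r; exact: hP1.
exists (a * del'); split.
  rewrite mulf_neq0 //; apply/eqP => e; move: a0; rewrite e horner0 => /eqP.
  by rewrite eq_sym oner_eq0.
move=> s; rewrite hornerM mulf_eq0 negb_or => /andP[as0 /h[L' [B' [tL dL tB e]]]].
pose Qs : 'M[C]_(1 + n) := map_mx (horner^~ s) Q.
pose al := a.[s].
exists (block_mx 1%:M 0 (al^-1 *: dlsubmx Qs) L'), (block_mx al%:M (ursubmx Qs) 0 (al^-1 *: B')); split.
- have h1 : @is_trig_mx C (1 + n) (1 + n) (block_mx (1%:M : 'M[C]_(1, 1)) 0 (al^-1 *: dlsubmx Qs) L').
    by rewrite is_trig_block_mx // eqxx tL scalar_mx_is_trig.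
  exact: h1.
- have h2 (i : 'I_(1 + n)) : block_mx (1%:M : 'M[C]_(1, 1)) 0 (al^-1 *: dlsubmx Qs) L' i i = 1.
    by have [j ->|j ->] := split_ordP i; rewrite ?block_mxEul ?block_mxEdr ?mxE ?eqxx.
  exact: h2.
- suff h1 : @is_trig_mx C (1 + n) (1 + n) (block_mx (al%:M : 'M[C]_(1, 1)) (ursubmx Qs) 0 (al^-1 *: B'))^T by exact: h1.
  rewrite tr_block_mx trmx0 is_trig_block_mx // eqxx tr_scalar_mx scalar_mx_is_trig /= linearZ /=.
  apply/is_trig_mxP => i j ij; rewrite mxE.
  by have /is_trig_mxP -> := tB; rewrite ?mulr0.
suff h3 : Qs = block_mx (1%:M : 'M[C]_(1, 1)) 0 (al^-1 *: dlsubmx Qs) L' *m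
    block_mx (al%:M : 'M[C]_(1, 1)) (ursubmx Qs) 0 (al^-1 *: B') by exact: h3.
rewrite -[LHS]submxK mulmx_block !mul1mx !mul0mx ?mulmx0 ?addr0; congr block_mx.
- apply/matrixP => i j; rewrite !ord1 !mxE eqxx mulr1n /al /a.
  by congr (_.[_]); congr (Q _ _); apply: val_inj.
- by rewrite mul_mx_scalar scalerA mulfV // scale1r.
- rewrite -scalemxAl -scalemxAr -e; apply/matrixP => i j.
  have hA : map_mx (horner^~ s) A' i j = al * (Q (rshift 1 i) (rshift 1 j)).[s] -
      (Q (rshift 1 i) 0).[s] * (Q 0 (rshift 1 j)).[s].
    by rewrite mxE A'E hornerD hornerN !hornerM.
  rewrite [RHS]mxE [X in _ = _ + X]mxE hA !mxE big_ord1 !mxE (_ : lshift n 0 = 0); last exact: val_inj.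
  by rewrite mulrBr mulKf // addrC subrK.
Qed.

Lemma trig_mul_eq1 (n : nat) (X Z : 'M[C]_n) : is_trig_mx X -> (forall i, X i i = 1) ->
  is_trig_mx Z^T -> X *m Z = 1%:M -> X = 1%:M /\ Z = 1%:M.
Proof.
move=> /is_trig_mxP tX dX /is_trig_mxP tZ e.
have main m (i : 'I_n) : (i < m)%N -> forall k, X i k = (i == k)%:R /\ Z i k = (i == k)%:R.
  elim: m i => // m IH i im k.
  have lowk (a : 'I_n) : (a < i)%N -> Z a k = (a == k)%:R.
    by move=> ai; have [] := IH a (leq_trans ai im) k.
  have sumE : \sum_(j < n | (j < i)%N) X i j * Z j k + Z i k = (i == k)%:R.
    have := congr1 (fun A : 'M[C]_n => A i k) e; rewrite !mxE => <-.
    rewrite [RHS](bigD1 i) //= dX mul1r addrC; congr (_ + _).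
    rewrite [RHS](bigID (fun j : 'I_n => (j < i)%N)) /= [X in _ = _ + X]big1 ?addr0 => [|j /andP[ji nji]].
      by apply: eq_bigl => j; case: (ltngtP j i) => [ji|ji|/val_inj ->]; rewrite ?andbF ?eqxx // andbT; apply/esym/eqP => ej; rewrite ej ltnn in ji.
    rewrite tX ?mul0r // ltn_neqAle leqNgt nji andbT.
    by apply: contra ji => /eqP/val_inj ->.
  have sumE' : \sum_(j < n | (j < i)%N) X i j * Z j k = if (k < i)%N then X i k else 0.
    case: ifP => ki.
      rewrite (bigD1 k) //= lowk // eqxx mulr1 big1 ?addr0 // => j /andP[ji jk].
      by rewrite lowk // (negbTE jk) mulr0.
    rewrite big1 // => j ji; rewrite lowk // (_ : j == k = false) ?mulr0 //.
    by apply/eqP => jk; rewrite jk ki in ji.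
  move: sumE; rewrite sumE'; case: (ltngtP k i) => [ki|ik|/val_inj ->].
  - have zik : Z i k = 0 by have := tZ _ _ ki; rewrite mxE.
    by rewrite zik addr0 => ->; split=> //; apply/esym; case: eqP => // ik; rewrite ik ltnn in ki.
  - rewrite add0r => ->; split=> //; rewrite tX //; case: eqP => // ek; rewrite ek ltnn in ik; by [].
  - by rewrite add0r eqxx dX.
split; apply/matrixP => i k; have [e1 e2] := main n i (ltn_ord i) k; rewrite !mxE ?e1 ?e2 //.
Qed.

End PolynomialCurves.

Section UniqueRepresentation.
Variables (C : numClosedFieldType) (l : nat).
Local Notation n := (l + l.+1)%N.
Local Notation G := (@SO C n).
Local Notation one := (fun=> 1 : C).

Lemma SO_orth (g : 'M[C]_n) : G g <-> orth one g /\ \det g = 1.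
Proof.
have sq (i : 'I_n) : (1 : C) * 1 = 1 by rewrite mulr1.
have er (i : 'I_n) : (1 : C) = 1 * 1 by rewrite mulr1.
rewrite SO_ggen; split => [/(ggen_orth sq er)//|[h d]].
by apply: (orth_ggen sq er).
Qed.

Lemma SO_mul (g h : 'M[C]_n) : G g -> G h -> G (g *m h).
Proof.
move=> /SO_orth[og dg] /SO_orth[oh dh]; apply/SO_orth; split; last by rewrite det_mulmx dg dh mulr1.
by apply: orth_mul => // i; rewrite ?mulr1.
Qed.

Lemma SO_1 : G 1%:M.
Proof. by apply/SO_ggen; exact: ggen1. Qed.

(** The factors inherit the form by uniqueness of the factorisation: [sigma L L] is lower
    unitriangular, [B sigma B] is upper triangular, and their product is 1. *)
Lemma SO_LU (L B : 'M[C]_n) : is_trig_mx L -> (forall i, L i i = 1) -> is_trig_mx B^T ->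
  G (L *m B) -> G L /\ G B.
Proof.
move=> tL dL tB /SO_orth[og dg].
have sM (X Y : 'M[C]_n) : sigma one (X *m Y) = sigma one Y *m sigma one X.
  by apply: sigmaM => i; rewrite ?mulr1.
have dL1 : \det L = 1 by rewrite det_trig // big1.
have dB1 : \det B = 1 by move: dg; rewrite det_mulmx dL1 mul1r.
have tsL : is_trig_mx (sigma one L).
  apply/is_trig_mxP => i j ij; rewrite mxE (trig0 tL) ?mulr0 //.
  by rewrite /=; have := ltn_ord j; lia.
have tsB : is_trig_mx (sigma one B)^T.
  apply/is_trig_mxP => i j ij; rewrite !mxE.
  have h := @trig0 _ _ _ tB (rev_ord j) (rev_ord i); rewrite mxE in h.
  by rewrite h ?mulr0 //=; have := ltn_ord j; lia.
have trM (X Y : 'M[C]_n) : is_trig_mx X -> is_trig_mx Y -> is_trig_mx (X *m Y).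
  move=> /is_trig_mxP tX /is_trig_mxP tY; apply/is_trig_mxP => i j ij; rewrite mxE big1 // => a _.
  by case: (leqP a i) => ai; [rewrite tY ?mulr0 // (leq_ltn_trans ai)|rewrite tX ?mul0r].
have e : (sigma one L *m L) *m (B *m sigma one B) = 1%:M.
  have h : sigma one B *m ((sigma one L *m L) *m B) = 1%:M by move: og; rewrite /orth sM !mulmxA.
  by rewrite mulmxA; exact: mulmx1C h.
have [|||eL eB] := trig_mul_eq1 _ _ _ e.
- exact: trM.
- move=> i; rewrite mxE (bigD1 i) //= mxE !dL !mulr1 big1 ?addr0 // => j ji.
  case: (ltngtP i j) => [ij|ij|/val_inj h]; last by rewrite h eqxx in ji.
    by rewrite (trig0 tsL) ?mul0r.
  by rewrite [L j i](trig0 tL) ?mulr0.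
- by rewrite trmx_mul; exact: trM.
split; apply/SO_orth; split => //; exact: mulmx1C eB.
Qed.

Definition lowU (u : 'M[C]_n) : Prop := [/\ G u, is_trig_mx u & forall i, u i i = 1].

Section LowerSpan.
Variables (d : nat) (rho : 'M[C]_n -> 'M[C]_d) (lam : 'I_l -> int) (v : 'cV[C]_d).
Hypothesis rr : rational_repr G rho.
Hypothesis hwv : hw_vector (m := l.+1) G (fun g x => rho g *m x) lam v.

Lemma rho_curve (g : C -> 'M[C]_n) (x : 'cV[C]_d) : (forall s, G (g s)) ->
  (forall i j, polyf (fun s => g s i j)) -> forall i, polyf (fun s => (rho (g s) *m x) i 0).
Proof.
case: rr => _ _ [q hq] Gg pg i.
have [r hr] : polyf (fun s => \sum_j meval (fun t => mxvec (g s) 0 t) (q i j) * x j 0).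
  apply: polyf_sum => j; apply: polyfM; last exact: polyf_cst.
  apply: (polyf_meval (y := fun t s => mxvec (g s) 0 t)) => t.
  by case/mxvec_indexP: t => a b; have [r hr] := pg a b; exists r => s; rewrite mxvecE.
by exists r => s; rewrite -hr mxE; apply: eq_bigr => j _; rewrite hq.
Qed.

Lemma low_exists : exists S : {vspace 'cV[C]_d}, forall x, x \in S <->
  forall U : {vspace 'cV[C]_d}, (forall u, lowU u -> rho u *m v \in U) -> x \in U.
Proof.
apply: pred_vspace => [U _|a x y hx hy U hU]; first exact: mem0v.
by rewrite memvD ?memvZ //; [exact: hx|exact: hy].
Qed.

(** The span of the orbit of [v] under the lower unitriangular subgroup. It plays the part of
    [lowgen] for an arbitrary rational representation, for which no derived action has been set
    up. *)
Definition low : {vspace 'cV[C]_d} := projT1 (cid low_exists).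

Lemma lowP x : x \in low <->
  forall U : {vspace 'cV[C]_d}, (forall u, lowU u -> rho u *m v \in U) -> x \in U.
Proof. by rewrite /low; case: (cid _) => S /= h; exact: h. Qed.

Lemma low_in u : lowU u -> rho u *m v \in low.
Proof. by move=> hu; apply/lowP => U; exact. Qed.

Lemma low_v : v \in low.
Proof.
have [r1 _ _] := rr; rewrite -[v]mul1mx -r1; apply: low_in; split; first exact: SO_1.
  exact: scalar_mx_is_trig.
by move=> i; rewrite mxE eqxx.
Qed.

Lemma low_ind (P : 'cV[C]_d -> Prop) : P 0 -> (forall a x y, P x -> P y -> P (a *: x + y)) ->
  (forall u, lowU u -> P (rho u *m v)) -> forall x, x \in low -> P x.
Proof.
move=> P0 PL Pg x /lowP hx; have [U hU] := pred_vspace P0 PL.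
by apply/hU; apply: hx => u /Pg /hU.
Qed.

(** The big cell argument: for generic parameter the product of a root element and a lower
    unitriangular [u] factors as [L B], and [B] multiplies [v] by a scalar. The curve is polynomial
    in the parameter, so [curve_sub] removes the restriction. *)
Lemma low_xr (i j : 'I_n) s x : i != j -> x \in low -> rho (xr one i j s) *m x \in low.
Proof.
have sq (a : 'I_n) : (1 : C) * 1 = 1 by rewrite mulr1.
have er (a : 'I_n) : (1 : C) = 1 * 1 by rewrite mulr1.
have [r1 rM _] := rr.
move=> ij; have Gx t : G (xr one i j t).
  by apply/SO_ggen; rewrite -[xr _ _ _ _]mulmx1; apply: ggen_xr => //; exact: ggen1.
move: x; apply: low_ind => [|a x y hx hy|u [Gu tu du]]; first by rewrite mulmx0 mem0v.
  by rewrite mulmxDr -scalemxAr memvD ?memvZ.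
pose g t := xr one i j t *m u.
have Gg t : G (g t) by exact: SO_mul.
have pg a b : polyf (fun t => g t a b).
  have [r hr] : polyf (fun t => \sum_c xr one i j t a c * u c b).
    apply: polyf_sum => c; apply: polyfM; last exact: polyf_cst.
    have [r hr] : polyf (fun t => (a == c)%:R + t * Fm one i j a c + t ^+ 2 * (2^-1 * (Fm one i j *m Fm one i j) a c)).
      apply: polyfD; first apply: polyfD; first exact: polyf_cst.
        by apply: polyfM; [exact: polyf_id|exact: polyf_cst].
      by apply: polyfM; [apply: polyfX; exact: polyf_id|exact: polyf_cst].
    by exists r => t; rewrite xrE -hr mulrA.
  by exists r => t; rewrite -hr mxE.
have /choice[P0 hP0] : forall a, exists r : 'I_n -> {poly C}, forall b t, g t a b = (r b).[t].
  by move=> a; have /choice[r hr] := pg a; exists r.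
pose P : 'M[{poly C}]_n := \matrix_(a, b) P0 a b.
have PE t : map_mx (horner^~ t) P = g t by apply/matrixP => a b; rewrite [LHS]mxE [X in X.[t]]mxE -hP0.
have g0 : g 0 = u by rewrite /g xr0 mul1mx.
have [||del [d0 hdel]] := poly_LU (P := P).
- by move=> a b ab; rewrite mxE -hP0 g0 (trig0 tu).
- by move=> a; rewrite mxE -hP0 g0.
have main := @curve_sub C d low (fun t => rho (g t) *m v) del _ d0.
rewrite mulmxA -rM //; apply: main; first exact: rho_curve.
move=> t /hdel[L [B [tL dL tB]]]; rewrite PE => e.
have [GL GB] : G L /\ G B by apply: SO_LU => //; rewrite -e.
rewrite e rM // -mulmxA; have [_ ->] := hwv => //.
by rewrite -scalemxAr memvZ // low_in.
Qed.

Lemma low_tor (t : 'rV[C]_n) x : is_tor t -> x \in low -> rho (diag_mx t) *m x \in low.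
Proof.
have [r1 rM _] := rr.
move=> ht; have Gt (t' : 'rV[C]_n) : is_tor t' -> G (diag_mx t').
  by move=> h; apply/SO_ggen; rewrite -[diag_mx _]mulmx1; apply: ggen_tor => //; exact: ggen1.
have tn0 j : t 0 j != 0.
  by have [h _] := ht j; apply/eqP => e; move/eqP: h; rewrite e mul0r eq_sym oner_eq0.
pose ti : 'rV[C]_n := \row_j (t 0 j)^-1.
have hti : is_tor ti.
  move=> j; rewrite !mxE; have [h1 h2] := ht j; split; first by rewrite -invfM h1 invr1.
  by move=> /h2 ->; rewrite invr1.
have tti : diag_mx ti *m diag_mx t = 1%:M.
  rewrite mulmx_diag; apply/matrixP => i j; rewrite !mxE; case: eqP => // _.
  by rewrite mulVf.
move: x; apply: low_ind => [|a x y hx hy|u [Gu tu du]]; first by rewrite mulmx0 mem0v.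
  by rewrite mulmxDr -scalemxAr memvD ?memvZ.
have e : diag_mx t *m u = (diag_mx t *m u *m diag_mx ti) *m diag_mx t by rewrite -mulmxA tti mulmx1.
have Gc : G (diag_mx t *m u *m diag_mx ti) by apply: SO_mul; [apply: SO_mul => //; exact: Gt|exact: Gt].
rewrite mulmxA -rM //; last exact: Gt.
set c := diag_mx t *m u *m diag_mx ti in Gc e *.
rewrite e rM //; last exact: Gt.
rewrite -mulmxA; have [_ ->] := hwv; [|exact: Gt|by rewrite tr_diag_mx diag_mx_is_trig].
rewrite -scalemxAr memvZ // low_in //; split => //; rewrite /c.
  by apply/is_trig_mxP => i j ij; rewrite mul_mx_diag mul_diag_mx !mxE (trig0 tu) // mulr0 mul0r.
by move=> i; rewrite mul_mx_diag mul_diag_mx !mxE du mulr1 mulfV.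
Qed.

Lemma low_stable g x : G g -> x \in low -> rho g *m x \in low.
Proof.
have [r1 rM _] := rr.
have Gx i j t : i != j -> G (xr one i j t).
  by move=> ij; apply/SO_ggen; rewrite -[xr _ _ _ _]mulmx1; apply: ggen_xr => //; exact: ggen1.
have Gt (t' : 'rV[C]_n) : is_tor t' -> G (diag_mx t').
  by move=> h; apply/SO_ggen; rewrite -[diag_mx _]mulmx1; apply: ggen_tor => //; exact: ggen1.
move=> /SO_ggen; elim=> [|i j s h ij hh IH|t h ht hh IH] hx.
- by rewrite r1 mul1mx.
- rewrite rM; [|exact: Gx|exact/SO_ggen]; rewrite -mulmxA; apply: low_xr => //; exact: IH.
- rewrite rM; [|exact: Gt|exact/SO_ggen]; rewrite -mulmxA; apply: low_tor => //; exact: IH.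
Qed.

(* Contracting [low] along the one-parameter subgroup [diag (t ^ l, ..., t ^ - l)]. *)
Lemma low_hw x : x \in low ->
  (forall g, G g -> is_trig_mx g^T ->
     rho g *m x = (\prod_(i < l) g (lshift l.+1 i) (lshift l.+1 i) ^ lam i) *: x) ->
  exists c, x = c *: v.
Proof.
have [r1 rM _] := rr.
pose dt (s : C) : 'rV[C]_n := \row_j s ^ ((j : nat)%:Z - l%:Z).
have hdt s : s != 0 -> is_tor (dt s).
  move=> s0 j; rewrite !mxE; split.
    by rewrite -expfzDr // (_ : _ + _ = 0) ?expr0z //= ; have := ltn_ord j; lia.
  by move=> /(congr1 (@nat_of_ord _)) /= ej; rewrite (_ : _ - _ = 0) ?expr0z //; have := ltn_ord j; lia.
have Gt (t' : 'rV[C]_n) : is_tor t' -> G (diag_mx t').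
  by move=> h; apply/SO_ggen; rewrite -[diag_mx _]mulmx1; apply: ggen_tor => //; exact: ggen1.
pose chi (s : C) := \prod_(i < l) (diag_mx (dt s)) (lshift l.+1 i) (lshift l.+1 i) ^ lam i.
have chi0 s : s != 0 -> chi s != 0.
  by move=> s0; apply/prodf_neq0 => i _; rewrite expfz_neq0 // !mxE eqxx expfz_neq0.
pose P x := exists (y : C -> 'cV[C]_d) c, [/\ forall i, polyf (fun s => y s i 0),
  forall s, s != 0 -> y s = (chi s)^-1 *: (rho (diag_mx (dt s)) *m x) & y 0 = c *: v].
move=> xlow hx; have : P x.
  move: x xlow {hx}; apply: low_ind => [|a x x' [y [c [h1 h2 h3]]] [y' [c' [h1' h2' h3']]]|u [Gu tu du]].
  - exists (fun=> 0), 0; split=> [i|s _|]; rewrite ?mulmx0 ?scaler0 ?scale0r //.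
    by exists 0 => s; rewrite mxE horner0.
  - exists (fun s => a *: y s + y' s), (a * c + c'); split=> [i|s s0|].
    + have [r hr] : polyf (fun s => a * y s i 0 + y' s i 0).
        by apply: polyfD => //; apply: polyfM => //; exact: polyf_cst.
      by exists r => s; rewrite -hr !mxE.
    + rewrite h2 // h2' // mulmxDr scalerDr -scalemxAr; congr (_ + _).
      by rewrite !scalerA mulrC.
    + by rewrite h3 h3' scalerDl scalerA.
  (* The conjugate of [u] by the one-parameter subgroup. Because [u] is lower unitriangular, the
     entries are polynomial in [s] and the value at 0 is the identity. *)
  - pose us (s : C) : 'M[C]_n := \matrix_(i, j) (s ^+ (i - j) * u i j).
    have usE s : s != 0 -> us s *m diag_mx (dt s) = diag_mx (dt s) *m u.
      move=> s0; apply/matrixP => i j; rewrite mul_mx_diag mul_diag_mx !mxE.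
      case: (ltnP i j) => ij; first by rewrite (trig0 tu) // !(mulr0, mul0r).
      rewrite mulrAC; congr (_ * _); rewrite -[s ^+ _]/(s ^ (i - j)%N%:Z) -expfzDr //; congr (_ ^ _); lia.
    have Gus s : G (us s).
      have [->|s0] := eqVneq s 0.
        have -> : us 0 = 1%:M; last exact: SO_1.
        apply/matrixP => i j; rewrite !mxE expr0n subn_eq0; case: (ltngtP i j) => [ij|ij|/val_inj ->].
        - by rewrite (trig0 tu) // mulr0; case: eqP => // ej; rewrite ej ltnn in ij.
        - by rewrite mul0r; case: eqP => // ej; rewrite ej ltnn in ij.
        - by rewrite du mulr1 eqxx.
      pose ds := dt s^-1.
      have e : diag_mx (dt s) *m diag_mx ds = 1%:M.
        rewrite mulmx_diag; apply/matrixP => i j; rewrite !mxE; case: eqP => // _.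
        by rewrite exprz_inv -expfzDr // addrN expr0z.
      have -> : us s = diag_mx (dt s) *m u *m diag_mx ds by rewrite -usE // -mulmxA e mulmx1.
      apply: SO_mul; first by apply: SO_mul => //; exact/Gt/hdt.
      by apply/Gt/hdt; rewrite invr_eq0.
    exists (fun s => rho (us s) *m v), 1; split=> [|s s0|].
    + apply: rho_curve => // i j; have [r hr] : polyf (fun s => s ^+ (i - j) * u i j).
        by apply: polyfM; [apply: polyfX; exact: polyf_id|exact: polyf_cst].
      by exists r => s; rewrite mxE hr.
    + have Gd := Gt _ (hdt s s0).
      rewrite mulmxA -rM // -usE // rM // -mulmxA; have [_ hv] := hwv.
      rewrite (hv _ Gd) ?tr_diag_mx ?diag_mx_is_trig //.
      by rewrite -scalemxAr scalerA mulVf ?scale1r //; exact: chi0.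
    + have -> : us 0 = 1%:M; last by rewrite r1 mul1mx scale1r.
      apply/matrixP => i j; rewrite !mxE expr0n subn_eq0; case: (ltngtP i j) => [ij|ij|/val_inj ->].
      * by rewrite (trig0 tu) // mulr0; case: eqP => // ej; rewrite ej ltnn in ij.
      * by rewrite mul0r; case: eqP => // ej; rewrite ej ltnn in ij.
      * by rewrite du mulr1 eqxx.
move=> [y [c [h1 h2 h3]]]; exists c; rewrite -h3.
apply/matrixP => i j; rewrite ord1; have [r hr] := h1 i.
have : (r - (x i 0)%:P) * 'X == 0.
  apply/eqP/poly_eq0_all => s; rewrite hornerM hornerX hornerD hornerN hornerC.
  have [->|s0] := eqVneq s 0; first by rewrite mulr0.
  rewrite -hr h2 // hx; [|exact/Gt/hdt|by rewrite tr_diag_mx diag_mx_is_trig].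
  by rewrite scalerA mulVf ?scale1r ?subrr ?mul0r //; exact: chi0.
by rewrite mulf_eq0 polyX_eq0 orbF subr_eq0 => /eqP e; rewrite hr e hornerC.
Qed.

End LowerSpan.
End UniqueRepresentation.

Section IrreducibleDimension.
Variables (C : numClosedFieldType) (l : nat).
Local Notation n := (l + l.+1)%N.
Local Notation G := (@SO C n).
Implicit Type lam : 'I_l -> int.

(** In the direct sum, the submodule generated by the pair of highest weight vectors meets both
    summands trivially, so it projects isomorphically onto each of them. *)
Lemma dim_of_irreducible (lam : 'I_l -> int) (d1 d2 : nat)
    (rho1 : 'M[C]_n -> 'M[C]_d1) (rho2 : 'M[C]_n -> 'M[C]_d2) :
  rational_repr G rho1 -> rational_repr G rho2 ->
  @irreducible_hw C l l.+1 G 'cV[C]_d1 (fun g v => rho1 g *m v) lam fullv ->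
  @irreducible_hw C l l.+1 G 'cV[C]_d2 (fun g v => rho2 g *m v) lam fullv -> d1 = d2.
Proof.
move=> [r11 r1M [q1 hq1]] [r21 r2M [q2 hq2]] [irr1 [v1 _ [v10 hv1]]] [irr2 [v2 _ [v20 hv2]]].
pose rho g := block_mx (rho1 g) 0 0 (rho2 g).
have rhoE g x y : rho g *m col_mx x y = col_mx (rho1 g *m x) (rho2 g *m y).
  by rewrite mul_block_col !mul0mx addr0 add0r.
have rr : rational_repr G rho.
  split=> [|g h Gg Gh|].
  - by rewrite /rho r11 r21 -scalar_mx_block.
  - by rewrite /rho mulmx_block r1M // r2M // !mul0mx !mulmx0 !addr0 add0r.
  - exists (fun i j => match fintype.split i, fintype.split j with
      | inl a, inl b => q1 a b | inr a, inr b => q2 a b | _, _ => 0 end) => g Gg i j.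
    rewrite /rho; case: (fintype.splitP i) => a ia; case: (fintype.splitP j) => b jb.
    + have -> : i = lshift d2 a by exact: val_inj. 
      have -> : j = lshift d2 b by exact: val_inj.
      by rewrite block_mxEul hq1.
    + have -> : i = lshift d2 a by exact: val_inj. 
      have -> : j = rshift d1 b by exact: val_inj.
      by rewrite block_mxEur mxE mpoly.meval0.
    + have -> : i = rshift d1 a by exact: val_inj. 
      have -> : j = lshift d2 b by exact: val_inj.
      by rewrite block_mxEdl mxE mpoly.meval0.
    + have -> : i = rshift d1 a by exact: val_inj. 
      have -> : j = rshift d1 b by exact: val_inj.
      by rewrite block_mxEdr hq2.
pose v := col_mx v1 v2.
have hwv : hw_vector (m := l.+1) G (fun g x => rho g *m x) lam v.
  split; first by rewrite col_mx_eq0 negb_and v10.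
  by move=> g Gg tg; rewrite rhoE hv1 // hv2 // scale_col_mx.
pose S := low rho v.
have vS : v \in S by apply: low_v; exact: rr.
have Sst g x : G g -> x \in S -> rho g *m x \in S by exact: (low_stable rr hwv).
have full_dim m : \dim (fullv : {vspace 'cV[C]_m}) = m by rewrite dimvf /dim /= muln1.
(* A nonzero intersection of [S] with one summand would contain its highest
   weight vector. *)
have inj1 (x : 'cV[C]_d1) : col_mx x 0 \in S -> x = 0.
  have [U hU] : exists U : {vspace 'cV[C]_d1}, forall x, x \in U <-> col_mx x 0 \in S.
    apply: pred_vspace => [|a x' y hx hy]; first by rewrite col_mx0 mem0v.
    have -> : col_mx (a *: x' + y) 0 = a *: col_mx x' 0 + col_mx y (0 : 'cV[C]_d2).
      by rewrite scale_col_mx add_col_mx scaler0 addr0.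
    by rewrite memvD ?memvZ.
  have [_ _ h] := irr1; have [||U0|UT] := h U; first exact: subvf.
  - by move=> g y Gg /hU hy; apply/hU; have := Sst g _ Gg hy; rewrite rhoE mulmx0.
  - by move=> /hU; rewrite U0 memv0 => /eqP.
  - have /hU v1S : v1 \in U by rewrite UT memvf.
    have [|c /eqP] := low_hw rr hwv v1S.
      by move=> g Gg tg; rewrite rhoE mulmx0 hv1 // scale_col_mx scaler0.
    rewrite scale_col_mx => /eqP/eq_col_mx[e1 e2]; move/esym/eqP: e2; rewrite scaler_eq0 (negbTE v20) orbF => /eqP c0.
    by move: v10; rewrite e1 c0 scale0r eqxx.
have inj2 (y : 'cV[C]_d2) : col_mx 0 y \in S -> y = 0.
  have [U hU] : exists U : {vspace 'cV[C]_d2}, forall y, y \in U <-> col_mx 0 y \in S.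
    apply: pred_vspace => [|a x' z hx hy]; first by rewrite col_mx0 mem0v.
    have -> : col_mx 0 (a *: x' + z) = a *: col_mx 0 x' + col_mx (0 : 'cV[C]_d1) z.
      by rewrite scale_col_mx add_col_mx scaler0 addr0.
    by rewrite memvD ?memvZ.
  have [_ _ h] := irr2; have [||U0|UT] := h U; first exact: subvf.
  - by move=> g z Gg /hU hz; apply/hU; have := Sst g _ Gg hz; rewrite rhoE mulmx0.
  - by move=> /hU; rewrite U0 memv0 => /eqP.
  - have /hU v2S : v2 \in U by rewrite UT memvf.
    have [|c /eqP] := low_hw rr hwv v2S.
      by move=> g Gg tg; rewrite rhoE mulmx0 hv2 // scale_col_mx scaler0.
    rewrite scale_col_mx => /eqP/eq_col_mx[e1 e2]; move/esym/eqP: e1; rewrite scaler_eq0 (negbTE v10) orbF => /eqP c0.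
    by move: v20; rewrite e2 c0 scale0r eqxx.
have dimS (d : nat) (f : {linear 'cV[C]_(d1 + d2) -> 'cV[C]_d}) (r : 'M[C]_n -> 'M[C]_d) :
    irreducible G (fun g x => r g *m x) (fullv : {vspace 'cV[C]_d}) ->
    (forall x, x \in S -> f x = 0 -> x = 0) -> f v != 0 ->
    (forall g x, f (rho g *m x) = r g *m f x) -> \dim S = d.
  move=> [_ _ h] finj fv fr.
  rewrite -(full_dim d) -(@limg_dim_eq _ _ _ (linfun f) S).
    have [||U0|->] := h (linfun f @: S)%VS; first exact: subvf; last by [].
    - move=> g y Gg /memv_imgP[x xS ->]; rewrite lfunE /= -fr -[f _]lfunE memv_img //.
      exact: Sst.
    - by have := memv_img (linfun f) vS; rewrite U0 memv0 lfunE /= (negbTE fv).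
  apply/eqP; rewrite -subv0; apply/subvP => x /memv_capP[xS]; rewrite memv_ker lfunE /= => /eqP fx.
  by rewrite (finj x xS fx) mem0v.
rewrite -(dimS d1 (@usubmx C d1 d2 1) rho1 irr1); last first.
- by move=> g x /=; rewrite -{1}[x]vsubmxK rhoE col_mxKu.
- by rewrite /= col_mxKu.
- move=> x xS ex; have := inj2 (dsubmx x); rewrite -[X in col_mx X]ex vsubmxK => /(_ xS) e2.
  by rewrite -[x]vsubmxK ex e2 col_mx0.
apply: (dimS d2 (@dsubmx C d1 d2 1) rho2 irr2).
- move=> x xS ex; have := inj1 (usubmx x); rewrite -[X in col_mx _ X]ex vsubmxK => /(_ xS) e2.
  by rewrite -[x]vsubmxK ex e2 col_mx0.
- by rewrite /= col_mxKd.
- by move=> g x /=; rewrite -{1}[x]vsubmxK rhoE col_mxKd.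
Qed.

Lemma irr_dimE (lam : 'I_l -> int) (d : nat) (rho : 'M[C]_n -> 'M[C]_d) : rational_repr G rho ->
  @irreducible_hw C l l.+1 G 'cV[C]_d (fun g v => rho g *m v) lam fullv ->
  irr_dim (m := l.+1) G lam = d.
Proof.
move=> rr irr; apply: xget_unique; first by exists rho.
by move=> d' [rho' [rr' irr']]; exact: (dim_of_irreducible rr' rr irr' irr).
Qed.

End IrreducibleDimension.

(** * Submodules of the exterior algebra as rational matrix representations *)

Section MatrixModel.
Variables (C : numClosedFieldType) (l m k : nat).
Local Notation n := (l + m)%N.
Local Notation I := ('I_n * 'I_k)%type.
Local Notation W := (exterior C I).
Variable G : set 'M[C]_n.
Hypothesis GM : forall g h, G g -> G h -> G (g *m h).

Definition entry_poly (f : 'M[C]_n -> C) : Prop :=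
  exists q : mpoly (n * n) C, forall g, f g = meval (fun t => mxvec g 0 t) q.

Lemma entry_poly_cst c : entry_poly (fun=> c).
Proof. by exists (mpolyC (n * n) c) => g; rewrite mpoly.mevalC. Qed.

Lemma entry_poly_entry i j : entry_poly (fun g => g i j).
Proof. by exists (mpolyX C (mnm1 (mxvec_index i j))) => g; rewrite mpoly.mevalXU mxvecE. Qed.

Lemma entry_polyD f h : entry_poly f -> entry_poly h -> entry_poly (fun g => f g + h g).
Proof. by move=> [p hp] [q hq]; exists (p + q) => g; rewrite mpoly.mevalD hp hq. Qed.

Lemma entry_polyM f h : entry_poly f -> entry_poly h -> entry_poly (fun g => f g * h g).
Proof. by move=> [p hp] [q hq]; exists (p * q) => g; rewrite mpoly.mevalM hp hq. Qed.

Lemma entry_poly_sum (J : Type) (r : seq J) (f : J -> 'M[C]_n -> C) : (forall j, entry_poly (f j)) ->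
  entry_poly (fun g => \sum_(j <- r) f j g).
Proof.
move=> /choice[q hq]; exists (\sum_(j <- r) q j) => g; rewrite (rmorph_sum (meval _)).
by apply: eq_bigr => j _; exact: hq.
Qed.

Lemma entry_poly_ext f h : f =1 h -> entry_poly f -> entry_poly h.
Proof. by move=> e [q hq]; exists q => g; rewrite -e. Qed.

Lemma ext_act_poly (u : W) S : entry_poly (fun g => ext_act g u S).
Proof.
elim/fock_ind: u S => [a u v hu hv S|S|p u hu S].
- apply: (@entry_poly_ext (fun g => a * ext_act g u S + ext_act g v S)).
    by move=> g; rewrite actDr actZr !ffunE.
  by apply: entry_polyD => //; apply: entry_polyM => //; exact: entry_poly_cst.
- by apply: (@entry_poly_ext (fun=> vac C I S)) => [g|]; [rewrite ext_act_vac|exact: entry_poly_cst].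
- apply: (@entry_poly_ext (fun g => \sum_(i < n) g i p.1 *
      (if (i, p.2) \in S then fsgn C (i, p.2) (S :\ (i, p.2))%SET * ext_act g u (S :\ (i, p.2))%SET else 0))).
    by move=> g; rewrite ext_act_cr /gcr sum_ffunE; apply: eq_bigr => i _; rewrite !ffunE.
  apply: entry_poly_sum => i; apply: entry_polyM; first exact: entry_poly_entry.
  case: ((i, p.2) \in S); last exact: entry_poly_cst.
  by apply: entry_polyM; [exact: entry_poly_cst|exact: hu].
Qed.

Variables (lam : 'I_l -> int) (M : {vspace W}).
Hypothesis irr : irreducible_hw G (@ext_act C n k) lam M.

(** Coordinates in a basis of [M]; it supplies the model that [irr_dim] asks for, with polynomial
    entries by [ext_act_poly]. *)
Lemma matrix_model : exists rho : 'M[C]_n -> 'M[C]_(\dim M), rational_repr G rho /\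
  @irreducible_hw C l m G 'cV[C]_(\dim M) (fun g v => rho g *m v) lam fullv.
Proof.
have [[M0 Mst Mirr] [v0 v0M [v00 hv0]]] := irr.
pose b := vbasis M; pose d := \dim M.
pose phi (x : 'cV[C]_d) : W := \sum_j x j 0 *: b`_j.
have phi_lin : linear phi.
  by move=> a x y; rewrite /phi scaler_sumr -big_split /=; apply: eq_bigr => j _; rewrite !mxE scalerDl scalerA.
pose psi (w : W) : 'cV[C]_d := \col_i coord b i w.
have psi_lin a x y : psi (a *: x + y) = a *: psi x + psi y.
  by apply/matrixP => i j; rewrite !mxE linearP.
have bM j : b`_j \in M.
  by have [jd|jd] := ltnP j d; [apply: vbasis_mem; rewrite mem_nth ?size_tuple|rewrite nth_default ?mem0v // size_tuple].
have phiM x : phi x \in M by apply: memv_suml => j _; rewrite memvZ.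
have phiK w : w \in M -> phi (psi w) = w.
  by move=> wM; rewrite [RHS](coord_vbasis wM); apply: eq_bigr => j _; rewrite mxE.
have psiK x : psi (phi x) = x.
  apply/matrixP => i j; rewrite !mxE ord1 /phi coord_sum_free //.
  exact: (basis_free (vbasisP M)).
pose rho (g : 'M[C]_n) : 'M[C]_d := \matrix_(i, j) coord b i (ext_act g b`_j).
have rhoE g x : G g -> rho g *m x = psi (ext_act g (phi x)).
  move=> Gg; apply/matrixP => i j; rewrite !mxE ord1 /phi act_sumr linear_sum; apply: eq_bigr => a _.
  by rewrite mxE actZr linearZ /= mulrC.
have phi_rho g x : G g -> phi (rho g *m x) = ext_act g (phi x).
  by move=> Gg; rewrite rhoE // phiK //; exact: (Mst _ _ Gg (phiM x)).
exists rho; split.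
  split=> [|g h Gg Gh|].
  - apply/matrixP => i j; rewrite !mxE ext_act1 coord_free //; last exact: (basis_free (vbasisP M)).
    by rewrite eq_sym.
  - apply/matrixP => i j.
    have e (g' : 'M[C]_n) : rho g' i j = (rho g' *m (delta_mx j 0 : 'cV_d)) i 0.
      by rewrite -colE [RHS]mxE.
    rewrite e [in RHS](_ : (rho g *m rho h) i j = (rho g *m rho h *m (delta_mx j 0 : 'cV_d)) i 0); last by rewrite -colE [RHS]mxE.
    rewrite -mulmxA !rhoE //; last exact: GM.
    by rewrite phiK ?ext_actM //; exact: (Mst _ _ Gh (phiM _)).
  - have hq i j : entry_poly (fun g => rho g i j).
      apply: (@entry_poly_ext (fun g => \sum_S ext_act g b`_j S * coord b i (ebas C S))).
        move=> g; rewrite mxE {2}[ext_act g b`_j]ebas_sum linear_sum /=; apply: eq_bigr => S _.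
        by rewrite linearZ.
      by apply: entry_poly_sum => S; apply: entry_polyM; [exact: ext_act_poly|exact: entry_poly_cst].
    have /choice[q hq'] : forall i, exists qi : 'I_d -> mpoly (n * n) C, forall j g, rho g i j = meval (fun t => mxvec g 0 t) (qi j).
      by move=> i; have /choice[q hq'] := hq i; exists q.
    by exists q => g _ i j; rewrite hq'.
split.
  split=> [|g u _ _|U _ sU].
  - rewrite -dimv_eq0 dimvf /dim /= muln1; apply: contraNneq M0 => e.
    by rewrite -dimv_eq0 e.
  - exact: memvf.
  have [U' hU'] : exists U' : {vspace W}, forall w, w \in U' <-> w \in M /\ psi w \in U.
    apply: pred_vspace => [|a x y [xM xU] [yM yU]].
      by split; rewrite ?mem0v // (_ : psi 0 = 0) ?mem0v //; apply/matrixP => i j; rewrite !mxE linear0.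
    by split; rewrite ?memvD ?memvZ // psi_lin memvD ?memvZ.
  have [||e|e] := Mirr U'; first by apply/subvP => w /hU'[].
  - move=> g w Gg /hU'[wM wU]; apply/hU'; split; first exact: Mst.
    have := sU g _ Gg wU; rewrite rhoE // phiK //.
  - left; apply/eqP; rewrite -subv0; apply/subvP => x xU.
    have : phi x \in U' by apply/hU'; rewrite psiK.
    by rewrite e !memv0 => /eqP e0; rewrite -[x]psiK e0; apply/eqP/matrixP => i j; rewrite !mxE linear0.
  - right; apply/eqP; rewrite eqEsubv subvf; apply/subvP => x _.
    have : phi x \in U' by rewrite e.
    by move=> /hU'[_]; rewrite psiK.
exists (psi v0); first exact: memvf.
split; first by apply: contraNneq v00 => e; rewrite -[v0]phiK // e /phi big1 // => j _; rewrite mxE scale0r.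
move=> g Gg tg; rewrite rhoE // phiK // hv0 //.
by apply/matrixP => i j; rewrite !mxE linearZ.
Qed.

End MatrixModel.

(** * The irreducible module generated by the monomial of a Young diagram *)

Section HighestComponent.
Variables (R : realType) (l k : nat) (lam : intpart l).
Hypothesis lamk : in_box k lam.
Local Notation C := R[i].
Local Notation m := l.+1.
Local Notation n := (l + m)%N.
Local Notation I := ('I_n * 'I_k)%type.
Local Notation W := (exterior C I).
Local Notation eps := (fun=> 1 : C).
Local Notation lsh := (@lsh l m).

Definition young : {set I} := [set p : I | [exists i : 'I_l, (p.1 == lsh i) && (p.2 < parts lam i)%N]].

Let half (j : 'I_n) : (j < rev_ord j)%N = (j < l)%N. Proof. by rewrite /=; have := ltn_ord j; lia. Qed.
Let eps_sq (i : 'I_n) : (1 : C) * 1 = 1. Proof. exact: mulr1. Qed.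
Let eps_rev (i : 'I_n) : (1 : C) = (1 : R)%:C%C * 1. Proof. by rewrite rmorph1 mulr1. Qed.
Let fl_eta : false -> m = l /\ forall i : 'I_n, (1 : C) = 1. Proof. by []. Qed.
Let nfl : ~~ false -> (1 : R)%:C%C = 1 :> C -> m = l.+1. Proof. by []. Qed.

Lemma young_lsh (i : 'I_l) (a : 'I_k) : ((lsh i, a) \in young) = (a < parts lam i)%N.
Proof.
rewrite finset.inE; apply/existsP/idP => [[j /andP[/eqP e h]]|h]; last by exists i; rewrite eqxx.
by have -> : i = j by apply: val_inj; exact: (congr1 val e).
Qed.

Lemma youngP p : p \in young -> exists2 i : 'I_l, p.1 = lsh i & (p.2 < parts lam i)%N.
Proof. by rewrite finset.inE => /existsP[i /andP[/eqP e h]]; exists i. Qed.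

Lemma occ_young_lsh i : occ (lsh i) young = parts lam i.
Proof.
have pk : (parts lam i <= k)%N by have /forallP := lamk; exact.
rewrite /occ -[RHS]card_ord -(card_imset 'I_(parts lam i) (_ : injective (fun a : 'I_(parts lam i) => (lsh i, widen_ord pk a)))); last first.
  by move=> a b /(congr1 snd)/(congr1 val) /= e; exact: val_inj.
apply: eq_card => p; rewrite [in LHS]inE; apply/andP/finset.imsetP => [[py /eqP pi]|[a _ ->]].
  have [j e h] := youngP py; have ij : j = i by apply: val_inj; move: pi; rewrite e => /(congr1 val).
  rewrite ij in h; exists (Ordinal h) => //.
  by rewrite [LHS]surjective_pairing pi; congr (_, _); apply: val_inj.
by rewrite young_lsh /= eqxx.
Qed.

Lemma occ_young_high (a : 'I_n) : (l <= a)%N -> occ a young = 0%N.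
Proof.
move=> la; apply: eq_card0 => p; rewrite inE; apply/negP => /andP[/youngP[i e _] /eqP pa].
by move: la; rewrite -pa e /= leqNgt; have := ltn_ord i => ->.
Qed.

Lemma wt_young i : wt (lsh i) young = (parts lam i)%:Z.
Proof. by rewrite /wt occ_young_lsh occ_young_high ?subr0 //; exact: rev_lsh_ge. Qed.

Local Notation e0 := (ebas C young : W).

(** The operator moves a cell from row [j] to the earlier row [i] in the same column; since parts
    decrease, that cell is already occupied. *)
Lemma delta_young (i j : 'I_n) : (i < j)%N -> dr (delta_mx i j) e0 = 0.
Proof.
move=> ij; rewrite dr_delta big1 // => a _; apply/ffunP => S; rewrite [RHS]ffunE.
apply/eqP; apply: contraT => /cr_supp[iS]; rewrite ffunE; case: ifP => [_|/negbT jS']; first by rewrite eqxx.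
rewrite mulf_eq0 negb_or => /andP[_ /ebas_supp e].
have jy : (j, a) \in young by rewrite -e finset.in_setU1 eqxx.
have [j' /= ej aj] := youngP jy.
have il : (i < l)%N by move: ij; rewrite ej /=; have := ltn_ord j'; lia.
have : (i, a) \in young.
  have -> : i = lsh (Ordinal il) by exact: val_inj.
  rewrite young_lsh; apply: leq_trans aj _; apply: parts_antitone => /=.
  by move: ij; rewrite ej => /ltnW.
rewrite -e finset.in_setU1 finset.in_setD1 eqxx /= orbF => /eqP[ije].
by rewrite ije ltnn in ij.
Qed.

Lemma HW_young : HW eps (full (m := m) (weight lam)) e0.
Proof.
split=> [S /ebas_supp -> a|a b ab].
  by rewrite (wt_full half fl_eta nfl) // (_ : (fun i => wt (lsh i) young) = weight lam) //; apply/funext => i; exact: wt_young.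
rewrite (FmE eps_sq eps_rev) drD drN drZ !delta_young ?scaler0 ?subr0 //.
by rewrite /=; have := ltn_ord b; lia.
Qed.

Definition hwcomp : {vspace W} := gen eps (eq e0).

Lemma e0_neq0 : e0 != 0.
Proof.
apply/eqP => /ffunP/(_ young); rewrite !ffunE eqxx => /eqP.
by rewrite oner_eq0.
Qed.

Lemma hwcomp_irreducible : irreducible_hw (@SO C n) (@ext_act C n k) (weight lam) hwcomp.
Proof.
apply: (irr_genP eps_sq eps_rev half) => [g||]; [exact: SO_ggen|exact: e0_neq0|exact: HW_young].
Qed.

Lemma hwcomp_stable : lie_stable eps hwcomp.
Proof. by apply: (gen_stable eps_sq eps_rev) => v <-; eexists; exact: HW_young. Qed.

Lemma hwcomp_sub : (hwcomp <= comp k false eps (weight lam))%VS.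
Proof.
apply: gen_min => [|v <-]; first exact: (comp_stable eps_sq eps_rev).
by apply/(genP eps)/lowgen_in; left; exact: HW_young.
Qed.

Lemma irr_dim_hwcomp : irr_dim (m := m) (@SO C n) (weight lam) = \dim hwcomp.
Proof.
have [rho [rr irr]] := matrix_model (@SO_mul C l) hwcomp_irreducible.
exact: irr_dimE rr irr.
Qed.

(** The highest weight space of the generated module is the line of [e0]: by [lowgen_lead] an
    element differs from a multiple of [e0] only in lower degree. *)
Lemma mult_top S : (forall i, wt (lsh i) S = (parts lam i)%:Z) -> mult hwcomp S = (S == young)%:R.
Proof.
move=> hS; apply: realC_inj; rewrite /= multE rmorph_nat.
have wS a : wt a S = wt a young.
  by rewrite !(wt_full half fl_eta nfl); congr (full _ a); apply/funext => i; rewrite hS wt_young.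
have top u : u \in hwcomp -> exists a, u S = a * (S == young)%:R.
  move=> /(genP eps) hu.
  have [a ha] := lowgen_lead eps_sq eps_rev (@yreg_odd n) (@yreg_mon n) (c := yw (@yreg n) young)
    (fun T hT => congr1 (yw (@yreg n)) (ebas_supp hT)) hu.
  exists a; have := ha S; rewrite (yw_eq (@yreg_odd n) wS) ltxx => h.
  have : (u - a *: e0) S = 0 by apply/eqP; apply: contraT => /h.
  by rewrite !ffunE => /eqP; rewrite subr_eq0 => /eqP ->.
have [->|ne] := eqVneq S young; last first.
  apply/eqP; apply: contraT => nz.
  have := @acoef_supp _ _ _ hwcomp (fun T => T != S) _ S nz; rewrite eqxx => H.
  suff : ~~ true by [].
  apply: H => u uM T uT; apply/eqP => eT; move: uT; rewrite eT; have [a ->] := top u uM.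
  by rewrite (negbTE ne) mulr0 eqxx.
rewrite acoef_proj (_ : oproj hwcomp (ebas C young) = ebas C young); last first.
  apply/esym/proj_uniq; first by apply/(genP eps); exact: lowgen_in.
  by rewrite subrr => x _; rewrite dot0l.
by rewrite dot_ebas ffunE eqxx.
Qed.

Lemma sum_mult_top : \sum_(S : {set I} | [forall i, wt (lsh i) S == (parts lam i)%:Z]) mult hwcomp S = 1.
Proof.
rewrite (bigD1 young) /=; last by apply/forallP => i; rewrite wt_young.
rewrite mult_top => [|i]; last exact: wt_young.
rewrite eqxx big1 ?addr0 // => S /andP[/forallP h ne].
by rewrite mult_top ?(negbTE ne) // => i; exact/eqP.
Qed.

End HighestComponent.

(** * The Legendre case *)

Lemma jpol_lead (R : realType) (al be : R) n : (jpol al be n)`_n = jnorm al n * jcoef al be n n.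
Proof.
rewrite /jpol coefZ coef_sum big_ord_recr /= big1 ?add0r => [|i _]; last first.
  rewrite coefZ nth_default ?mulr0 //.
  by rewrite -[1]/(1%:P) size_exp_XsubC.
rewrite coefZ; congr (_ * _).
have /monicP := monic_exp n (monicXsubC (1 : R)); rewrite /lead_coef size_exp_XsubC /= => h.
by rewrite [X in _ * X]h mulr1.
Qed.

Section LegendreExpansion.
Variables (R : realType) (l k : nat).
Hypothesis l0 : (0 < l)%N.
Local Notation M := (l + k).-1.
Local Notation N := (jev (0 : R) 0).
Local Notation J := (jpol (0 : R) 0).
Local Notation V := (vandermonde_mpoly R l).
Local Notation G := (mprod (fun _ : 'I_l => ((2^-1%:P * (1 + 'X)) ^+ k : {poly R}))).

Let m1 : (-1 : R) < 0. Proof. by rewrite oppr_lt0. Qed.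

Definition bern (m n : nat) : R := phin 0 0 n ((1 + 'X) ^+ m).

(** Self-adjointness of the Legendre operator, which sends [(1 + x) ^ (m + 1)] to [- N (m + 1)]
    times itself plus [2 (m + 1)^2 (1 + x) ^ m]. *)
Lemma bern_rec m n : (N m.+1 - N n) * bern m.+1 n = 2 * m.+1%:R ^+ 2 * bern m n.
Proof.
have e : jD (0 : R) 0 ((1 + 'X) ^+ m.+1) = - (N m.+1 *: (1 + 'X) ^+ m.+1) + (2 * m.+1%:R ^+ 2) *: (1 + 'X) ^+ m.
  have du : ((1 + 'X) : {poly R})^`() = 1 by rewrite derivD derivX -[1 in LHS]/(1%:P) derivC add0r.
  rewrite /jD /jop deriv_exp du mul1r derivMn /=.
  case: m => [|m].
    rewrite expr0 !expr1 mulr1n -[1]/(1%:P) derivC /jev.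
    rewrite -!mul_polyC !(polyCD, polyCB, polyCM); ring.
  rewrite deriv_exp du mul1r /= !exprS -!mul_polyC /jev -(mulr_natl _ m.+1) -2!(mulr_natl _ m.+2).
  rewrite -[m.+2]addn2 -[m.+1]addn1 !natrD !(polyCD, polyCB, polyCM, polyC_natr); ring.
have := jL_jD_sym m1 m1 ((1 + 'X) ^+ m.+1) (J n); rewrite jpol_eigen // e /bern /phin.
move: (J n) => P h.
have LZ c p : jL (0 : R) 0 (c *: p) = c * jL 0 0 p by rewrite linearZ.
have LN p : jL (0 : R) 0 (- p) = - jL 0 0 p by rewrite linearN.
have LD p r : jL (0 : R) 0 (p + r) = jL 0 0 p + jL 0 0 r by rewrite linearD.
rewrite mulrDl mulNr -!scalerAl -[X in _ = jL _ _ X]scalerAr LD LN !LZ in h.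
move: h; move: (jL _ _ (_ ^+ m.+1 * P)) (jL _ _ (_ ^+ m * P)) (N m.+1) (N n) (2 * _) => x y a b c h.
by apply/eqP; rewrite mulrBl subr_eq -[b * x]opprK -mulNr -h opprD opprK addrC subrK.
Qed.

(** The value 1 on the diagonal lets products run over all positions without excluding one. *)
Definition gap (a b : nat) : R := if a == b then 1 else `|N a - N b|.

Lemma gap_gt0 a b : 0 < gap a b.
Proof.
rewrite /gap; case: eqP => // /eqP ab; rewrite normr_gt0 subr_eq0.
by apply: contraNneq ab => /(jev_inj m1 m1) ->.
Qed.

Lemma jev_lt a b : (a < b)%N -> N a < N b.
Proof.
move=> ab; rewrite /jev !add0r; apply: ltr_pM => //; first by rewrite ltr_nat.
by rewrite ltrD2r ltr_nat.
Qed.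

Lemma bern_mul m d n : bern m n * \prod_(s < d) (2 * (m + s).+1%:R ^+ 2) =
  bern (m + d) n * \prod_(s < d) (N (m + s).+1 - N n).
Proof.
elim: d => [|d IH]; first by rewrite !big_ord0 addn0.
rewrite !big_ord_recr /= mulrA IH addnS -mulrA mulrCA [RHS]mulrCA; congr (_ * _).
by rewrite mulrC -bern_rec mulrC.
Qed.

Definition bernc : R := \prod_(s < M) (2 * s.+1%:R ^+ 2).

(** The recurrence climbs from exponent [n], where only leading coefficients matter, to [M]. The
    factors with [a < n] of the product come from the leading coefficient of the Legendre
    polynomial, those with [a > n] from the recurrence. *)
Lemma bern_ratio n : (n <= M)%N ->
  bern M n / phin 0 0 n (J n) = bernc / \prod_(a < M.+1) gap a n.
Proof.
move=> nM; have c0 s : 2 * s.+1%:R ^+ 2 != 0 :> R by rewrite mulf_neq0 ?expf_neq0 ?pnatr_eq0.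
have J0 : phin 0 0 n (J n) != 0 by rewrite gt_eqF // jpol_sq_gt0.
pose A := \prod_(s < n) (N n - N s); pose B := \prod_(s < M - n) (N (n + s).+1 - N n).
have A0 : A != 0 by apply/prodf_neq0 => s _; rewrite gt_eqF // subr_gt0 jev_lt.
have B0 : B != 0 by apply/prodf_neq0 => s _; rewrite gt_eqF // subr_gt0 jev_lt // ltnS leq_addr.
have gE : \prod_(a < M.+1) gap a n = A * B.
  have e : M.+1 = (n + (M - n).+1)%N by lia.
  rewrite e big_split_ord big_ord_recl /= {2}/gap addn0 eqxx mul1r; congr (_ * _).
    by apply: eq_bigr => s _; rewrite /gap ltn_eqF // distrC gtr0_norm // subr_gt0 jev_lt.
  apply: eq_bigr => s _; rewrite /gap /bump /= add1n addnS gtn_eqF ?ltnS ?leq_addr //.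
  by rewrite gtr0_norm // subr_gt0 jev_lt // ltnS leq_addr.
have cE : bernc = \prod_(s < n) (2 * s.+1%:R ^+ 2) * \prod_(s < M - n) (2 * (n + s).+1%:R ^+ 2).
  have sp a b : \prod_(s < a + b) (2 * s.+1%:R ^+ 2) =
        \prod_(s < a) (2 * s.+1%:R ^+ 2) * \prod_(s < b) (2 * (a + s).+1%:R ^+ 2) :> R by rewrite big_split_ord.
    by rewrite -sp subnKC.
have := bern_mul n (M - n) n; rewrite subnKC // -/B => h.
have sz : size ((1 + 'X : {poly R}) ^+ n) = n.+1.
  by rewrite (_ : 1 + 'X = 'X - (-1)%:P) ?size_exp_XsubC // polyCN opprK addrC.
have top : ((1 + 'X : {poly R}) ^+ n)`_n = 1.
  have /monicP := monic_exp n (monicXsubC (-1 : R)).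
  by rewrite /lead_coef size_exp_XsubC /= polyCN opprK addrC.
have bn : bern n n = A^-1 * \prod_(s < n) (2 * s.+1%:R ^+ 2) * phin 0 0 n (J n).
  rewrite /bern phin_top ?sz // top; congr (_ * _).
  rewrite jpol_lead (_ : jnorm 0 n = 1) ?mul1r; last first.
    by rewrite /jnorm big1 // => i _; rewrite add0r divff // pnatr_eq0.
  rewrite /jcoef prodf_div invf_div mulrC.
  by congr (_ * _); apply: eq_bigr => s _; rewrite addr0 expr2 mulrA.
rewrite gE cE; move: h; rewrite bn.
move: (\prod_(s < n) _) (\prod_(s < M - n) (2 * _)) (phin _ _ _ _) (bern _ _) J0 A0 B0 => x1 x2 x3 x4.
move=> h1 h2 h3 h; apply/eqP; rewrite eqr_div ?mulf_neq0 //; apply/eqP.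
rewrite mulrCA -mulrA in h |- *.
by rewrite -h; field.
Qed.

Local Notation q := (fun j : 'I_l => (2^-1%:P * (1 + 'X)) ^+ k * (1 + 'X) ^+ j : {poly R}).

(** The Vandermonde determinant can be written in powers of [1 + x] instead of [x], and [G] is then
    absorbed into the rows. *)
Lemma vandermonde_power : exists e : R, V * G = e *: \det (\matrix_(i, j) emb i (q j)).
Proof.
pose e : R := \prod_(j < l) (-1) ^+ j.
have ee : e * e = 1.
  rewrite /e -big_split big1 //= => j _.
  by rewrite -signr_odd -signr_addb addbb.
have h : \det (\matrix_(i < l, j < l) emb i ((1 + 'X : {poly R}) ^+ j)) = e *: V.
  have sz n : size (('X + 1 : {poly (mpoly l R)}) ^+ n) = n.+1.
    by rewrite (_ : 'X + 1 = 'X - (-1)%:P) ?size_exp_XsubC // polyCN opprK.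
  have := @det_horner_tri _ l (fun j => ('X + 1) ^+ j) (fun i => mpolyX R (mnm1 i)) (fun j => eq_leq (sz j)).
  rewrite -vandermonde_vdm => D; rewrite -mpoly.mul_mpolyC mulrC.
  have -> : mpolyC l e = \prod_(j < l) ((-1) ^+ j * (('X + 1 : {poly (mpoly l R)}) ^+ j)`_j).
    rewrite /e rmorph_prod; apply: eq_bigr => j _; rewrite rmorphXn rmorphN1.
    have /monicP := monic_exp j (monicXsubC (-1 : mpoly l R)).
    by rewrite /lead_coef size_exp_XsubC /= polyCN opprK => ->; rewrite mulr1.
  rewrite -D; congr (\det _); apply/matrixP => i j; rewrite !mxE emb_exp embD embX.
  by rewrite -[1]/(1%:P) embC horner_exp !hornerE mpoly.mpolyC1 addrC.
exists e; rewrite (_ : \det _ = G * (e *: V)).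
  by rewrite -scalerAr scalerA ee scale1r mulrC.
rewrite -h; have -> : G = \det (diag_mx (\row_i emb i ((2^-1%:P * (1 + 'X)) ^+ k))) :> mpoly l R.
  by rewrite det_diag; apply: eq_bigr => i _; rewrite mxE.
rewrite -det_mulmx mul_diag_mx; congr (\det _); apply/matrixP => i j.
by rewrite !mxE embM.
Qed.

Lemma alternating_VG : alternating 0 0 (V * G).
Proof.
have [e ->] := vandermonde_power => n i j ij.
by rewrite !PhiZ alternating_det // mulrN.
Qed.

(** Going down from [M], the recurrence gives the integral of [(1 + x) ^ (k + j)] as [bern M n]
    times a polynomial in [N n] of degree [M - k - j], less than [l]. Hence the determinant is a
    Vandermonde determinant in the [N (n i)]. *)
Lemma Phi_VG : exists K : R, forall n : 'I_l -> nat,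
  Phi 0 0 n (V * G) = K * (\prod_i bern M (n i)) * vdm (fun i => N (n i)).
Proof.
have [e VG] := vandermonde_power.
pose p (j : 'I_l) : {poly R} := (2^-1 ^+ k / \prod_(s < M - (k + j)) (2 * (k + j + s).+1%:R ^+ 2)) *:
  \prod_(s < M - (k + j)) ((N (k + j + s).+1)%:P - 'X).
have pE j n : phin 0 0 n (q j) = bern M n * (p j).[N n].
  rewrite exprMn -mulrA -exprD -polyC_exp mul_polyC.
  have := plin_phin m1 m1 n (2^-1 ^+ k) ((1 + 'X) ^+ (k + j)) 0.
  have Z0 : phin (0 : R) 0 n 0 = 0 by rewrite /phin mul0r linear0.
  rewrite !addr0 Z0 addr0 => ->; rewrite -/(bern _ _).
  have jM : (k + j <= M)%N by have := ltn_ord j; lia.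
  have := bern_mul (k + j) (M - (k + j)) n; rewrite subnKC //.
  rewrite /p hornerZ horner_prod.
  under [X in _ * (_ * X)]eq_bigr do rewrite hornerD hornerN hornerC hornerX.
  have c0 : \prod_(s < M - (k + j)) (2 * (k + j + s).+1%:R ^+ 2) != 0 :> R.
    by apply/prodf_neq0 => s _; rewrite mulf_neq0 ?expf_neq0 ?pnatr_eq0.
  move: (\prod_(s < _) (2 * _)) (\prod_(s < _) (_ - _)) (2^-1 ^+ k) (bern _ _) (bern _ _) c0.
  move=> x1 x2 x3 x4 x5 h1 h2.
  have -> : x5 = x4 * x2 / x1 by rewrite -h2 mulfK.
  by ring.
have sp j : (size (p j) <= l)%N.
  apply: leq_trans (size_scale_leq _ _) _.
  have h (d m : nat) : (size (\prod_(s < d) ((N (m + s).+1)%:P - 'X) : {poly R})%R <= d.+1)%N.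
    elim: d => [|d IH]; first by rewrite big_ord0 size_polyC oner_neq0.
    rewrite big_ord_recr /=; apply: leq_trans (size_polyMleq _ _) _.
    have s2 : size ((N (m + d).+1)%:P - 'X : {poly R}) = 2%N.
      by rewrite -opprB size_polyN size_XsubC.
    by rewrite s2 addn2.
  by apply: leq_trans (h _ _) _; have := ltn_ord j; lia.
exists (e * \det (\matrix_(a < l, j < l) ((-1) ^+ a * (p j)`_a))) => n.
rewrite VG PhiZ Phi_det //.
have -> : \matrix_(i, j) phin 0 0 (n i) (q j) =
    diag_mx (\row_i bern M (n i)) *m \matrix_(i, j) (p j).[N (n i)].
  by apply/matrixP => i j; rewrite mul_diag_mx !mxE pE.
rewrite det_mulmx det_diag det_horner_small //.
rewrite (eq_bigr (fun i => bern M (n i))) => [|i _]; last by rewrite mxE.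
ring.
Qed.

(** One Vandermonde factor comes from [Phi_VG], the other from the value of [P_lam] at
    [(1, ..., 1)]; hence the square. *)
Lemma legendre_expansion : exists K : R, forall x : 'I_l -> R,
  \sum_(lam <- fset_set (box l k)) (K * (vdm (fun i => N (jpos lam i)) ^+ 2 / \prod_i \prod_(a < M.+1) gap a (jpos lam i))) *
    normalized_jacobiP 0 0 lam x = \prod_i ((1 + x i) / 2) ^+ k.
Proof.
have [K hK] := Phi_VG.
pose P1 (lam : intpart l) : R := meval (fun=> 1) (jacobiP 0 0 lam).
have P1E lam : P1 lam = jdet_const l 0 * vdm (fun i => N (jpos lam i)).
  rewrite /P1 jacobiP1 // [X in X * _ * _]big1 ?mul1r // => j _.
  by rewrite /jnorm big1 // => i _; rewrite add0r divff // pnatr_eq0.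
have P10 lam : P1 lam != 0 by exact: jacobiP1_neq0.
pose d (lam : intpart l) : R := Phi 0 0 (jpos lam) (V * G) / \prod_i phin 0 0 (jpos lam i) (J (jpos lam i)).
have jM (lam : intpart l) : in_box k lam -> forall i, (jpos lam i <= M)%N.
  by move=> /forallP h i; have := h i; have := ltn_ord i; rewrite /jpos; lia.
have dE lam : in_box k lam -> d lam * P1 lam = K * bernc ^+ l * jdet_const l 0 *
    (vdm (fun i => N (jpos lam i)) ^+ 2 / \prod_i \prod_(a < M.+1) gap a (jpos lam i)).
  move=> lk; rewrite /d hK P1E.
  have h : (\prod_i bern M (jpos lam i)) / (\prod_i phin 0 0 (jpos lam i) (J (jpos lam i))) =
      bernc ^+ l / \prod_i \prod_(a < M.+1) gap a (jpos lam i).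
    have -> : bernc ^+ l = \prod_(i < l) bernc by rewrite prodr_const card_ord.
    rewrite -!prodfV -!big_split /=; apply: eq_bigr => i _.
    by rewrite bern_ratio // jM.
  move: h; move: (\prod_i bern _ _) (\prod_i phin _ _ _ _) (\prod_i \prod_(a < _) _) (vdm _) => x1 x2 x3 x4 h.
  rewrite (_ : K * x1 * x4 / x2 = K * x4 * (x1 / x2)); last by ring.
  rewrite h.
  by ring.
have exp : V * G = \sum_(lam <- fset_set (box l k)) d lam *: jdet 0 0 (jpos lam).
  apply/eqP; rewrite -subr_eq0; apply/eqP.
  have PhiD n p : Phi 0 0 n (V * G - p) = Phi 0 0 n (V * G) - Phi 0 0 n p :> R.
    by rewrite /Phi mfunB //= => i; exact: plin_phin.
  have PhiS n : Phi 0 0 n (\sum_(lam <- fset_set (box l k)) d lam *: jdet 0 0 (jpos lam)) =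
      \sum_(lam <- fset_set (box l k)) d lam * Phi 0 0 n (jdet 0 0 (jpos lam)).
    by rewrite Phi_sum; apply: eq_bigr => lam _; rewrite PhiZ.
  apply: (alternating_eq0 m1 m1) => [n i j ij|n dec].
    rewrite !PhiD !PhiS alternating_VG // opprB [LHS]addrC; congr (_ + _).
    rewrite -sumrN; apply: eq_bigr => lam _.
    by rewrite alternating_det // mulrN opprK.
  rewrite PhiD PhiS.
  (* A degree beyond [M] annihilates [bern M]. In the other case a strictly decreasing sequence
     bounded by [M] is [jpos] of a partition in the box. *)
  have [nM|/existsNP[i /negP]] := pselect (forall i, (n i <= M)%N); last first.
    rewrite -ltnNge => ni.
    have b0 : bern M (n i) = 0.
      apply: phin_small => //; apply: leq_trans ni.
      by rewrite (_ : 1 + 'X = 'X - (-1)%:P) ?size_exp_XsubC // polyCN opprK addrC.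
    rewrite hK (bigD1 i) //= b0 mul0r mulr0 mul0r sub0r big_seq big1 ?oppr0 // => lam.
    rewrite in_fset_set; last exact: box_finite.
    move=> /set_mem lk; rewrite Phi_jdet_neq ?mulr0 //; first exact: jpos_anti.
    by apply/eqP => e; have := jM lam lk i; rewrite -e leqNgt ni.
  have ge r (rl : (r < l)%N) : (l - r.+1 <= n (Ordinal rl))%N.
    move: rl; have [c] := ubnP (l - r); elim: c r => [//|c IH] r rc rl.
    have [rl1|] := ltnP r.+1 l; last by lia.
    by have := IH r.+1 ltac:(lia) rl1; have := dec (Ordinal rl) (Ordinal rl1) (ltnSn r); lia.
  have gei (i : 'I_l) : (l - i.+1 <= n i)%N by have := ge _ (ltn_ord i); rewrite (_ : Ordinal _ = i) //; exact: val_inj.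
  have main (i : 'I_l) c : forall j : 'I_l, (i + c = j)%N -> (n j + c <= n i)%N.
    elim: c => [|c IH] j e; first by rewrite (_ : i = j) ?addn0 //; apply: ord_inj; rewrite -e addn0.
    have hc : (i + c < l)%N by have := ltn_ord j; lia.
    by have := IH (Ordinal hc) erefl; have := dec (Ordinal hc) j ltac:(rewrite /= -e; lia); lia.
  have [nu hnu] : exists nu : intpart l, forall i, parts nu i = (n i - (l - i.+1))%N.
    apply: intpart_of => i j ij.
    by have := main i (j - i)%N j (subnKC (ltnW ij)); have := gei j; have := ltn_ord j; lia.
  have en : n = jpos nu.
    by apply/funext => i; rewrite /jpos hnu subnK.
  have nk : in_box k nu.
    by apply/forallP => i; rewrite hnu; have := nM (Ordinal l0); have := main (Ordinal l0) i i (add0n i); lia.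
  have mem : nu \in fset_set (box l k).
    by rewrite in_fset_set; [exact: mem_set|exact: box_finite].
  rewrite (bigD1_seq nu mem (fset_uniq _)) /= big1 => [|lam ne]; last first.
    rewrite Phi_jdet_neq ?mulr0 //; first exact: jpos_anti.
    rewrite en; apply: contra_neq ne => e; apply: parts_inj => i.
    by have /eqP := congr1 (fun f => f i) e; rewrite /jpos eqn_add2r => /eqP.
  rewrite en Phi_jdet_diag //; last exact: jpos_inj.
  rewrite /d addr0 divfK ?subrr //; apply/prodf_neq0 => i _.
  by rewrite gt_eqF // jpol_sq_gt0.
have GE : G = \sum_(lam <- fset_set (box l k)) d lam *: jacobiP 0 0 lam.
  apply: (mulfI (vandermonde_neq0 R l)); rewrite exp mulr_sumr; apply: eq_bigr => lam _.
  have := jacobiP_spec m1 m1 lam; move: (jacobiP 0 0 lam) => P hP.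
  by rewrite -scalerAr (mulrC _ P) hP jacobi_det_emb.
exists (K * bernc ^+ l * jdet_const l 0) => x.
transitivity (meval x G); last first.
  by rewrite meval_mprod; apply: eq_bigr => i _; rewrite horner_exp !hornerE mulrC.
rewrite GE (rmorph_sum (meval x)) /= big_seq [RHS]big_seq; apply: eq_bigr => lam.
rewrite in_fset_set; last exact: box_finite.
move=> /set_mem lk; rewrite -dE // mpoly.mevalZ /normalized_jacobiP -/(P1 lam).
by rewrite -mulrA; congr (_ * _); rewrite mulrC divfK.
Qed.

End LegendreExpansion.

(** * The dimension formula for the odd orthogonal groups *)

Section OddDimension.
Variables (R : realType).
Local Notation C := R[i].
Local Notation h2 := (2^-1 : R).

(** Its denominator is the origin of the factors [2 n + 1] of the dimension, which belong to the
    short roots. *)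
Lemma jcoef_top n : jcoef h2 (- h2) n n = 2 ^+ n / (2 * n + 1)%:R.
Proof.
pose A n := \prod_(s < n) (n + s.+1)%:R : R; pose B n := \prod_(s < n) (2 * s + 3)%:R : R.
have B0 n' : B n' != 0 by apply/prodf_neq0 => s _; rewrite pnatr_eq0 addn_eq0 andbF.
have AB n' : A n' * (2 * n' + 1)%:R = 2 ^+ n' * B n'.
  elim: n' => [|n' IH]; first by rewrite /A /B !big_ord0 expr0 !mul1r.
  have step : A n'.+1 = A n' * (2 * (2 * n' + 1)%:R).
    apply: (mulfI (_ : n'.+1%:R != 0 :> R)); first by rewrite pnatr_eq0.
    have e1 : n'.+1%:R * A n'.+1 = \prod_(s < n'.+2) (n' + s.+1)%:R.
      rewrite big_ord_recl /= addn1; congr (_ * _); apply: eq_bigr => s _.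
      by congr (_%:R); rewrite /bump /=; lia.
    rewrite e1 !big_ord_recr /= -/(A n') -(mulrA (A n')) [RHS]mulrCA; congr (_ * _).
    by rewrite -!natrM; congr (_%:R); nia.
  rewrite step /B big_ord_recr /= -/(B n').
  rewrite (_ : (2 * n'.+1 + 1 = 2 * n' + 3)%N); last by lia.
  transitivity (A n' * (2 * n' + 1)%:R * (2 * (2 * n' + 3)%:R)); first by rewrite !mulrA; ring.
  by rewrite IH exprS; ring.
have -> : jcoef h2 (- h2) n n = A n / B n.
  rewrite /jcoef /A /B -prodfV -big_split /=.
  transitivity ((\prod_(s < n) (n - s)%:R) * (\prod_(s < n) s.+1%:R)^-1 * \prod_(s < n) ((n + s.+1)%:R / (2 * s + 3)%:R) : R).
    rewrite -prodfV -!big_split /=; apply: eq_bigr => s _; rewrite jevB.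
    have sn : (s <= n)%N := ltnW (ltn_ord s).
    rewrite -(natrB _ sn) (_ : n%:R + s%:R + (h2 + - h2 + 1) = (n + s.+1)%:R); last first.
      by rewrite natrD -natr1; ring.
    rewrite (_ : 2 * s.+1%:R * (s.+1%:R + h2) = s.+1%:R * (2 * s + 3)%:R); last first.
      by rewrite natrD natrM -natr1; field.
    rewrite invfM; ring.
  rewrite (reindex_inj rev_ord_inj) /=.
  rewrite (eq_bigr (fun s : 'I_n => s.+1%:R)) => [|s _]; last by congr (_%:R); have := ltn_ord s; lia.
  by rewrite divff ?mul1r //; apply/prodf_neq0 => s _; rewrite pnatr_eq0.
by apply/eqP; rewrite eqr_div // AB.
Qed.

Definition dimc (l : nat) : R := (2 ^+ (\sum_(j < l) (l - j.+1)))^-1 * jdet_const l h2.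

Lemma dimc_gt0 l : 0 < dimc l.
Proof.
rewrite /dimc mulr_gt0 ?invr_gt0 ?exprn_gt0 ?ltr0n // jdet_const_gt0 //.
by apply: lt_trans (_ : 0 < _); rewrite ?invr_gt0 ?ltr0n // oppr_lt0.
Qed.

Lemma vdm_jev_gt0 l (lam : intpart l) : 0 < vdm (fun j => jev (0 : R) 0 (jpos lam j)).
Proof.
apply: prodr_gt0 => i _; apply: prodr_gt0 => j ij; rewrite jevB.
have h := jpos_anti lam ij.
rewrite mulr_gt0 ?subr_gt0 ?ltr_nat //.
Qed.

(** Weyl's dimension formula, as [N_a - N_b = (a - b) (a + b + 1)] with [a + 1/2] a coordinate of
    [lam + rho]. It is [dim_lead] for the module of one Young monomial, whose highest weight space
    has dimension one. *)
Lemma irr_dim_SOodd l (lam : intpart l) :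
  (irr_dim (m := l.+1) (@SO C (l + l.+1)) (weight lam))%:R =
  dimc l * \prod_j (2 * jpos lam j + 1)%:R * vdm (fun j => jev (0 : R) 0 (jpos lam j)).
Proof.
(* The dimension does not involve [k]; this value is large enough for the Young diagram of [lam] to
   fit. *)
pose k := (\sum_i parts lam i)%N.
have lamk : in_box k lam by apply/forallP => i; rewrite /k (bigD1 i) //= leq_addr.
have er (i : 'I_(l + l.+1)) : (1 : C) = (1 : R)%:C%C * 1 by rewrite rmorph1 mulr1.
have sq (i : 'I_(l + l.+1)) : (1 : C) * 1 = 1 by rewrite mulr1.
have half (j : 'I_(l + l.+1)) : (j < rev_ord j)%N = (j < l)%N by rewrite /=; have := ltn_ord j; lia.
have el (i j : 'I_(l + l.+1)) : (i < l)%N -> (j < l)%N -> (1 : C) = 1 by [].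
have fe : false -> l.+1 = l /\ forall i : 'I_(l + l.+1), (1 : C) = 1 by [].
have nf : ~~ false -> (1 : R)%:C%C = 1 :> C -> l.+1 = l.+1 by [].
have [a1 a0 a2 a3 a4] : [/\ -1 < h2, -1 < - h2, 0 <= h2 + - h2 + 1,
    h2 + - h2 = 1%:R - 1 & h2 - - h2 = 1%:R] by split; lra.
pose U := hwcomp R k lam.
have sU : lie_stable (fun=> 1) U := hwcomp_stable lamk.
have Uc : (U <= comp k false (fun=> 1%R) (weight lam))%VS by exact: hwcomp_sub.
have [e e1 H] := dim_lead a1 a0 a2
  (fun i => mult_fl half (fun S => mult_wfl_stable sq er half fe nf i S isT sU))
  (fun i j ij => mult_tr sq er half el sU ij)
  (fun r S rl => mult_psum sq er half fe nf Uc rl (S := S))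
  (mult_radial sq er half fe nf (esym (addn1 l)) (leqnn 1) a3 a4 sU Uc).
rewrite mult_dim sum_mult_top // -irr_dim_hwcomp // in H.
set X := RHS; have X0 : 0 < X.
  rewrite /X mulr_gt0 ?vdm_jev_gt0 // mulr_gt0 ?dimc_gt0 //.
  by apply: prodr_gt0 => j _; rewrite ltr0n addn1.
have {}H : (irr_dim (m := l.+1) (@SO C (l + l.+1)) (weight lam))%:R = e * X.
  rewrite H jacobiP1 // mulr1 -!mulrA; congr (_ * _).
  have -> : \prod_i (jpol h2 (- h2) (jpos lam i))`_(jpos lam i) =
      (\prod_i jnorm h2 (jpos lam i)) * (2 ^+ (\sum_i parts lam i) * 2 ^+ (\sum_(j < l) (l - j.+1))) /
      \prod_j (2 * jpos lam j + 1)%:R.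
    rewrite -exprD -big_split /= -prodrXr -prodfV -!big_split /=; apply: eq_bigr => i _.
    by rewrite jpol_lead jcoef_top mulrA.
  (* The eigenvalues depend on the parameters only through their sum, which is 0 in both cases. *)
  have -> : vdm (fun j => jev h2 (- h2) (jpos lam j)) = vdm (fun j => jev 0 0 (jpos lam j)).
    by congr vdm; apply/funext => j; rewrite /jev !addr0 subrr.
  rewrite /X /dimc.
  have N0 : \prod_i jnorm h2 (jpos lam i) != 0.
    by rewrite gt_eqF // prodr_gt0 // => j _; rewrite jnorm_gt0.
  have D0 : \prod_j (2 * jpos lam j + 1)%:R != 0 :> R.
    by apply/prodf_neq0 => j _; rewrite pnatr_eq0 addn1.
  have p2 q : 2 ^+ q != 0 :> R by rewrite expf_neq0 // pnatr_eq0.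
  move: (p2 (\sum_i parts lam i)%N) (p2 (\sum_(j < l) (l - j.+1))%N) N0 D0.
  move: (2 ^+ _) (2 ^+ _) (\prod_j jnorm _ _) (\prod_j _%:R) (vdm _) (jdet_const _ _).
  by move=> x1 x2 x3 x4 x5 x6 h1 h3 h4 h5; field; rewrite h1 h3 h4 h5.
have : 0 <= e * X by rewrite -H ler0n.
rewrite pmulr_lge0 // => e0.
have /eqP := e1; rewrite -expr2 sqrf_eq1 => /orP[/eqP ee|/eqP ee]; first by rewrite H ee mul1r.
by move: e0; rewrite ee; rewrite lerNr oppr0 ler10.
Qed.

End OddDimension.

Lemma vdm_sq (R : realType) (l : nat) (lam : intpart l) :
  vdm (fun i => jev (0 : R) 0 (jpos lam i)) ^+ 2 = \prod_i \prod_i' gap R (jpos lam i') (jpos lam i).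
Proof.
set N := fun i => _; have h : vdm N = \prod_(i < l) \prod_(j < l | (i < j)%N) gap R (jpos lam j) (jpos lam i).
  apply: eq_bigr => i _; apply: eq_bigr => j ij; have lt := jpos_anti lam ij.
  by rewrite /gap ltn_eqF // distrC gtr0_norm // subr_gt0 jev_lt.
have h' : vdm N = \prod_(i < l) \prod_(j < l | (j < i)%N) gap R (jpos lam j) (jpos lam i).
  rewrite h (exchange_big_dep xpredT) //=; apply: eq_bigr => i _; apply: eq_bigr => j _.
  by rewrite /gap eq_sym distrC.
rewrite expr2 {1}h h' -big_split /=; apply: eq_bigr => i _.
rewrite [RHS](bigD1 i) //= {3}/gap eqxx mul1r [RHS](bigID (fun j : 'I_l => (i < j)%N)) /=.
congr (_ * _); apply: eq_bigl => j; rewrite -val_eqE /=; lia.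
Qed.

Lemma conj_complE (l k : nat) (lam : intpart l) (j : 'I_k) :
  conj_compl lam j = #|[pred i : 'I_l | (parts lam i + j < k)%N]|.
Proof.
rewrite /conj_compl -(card_imset _ rev_ord_inj); apply: eq_card => i; rewrite [RHS]inE.
apply/finset.imsetP/idP => [[i' + ->]|h]; first by rewrite inE; lia.
by exists (rev_ord i); rewrite ?rev_ordK // inE rev_ordK; lia.
Qed.

Lemma conj_complP (l k : nat) (lam : intpart l) : exists nu : intpart k, parts nu =1 conj_compl lam.
Proof.
apply: intpart_of => i j ij; rewrite !conj_complE; apply: subset_leq_card.
by apply/fintype.subsetP => a; rewrite !inE; lia.
Qed.

Lemma gapC (R : realType) a b : gap R a b = gap R b a.
Proof. by rewrite /gap eq_sym distrC. Qed.

(** * A partition and the conjugate of its complement have complementary positions *)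

Section Complement.
Variables (R : realType) (l k : nat).
Hypothesis l0 : (0 < l)%N.
Local Notation M := (l + k).-1.
Local Notation N := (jev (0 : R) 0).
Local Notation gap := (gap R).

Let M1 : M.+1 = (l + k)%N. Proof. by lia. Qed.

Section Positions.
Variables (lam : intpart l) (nu : intpart k).
Hypotheses (lamk : in_box k lam) (nuE : parts nu =1 conj_compl lam).

Lemma jpos_box i : (jpos lam i <= M)%N.
Proof. by have := forallP lamk i; have := ltn_ord i; rewrite /jpos; lia. Qed.

Lemma jpos_compl_box j : (jpos nu j <= M)%N.
Proof.
have := max_card [pred i : 'I_l | (parts lam i + j < k)%N]; rewrite -conj_complE -nuE card_ord.
by have := ltn_ord j; rewrite /jpos; lia.
Qed.

(** The rows counted by part [j] of the conjugate complement form a final segment. If row [i] is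
    among them, the position of [j] is larger than that of [i]; otherwise it is smaller. *)
Lemma jpos_compl_neq i j : jpos lam i != jpos nu j.
Proof.
rewrite /jpos nuE conj_complE; set Q := #|_|; have li := ltn_ord i; have kj := ltn_ord j.
have cardge (a : nat) : (a <= l)%N -> #|[pred i' : 'I_l | (a <= i')%N]| = (l - a)%N.
  move=> al; have := cardC [pred i' : 'I_l | (i' < a)%N]; rewrite card_ord.
  have -> : #|[pred i' : 'I_l | (i' < a)%N]| = a.
    by rewrite -sum1_card (big_ord_narrow al) sum1_card card_ord.
  have -> : #|[predC [pred i' : 'I_l | (i' < a)%N]]| = #|[pred i' : 'I_l | (a <= i')%N]|.
    by apply: eq_card => i'; rewrite !inE -leqNgt.
  by lia.
have [h|h] := ltnP (parts lam i + j) k.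
  have : (l - i <= Q)%N.
    rewrite -(cardge i (ltnW li)) /Q; apply: subset_leq_card; apply/fintype.subsetP => a; rewrite !inE => ia.
    by have := parts_antitone lam ia; lia.
  by lia.
have : (Q <= l - i.+1)%N.
  rewrite -(cardge i.+1 li) /Q; apply: subset_leq_card; apply/fintype.subsetP => a; rewrite !inE => hj.
  by rewrite ltnNge; apply/negP => ia; have := parts_antitone lam ia; lia.
by lia.
Qed.

(* The two sets of positions partition [0, l + k). *)
Lemma prod_positions (F : nat -> R) :
  \prod_(a < M.+1) F a = (\prod_i F (jpos lam i)) * \prod_j F (jpos nu j).
Proof.
pose pos (s : 'I_l + 'I_k) : nat := match s with inl i => jpos lam i | inr j => jpos nu j end.
have posM s : (pos s < M.+1)%N by case: s => i; rewrite ltnS /= ?jpos_box ?jpos_compl_box.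
pose f s := Ordinal (posM s).
have inj : injective f.
  move=> [i|i] [j|j] /(congr1 val) /= e.
  - by rewrite (jpos_inj e).
  - by have := jpos_compl_neq i j; rewrite e eqxx.
  - by have := jpos_compl_neq j i; rewrite e eqxx.
  - by rewrite (jpos_inj e).
have bij : bijective f by apply: inj_card_bij => //; rewrite card_sum !card_ord M1.
rewrite (reindex f) /=; last exact: onW_bij.
by rewrite big_sumType.
Qed.

Local Notation X := (\prod_i \prod_j gap (jpos nu j) (jpos lam i)).

(** The denominator splits along the two families of positions; its part inside [lam] is the squared
    Vandermonde product. *)
Lemma gap_quotient : vdm (fun i => N (jpos lam i)) ^+ 2 / \prod_i \prod_(a < M.+1) gap a (jpos lam i) = X^-1.
Proof.
rewrite (eq_bigr (fun i => (\prod_i' gap (jpos lam i') (jpos lam i)) * \prod_j gap (jpos nu j) (jpos lam i))); last first.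
  by move=> i _; exact: (prod_positions (fun a => gap a _)).
rewrite big_split /= -vdm_sq invfM mulrA divff ?mul1r //.
by rewrite expf_neq0 // gt_eqF // vdm_jev_gt0.
Qed.

(** The left side is the product of the gaps over all unordered pairs of positions, so it does not
    depend on [lam]; ordered pairs count each gap twice, hence the square root. *)
Lemma vdm_positions : vdm (fun i => N (jpos lam i)) * vdm (fun j => N (jpos nu j)) * X =
  Num.sqrt (\prod_(b < M.+1) \prod_(a < M.+1) gap a b).
Proof.
have X0 : 0 < X by apply: prodr_gt0 => i _; apply: prodr_gt0 => j _; exact: gap_gt0.
have -> : \prod_(b < M.+1) \prod_(a < M.+1) gap a b =
    (vdm (fun i => N (jpos lam i)) * vdm (fun j => N (jpos nu j)) * X) ^+ 2.
  rewrite (prod_positions (fun b => \prod_(a < M.+1) gap a b)).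
  have e b : \prod_(a < M.+1) gap a b = (\prod_i gap (jpos lam i) b) * \prod_j gap (jpos nu j) b.
    exact: (prod_positions (fun a => gap a b)).
  rewrite (eq_bigr _ (fun i _ => e (jpos lam i))) (eq_bigr _ (fun j _ => e (jpos nu j))).
  rewrite !big_split /= -!vdm_sq.
  have -> : \prod_j \prod_i gap (jpos lam i) (jpos nu j) = X.
    by rewrite exchange_big /=; apply: eq_bigr => i _; apply: eq_bigr => j _; exact: gapC.
  by ring.
by rewrite sqrtr_sqr gtr0_norm // !mulr_gt0 ?vdm_jev_gt0.
Qed.

End Positions.
End Complement.

Section OddOddMeasure.
Variables (R : realType) (k l : nat).
Hypothesis l0 : (0 < l)%N.

(** The factors [2 n + 1] of the two dimensions multiply to a constant [P], since the positions
    exhaust an interval; the two Vandermonde products are [S / X] by [vdm_positions]. *)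
Lemma odd_odd_weightE : exists2 c : R, c != 0 & forall lam : intpart l, in_box k lam ->
  vdm (fun i => jev (0 : R) 0 (jpos lam i)) ^+ 2 / \prod_i \prod_(a < (l + k).-1.+1) gap R a (jpos lam i) =
  c * odd_odd_weight R k lam.
Proof.
pose P : R := \prod_(a < (l + k).-1.+1) (2 * a + 1)%:R.
pose S : R := Num.sqrt (\prod_(b < (l + k).-1.+1) \prod_(a < (l + k).-1.+1) gap R a b).
have P0 : 0 < P by apply: prodr_gt0 => a _; rewrite ltr0n addn1.
have S0 : 0 < S.
  by rewrite sqrtr_gt0; apply: prodr_gt0 => a _; apply: prodr_gt0 => b _; exact: gap_gt0.
exists (dimc R l * dimc R k * P * S)^-1.
  by rewrite invr_eq0 (gt_eqF (mulr_gt0 (mulr_gt0 (mulr_gt0 (dimc_gt0 R l) (dimc_gt0 R k)) P0) S0)).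
move=> lam lamk; have [nu nuE] := conj_complP k lam.
rewrite (gap_quotient R l0 lamk nuE); have := vdm_positions R l0 lamk nuE; rewrite -/S.
rewrite /odd_odd_weight irr_dim_SOodd.
have -> : (fun j => (conj_compl lam j)%:Z) = weight nu by apply/funext => j; rewrite /weight nuE.
rewrite irr_dim_SOodd.
have PE : P = (\prod_i (2 * jpos lam i + 1)%:R) * \prod_j (2 * jpos nu j + 1)%:R.
  exact: (prod_positions l0 lamk nuE (fun a => (2 * a + 1)%:R)).
rewrite PE in P0 *; set X := \prod_i \prod_j _.
have X0 : X != 0 by apply/prodf_neq0 => i _; apply/prodf_neq0 => j _; rewrite gt_eqF // gap_gt0.
move: S S0 X X0 (vdm_jev_gt0 R lam) (vdm_jev_gt0 R nu) (dimc_gt0 R l) (dimc_gt0 R k) P0.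
move: (\prod_i (2 * _ + 1)%:R) (\prod_i (2 * _ + 1)%:R) (vdm _) (vdm _) (dimc R l) (dimc R k).
move=> x1 x2 x3 x4 x5 x6 S S0 X X0 h3 h4 h5 h6 h12 e.
have {h12} : x2 * x1 != 0 by rewrite gt_eqF.
rewrite mulf_eq0 negb_or => /andP[n2 n1]; rewrite -e; field.
by rewrite X0 n1 n2 !gt_eqF.
Qed.

Lemma howe_odd_odd_unique : unique (@is_spectral_measure R l 0 0 (omega R k)) (@howe_Oodd_SOodd R l k).
Proof.
have m1 : (-1 : R) < 0 by rewrite oppr_lt0.
have [K hK] := legendre_expansion R k l0.
have [c c0 hc] := odd_odd_weightE.
have wexp (x : 'I_l -> R) : \sum_(lam <- fset_set (box l k)) (K * c * odd_odd_weight R k lam) *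
    normalized_jacobiP 0 0 lam x = \prod_i ((1 + x i) / 2) ^+ k.
  rewrite -hK big_seq [RHS]big_seq; apply: eq_bigr => lam.
  rewrite in_fset_set; last exact: box_finite.
  by move=> /set_mem lk; rewrite hc // mulrA.
pose W : R := \sum_(lam <- fset_set (box l k)) odd_odd_weight R k lam.
(* Evaluation at [(1, ..., 1)] identifies the normalising constant, so that [K] and [c] never have
   to be computed. *)
have KW : K * c * W = 1.
  have := wexp (fun=> 1); rewrite [RHS]big1 => [<-|i _]; last first.
    by rewrite (_ : (1 + 1) / 2 = 1 :> R) ?expr1n //; field.
  by rewrite /W mulr_sumr; apply: eq_bigr => lam _; rewrite normalized_jacobiP1 // mulr1.
have W0 : W != 0 by apply: contra_eq_neq KW => ->; rewrite mulr0 eq_sym oner_neq0.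
have w0 (lam : intpart l) : 0 <= odd_odd_weight R k lam by rewrite mulr_ge0 // ler0n.
have howeE (lam : intpart l) : howe_Oodd_SOodd R k lam = if in_box k lam then odd_odd_weight R k lam / W else 0.
  by rewrite /howe_Oodd_SOodd box_fsbig.
apply: spectral_unique => // [lam|lam nb|x].
- rewrite howeE; case: ifP => // _; rewrite divr_ge0 //.
  by apply: sumr_ge0 => nu _; exact: w0.
- by rewrite howeE (negbTE nb).
- rewrite -wexp big_seq [RHS]big_seq; apply: eq_bigr => lam.
  rewrite in_fset_set; last exact: box_finite.
  move=> /set_mem lk; rewrite howeE (lk : in_box k lam); congr (_ * _).
  rewrite mulrC; congr (_ * _); apply: (mulIf W0); rewrite mulVf //.
Qed.

End OddOddMeasure.

Theorem corollary5p4 (R : realType) (k l : nat) (hk : (0 < k)%N) (hl : (0 < l)%N) :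
  [/\ unique (@is_spectral_measure R l 2^-1 2^-1 (omega R k))
             (@howe_Sp_Sp R l k),
      unique (@is_spectral_measure R l 2^-1 (- 2^-1) (omega R k))
             (@howe_SOodd_Pin R l k),
      unique (@is_spectral_measure R l (- 2^-1) (- 2^-1) (omega R k))
             (@howe_Oeven_SO R l k)
    & unique (@is_spectral_measure R l 0 0 (omega R k))
             (@howe_Oodd_SOodd R l k)].
Proof.
split; [exact: howe_Sp_unique|exact: howe_SOodd_unique|exact: howe_SOeven_unique|].
exact: howe_odd_odd_unique.
Qed.
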